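(* The following twelve one-parameter families of rotationally symmetric metrics are gradient Ricci soliton metrics on either the disks $\mathbb{D}=\{x:|x|<1\}\subset\mathbb{R}^2$ or $\mathbb{R}^2$ or the annuli $\mathbb{D}_*=\mathbb{D}\setminus\{0\}$ or $\mathbb{R}^2_*=\mathbb{R}^2\setminus\{0\}$: (1) Steady solitons: (a) $(\mathbb{R}^2,g_1(\nu))$: the cigar solitons of Hamilton, i.e. complete positively curved steady solitons; the parameter $\nu$ corresponds to scaling of the metric. (b) $(\mathbb{R}^2,g_2(\nu))$: incomplete steady solitons with unbounded negative curvature (called the exploding solitons); the parameter $\nu$ corresponds to scaling of the metric. (c) $(\mathbb{R}^2_*,g_3(\nu))$: incomplete negatively curved steady solitons asymptotic to a cylinder of radius $\nu\ge 0$ at $0$ and to $g_2(1)$ at $\infty$. (2) Shrinking solitons: (a) $(\mathbb{D},g_4^{\pm}(\nu))$: two families of incomplete positively curved shrinking solitons which extend smoothly to $\bar{\mathbb{D}}$ so that $\partial\bar{\mathbb{D}}$ is totally geodesic and has length $2\pi$; the parameter $\nu=\mathrm{dist}(0,\partial\mathbb{D})$ satisfies $\nu\in(1,\infty)$ for $g_4^+$ and $\nu\in(\frac{\pi}{2},\infty)$ for $g_4^-$. (b) $(\mathbb{R}^2,g_5(\nu))$: incomplete negatively curved shrinking solitons asymptotic to $g_2(\nu)$. (3) Expanding solitons: (a) $(\mathbb{R}^2,g_6(\nu))$: complete positively curved expanding solitons asymptotic to the end of a flat cone of angle $\nu\in(0,2\pi)$. (b) $(\mathbb{R}^2,g_7(\nu))$: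 complete negatively curved expanding solitons asymptotic to the end of a flat cone of angle $\nu\in(2\pi,\infty)$. (c) $(\mathbb{R}^2_*,g_8(\nu))$: complete negatively curved expanding solitons asymptotic to a hyperbolic cusp at $0$ and to the end of a flat cone of angle $\nu\in(0,\infty)$ at $\infty$. (d) $(\mathbb{D}_*,g_9(\nu))$: incomplete negatively curved expanding solitons asymptotic to the end of a flat cone of angle $\nu\in(0,\infty)$ at $0$ and extending smoothly to $\bar{\mathbb{D}}_*$ so that $\partial\bar{\mathbb{D}}$ is totally geodesic and of length $2\pi$. (e) $(\mathbb{R}^2,g_{10}(\nu))$: incomplete negatively curved expanding solitons asymptotic to $g_2(\nu)$. (f) $(\mathbb{R}^2_*,g_{11}(\nu))$: incomplete negatively curved expanding solitons asymptotic to a hyperbolic cusp at $0$ and to $g_2(\nu)$ at $\infty$. (g) $(\mathbb{D}_*,g_{12}(\nu))$: incomplete negatively curved expanding solitons asymptotic to $g_2(\nu)$ at $0$ and extending smoothly to $\bar{\mathbb{D}}_*$ so that $\partial\bar{\mathbb{D}}$ is totally geodesic and of length $2\pi$.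
   Context: A gradient Ricci soliton with expansion constant $\lambda\in\mathbb{R}$ on a surface $M$ is a triple $(M,g,f)$, with $g$ a smooth Riemannian metric and $f\in C^\infty(M)$ (the soliton potential), satisfying $-2\mathrm{Ric}(g)=L_{\nabla f}g-2\lambda g$; in dimension two this says $\nabla^2 f+K_g\,g-\lambda g=0$, where $K_g$ is the Gauss curvature. It is steady if $\lambda=0$, shrinking if $\lambda>0$, expanding if $\lambda<0$. A metric $g$ is a gradient Ricci soliton metric if it admits such an $f$. Here $\bar{\mathbb{D}}$ is the closed unit disk and $\bar{\mathbb{D}}_*=\bar{\mathbb{D}}\setminus\{0\}$. A rotationally symmetric metric is one of the form $dr^2+b(r)^2d\theta^2$ (away from the origin) with $b>0$ smooth. The metrics. For a positive function $a$ on an interval $I\subset(0,\infty)$ put $G_a=\frac{a(t)^2}{t}dt^2+4t\,d\theta^2$ with $\theta\in\mathbb{R}/2\pi\mathbb{Z}$ (equivalently $dr^2+b(r)^2d\theta^2$ with $t=b^2/4$ and $a(b^2/4)\,b'=1$). The metrics in the families are $G_a$ for solutions $a>0$ of $a'=2\lambda a^3-4\mu a^2$ with $\mu\neq0$, where $\lambda$ is the expansion constant; when $\lambda\ne0$ write $\gamma=2\mu/\lambda$. When $I=(0,T)$ and $a(t)\to1$ as $t\to0$ (written $a(0)=1$), $G_a$ extends smoothly over the origin, which corresponds to $t=0$. - $g_1(\nu)$: $a=\frac{1}{1-4\nu^2t}$, that is $g_1(\nu)=dr^2+\frac{1}{\nu^2}\tanh^2(\nu r)\,d\theta^2$. - $g_2(\nu)$: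 $a=\frac{1}{1+4\nu^2t}$, that is $g_2(\nu)=dr^2+\frac{1}{\nu^2}\tan^2(\nu r)\,d\theta^2$ for $0<r<\frac{\pi}{2\nu}$; an end is compared with the end $r\to\frac{\pi}{2\nu}$ of $g_2(\nu)$. - $g_3(\nu)$: $a=\frac{1}{4t-\nu^2}$, that is $g_3(\nu)=d\rho^2+\frac{\nu^2}{\tanh^2(\nu\rho)}d\theta^2$ for $\nu>0$ and $g_3(0)=d\rho^2+\frac{1}{\rho^2}d\theta^2$, with $\rho\in(-\infty,0)$. - $g_4^+$: $\mu>0$, $0<\gamma<1$, $a(0)=1$, scaled so that $a$ blows up at $t=\frac14$. $g_4^-$: $\mu<0$, $\gamma<0$, $a(0)=1$, scaled so that $a$ blows up at $t=\frac14$. - $g_5(\nu)$: $\mu=\nu^2>0$, $\gamma>1$, $a(0)=1$. - $g_6(\nu)$: $\mu<0$, $\gamma=2\pi/\nu>1$, $a(0)=1$. $g_7(\nu)$: $\mu<0$, $0<\gamma=2\pi/\nu<1$, $a(0)=1$. - $g_8(\nu)$: $\lambda=-1$, $\mu<0$, $\gamma=2\pi/\nu>0$, $a\to\infty$ as $t\to0$. $g_9(\nu)$: $\mu<0$, $\gamma=2\pi/\nu>0$, $a\to\infty$ as $t\to\frac14$ from above. - $g_{10}$, $g_{11}$, $g_{12}$: $\mu>0$, $\gamma<0$, and respectively $a(0)=1$; $\lambda=-1$ and $a\to\infty$ as $t\to0$; $a\to\infty$ as $t\to\frac14$ from above. The parameter $\nu$ labels the member $g_2(\nu)$ to which the end $t\to\infty$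 is asymptotic. *)

(* Defs.v *)
From Stdlib Require Import Reals List.
From Coquelicot Require Import Coquelicot.
Import ListNotations.
Open Scope R_scope.

(* Every surface is a rotationally invariant open
   subset of R^2, and tensors are given by their Cartesian components. *)

Definition pt : Type := (R * R)%type.

Inductive ix : Type := X1 | X2.

Definition comp (i : ix) (v : pt) : R :=
  match i with X1 => fst v | X2 => snd v end.

Definition sum_ix (F : ix -> R) : R := F X1 + F X2.

Definition rad (p : pt) : R := sqrt (fst p ^ 2 + snd p ^ 2).

Definition plane (p : pt) : Prop := True.
Definition punctured_plane (p : pt) : Prop := 0 < rad p.
Definition disk (r : R) (p : pt) : Prop := rad p < r.
Definition punctured_disk (r : R) (p : pt) : Prop := 0 < rad p < r.
Definition closed_unit_disk (p : pt) : Prop := rad p <= 1.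
Definition unit_circle (p : pt) : Prop := rad p = 1.

Definition slice (i : ix) (f : pt -> R) (p : pt) : R -> R :=
  match i with
  | X1 => fun s => f (s, snd p)
  | X2 => fun s => f (fst p, s)
  end.

Definition pd (i : ix) (f : pt -> R) (p : pt) : R :=
  Derive (slice i f p) (comp i p).

Definition iter_pd (w : list ix) (f : pt -> R) : pt -> R := fold_right pd f w.

(* Since [Derive] is total, existence of each partial derivative is required
   separately. *)
Definition smooth (U : pt -> Prop) (f : pt -> R) : Prop :=
  forall (w : list ix) (p : pt), U p ->
    continuous (iter_pd w f) p /\
    forall i : ix, ex_derive (slice i (iter_pd w f) p) (comp i p).

Definition metric : Type := ix -> ix -> pt -> R.

Definition quad (h : metric) (p v : pt) : R :=
  sum_ix (fun i => sum_ix (fun j => h i j p * comp i v * comp j v)).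

Definition bilin (h : metric) (p v w : pt) : R :=
  sum_ix (fun i => sum_ix (fun j => h i j p * comp i v * comp j w)).

Definition riemannian (U : pt -> Prop) (h : metric) : Prop :=
  (forall i j, smooth U (h i j)) /\
  (forall p, U p -> forall i j, h i j p = h j i p) /\
  (forall p, U p -> forall v : pt, v <> (0, 0) -> 0 < quad h p v).

Definition rescale (c : R) (h : metric) : metric := fun i j p => c * h i j p.

Definition det (h : metric) (p : pt) : R :=
  h X1 X1 p * h X2 X2 p - h X1 X2 p * h X2 X1 p.

Definition inv_metric (h : metric) (i j : ix) (p : pt) : R :=
  match i, j with
  | X1, X1 => h X2 X2 p / det h p
  | X2, X2 => h X1 X1 p / det h p
  | X1, X2 => - h X1 X2 p / det h p
  | X2, X1 => - h X2 X1 p / det h p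
  end.

(* [christoffel h k i j] is the symbol with upper index k. *)
Definition christoffel (h : metric) (k i j : ix) (p : pt) : R :=
  / 2 * sum_ix (fun l => inv_metric h k l p *
    (pd i (h j l) p + pd j (h i l) p - pd l (h i j) p)).

(* R(d_i, d_j) d_k = sum_l [riem h l i j k] d_l, with
   R(X, Y) = nabla_X nabla_Y - nabla_Y nabla_X - nabla_[X, Y]. *)
Definition riem (h : metric) (l i j k : ix) (p : pt) : R :=
  pd i (christoffel h l j k) p - pd j (christoffel h l i k) p +
  sum_ix (fun m => christoffel h m j k p * christoffel h l i m p -
                   christoffel h m i k p * christoffel h l j m p).

Definition ricci (h : metric) (j k : ix) (p : pt) : R :=
  sum_ix (fun i => riem h i i j k p).

Definition gauss (h : metric) (p : pt) : R :=
  sum_ix (fun l => riem h l X1 X2 X2 p * h l X1 p) / det h p.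

Definition pos_curved (U : pt -> Prop) (h : metric) : Prop :=
  forall p, U p -> 0 < gauss h p.

Definition neg_curved (U : pt -> Prop) (h : metric) : Prop :=
  forall p, U p -> gauss h p < 0.

Definition curvature_unbounded_below (U : pt -> Prop) (h : metric) : Prop :=
  forall M : R, exists p, U p /\ gauss h p < M.

Definition grad (h : metric) (f : pt -> R) (k : ix) (p : pt) : R :=
  sum_ix (fun l => inv_metric h k l p * pd l f p).

Definition lie_metric (V : ix -> pt -> R) (h : metric) (i j : ix) (p : pt) : R :=
  sum_ix (fun k => V k p * pd k (h i j) p +
                   h k j p * pd i (V k) p + h i k p * pd j (V k) p).

Definition gradient_soliton (U : pt -> Prop) (h : metric) (lam : R) : Prop :=
  riemannian U h /\
  exists f : pt -> R, smooth U f /\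
    forall p, U p -> forall i j,
      - 2 * ricci h i j p = lie_metric (grad h f) h i j p - 2 * lam * h i j p.

Definition steady_soliton (U : pt -> Prop) (h : metric) : Prop :=
  gradient_soliton U h 0.
Definition shrinking_soliton (U : pt -> Prop) (h : metric) (lam : R) : Prop :=
  0 < lam /\ gradient_soliton U h lam.
Definition expanding_soliton (U : pt -> Prop) (h : metric) (lam : R) : Prop :=
  lam < 0 /\ gradient_soliton U h lam.

Definition velocity (c : R -> pt) (t : R) : pt :=
  (Derive (fun s => fst (c s)) t, Derive (fun s => snd (c s)) t).

Definition C1_curve (A : pt -> Prop) (c : R -> pt) : Prop :=
  forall t, 0 <= t <= 1 ->
    A (c t) /\
    forall i, ex_derive (fun s => comp i (c s)) t /\
              continuous (Derive (fun s => comp i (c s))) t.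

Definition curve_length (h : metric) (c : R -> pt) (t0 t1 : R) : R :=
  RInt (fun t => sqrt (quad h (c t) (velocity c t))) t0 t1.

(* The distance from p to the set S, measured along curves inside A. *)
Definition set_dist (A : pt -> Prop) (h : metric) (p : pt) (S : pt -> Prop) : Rbar :=
  Glb_Rbar (fun L => exists c, C1_curve A c /\ c 0 = p /\ S (c 1) /\
                               L = curve_length h c 0 1).

Definition dist (A : pt -> Prop) (h : metric) (p q : pt) : Rbar :=
  set_dist A h p (fun x => x = q).

Definition complete (U : pt -> Prop) (h : metric) : Prop :=
  forall x : nat -> pt, (forall n, U (x n)) ->
    (forall eps, 0 < eps -> exists N : nat, forall m n : nat,
       (N <= m)%nat -> (N <= n)%nat -> Rbar_lt (dist U h (x m) (x n)) eps) ->
    exists q, U q /\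
      forall eps, 0 < eps -> exists N : nat, forall n : nat,
        (N <= n)%nat -> Rbar_lt (dist U h (x n) q) eps.

Definition incomplete (U : pt -> Prop) (h : metric) : Prop := ~ complete U h.

Definition push (Phi : pt -> pt) (p v : pt) : pt :=
  (sum_ix (fun i => pd i (fun x => fst (Phi x)) p * comp i v),
   sum_ix (fun i => pd i (fun x => snd (Phi x)) p * comp i v)).

Definition smooth_map (U V : pt -> Prop) (Phi : pt -> pt) : Prop :=
  (forall p, U p -> V (Phi p)) /\ forall i, smooth U (fun x => comp i (Phi x)).

Definition isometric (U : pt -> Prop) (h : metric) (V : pt -> Prop) (k : metric) : Prop :=
  exists Phi Psi : pt -> pt,
    smooth_map U V Phi /\ smooth_map V U Psi /\
    (forall p, U p -> Psi (Phi p) = p) /\ (forall q, V q -> Phi (Psi q) = q) /\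
    forall p, U p -> forall v, quad k (Phi p) (push Phi p v) = quad h p v.

Definition circle_param (t : R) : pt := (cos t, sin t).

Definition acceleration (h : metric) (c : R -> pt) (t : R) : pt :=
  let acc k := Derive_n (fun s => comp k (c s)) 2 t +
    sum_ix (fun i => sum_ix (fun j => christoffel h k i j (c t) *
      comp i (velocity c t) * comp j (velocity c t))) in
  (acc X1, acc X2).

Definition circle_totally_geodesic (h : metric) : Prop :=
  forall (t : R) (n : pt),
    bilin h (circle_param t) (velocity circle_param t) n = 0 ->
    bilin h (circle_param t) (acceleration h circle_param t) n = 0.

(* [W r] is the disk of radius r, possibly punctured.  A metric is smooth up to
   the unit circle when it is smooth on W r for some r > 1, and h stands for such
   an extension. *)
Definition smooth_to_boundary (W : R -> pt -> Prop) (h : metric) : Prop :=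
  exists r, 1 < r /\ riemannian (W r) h.

Definition geodesic_boundary (W : R -> pt -> Prop) (h : metric) : Prop :=
  smooth_to_boundary W h /\ circle_totally_geodesic h /\
  curve_length h circle_param 0 (2 * PI) = 2 * PI.

(* P dt^2 + Q dtheta^2, with theta in R / 2 pi Z. *)
Record radial : Type := Radial { rP : R -> R; rQ : R -> R }.

Definition warped (b : R -> R) : radial := Radial (fun _ => 1) (fun r => b r ^ 2).

Definition G (a : R -> R) : radial := Radial (fun t => a t ^ 2 / t) (fun t => 4 * t).

Definition pull (tau : R -> R) (m : radial) : radial :=
  Radial (fun x => rP m (tau x) * Derive tau x ^ 2) (fun x => rQ m (tau x)).

(* The quadratic form of P drho^2 + Q dtheta^2 at p, for (rho, theta) the polar
   coordinates of R^2. *)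
Definition polar (m : radial) (p v : pt) : R :=
  rP m (rad p) * ((fst p * fst v + snd p * snd v) / rad p) ^ 2 +
  rQ m (rad p) * ((fst p * snd v - snd p * fst v) / rad p ^ 2) ^ 2.

Definition outer_end (r : Rbar) : (R -> Prop) -> Prop :=
  match r with
  | Finite x => at_left x
  | _ => Rbar_locally r
  end.

(* Away from the origin, h on the disk of radius r (the plane if r = p_infty) is
   isometric to m on the open interval between e0 and e1, by a rotationally
   symmetric diffeomorphism t = tau(rho); e0 corresponds to the origin and e1 to
   the outer end, so tau decreases when e1 < e0. *)
Definition realizes (h : metric) (r e0 e1 : Rbar) (m : radial) : Prop :=
  exists tau : R -> R,
    (forall x : R, 0 < x -> Rbar_lt x r ->
       (forall n, ex_derive_n tau n x) /\ Derive tau x <> 0) /\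
    filterlim tau (at_right 0) (Rbar_locally e0) /\
    filterlim tau (outer_end r) (Rbar_locally e1) /\
    forall p v : pt, 0 < rad p -> Rbar_lt (rad p) r ->
      quad h p v = polar (pull tau m) p v.

(* The end F of h (a filter in rho) is compared with the end E of the model m by
   a rotationally symmetric diffeomorphism sigma: h - sigma^* m tends to 0, in
   operator norm with respect to sigma^* m0. *)
Definition asymptotic_rel (F : (R -> Prop) -> Prop) (h : metric)
    (E : (R -> Prop) -> Prop) (m m0 : radial) : Prop :=
  exists sigma : R -> R,
    filterlim sigma F E /\
    forall eps : R, 0 < eps ->
      F (fun x => (forall n, ex_derive_n sigma n x) /\ Derive sigma x <> 0 /\
           forall p v : pt, rad p = x ->
             Rabs (quad h p v - polar (pull sigma m) p v)
               <= eps * polar (pull sigma m0) p v).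

Definition asymptotic (F : (R -> Prop) -> Prop) (h : metric)
    (E : (R -> Prop) -> Prop) (m : radial) : Prop :=
  asymptotic_rel F h E m m.

(* The error is measured by the cylinder of radius 1, so that radius 0 makes
   sense; for nu > 0 this is equivalent to [asymptotic]. *)
Definition asymptotic_cylinder (F : (R -> Prop) -> Prop) (h : metric) (nu : R) : Prop :=
  asymptotic_rel F h (Rbar_locally m_infty) (warped (fun _ => nu)) (warped (fun _ => 1)).

Definition asymptotic_cusp (F : (R -> Prop) -> Prop) (h : metric) : Prop :=
  asymptotic F h (Rbar_locally m_infty) (warped exp).

(* The flat cone of angle nu is ds^2 + (nu s / 2 pi)^2 dtheta^2. *)
Definition asymptotic_cone (F : (R -> Prop) -> Prop) (h : metric) (nu : R) : Prop :=
  asymptotic F h (Rbar_locally p_infty) (warped (fun s => nu / (2 * PI) * s)).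

Definition a1 (nu t : R) : R := / (1 - 4 * nu ^ 2 * t).
Definition a2 (nu t : R) : R := / (1 + 4 * nu ^ 2 * t).
Definition a3 (nu t : R) : R := / (4 * t - nu ^ 2).

(* In G (a2 nu) the end r -> pi / (2 nu) of dr^2 + (tan (nu r) / nu)^2 dtheta^2
   is t -> infinity, as t = (tan (nu r) / nu)^2 / 4. *)
Definition asymptotic_g2 (F : (R -> Prop) -> Prop) (h : metric) (nu : R) : Prop :=
  asymptotic F h (Rbar_locally p_infty) (G (a2 nu)).

Definition gam (lam mu : R) : R := 2 * mu / lam.

Definition profile (lam mu : R) (a : R -> R) (e0 e1 : Rbar) : Prop :=
  forall t : R, Rbar_lt e0 t -> Rbar_lt t e1 ->
    0 < a t /\ is_derive a t (2 * lam * a t ^ 3 - 4 * mu * a t ^ 2).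

Definition one_at_0 (a : R -> R) : Prop := filterlim a (at_right 0) (locally 1).

Definition blows_up (a : R -> R) (F : (R -> Prop) -> Prop) : Prop :=
  filterlim a F (Rbar_locally p_infty).

(* The parameter conditions and the profile conditions of the family g_k are kept
   apart, so that existence of a profile for all admissible parameters can be
   stated.  For g_4 they are kept together: given gam lam mu, the blow-up time 1/4
   determines lam and mu. *)

Definition g4_profile (lam mu : R) (a : R -> R) : Prop :=
  profile lam mu a 0 (1 / 4) /\ one_at_0 a /\ blows_up a (at_left (1 / 4)).

Definition g4_plus (lam mu : R) (a : R -> R) : Prop :=
  lam <> 0 /\ 0 < mu /\ 0 < gam lam mu < 1 /\ g4_profile lam mu a.

Definition g4_minus (lam mu : R) (a : R -> R) : Prop :=
  lam <> 0 /\ mu < 0 /\ gam lam mu < 0 /\ g4_profile lam mu a.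

Definition origin_profile (lam mu : R) (a : R -> R) : Prop :=
  profile lam mu a 0 p_infty /\ one_at_0 a.

Definition cusp_profile (lam mu : R) (a : R -> R) : Prop :=
  profile lam mu a 0 p_infty /\ blows_up a (at_right 0).

Definition boundary_profile (lam mu : R) (a : R -> R) : Prop :=
  profile lam mu a (1 / 4) p_infty /\ blows_up a (at_right (1 / 4)).

Definition g5_param (nu lam mu : R) : Prop :=
  0 < nu /\ lam <> 0 /\ mu = nu ^ 2 /\ 1 < gam lam mu.

Definition g6_param (nu lam mu : R) : Prop :=
  0 < nu /\ lam <> 0 /\ mu < 0 /\ gam lam mu = 2 * PI / nu /\ 1 < gam lam mu.

Definition g7_param (nu lam mu : R) : Prop :=
  0 < nu /\ lam <> 0 /\ mu < 0 /\ gam lam mu = 2 * PI / nu /\ 0 < gam lam mu < 1.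

Definition g8_param (nu lam mu : R) : Prop :=
  0 < nu /\ lam = -1 /\ mu < 0 /\ gam lam mu = 2 * PI / nu.

Definition g9_param (nu lam mu : R) : Prop :=
  0 < nu /\ lam <> 0 /\ mu < 0 /\ gam lam mu = 2 * PI / nu.

Definition g10_param (lam mu : R) : Prop :=
  lam <> 0 /\ 0 < mu /\ gam lam mu < 0.

Definition g11_param (lam mu : R) : Prop :=
  lam = -1 /\ 0 < mu /\ gam lam mu < 0.

Definition g12_param (lam mu : R) : Prop := g10_param lam mu.

(* h is the metric on the closed unit disk defined by the profile a, and nu is the
   distance from the origin to the boundary. *)
Definition closed_disk_metric (a : R -> R) (h : metric) (nu : R) : Prop :=
  smooth_to_boundary disk h /\ realizes h 1 0 (1 / 4) (G a) /\
  set_dist closed_unit_disk h (0, 0) unit_circle = Finite nu.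

(* nu is the unique label of the end F of h. *)
Definition g2_label (F : (R -> Prop) -> Prop) (h : metric) (nu : R) : Prop :=
  0 < nu /\ asymptotic_g2 F h nu /\
  forall nu', 0 < nu' -> asymptotic_g2 F h nu' -> nu' = nu.

(* Main.v *)
(* With a momentum coordinate x, the metric G_a reads dx^2 / T(x) + 4 T(x) dtheta^2, where
   t = T(x) and T' = U = 1 / a.  The equation for a becomes the linear equation
   U' = 4 mu U - 2 lam, so U and T are explicit exponentials; the Gauss curvature is
   -T'' / 2 = (lam - 2 mu U(0)) e^(4 mu x), of constant sign, and 4 mu x is the soliton
   potential.  In Cartesian coordinates the metric is P(q) delta + Q(q) x_i x_j with q = |p|^2
   and x = X(q), where X is linear at a smooth origin or at a cusp and logarithmic at a cylinder
   or at a totally geodesic boundary.  The sign of mu decides between linear and exponential growth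
   of T, hence between complete conical ends and incomplete ends asymptotic to g_2.
   For the disks, u = 1 / a satisfies int_0^u s / (1 - gamma s) ds = 2 lam (1/4 - t), where
   gamma = 2 mu / lam; comparing these integrals shows that the distance nu from the origin to
   the boundary decreases strictly and continuously in gamma, with nu = pi / 2 at gamma = 0
   (the round hemisphere), nu -> infinity as gamma -> -infinity, and nu > 1 by comparison with
   the flat disk a = 1. *)

Require Import Defs.
From Stdlib Require Import Reals List Lra Lia.
From Stdlib Require ClassicalEpsilon.
From Coquelicot Require Import Coquelicot.
Import ListNotations.
Open Scope R_scope.

(** The profile [a] is an arbitrary solution known only through a limit at one end, so the explicit
    exponentials must be shown to describe every such solution. Integrating [a] yields a momentum
    coordinate, two first integrals then identify [U] and [T], and the coordinate stays finite at
    that end because the limit of 1 / a is not the equilibrium slope lam / (2 mu). At a smooth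
    origin the momentum formulas have a removable singularity at q = 0; there the coefficients are
    rewritten through an entire power series and the soliton equation is checked separately. Lengths
    of curves are bounded below by following the radius only while a curve crosses a given annulus,
    so that the radius is never differentiated at the origin. That every nu > pi / 2 occurs for mu <
    0 needs continuity of nu in gamma; it does not come from dependence of solutions on parameters
    but from comparing two profiles at equal slope u, where the quotient of the distances is at most
    (1 - gamma) / (1 - gamma'). *)

Local Notation comp := Defs.comp.

(** * Smooth functions of two variables *)

Definition nsq (p : pt) : R := fst p ^ 2 + snd p ^ 2.

Definition kron (i j : ix) : R :=
  match i, j with X1, X1 => 1 | X2, X2 => 1 | _, _ => 0 end.

(** [pd] is total, so an equation on it carries no existence; this relational form keeps value and
    existence together, and the calculus rules are proved for it. *)
Definition is_pd (i : ix) (f : pt -> R) (p : pt) (l : R) : Prop :=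
  is_derive (slice i f p) (comp i p) l.

Definition move (i : ix) (p : pt) (s : R) : pt :=
  match i with X1 => (s, snd p) | X2 => (fst p, s) end.

Lemma slice_move i f p s : slice i f p s = f (move i p s).
Proof. destruct i; reflexivity. Qed.

Lemma move_comp i p : move i p (comp i p) = p.
Proof. destruct i, p; reflexivity. Qed.

Lemma slice_comp i f p : slice i f p (comp i p) = f p.
Proof. rewrite slice_move, move_comp; reflexivity. Qed.

Lemma continuous_move i p s : continuous (move i p) s.
Proof.
destruct i; simpl.
- apply (continuous_comp_2 (fun s : R => s) (fun _ => snd p) (fun a b => (a, b))).
  + apply continuous_id.
  + apply continuous_const.
  + apply (continuous_ext (fun x => x)); [intros []; reflexivity | apply continuous_id].
- apply (continuous_comp_2 (fun _ => fst p) (fun s : R => s) (fun a b => (a, b))).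
  + apply continuous_const.
  + apply continuous_id.
  + apply (continuous_ext (fun x => x)); [intros []; reflexivity | apply continuous_id].
Qed.

Lemma locally_move i (U : pt -> Prop) p :
  open U -> U p -> locally (comp i p) (fun s => U (move i p s)).
Proof.
intros oU Up.
apply (continuous_move i p (comp i p)).
rewrite move_comp; auto.
Qed.

Lemma is_pd_unique i f p l : is_pd i f p l -> pd i f p = l.
Proof. apply is_derive_unique. Qed.

Lemma is_pd_ext_loc i (U : pt -> Prop) f g p l :
  open U -> U p -> (forall x, U x -> f x = g x) -> is_pd i f p l -> is_pd i g p l.
Proof.
intros oU Up e. apply is_derive_ext_loc.
apply (filter_imp (fun s => U (move i p s))); [|apply locally_move; assumption].
intros s Us; rewrite !slice_move; auto.
Qed.

Lemma pd_ext_loc i (U : pt -> Prop) f g p :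
  open U -> U p -> (forall x, U x -> f x = g x) -> pd i f p = pd i g p.
Proof.
intros oU Up e. apply Derive_ext_loc.
apply (filter_imp (fun s => U (move i p s))); [|apply locally_move; assumption].
intros s Us; rewrite !slice_move; auto.
Qed.

Lemma is_pd_const i c p : is_pd i (fun _ => c) p 0.
Proof. destruct i; apply (is_derive_const c). Qed.

Lemma is_pd_coord i j p :
  is_pd i (comp j) p (kron i j).
Proof.
destruct i, j; unfold is_pd; simpl.
- apply (is_derive_id (K := R_AbsRing)).
- apply (is_derive_const (snd p)).
- apply (is_derive_const (fst p)).
- apply (is_derive_id (K := R_AbsRing)).
Qed.

Lemma is_pd_plus i f g p a b :
  is_pd i f p a -> is_pd i g p b -> is_pd i (fun x => f x + g x) p (a + b).
Proof. destruct i; apply (is_derive_plus (V := R_NormedModule)). Qed.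

Lemma is_pd_mult i f g p a b :
  is_pd i f p a -> is_pd i g p b ->
  is_pd i (fun x => f x * g x) p (a * g p + f p * b).
Proof.
intros Ha Hb.
assert (H := is_derive_mult _ _ _ _ _ Ha Hb Rmult_comm).
unfold is_pd.
rewrite !slice_comp in H.
destruct i; exact H.
Qed.

Lemma is_pd_compose i (phi : R -> R) f p a l :
  is_derive phi (f p) l -> is_pd i f p a ->
  is_pd i (fun x => phi (f x)) p (a * l).
Proof.
intros Hl Ha.
rewrite <- (slice_comp i f p) in Hl.
assert (H := is_derive_comp phi (slice i f p) (comp i p) l a Hl Ha).
destruct i; exact H.
Qed.

(** Class C^n on U. [smooth] quantifies over all words of derivatives at once; a graded version that
    peels off the innermost derivative makes products and compositions provable by induction on the
    order. *)
Fixpoint ck (n : nat) (U : pt -> Prop) (f : pt -> R) : Prop :=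
  (forall p, U p -> continuous f p) /\
  match n with
  | O => True
  | S m => (forall i p, U p -> ex_derive (slice i f p) (comp i p)) /\
           forall i, ck m U (pd i f)
  end.

Lemma ck_continuous n U f p : ck n U f -> U p -> continuous f p.
Proof. destruct n; intros [H _]; auto. Qed.

Lemma ck_pred n U f : ck (S n) U f -> ck n U f.
Proof.
revert f; induction n as [|n IH]; intros f [Hc [Hd Hp]].
- split; auto.
- split; [exact Hc|split; [exact Hd|]]. intros i; apply IH, Hp.
Qed.

Lemma ck_smooth U f : (forall n, ck n U f) -> smooth U f.
Proof.
intros H w.
assert (K : forall g, ck (S (length w)) U g -> forall p, U p ->
  continuous (iter_pd w g) p /\
  forall i : ix, ex_derive (slice i (iter_pd w g) p) (comp i p)).
(* The last letter of [w] is the derivative applied first, hence induction from the right end. *)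
{ clear f H. induction w as [|i w IH] using rev_ind; intros g Hg p Up.
  - destruct Hg as [Hc [Hd _]]; simpl; auto.
  - unfold iter_pd. rewrite fold_right_app. simpl.
    rewrite length_app, PeanoNat.Nat.add_comm in Hg.
    apply IH; auto. apply Hg. }
apply K, H.
Qed.

Lemma smooth_ck U f : smooth U f -> forall n, ck n U f.
Proof.
intros H n; revert f H; induction n as [|n IH]; intros f H.
- split; auto. intros p Up; apply (H nil p Up).
- split; [intros p Up; apply (H nil p Up)|split].
  + intros i p Up; apply (H nil p Up).
  + intros i; apply IH. intros w p Up.
    generalize (H (w ++ [i]) p Up). unfold iter_pd. rewrite fold_right_app. auto.
Qed.

Lemma ck_ext n U f g :
  open U -> (forall x, U x -> f x = g x) -> ck n U f -> ck n U g.
Proof.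
intros oU; revert f g; induction n as [|n IH]; intros f g e [Hc Hn].
- split; auto. intros p Up.
  apply (continuous_ext_loc g f p); [|auto].
  apply (filter_imp U); [auto|apply (oU p Up)].
- destruct Hn as [Hd Hp]. split; [|split].
  + intros p Up. apply (continuous_ext_loc g f p); [|auto].
    apply (filter_imp U); [auto|apply (oU p Up)].
  + intros i p Up. destruct (Hd i p Up) as [l Hl].
    exists l. apply (is_pd_ext_loc i U f g p l); auto.
  + intros i. apply (IH (pd i f)); [|auto].
    intros p Up. apply (pd_ext_loc i U); auto.
Qed.

Lemma ck_intro n U f (df : ix -> pt -> R) :
  open U -> (forall p, U p -> continuous f p) ->
  (forall i p, U p -> is_pd i f p (df i p)) ->
  (forall i, ck n U (df i)) -> ck (S n) U f.
Proof.
intros oU Hc Hd Hn. split; [exact Hc|split].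
- intros i p Up; exists (df i p); apply (Hd i p Up).
- intros i. apply (ck_ext n U (df i)); auto.
  intros p Up; symmetry; apply is_pd_unique; auto.
Qed.

Lemma ck_is_pd n U f i p : ck (S n) U f -> U p -> is_pd i f p (pd i f p).
Proof. intros [_ [Hd _]] Up. apply Derive_correct; auto. Qed.

Lemma ck_const n U c : open U -> ck n U (fun _ => c).
Proof.
intros oU; revert c; induction n as [|n IH]; intros c.
- split; auto. intros; apply continuous_const.
- apply (ck_intro n U _ (fun _ _ => 0)); auto.
  + intros; apply continuous_const.
  + intros; apply is_pd_const.
Qed.

Lemma continuous_coord j p : continuous (comp j) p.
Proof.
destruct p, j; [apply (continuous_fst (U := R_UniformSpace) (V := R_UniformSpace))|apply (continuous_snd (U := R_UniformSpace) (V := R_UniformSpace))].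
Qed.

Lemma ck_coord n U j : open U -> ck n U (comp j).
Proof.
intros oU; destruct n as [|n].
- split; auto. intros; apply continuous_coord.
- apply (ck_intro n U _ (fun i _ => kron i j)); auto.
  + intros; apply continuous_coord.
  + intros; apply is_pd_coord.
  + intros; apply ck_const; auto.
Qed.

Lemma ck_plus n U f g : open U -> ck n U f -> ck n U g -> ck n U (fun x => f x + g x).
Proof.
intros oU; revert f g; induction n as [|n IH]; intros f g Hf Hg.
- split; auto. intros p Up; apply (continuous_plus (V := R_NormedModule)); eapply ck_continuous; eauto.
- apply (ck_intro n U _ (fun i p => pd i f p + pd i g p)); auto.
  + intros p Up; apply (continuous_plus (V := R_NormedModule)); eapply ck_continuous; eauto.
  + intros i p Up; apply is_pd_plus; eapply ck_is_pd; eauto.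
  + intros i; apply IH; [apply Hf|apply Hg].
Qed.

Lemma ck_mult n U f g : open U -> ck n U f -> ck n U g -> ck n U (fun x => f x * g x).
Proof.
intros oU; revert f g; induction n as [|n IH]; intros f g Hf Hg.
- split; auto. intros p Up; apply (continuous_mult (K := R_AbsRing)); eapply ck_continuous; eauto.
- apply (ck_intro n U _ (fun i p => pd i f p * g p + f p * pd i g p)); auto.
  + intros p Up; apply (continuous_mult (K := R_AbsRing)); eapply ck_continuous; eauto.
  + intros i p Up; apply is_pd_mult; eapply ck_is_pd; eauto.
  + intros i; apply ck_plus; auto; apply IH; try apply Hf; try apply Hg; apply ck_pred; auto.
Qed.

Lemma continuous_compose (phi : R -> R) (f : pt -> R) p l :
  is_derive phi (f p) l -> continuous f p -> continuous (fun x => phi (f x)) p.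
Proof.
intros Hd Hc. apply continuous_comp; auto.
apply (ex_derive_continuous phi); exists l; exact Hd.
Qed.

Lemma ck_compose n U (phi dphi : R -> R) f :
  open U -> (forall p, U p -> is_derive phi (f p) (dphi (f p))) ->
  ck (S n) U f -> ck n U (fun x => dphi (f x)) -> ck (S n) U (fun x => phi (f x)).
Proof.
intros oU Hd Hf Hn.
apply (ck_intro n U _ (fun i p => pd i f p * dphi (f p))); auto.
- intros p Up; eapply continuous_compose; [auto|eapply ck_continuous; eauto].
- intros i p Up; apply is_pd_compose; auto; eapply ck_is_pd; eauto.
- intros i; apply ck_mult; auto; apply Hf.
Qed.

(** The derivative of 1 / f is a polynomial in 1 / f and the derivatives of f, so order n for 1 / f
    itself is the induction hypothesis that yields order n + 1. *)
Lemma ck_inv n U f : open U -> (forall p, U p -> f p <> 0) -> ck n U f -> ck n U (fun x => / f x).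
Proof.
intros oU H0. assert (Hd : forall p, U p -> is_derive Rinv (f p) (- (/ f p * / f p))).
{ intros p Up. auto_derive; [auto|]. field; auto. }
induction n as [|n IH]; intros Hf.
- split; auto. intros p Up; eapply continuous_compose; [auto|eapply ck_continuous; eauto].
- apply (ck_compose n U Rinv (fun y => - (/ y * / y)) f); auto.
  assert (K := IH (ck_pred _ _ _ Hf)).
  apply (ck_ext n U (fun x => (-1) * (/ f x * / f x))); auto; [intros; ring|].
  apply ck_mult; auto; [apply ck_const; auto|apply ck_mult; auto].
Qed.

Lemma ck_ln n U f : open U -> (forall p, U p -> 0 < f p) -> ck n U f -> ck n U (fun x => ln (f x)).
Proof.
intros oU H0 Hf. assert (Hd : forall p, U p -> is_derive ln (f p) (/ f p)).
{ intros p Up. apply is_derive_ln; auto. }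
destruct n as [|n].
- split; auto. intros p Up; eapply continuous_compose; [auto|eapply ck_continuous; eauto].
- apply (ck_compose n U ln Rinv f); auto.
  apply ck_inv; auto; [|apply ck_pred; auto].
  intros p Up; specialize (H0 p Up); lra.
Qed.

Lemma ck_exp n U f : open U -> ck n U f -> ck n U (fun x => exp (f x)).
Proof.
intros oU. assert (Hd : forall p, U p -> is_derive exp (f p) (exp (f p))).
{ intros p Up. apply is_derive_exp. }
induction n as [|n IH]; intros Hf.
- split; auto. intros p Up; eapply continuous_compose; [auto|eapply ck_continuous; eauto].
- apply (ck_compose n U exp exp f); auto. apply IH, ck_pred; auto.
Qed.

(** Reduced to [exp] and [ln] by sqrt y = exp (ln y / 2) for y > 0. *)
Lemma ck_sqrt n U f : open U -> (forall p, U p -> 0 < f p) -> ck n U f -> ck n U (fun x => sqrt (f x)).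
Proof.
intros oU H0 Hf.
apply (ck_ext n U (fun x => exp (/ 2 * ln (f x)))); auto.
- intros p Up. specialize (H0 p Up).
  apply Rsqr_inj; [left; apply exp_pos|apply sqrt_pos|].
  rewrite Rsqr_sqrt; [|lra]. unfold Rsqr. rewrite <- exp_plus.
  replace (/ 2 * ln (f p) + / 2 * ln (f p)) with (ln (f p)) by field.
  apply exp_ln; auto.
- apply ck_exp; auto. apply ck_mult; auto; [apply ck_const|apply ck_ln]; auto.
Qed.

(** Differentiation keeps the radius of convergence infinite, so the induction runs over all
    coefficient sequences at once. *)
Lemma ck_PSeries n U a f : open U -> CV_radius a = p_infty -> ck n U f -> ck n U (fun x => PSeries a (f x)).
Proof.
intros oU; revert a. induction n as [|n IH]; intros a Ha Hf;
  assert (Hd : forall p, U p -> is_derive (PSeries a) (f p) (PSeries (PS_derive a) (f p)))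
   by (intros p Up; apply is_derive_PSeries; rewrite Ha; exact I).
- split; auto. intros p Up; eapply continuous_compose; [auto|eapply ck_continuous; eauto].
- apply (ck_compose n U _ (PSeries (PS_derive a)) f); auto.
  apply IH; [rewrite CV_radius_derive; auto|apply ck_pred; auto].
Qed.

Lemma smooth_sub (U V : pt -> Prop) f : (forall p, V p -> U p) -> smooth U f -> smooth V f.
Proof. intros s H w p Vp; apply H; auto. Qed.

(** On the positive horizontal axis the radius is the first coordinate, so the one-variable
    regularity demanded by [realizes] and [asymptotic_rel] is read off planar smoothness. *)
Lemma smooth_ex_derive_n U f x n :
  smooth U f -> U (x, 0) -> ex_derive_n (fun s => f (s, 0)) n x.
Proof.
intros H Ux.
assert (K : forall n x, Derive_n (fun s => f (s, 0)) n x = iter_pd (repeat X1 n) f (x, 0)).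
{ clear. induction n as [|n IH]; intros x; [reflexivity|].
  simpl. unfold pd. simpl. apply Derive_ext. intros t; apply IH. }
destruct n as [|n]; simpl; [exact I|].
apply (ex_derive_ext (fun s => iter_pd (repeat X1 n) f (s, 0))); [symmetry; apply K|].
exact (proj2 (H (repeat X1 n) (x, 0) Ux) X1).
Qed.

Lemma nsq_ge0 p : 0 <= nsq p.
Proof. unfold nsq; generalize (pow2_ge_0 (fst p)) (pow2_ge_0 (snd p)); lra. Qed.

Lemma continuous_nsq p : continuous nsq p.
Proof.
unfold nsq. apply (continuous_plus (V := R_NormedModule) (fun p : pt => fst p ^ 2) (fun p : pt => snd p ^ 2)).
- apply (continuous_ext (fun p : pt => comp X1 p * comp X1 p)); [intros; simpl; ring|].
  apply (continuous_mult (K := R_AbsRing)); apply continuous_coord.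
- apply (continuous_ext (fun p : pt => comp X2 p * comp X2 p)); [intros; simpl; ring|].
  apply (continuous_mult (K := R_AbsRing)); apply continuous_coord.
Qed.

Lemma open_nsq (D : R -> Prop) : open D -> open (fun p => D (nsq p)).
Proof.
intros oD p Dp. apply (continuous_nsq p). apply oD; auto.
Qed.

Lemma is_pd_nsq i p : is_pd i nsq p (2 * comp i p).
Proof.
destruct i; unfold is_pd, nsq; simpl; auto_derive; auto; simpl; ring.
Qed.

Lemma is_pd_radial i F p l :
  is_derive F (nsq p) l -> is_pd i (fun x => F (nsq x)) p (2 * comp i p * l).
Proof. intros H. apply is_pd_compose; [auto|apply is_pd_nsq]. Qed.

Lemma is_pd_val i f p a b : is_pd i f p a -> a = b -> is_pd i f p b.
Proof. intros H <-; exact H. Qed.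

Lemma is_pd_scal i c f p a : is_pd i f p a -> is_pd i (fun x => c * f x) p (c * a).
Proof.
intros H. eapply is_pd_val; [apply is_pd_mult; [apply is_pd_const|exact H]|simpl; ring].
Qed.

(** * Curvature of rotationally symmetric metrics *)

(** P is the eigenvalue in the angular direction and P + q Q the one in the radial direction.
    Coefficients that are functions of q = |p|^2 make smoothness at the origin a matter of
    smoothness of P and Q. *)
Definition hm (P Q : R -> R) : metric := fun i j p =>
  kron i j * P (nsq p) + comp i p * comp j p * Q (nsq p).

(** The shape of the Christoffel symbols of [hm], with upper index k: the general tensor equivariant
    under rotations and reflections that is symmetric in i and j. *)
Definition rot3 (al be ga : R -> R) (k i j : ix) (p : pt) : R :=
  (comp i p * kron j k + comp j p * kron i k) * al (nsq p) +
  kron i j * comp k p * be (nsq p) + comp i p * comp j p * comp k p * ga (nsq p).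

Lemma is_pd_hm P Q p P1 Q1 k i j :
  is_derive P (nsq p) P1 -> is_derive Q (nsq p) Q1 ->
  is_pd k (hm P Q i j) p
    (2 * comp k p * (kron i j * P1 + comp i p * comp j p * Q1) +
     Q (nsq p) * (kron k i * comp j p + comp i p * kron k j)).
Proof.
intros HP HQ. unfold hm.
eapply is_pd_val.
- apply is_pd_plus; [apply is_pd_scal, is_pd_radial, HP|].
  apply is_pd_mult; [apply is_pd_mult; apply is_pd_coord|apply is_pd_radial, HQ].
- simpl; ring.
Qed.

Lemma is_pd_rot3 al be ga p al1 be1 ga1 m k i j :
  is_derive al (nsq p) al1 -> is_derive be (nsq p) be1 -> is_derive ga (nsq p) ga1 ->
  is_pd m (rot3 al be ga k i j) p
    ((comp i p * kron j k + comp j p * kron i k) * (2 * comp m p * al1) +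
     (kron m i * kron j k + kron m j * kron i k) * al (nsq p) +
     kron i j * comp k p * (2 * comp m p * be1) + kron i j * kron m k * be (nsq p) +
     comp i p * comp j p * comp k p * (2 * comp m p * ga1) +
     (kron m i * comp j p * comp k p + comp i p * kron m j * comp k p +
      comp i p * comp j p * kron m k) * ga (nsq p)).
Proof.
intros Ha Hb Hg. unfold rot3.
eapply is_pd_val.
- apply is_pd_plus; [apply is_pd_plus|].
  + apply is_pd_mult; [apply is_pd_plus|apply is_pd_radial, Ha].
    * apply is_pd_mult; [apply is_pd_coord|apply is_pd_const].
    * apply is_pd_mult; [apply is_pd_coord|apply is_pd_const].
  + apply is_pd_mult; [apply is_pd_scal, is_pd_coord|apply is_pd_radial, Hb].
  + apply is_pd_mult; [|apply is_pd_radial, Hg].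
    apply is_pd_mult; [apply is_pd_mult; apply is_pd_coord|apply is_pd_coord].
- simpl; ring.
Qed.

Lemma det_hm P Q p : det (hm P Q) p = P (nsq p) * (P (nsq p) + nsq p * Q (nsq p)).
Proof.
unfold det, hm. simpl. generalize (P (nsq p)) (Q (nsq p)); intros. unfold nsq. ring.
Qed.

Lemma christoffel_hm P Q p P1 Q1 k i j :
  is_derive P (nsq p) P1 -> is_derive Q (nsq p) Q1 ->
  P (nsq p) <> 0 -> P (nsq p) + nsq p * Q (nsq p) <> 0 ->
  christoffel (hm P Q) k i j p =
  (comp i p * kron j k + comp j p * kron i k) * (P1 / P (nsq p)) +
  kron i j * comp k p * ((Q (nsq p) - P1) / (P (nsq p) + nsq p * Q (nsq p))) +
  comp i p * comp j p * comp k p *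
    ((Q1 - 2 * P1 * Q (nsq p) / P (nsq p)) / (P (nsq p) + nsq p * Q (nsq p))).
Proof.
intros HP HQ P0 N0. unfold christoffel, sum_ix.
rewrite !(is_pd_unique _ _ _ _ (is_pd_hm P Q p P1 Q1 _ _ _ HP HQ)).
destruct k; simpl inv_metric; rewrite det_hm; unfold hm;
  revert P0 N0; generalize (P (nsq p)) (Q (nsq p)); intros a b P0 N0;
  unfold nsq in *; destruct i, j, p as [x y]; simpl fst in *; simpl snd in *;
  simpl comp; simpl kron; field; repeat split; assumption.
Qed.

Section Curvature.

Variables (D : R -> Prop) (P P1 P2 Q Q1 Q2 : R -> R).
Hypothesis oD : open D.
Hypothesis HP : forall q, 0 <= q -> D q -> is_derive P q (P1 q).
Hypothesis HP1 : forall q, 0 <= q -> D q -> is_derive P1 q (P2 q).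
Hypothesis HQ : forall q, 0 <= q -> D q -> is_derive Q q (Q1 q).
Hypothesis HQ1 : forall q, 0 <= q -> D q -> is_derive Q1 q (Q2 q).
Hypothesis P_pos : forall q, 0 <= q -> D q -> 0 < P q.
Hypothesis N_pos : forall q, 0 <= q -> D q -> 0 < P q + q * Q q.

(** Gauss curvature in the orthogonal coordinates (q, theta). There E = N / (4 q) and G = q P with N
    = P + q Q, so E G = N P / 4, and - (G' / sqrt (E G))' / (2 sqrt (E G)) expands to this
    expression, free of square roots and of a pole at q = 0. *)
Definition hm_curv (q : R) : R :=
  - 2 * ((2 * P1 q + q * P2 q) / (P q * (P q + q * Q q)) -
    (P q + q * P1 q) * (P1 q * (P q + q * Q q) + P q * (P1 q + Q q + q * Q1 q)) /
      (2 * (P q * (P q + q * Q q)) ^ 2)).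

Let al q := P1 q / P q.
Let be q := (Q q - P1 q) / (P q + q * Q q).
Let ga q := (Q1 q - 2 * P1 q * Q q / P q) / (P q + q * Q q).

Lemma christoffel_hm_rot3 k i j p :
  D (nsq p) -> christoffel (hm P Q) k i j p = rot3 al be ga k i j p.
Proof.
intros Dp. assert (q0 := nsq_ge0 p).
assert (a := P_pos _ q0 Dp). assert (b := N_pos _ q0 Dp).
rewrite (christoffel_hm P Q p (P1 (nsq p)) (Q1 (nsq p))); auto; lra.
Qed.

(** The derivative of [ga] enters only through a term symmetric in all four indices, which cancels
    in the curvature tensor; leaving it as an unspecified [ga1] keeps the second derivative of Q out
    of the later computations. *)
Lemma pd_christoffel_hm p : D (nsq p) -> exists ga1, forall m k i j,
  let q := nsq p in
  let N := P q + q * Q q in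
  pd m (christoffel (hm P Q) k i j) p =
    ((comp i p * kron j k + comp j p * kron i k) *
       (2 * comp m p * (P2 q / P q - P1 q ^ 2 / P q ^ 2)) +
     (kron m i * kron j k + kron m j * kron i k) * al (nsq p) +
     kron i j * comp k p *
       (2 * comp m p * ((Q1 q - P2 q) / N - (Q q - P1 q) * (P1 q + Q q + q * Q1 q) / N ^ 2)) +
     kron i j * kron m k * be (nsq p) +
     comp i p * comp j p * comp k p * (2 * comp m p * ga1) +
     (kron m i * comp j p * comp k p + comp i p * kron m j * comp k p +
      comp i p * comp j p * kron m k) * ga (nsq p)).
Proof.
intros Dp. assert (q0 := nsq_ge0 p).
assert (a := P_pos _ q0 Dp). assert (b := N_pos _ q0 Dp).
assert (dP := HP _ q0 Dp). assert (dP1 := HP1 _ q0 Dp).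
assert (dQ := HQ _ q0 Dp). assert (dQ1 := HQ1 _ q0 Dp).
assert (eP : ex_derive P (nsq p)) by (eexists; eauto).
assert (eP1 : ex_derive P1 (nsq p)) by (eexists; eauto).
assert (eQ : ex_derive Q (nsq p)) by (eexists; eauto).
assert (eQ1 : ex_derive Q1 (nsq p)) by (eexists; eauto).
assert (N0 : P (nsq p) + nsq p * Q (nsq p) <> 0) by lra.
assert (P0 : P (nsq p) <> 0) by lra.
assert (eg : ex_derive ga (nsq p)).
{ unfold ga. auto_derive. repeat split; auto. }
exists (Derive ga (nsq p)).
assert (rP : Derive (fun x : R => P x) (nsq p) = P1 (nsq p)) by (apply is_derive_unique; auto).
assert (rP1 : Derive (fun x : R => P1 x) (nsq p) = P2 (nsq p)) by (apply is_derive_unique; auto).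
assert (rQ : Derive (fun x : R => Q x) (nsq p) = Q1 (nsq p)) by (apply is_derive_unique; auto).
intros m k i j q N.
rewrite (pd_ext_loc m (fun p => D (nsq p)) _ (rot3 al be ga k i j)); auto.
2: apply open_nsq; auto.
2: intros; apply christoffel_hm_rot3; auto.
apply is_pd_unique, is_pd_rot3; subst N; subst q.
- unfold al; auto_derive; [repeat split; auto|].
  rewrite rP, rP1. field; auto.
- unfold be; auto_derive; [repeat split; auto|].
  rewrite rP, rP1, rQ.
  field; auto.
- apply Derive_correct; auto.
Qed.

Lemma ricci_hm j k p : D (nsq p) -> ricci (hm P Q) j k p = hm_curv (nsq p) * hm P Q j k p.
Proof.
intros Dp. assert (q0 := nsq_ge0 p).
assert (a := P_pos _ q0 Dp). assert (b := N_pos _ q0 Dp).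
destruct (pd_christoffel_hm p Dp) as [ga1 H].
unfold ricci, riem, sum_ix, hm_curv, hm. rewrite !H, !christoffel_hm_rot3; auto.
unfold rot3, al, be, ga. clear H.
generalize dependent (P (nsq p)); intros u a b.
generalize dependent (Q (nsq p)); intros v b.
generalize (P1 (nsq p)) (P2 (nsq p)) (Q1 (nsq p)); intros u1 u2 v1.
clear -a b. unfold nsq in *. destruct p as [x y]. simpl fst in *; simpl snd in *.
destruct j, k; simpl comp; simpl kron; field; repeat split; lra.
Qed.

Lemma gauss_hm p : D (nsq p) -> gauss (hm P Q) p = hm_curv (nsq p).
Proof.
intros Dp. assert (q0 := nsq_ge0 p).
assert (a := P_pos _ q0 Dp). assert (b := N_pos _ q0 Dp).
destruct (pd_christoffel_hm p Dp) as [ga1 H].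
unfold gauss, riem, sum_ix, hm_curv. rewrite det_hm.
rewrite !H, !christoffel_hm_rot3; auto.
unfold rot3, al, be, ga. clear H.
unfold hm.
generalize dependent (P (nsq p)); intros u a b.
generalize dependent (Q (nsq p)); intros v b.
generalize (P1 (nsq p)) (P2 (nsq p)) (Q1 (nsq p)); intros u1 u2 v1.
clear -a b. unfold nsq in *. destruct p as [x y]. simpl fst in *; simpl snd in *.
simpl comp; simpl kron; field; repeat split; lra.
Qed.

Variables (F F1 F2 : R -> R) (lam : R).
Hypothesis HF : forall q, 0 <= q -> D q -> is_derive F q (F1 q).
Hypothesis HF1 : forall q, 0 <= q -> D q -> is_derive F1 q (F2 q).

Let eta q := 2 * F1 q / (P q + q * Q q).

(** The position vector is an eigenvector of the metric for P + q Q, and the differential of F (q)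
    is 2 F' times that vector, so the gradient is a radial field with factor [eta]. *)
Lemma grad_hm k p : D (nsq p) ->
  grad (hm P Q) (fun x => F (nsq x)) k p = eta (nsq p) * comp k p.
Proof.
intros Dp. assert (q0 := nsq_ge0 p).
assert (a := P_pos _ q0 Dp). assert (b := N_pos _ q0 Dp).
unfold grad, sum_ix.
rewrite !(is_pd_unique _ _ _ _ (is_pd_radial _ F p _ (HF _ q0 Dp))).
unfold eta. generalize (F1 (nsq p)); intros f1.
destruct k; simpl inv_metric; rewrite det_hm; unfold hm;
  generalize dependent (P (nsq p)); intros u a b; revert b;
  generalize (Q (nsq p)); intros v b;
  clear -a b; unfold nsq in *; destruct p as [x y]; simpl fst in *; simpl snd in *;
  simpl comp; simpl kron; field; repeat split; lra.
Qed.

Lemma lie_hm i j p : D (nsq p) ->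
  let q := nsq p in
  let N := P q + q * Q q in
  let eta1 := 2 * F2 q / N - 2 * F1 q * (P1 q + Q q + q * Q1 q) / N ^ 2 in
  lie_metric (grad (hm P Q) (fun x => F (nsq x))) (hm P Q) i j p =
  kron i j * (2 * eta q * (q * P1 q + P q)) +
  comp i p * comp j p * (2 * eta q * (q * Q1 q + 2 * Q q) + 4 * eta1 * N).
Proof.
intros Dp q N eta1. assert (q0 := nsq_ge0 p).
assert (a := P_pos _ q0 Dp). assert (b := N_pos _ q0 Dp).
assert (N0 : P (nsq p) + nsq p * Q (nsq p) <> 0) by lra.
assert (de : is_derive eta (nsq p) eta1).
{ assert (eP : ex_derive P (nsq p)) by (eexists; auto).
  assert (eQ : ex_derive Q (nsq p)) by (eexists; auto).
  assert (eF : ex_derive F1 (nsq p)) by (eexists; auto).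
  assert (rP : Derive (fun x : R => P x) (nsq p) = P1 (nsq p)) by (apply is_derive_unique; auto).
  assert (rF : Derive (fun x : R => F1 x) (nsq p) = F2 (nsq p)) by (apply is_derive_unique; auto).
  assert (rQ : Derive (fun x : R => Q x) (nsq p) = Q1 (nsq p)) by (apply is_derive_unique; auto).
  unfold eta. auto_derive; [repeat split; auto|].
  rewrite rP, rF, rQ. unfold eta1, N, q. field; auto. }
assert (dV : forall m k, pd m (grad (hm P Q) (fun x => F (nsq x)) k) p =
  2 * comp m p * eta1 * comp k p + eta q * kron m k).
{ intros m k.
  rewrite (pd_ext_loc m (fun p => D (nsq p)) _ (fun p => eta (nsq p) * comp k p)); auto.
  2: apply open_nsq; auto.
  2: intros; apply grad_hm; auto.
  apply is_pd_unique, is_pd_mult; [apply is_pd_radial; auto|apply is_pd_coord]. }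
unfold lie_metric, sum_ix. rewrite !dV, !grad_hm; auto.
rewrite !(is_pd_unique _ _ _ _ (is_pd_hm P Q p _ _ _ _ _ (HP _ q0 Dp) (HQ _ q0 Dp))).
unfold hm. subst N q. clearbody eta1. clear de dV. fold (eta (nsq p)).
generalize (eta (nsq p)) (P (nsq p)) (Q (nsq p)) (P1 (nsq p)) (Q1 (nsq p)).
intros e u v u1 v1.
unfold nsq; destruct i, j, p as [x y]; simpl fst; simpl snd; simpl comp; simpl kron; ring.
Qed.

(** The tensor equation splits into the coefficients of [kron i j] and of x_i x_j. At the origin x_i
    x_j vanishes, so the second scalar equation is required only for q > 0, where the momentum
    formulas apply. *)
Lemma soliton_hm :
  (forall q, 0 <= q -> D q -> (lam - hm_curv q) * P q = eta q * (q * P1 q + P q)) ->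
  (forall q, 0 < q -> D q -> (lam - hm_curv q) * Q q =
     eta q * (q * Q1 q + 2 * Q q) + 2 * (2 * F2 q -
       2 * F1 q * (P1 q + Q q + q * Q1 q) / (P q + q * Q q))) ->
  forall p, D (nsq p) -> forall i j,
    - 2 * ricci (hm P Q) i j p =
    lie_metric (grad (hm P Q) (fun x => F (nsq x))) (hm P Q) i j p - 2 * lam * hm P Q i j p.
Proof.
intros HA HB p Dp i j. rewrite ricci_hm, lie_hm; auto.
assert (q0 := nsq_ge0 p). assert (b := N_pos _ q0 Dp).
specialize (HA _ q0 Dp).
assert (HB' : comp i p * comp j p * ((lam - hm_curv (nsq p)) * Q (nsq p)) =
  comp i p * comp j p * (eta (nsq p) * (nsq p * Q1 (nsq p) + 2 * Q (nsq p)) +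
     2 * (2 * F2 (nsq p) - 2 * F1 (nsq p) * (P1 (nsq p) + Q (nsq p) + nsq p * Q1 (nsq p)) /
       (P (nsq p) + nsq p * Q (nsq p))))).
{ destruct (Req_dec (nsq p) 0) as [e|e].
  - assert (c0 : comp i p = 0).
    { unfold nsq in e. assert (h1 := pow2_ge_0 (fst p)). assert (h2 := pow2_ge_0 (snd p)).
      destruct i; simpl comp; apply Rsqr_0_uniq; unfold Rsqr; nra. }
    rewrite c0; ring.
  - rewrite HB; auto. destruct q0; [lra|congruence]. }
unfold hm.
revert HA HB' b.
generalize (hm_curv (nsq p)) (eta (nsq p)) (P (nsq p)) (Q (nsq p)) (P1 (nsq p)) (Q1 (nsq p)) (F1 (nsq p)) (F2 (nsq p)).
intros K e u v u1 v1 f1 f2 HA HB' b.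
match goal with |- _ = ?r => replace r with (kron i j * (2 * (e * (nsq p * u1 + u))) +
  2 * (comp i p * comp j p * (e * (nsq p * v1 + 2 * v) +
        2 * (2 * f2 - 2 * f1 * (u1 + v + nsq p * v1) / (u + nsq p * v)))) - 2 * lam * (kron i j * u + comp i p * comp j p * v)) end.
- rewrite <- HA, <- HB'. unfold hm. ring.
- unfold hm. field. lra.
Qed.

End Curvature.

(** * Momentum coordinates *)

Ltac nz := repeat (first [assumption | lra | apply pow_nonzero | apply Rmult_integral_contrapositive_currified]).

(** P, Q and their derivatives are handed over as abstract functions, given by power series near a
    smooth origin; uniqueness of derivatives identifies them with closed forms in T, U and X for q >
    0. *)
Lemma is_derive_eq_loc (D : R -> Prop) (f g : R -> R) (q a b : R) :
  open D -> D q -> (forall y, D y -> f y = g y) ->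
  is_derive f q a -> is_derive g q b -> a = b.
Proof.
intros oD Dq e Hf Hg.
rewrite <- (is_derive_unique f q a Hf), <- (is_derive_unique g q b Hg).
apply Derive_ext_loc, (filter_imp D); auto.
Qed.

Lemma open_and_pos (D : R -> Prop) : open D -> open (fun q => 0 < q /\ D q).
Proof. intros oD. apply open_and; [apply open_gt|exact oD]. Qed.

Section Momentum.

Variables (lam mu : R) (T U X X1 X2 : R -> R) (D : R -> Prop).
Variables (P P1 P2 Q Q1 : R -> R).
Hypothesis dT : forall x, is_derive T x (U x).
Hypothesis dU : forall x, is_derive U x (4 * mu * U x - 2 * lam).
Hypothesis oD : open D.
Hypothesis dX : forall q, 0 < q -> D q -> is_derive X q (X1 q).
Hypothesis dX1 : forall q, 0 < q -> D q -> is_derive X1 q (X2 q).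
Hypothesis X1_neq0 : forall q, 0 < q -> D q -> X1 q <> 0.
Hypothesis T_pos : forall q, 0 < q -> D q -> 0 < T (X q).
Hypothesis HP : forall q, 0 < q -> D q -> is_derive P q (P1 q).
Hypothesis HP1 : forall q, 0 < q -> D q -> is_derive P1 q (P2 q).
Hypothesis HQ : forall q, 0 < q -> D q -> is_derive Q q (Q1 q).
Hypothesis PT : forall q, 0 < q -> D q -> P q = 4 * T (X q) / q.
Hypothesis QT : forall q, 0 < q -> D q -> Q q = 4 * (X1 q ^ 2 / T (X q) - T (X q) / q ^ 2).

Lemma momentum_P1 q : 0 < q -> D q -> P1 q = 4 * (U (X q) * X1 q / q - T (X q) / q ^ 2).
Proof.
intros q0 Dq.
apply (is_derive_eq_loc _ P (fun q => 4 * T (X q) / q) q _ _ (open_and_pos D oD)); auto.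
- intros y [y0 Dy]; auto.
- assert (e1 : ex_derive T (X q)) by (eexists; auto). assert (e0 : ex_derive X q) by (eexists; auto).
  auto_derive; [repeat split; auto; nz|].
  replace (Derive (fun x : R => T x) (X q)) with (U (X q)) by (symmetry; apply is_derive_unique; auto).
  replace (Derive (fun x : R => X x) q) with (X1 q) by (symmetry; apply is_derive_unique; auto).
  field; lra.
Qed.

Lemma momentum_P2 q : 0 < q -> D q ->
  P2 q = 4 * (((4 * mu * U (X q) - 2 * lam) * X1 q ^ 2 + U (X q) * X2 q) / q
              - 2 * U (X q) * X1 q / q ^ 2 + 2 * T (X q) / q ^ 3).
Proof.
intros q0 Dq.
apply (is_derive_eq_loc _ P1 (fun q => 4 * (U (X q) * X1 q / q - T (X q) / q ^ 2)) q _ _ (open_and_pos D oD)); auto.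
- intros y [y0 Dy]; apply momentum_P1; auto.
- assert (d3 := dX1 q q0 Dq).
  assert (e1 : ex_derive T (X q)) by (eexists; auto). assert (e0 : ex_derive X q) by (eexists; auto).
  assert (e2 : ex_derive U (X q)) by (eexists; auto).
  assert (e3 : ex_derive X1 q) by (eexists; eauto).
  auto_derive; [repeat split; auto; nz|].
  replace (Derive (fun x : R => T x) (X q)) with (U (X q)) by (symmetry; apply is_derive_unique; auto).
  replace (Derive (fun x : R => X x) q) with (X1 q) by (symmetry; apply is_derive_unique; auto).
  replace (Derive (fun x : R => U x) (X q)) with (4 * mu * U (X q) - 2 * lam)
    by (symmetry; apply is_derive_unique; auto).
  replace (Derive (fun x : R => X1 x) q) with (X2 q)
    by (symmetry; apply is_derive_unique; auto).
  field; lra.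
Qed.

Lemma momentum_Q1 q : 0 < q -> D q ->
  Q1 q = 4 * (2 * X1 q * X2 q / T (X q) - X1 q ^ 3 * U (X q) / T (X q) ^ 2
              - U (X q) * X1 q / q ^ 2 + 2 * T (X q) / q ^ 3).
Proof.
intros q0 Dq.
apply (is_derive_eq_loc _ Q (fun q => 4 * (X1 q ^ 2 / T (X q) - T (X q) / q ^ 2)) q _ _ (open_and_pos D oD)); auto.
- intros y [y0 Dy]; auto.
- assert (d3 := dX1 q q0 Dq). assert (t0 := T_pos q q0 Dq).
  assert (e1 : ex_derive T (X q)) by (eexists; auto). assert (e0 : ex_derive X q) by (eexists; auto).
  assert (e3 : ex_derive X1 q) by (eexists; eauto).
  auto_derive; [repeat split; auto; nz|].
  replace (Derive (fun x : R => T x) (X q)) with (U (X q)) by (symmetry; apply is_derive_unique; auto).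
  replace (Derive (fun x : R => X x) q) with (X1 q) by (symmetry; apply is_derive_unique; auto).
  replace (Derive (fun x : R => X1 x) q) with (X2 q)
    by (symmetry; apply is_derive_unique; auto).
  field; lra.
Qed.

Lemma momentum_N q : 0 < q -> D q -> P q + q * Q q = 4 * X1 q ^ 2 * q / T (X q).
Proof.
intros q0 Dq. assert (t0 := T_pos q q0 Dq). rewrite PT, QT; auto. field; lra.
Qed.

Lemma momentum_curv q : 0 < q -> D q -> hm_curv P P1 P2 Q Q1 q = lam - 2 * mu * U (X q).
Proof.
intros q0 Dq. assert (t0 := T_pos q q0 Dq). assert (x0 := X1_neq0 q q0 Dq).
unfold hm_curv.
(* The product (P + q Q) P equals 16 X1^2, where T has cancelled, so its derivative is 32 X1 X2. *)
replace (P1 q * (P q + q * Q q) + P q * (P1 q + Q q + q * Q1 q))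
  with (32 * X1 q * X2 q)
  by (rewrite momentum_P1, momentum_Q1, PT, QT; auto; field; lra).
rewrite momentum_N, momentum_P1, momentum_P2, PT; auto.
field. repeat split; lra.
Qed.

Lemma momentum_soliton1 q : 0 < q -> D q ->
  (lam - hm_curv P P1 P2 Q Q1 q) * P q =
  2 * (4 * mu * X1 q) / (P q + q * Q q) * (q * P1 q + P q).
Proof.
intros q0 Dq. assert (t0 := T_pos q q0 Dq). assert (x0 := X1_neq0 q q0 Dq).
rewrite momentum_curv, momentum_N, momentum_P1, PT; auto.
field. repeat split; lra.
Qed.

Lemma momentum_soliton2 q : 0 < q -> D q ->
  (lam - hm_curv P P1 P2 Q Q1 q) * Q q =
  2 * (4 * mu * X1 q) / (P q + q * Q q) * (q * Q1 q + 2 * Q q) +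
  2 * (2 * (4 * mu * X2 q) -
       2 * (4 * mu * X1 q) * (P1 q + Q q + q * Q1 q) / (P q + q * Q q)).
Proof.
intros q0 Dq. assert (t0 := T_pos q q0 Dq). assert (x0 := X1_neq0 q q0 Dq).
rewrite momentum_curv, momentum_N, momentum_P1, momentum_Q1, QT; auto.
field. repeat split; lra.
Qed.

End Momentum.

(** * Radial and angular components of the metric form *)

Definition dot (p v : pt) : R := fst p * fst v + snd p * snd v.
Definition crs (p v : pt) : R := fst p * snd v - snd p * fst v.

Lemma quad_hm P Q p v :
  quad (hm P Q) p v = P (nsq p) * nsq v + Q (nsq p) * dot p v ^ 2.
Proof.
unfold quad, sum_ix, hm. generalize (P (nsq p)) (Q (nsq p)); intros a b.
unfold nsq, dot. simpl comp; simpl kron. ring.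
Qed.

Lemma dot_crs p v : dot p v ^ 2 + crs p v ^ 2 = nsq p * nsq v.
Proof. unfold dot, crs, nsq; ring. Qed.

Lemma nsq_pos v : v <> (0, 0) -> 0 < nsq v.
Proof.
intros H. destruct (nsq_ge0 v) as [h|h]; auto. exfalso; apply H.
destruct v as [x y]; unfold nsq in h; simpl fst in h; simpl snd in h.
assert (hx := pow2_ge_0 x); assert (hy := pow2_ge_0 y).
f_equal; apply Rsqr_0_uniq; unfold Rsqr; nra.
Qed.

(** [dot] and [crs] divided by |p| are the radial and angular components of v; clearing the
    denominator keeps the identity valid at the origin. *)
Lemma nsq_quad_hm P Q p v :
  nsq p * quad (hm P Q) p v =
  (P (nsq p) + nsq p * Q (nsq p)) * dot p v ^ 2 + P (nsq p) * crs p v ^ 2.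
Proof.
rewrite quad_hm.
transitivity (P (nsq p) * (dot p v ^ 2 + crs p v ^ 2) + nsq p * Q (nsq p) * dot p v ^ 2); [rewrite dot_crs|]; ring.
Qed.

(** A lower bound on both eigenvalues bounds the form, by dot^2 + crs^2 = |p|^2 |v|^2; at the origin
    that identity says nothing about v, and the form is read off directly. *)
Lemma quad_hm_lower P Q p v c :
  c <= P (nsq p) -> c <= P (nsq p) + nsq p * Q (nsq p) -> c * nsq v <= quad (hm P Q) p v.
Proof.
intros H1 H2. assert (q0 := nsq_ge0 p). destruct q0 as [q0|q0].
- apply (Rmult_le_reg_l (nsq p)); auto.
  rewrite nsq_quad_hm.
  replace (nsq p * (c * nsq v)) with (c * (dot p v ^ 2 + crs p v ^ 2)) by (rewrite dot_crs; ring).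
  assert (h1 := Rmult_le_compat_r _ _ _ (pow2_ge_0 (dot p v)) H2).
  assert (h2 := Rmult_le_compat_r _ _ _ (pow2_ge_0 (crs p v)) H1). lra.
- rewrite quad_hm. assert (h := dot_crs p v). rewrite <- q0 in *.
  assert (h1 := pow2_ge_0 (dot p v)). assert (h2 := pow2_ge_0 (crs p v)).
  assert (e : dot p v ^ 2 = 0) by lra. rewrite e. assert (h3 := nsq_ge0 v). nra.
Qed.

Lemma quad_hm_pos P Q p v :
  0 < P (nsq p) -> 0 < P (nsq p) + nsq p * Q (nsq p) -> v <> (0, 0) -> 0 < quad (hm P Q) p v.
Proof.
intros H1 H2 v0. apply nsq_pos in v0.
apply Rlt_le_trans with (Rmin (P (nsq p)) (P (nsq p) + nsq p * Q (nsq p)) * nsq v).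
- apply Rmult_lt_0_compat; auto. apply Rmin_pos; auto.
- apply quad_hm_lower; [apply Rmin_l|apply Rmin_r].
Qed.

Definition dom (D : R -> Prop) (p : pt) : Prop := D (nsq p).

Lemma open_dom D : open D -> open (dom D).
Proof. apply open_nsq. Qed.

Lemma ck_nsq n V : open V -> ck n V nsq.
Proof.
intros oV. apply (ck_ext n V (fun p => comp X1 p * comp X1 p + comp X2 p * comp X2 p)); auto.
- intros; unfold nsq; simpl; ring.
- apply ck_plus; auto; apply ck_mult; auto; apply ck_coord; auto.
Qed.

Lemma smooth_hm V P Q : open V -> (forall n, ck n V (fun p => P (nsq p))) ->
  (forall n, ck n V (fun p => Q (nsq p))) -> forall i j, smooth V (hm P Q i j).
Proof.
intros oV sP sQ i j. apply ck_smooth. intros n. unfold hm.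
apply ck_plus; auto; apply ck_mult; auto.
- apply ck_const; auto.
- apply ck_mult; auto; apply ck_coord; auto.
Qed.

Lemma riemannian_hm D P Q : open D -> (forall n, ck n (dom D) (fun p => P (nsq p))) ->
  (forall n, ck n (dom D) (fun p => Q (nsq p))) ->
  (forall q, 0 <= q -> D q -> 0 < P q) -> (forall q, 0 <= q -> D q -> 0 < P q + q * Q q) ->
  riemannian (dom D) (hm P Q).
Proof.
intros oD sP sQ P0 N0. split; [|split].
- apply smooth_hm; auto. apply open_dom; auto.
- intros p Dp i j. unfold hm. destruct i, j; simpl; ring.
- intros p Dp v v0. assert (q0 := nsq_ge0 p). apply quad_hm_pos; auto.
Qed.

Lemma riemannian_sub (V W : pt -> Prop) h :
  (forall p, W p -> V p) -> riemannian V h -> riemannian W h.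
Proof.
intros s [H1 [H2 H3]]. split; [|split]; auto.
intros i j; apply (smooth_sub V); auto.
Qed.

Lemma gradient_soliton_sub (V W : pt -> Prop) h lam :
  (forall p, W p -> V p) -> gradient_soliton V h lam -> gradient_soliton W h lam.
Proof.
intros s [H1 [f [H2 H3]]]. split; [apply (riemannian_sub V); auto|].
exists f; split; auto. apply (smooth_sub V); auto.
Qed.

(** Together with [Tm]: the solutions of U' = 4 mu U - 2 lam and T' = U with values u0 and t0 at x =
    0. The number lam / (2 mu) is the equilibrium of the first equation, and the position of u0
    relative to it decides the behaviour at an end. *)
Definition Um (u0 lam mu x : R) : R :=
  lam / (2 * mu) + (u0 - lam / (2 * mu)) * exp (4 * mu * x).

Definition Tm (t0 u0 lam mu x : R) : R :=
  t0 + lam / (2 * mu) * x + (u0 - lam / (2 * mu)) * (exp (4 * mu * x) - 1) / (4 * mu).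

Lemma dTm t0 u0 lam mu x : mu <> 0 -> is_derive (Tm t0 u0 lam mu) x (Um u0 lam mu x).
Proof. intros m0. unfold Tm, Um. auto_derive; auto. field; auto. Qed.

Lemma dUm u0 lam mu x : mu <> 0 ->
  is_derive (Um u0 lam mu) x (4 * mu * Um u0 lam mu x - 2 * lam).
Proof. intros m0. unfold Um. auto_derive; auto. field; auto. Qed.

Lemma Tm_0 t0 u0 lam mu : Tm t0 u0 lam mu 0 = t0.
Proof. unfold Tm. rewrite !Rmult_0_r, exp_0. unfold Rdiv; ring. Qed.

Lemma Um_0 u0 lam mu : Um u0 lam mu 0 = u0.
Proof. unfold Um. rewrite !Rmult_0_r, exp_0. ring. Qed.

Lemma Um_curv u0 lam mu x : mu <> 0 ->
  lam - 2 * mu * Um u0 lam mu x = (lam - 2 * mu * u0) * exp (4 * mu * x).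
Proof. intros m0. unfold Um. field; auto. Qed.

Lemma ck_Tm n V t0 u0 lam mu f : open V -> ck n V f -> ck n V (fun p => Tm t0 u0 lam mu (f p)).
Proof.
intros oV sf. unfold Tm.
apply ck_plus; auto; [apply ck_plus; auto; [apply ck_const; auto|]|].
- apply ck_mult; auto. apply ck_const; auto.
- apply (ck_mult n V _ (fun _ => / (4 * mu))); auto; [|apply ck_const; auto].
  apply ck_mult; auto; [apply ck_const; auto|].
  apply ck_plus; auto; [|apply ck_const; auto].
  apply ck_exp; auto. apply ck_mult; auto. apply ck_const; auto.
Qed.

(* (exp z - 1 - z) / z^2, as a power series to be smooth at z = 0. *)
Definition phi2 (z : R) : R :=
  PSeries (PS_decr_1 (PS_decr_1 (fun n => / INR (Factorial.fact n)))) z.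

Lemma CV_radius_exp : CV_radius (fun n => / INR (Factorial.fact n)) = p_infty.
Proof.
apply CV_radius_infinite_DAlembert.
- intros n; apply Rinv_neq_0_compat, INR_fact_neq_0.
- apply (is_lim_seq_ext (fun n => / INR (S n))).
  + intros n. change (Factorial.fact (S n)) with (S n * Factorial.fact n)%nat; rewrite mult_INR.
    assert (h1 := INR_fact_neq_0 n). assert (h2 := not_0_INR (S n) (PeanoNat.Nat.neq_succ_0 n)).
    replace (/ (INR (S n) * INR (Factorial.fact n)) / / INR (Factorial.fact n)) with (/ INR (S n)) by (field; auto).
    rewrite Rabs_right; auto. apply Rle_ge, Rlt_le, Rinv_0_lt_compat, lt_0_INR. lia.
  + apply (is_lim_seq_incr_1 (fun n => / INR n)).
    apply (is_lim_seq_inv INR p_infty); [apply is_lim_seq_INR|discriminate].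
Qed.

Lemma CV_radius_phi2 : CV_radius (PS_decr_1 (PS_decr_1 (fun n => / INR (Factorial.fact n)))) = p_infty.
Proof. rewrite !CV_radius_decr_1. apply CV_radius_exp. Qed.

Lemma exp_phi2 z : exp z = 1 + z + z ^ 2 * phi2 z.
Proof.
rewrite <- (is_pseries_unique _ _ _ (is_exp_Reals z)).
rewrite PSeries_decr_1, (PSeries_decr_1 (PS_decr_1 _)).
- unfold PS_decr_1 at 1. fold (phi2 z). simpl. field.
- apply CV_radius_inside. rewrite CV_radius_decr_1, CV_radius_exp. exact I.
- apply CV_radius_inside. rewrite CV_radius_exp. exact I.
Qed.

Lemma is_derive_PS a (x : R) : CV_radius a = p_infty ->
  is_derive (PSeries a) x (PSeries (PS_derive a) x).
Proof. intros H. apply is_derive_PSeries. rewrite H. exact I. Qed.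

Lemma phi2_0 : phi2 0 = / 2.
Proof. unfold phi2. rewrite PSeries_0. unfold PS_decr_1; simpl. f_equal; ring. Qed.

(* The metric dx^2 / T(x) + 4 T(x) dtheta^2 with x = X(q), q = |p|^2, X1 = X'. *)
Record surface (D : R -> Prop) (P Q : R -> R) (lam mu : R) (T U X X1 : R -> R) : Prop := {
  sf_open : open D;
  sf_ex : forall q, 0 <= q -> D q -> ex_derive P q /\ ex_derive Q q;
  sf_P : forall q, 0 <= q -> D q -> 0 < P q;
  sf_N : forall q, 0 <= q -> D q -> 0 < P q + q * Q q;
  sf_riem : riemannian (dom D) (hm P Q);
  sf_sol : gradient_soliton (dom D) (hm P Q) lam;
  sf_curv : forall p, D (nsq p) -> gauss (hm P Q) p = lam - 2 * mu * U (X (nsq p));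
  sf_PT : forall q, 0 < q -> D q -> P q = 4 * T (X q) / q;
  sf_QT : forall q, 0 < q -> D q -> Q q = 4 * (X1 q ^ 2 / T (X q) - T (X q) / q ^ 2);
  sf_T : forall q, 0 < q -> D q -> 0 < T (X q);
  sf_dT : forall x, is_derive T x (U x);
  sf_dX : forall q, 0 < q -> D q -> is_derive X q (X1 q);
  sf_X1 : forall q, 0 < q -> D q -> X1 q <> 0;
  sf_TX : forall n, ck n (fun p => 0 < nsq p /\ D (nsq p)) (fun p => T (X (nsq p)))
}.

(** * Surfaces through a smooth origin *)

Section Origin.

Variables (lam mu c : R) (D : R -> Prop).
Hypothesis mu0 : mu <> 0.
Hypothesis c0 : 0 < c.

Let a2 := PS_decr_1 (PS_decr_1 (fun n => / INR (Factorial.fact n))).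
Let W x := (4 * mu - 2 * lam) * phi2 (4 * mu * x).
Let W1 x := (4 * mu - 2 * lam) * (4 * mu) * PSeries (PS_derive a2) (4 * mu * x).
Let W2 x := (4 * mu - 2 * lam) * (4 * mu) ^ 2 * PSeries (PS_derive (PS_derive a2)) (4 * mu * x).
Let S x := 1 + x * W x.
Let S1 x := W x + x * W1 x.
Let S2 x := 2 * W1 x + x * W2 x.

(** The quotient T (x) / x for t0 = 0 and u0 = 1, continued through x = 0 by the series [phi2]. *)
Definition origin_S (x : R) : R := 1 + x * ((4 * mu - 2 * lam) * phi2 (4 * mu * x)).

Definition origin_P (q : R) : R := 4 * c * origin_S (c * q).

(** The expression 4 (c^2 / T - T / q^2) with its pole removed. With x = c q and T = x S it is (4 c
    / q) (1 / S - S) = - (4 c / q) (S - 1) (1 + 1 / S), and S - 1 contains the factor c q. *)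
Definition origin_Q (q : R) : R :=
  - 4 * c ^ 2 * ((4 * mu - 2 * lam) * phi2 (4 * mu * (c * q))) *
  (1 + / origin_S (c * q)).

Lemma Tm_origin_S x : Tm 0 1 lam mu x = x * origin_S x.
Proof.
unfold Tm, origin_S. rewrite (exp_phi2 (4 * mu * x)).
generalize (phi2 (4 * mu * x)); intros y. field; auto.
Qed.

Lemma PS_affine a k m x : CV_radius a = p_infty ->
  is_derive (fun x => k * PSeries a (m * x)) x (k * m * PSeries (PS_derive a) (m * x)).
Proof.
intros Ha.
replace (k * m * PSeries (PS_derive a) (m * x)) with (k * (m * PSeries (PS_derive a) (m * x))) by ring.
apply (is_derive_scal (fun x => PSeries a (m * x))).
apply (is_derive_comp (PSeries a) (fun x => m * x)); [apply is_derive_PS; auto|].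
auto_derive; auto; ring.
Qed.

Lemma dW x : is_derive W x (W1 x).
Proof. apply PS_affine, CV_radius_phi2. Qed.

Lemma dW1 x : is_derive W1 x (W2 x).
Proof.
unfold W1, W2. replace (_ * (4 * mu) ^ 2) with ((4 * mu - 2 * lam) * (4 * mu) * (4 * mu)) by ring.
apply PS_affine. rewrite CV_radius_derive. apply CV_radius_phi2.
Qed.

Hypothesis oD : open D.
Hypothesis S_pos : forall q, 0 <= q -> D q -> 0 < origin_S (c * q).

Lemma origin_smooth n : ck n (dom D) (fun p => phi2 (4 * mu * (c * nsq p))).
Proof.
assert (oV := open_dom D oD).
apply ck_PSeries; auto; [apply CV_radius_phi2|].
apply ck_mult; auto; [apply ck_const; auto|].
apply ck_mult; auto; [apply ck_const; auto|apply ck_nsq; auto].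
Qed.

Lemma origin_S_smooth n : ck n (dom D) (fun p => origin_S (c * nsq p)).
Proof.
assert (oV := open_dom D oD). unfold origin_S.
apply ck_plus; auto; [apply ck_const; auto|].
apply ck_mult; auto; [apply ck_mult; auto; [apply ck_const; auto|apply ck_nsq; auto]|].
apply ck_mult; auto; [apply ck_const; auto|apply origin_smooth].
Qed.

Lemma origin_surface :
  surface D origin_P origin_Q lam mu (Tm 0 1 lam mu) (Um 1 lam mu) (fun q => c * q) (fun _ => c).
Proof.
assert (oV := open_dom D oD).
pose (P1 q := 4 * c ^ 2 * S1 (c * q)).
pose (P2 q := 4 * c ^ 3 * S2 (c * q)).
pose (Q1 q := - 4 * c ^ 3 * (W1 (c * q) * (1 + / S (c * q)) - W (c * q) * S1 (c * q) / S (c * q) ^ 2)).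
pose (Q2 q := Derive Q1 q).
assert (dS : forall x, is_derive S x (S1 x)).
{ intros x. assert (H := dW x). assert (e : ex_derive W x) by (eexists; eauto).
  unfold S, S1; auto_derive; auto.
  replace (Derive (fun x : R => W x) x) with (W1 x) by (symmetry; apply is_derive_unique; auto). ring. }
assert (dS1 : forall x, is_derive S1 x (S2 x)).
{ intros x. assert (H := dW x). assert (e : ex_derive W x) by (eexists; eauto).
  assert (H1 := dW1 x). assert (e1 : ex_derive W1 x) by (eexists; eauto).
  unfold S1, S2; auto_derive; auto.
  replace (Derive (fun x : R => W x) x) with (W1 x) by (symmetry; apply is_derive_unique; auto).
  replace (Derive (fun x : R => W1 x) x) with (W2 x) by (symmetry; apply is_derive_unique; auto). ring. }
assert (HP : forall q, 0 <= q -> D q -> is_derive origin_P q (P1 q)).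
{ intros q q0 Dq. change origin_P with (fun q => 4 * c * S (c * q)). unfold P1.
  auto_derive; [eexists; apply dS|].
  replace (Derive (fun x : R => S x) (c * q)) with (S1 (c * q)) by (symmetry; apply is_derive_unique; auto). ring. }
assert (HP1 : forall q, 0 <= q -> D q -> is_derive P1 q (P2 q)).
{ intros q q0 Dq. unfold P1, P2.
  auto_derive; [eexists; apply dS1|].
  replace (Derive (fun x : R => S1 x) (c * q)) with (S2 (c * q)) by (symmetry; apply is_derive_unique; auto). ring. }
assert (HQ : forall q, 0 <= q -> D q -> is_derive origin_Q q (Q1 q)).
{ intros q q0 Dq. change origin_Q with (fun q => - 4 * c ^ 2 * W (c * q) * (1 + / S (c * q))). unfold Q1.
  assert (s0 : 0 < S (c * q)) by (apply (S_pos q); auto).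
  auto_derive; [split; [eexists; apply dW|split; [eexists; apply dS|split; auto; lra]]|].
  replace (Derive (fun x : R => S x) (c * q)) with (S1 (c * q)) by (symmetry; apply is_derive_unique; auto).
  replace (Derive (fun x : R => W x) (c * q)) with (W1 (c * q)) by (symmetry; apply is_derive_unique, dW).
  field. lra. }
assert (HQ1 : forall q, 0 <= q -> D q -> is_derive Q1 q (Q2 q)).
{ intros q q0 Dq. apply Derive_correct. unfold Q1.
  assert (s0 : 0 < S (c * q)) by (apply (S_pos q); auto).
  assert (s1 : S (c * q) * (S (c * q) * 1) <> 0) by nz.
  assert (e1 : ex_derive W (c * q)) by (eexists; apply dW).
  assert (e2 : ex_derive W1 (c * q)) by (eexists; apply dW1).
  assert (e3 : ex_derive S (c * q)) by (eexists; apply dS).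
  assert (e4 : ex_derive S1 (c * q)) by (eexists; apply dS1).
  auto_derive; repeat split; auto; lra. }
assert (P_pos : forall q, 0 <= q -> D q -> 0 < origin_P q).
{ intros q q0 Dq. unfold origin_P. specialize (S_pos q q0 Dq). nra. }
assert (N_eq : forall q, 0 <= q -> D q -> origin_P q + q * origin_Q q = 4 * c / origin_S (c * q)).
{ intros q q0 Dq. specialize (S_pos q q0 Dq). unfold origin_P, origin_Q.
  assert (e : c * q * ((4 * mu - 2 * lam) * phi2 (4 * mu * (c * q))) = origin_S (c * q) - 1) by (unfold origin_S; ring).
  apply (Rmult_eq_reg_r (origin_S (c * q))); [|lra].
  transitivity (4 * c * (origin_S (c * q) ^ 2 - c * q * ((4 * mu - 2 * lam) * phi2 (4 * mu * (c * q))) * (origin_S (c * q) + 1))).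
  - field. lra.
  - rewrite e. field. lra. }
assert (N_pos : forall q, 0 <= q -> D q -> 0 < origin_P q + q * origin_Q q).
{ intros q q0 Dq. rewrite N_eq; auto. apply Rdiv_lt_0_compat; [lra|apply S_pos; auto]. }
assert (T_pos : forall q, 0 < q -> D q -> 0 < Tm 0 1 lam mu (c * q)).
{ intros q q0 Dq. rewrite Tm_origin_S. specialize (S_pos q (Rlt_le _ _ q0) Dq).
  apply Rmult_lt_0_compat; nra. }
assert (PT : forall q, 0 < q -> D q -> origin_P q = 4 * Tm 0 1 lam mu (c * q) / q).
{ intros q q0 Dq. rewrite Tm_origin_S. unfold origin_P. field. lra. }
assert (QT : forall q, 0 < q -> D q -> origin_Q q =
   4 * (c ^ 2 / Tm 0 1 lam mu (c * q) - Tm 0 1 lam mu (c * q) / q ^ 2)).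
{ intros q q0 Dq. assert (e := N_eq q (Rlt_le _ _ q0) Dq). rewrite PT in e; auto.
  specialize (S_pos q (Rlt_le _ _ q0) Dq).
  apply (Rmult_eq_reg_l q); [|lra].
  replace (q * origin_Q q) with (4 * c / origin_S (c * q) - 4 * Tm 0 1 lam mu (c * q) / q) by lra.
  rewrite Tm_origin_S. field. lra. }
assert (sP : forall n, ck n (dom D) (fun p => origin_P (nsq p))).
{ intros n. apply ck_mult; auto; [apply ck_const; auto|apply origin_S_smooth]. }
assert (sQ : forall n, ck n (dom D) (fun p => origin_Q (nsq p))).
{ intros n. unfold origin_Q. apply ck_mult; auto; [apply ck_mult; auto; [apply ck_const; auto|]|].
  - apply ck_mult; auto; [apply ck_const; auto|apply origin_smooth].
  - apply ck_plus; auto; [apply ck_const; auto|]. apply ck_inv; auto; [|apply origin_S_smooth].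
    intros p Dp. specialize (S_pos _ (nsq_ge0 p) Dp). lra. }
assert (riem : riemannian (dom D) (hm origin_P origin_Q)) by (apply riemannian_hm; auto).
(* The momentum formulas divide by q, so at q = 0 the curvature and the first soliton equation are
   checked from the Taylor data of [W] and [S]. *)
assert (W_0 : W 0 = 2 * mu - lam).
{ unfold W. rewrite Rmult_0_r, phi2_0. field. }
assert (S_0 : S 0 = 1) by (unfold S; ring).
assert (S1_0 : S1 0 = 2 * mu - lam) by (unfold S1; rewrite W_0; ring).
assert (P_0 : origin_P 0 = 4 * c).
{ unfold origin_P. rewrite Rmult_0_r. change (4 * c * S 0 = 4 * c). rewrite S_0; ring. }
assert (Q_0 : origin_Q 0 = - 8 * c ^ 2 * (2 * mu - lam)).
{ unfold origin_Q. rewrite Rmult_0_r. change (- 4 * c ^ 2 * W 0 * (1 + / S 0) = - 8 * c ^ 2 * (2 * mu - lam)).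
  rewrite S_0, W_0; field. }
assert (P1_0 : P1 0 = 4 * c ^ 2 * (2 * mu - lam)).
{ unfold P1. rewrite Rmult_0_r, S1_0; ring. }
assert (curv_0 : hm_curv origin_P P1 P2 origin_Q Q1 0 = lam - 2 * mu).
{ unfold hm_curv. rewrite P_0, Q_0, P1_0. field. lra. }
assert (dX : forall q : R, is_derive (fun q => c * q) q c) by (intros; auto_derive; auto; ring).
assert (dX1 : forall q : R, is_derive (fun q => c) q 0) by (intros; auto_derive; auto; ring).
assert (curv : forall q, 0 <= q -> D q ->
  hm_curv origin_P P1 P2 origin_Q Q1 q = lam - 2 * mu * Um 1 lam mu (c * q)).
{ intros q [q0|q0] Dq.
  - apply (momentum_curv lam mu (Tm 0 1 lam mu) (Um 1 lam mu) (fun q => c * q) (fun _ => c) (fun _ => 0) D); auto;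
    intros; try (apply dTm; auto); try (apply dUm; auto); try (apply HP || apply HP1 || apply HQ; auto; lra); try lra.
  - rewrite <- q0, curv_0, Rmult_0_r, Um_0. ring. }
split; auto.
- intros q q0 Dq; split; eexists; auto.
- split; auto. exists (fun p => 4 * mu * (c * nsq p)). split.
  + apply ck_smooth; intros n. apply ck_mult; auto; [apply ck_const; auto|].
    apply ck_mult; auto; [apply ck_const; auto|apply ck_nsq; auto].
  + apply (soliton_hm D _ P1 P2 _ Q1 Q2 oD HP HP1 HQ HQ1 P_pos N_pos (fun q => 4 * mu * (c * q)) (fun _ => 4 * mu * c) (fun _ => 4 * mu * 0)).
    * intros; auto_derive; auto; ring.
    * intros; auto_derive; auto; ring.
    * intros q [q0|q0] Dq.
      -- apply (momentum_soliton1 lam mu (Tm 0 1 lam mu) (Um 1 lam mu) (fun q => c * q) (fun _ => c) (fun _ => 0) D); auto;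
         intros; try (apply dTm; auto); try (apply dUm; auto); try (apply HP || apply HP1 || apply HQ; auto; lra); try lra.
      -- rewrite <- q0, curv_0, P_0. field. lra.
    * intros q q0 Dq.
      apply (momentum_soliton2 lam mu (Tm 0 1 lam mu) (Um 1 lam mu) (fun q => c * q) (fun _ => c) (fun _ => 0) D
        origin_P P1 P2 origin_Q Q1); auto;
         intros; try (apply dTm; auto); try (apply dUm; auto); try (apply HP || apply HP1 || apply HQ; auto; lra); try lra.
- intros p Dp. rewrite (gauss_hm D _ P1 P2 _ Q1 Q2 oD HP HP1 HQ HQ1 P_pos N_pos); auto.
  apply curv; auto. apply nsq_ge0.
- intros; apply dTm; auto.
- intros; lra.
- intros n. assert (oV' : open (fun p => 0 < nsq p /\ D (nsq p))).
  { apply (open_dom (fun q => 0 < q /\ D q)), open_and_pos, oD. }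
  apply ck_Tm; auto. apply ck_mult; auto; [apply ck_const; auto|apply ck_nsq; auto].
Qed.

End Origin.

(** * Surfaces on an annulus *)

Section Radial.

Variables (t0 u0 lam mu : R) (D : R -> Prop) (X X1 X2 X3 : R -> R).
Hypothesis mu0 : mu <> 0.
Hypothesis oD : open D.
Hypothesis D_pos : forall q, D q -> 0 < q.
Hypothesis dX : forall q, D q -> is_derive X q (X1 q).
Hypothesis dX1 : forall q, D q -> is_derive X1 q (X2 q).
Hypothesis dX2 : forall q, D q -> is_derive X2 q (X3 q).
Hypothesis X1_neq0 : forall q, D q -> X1 q <> 0.
Hypothesis sX : forall n, ck n (dom D) (fun p => X (nsq p)).
Hypothesis sX1 : forall n, ck n (dom D) (fun p => X1 (nsq p)).

Let T := Tm t0 u0 lam mu.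
Let U := Um u0 lam mu.

Hypothesis T_pos : forall q, D q -> 0 < T (X q).

(** With [radial_Q], the Cartesian form of dX^2 / T + 4 T dtheta^2 for any momentum function X: the
    angular eigenvalue is 4 T / q and the radial one 4 q X1^2 / T. *)
Definition radial_P (q : R) : R := 4 * Tm t0 u0 lam mu (X q) / q.

Definition radial_Q (q : R) : R :=
  4 * (X1 q ^ 2 / Tm t0 u0 lam mu (X q) - Tm t0 u0 lam mu (X q) / q ^ 2).

Lemma radial_surface : surface D radial_P radial_Q lam mu T U X X1.
Proof.
assert (oV := open_dom D oD).
assert (dT : forall x, is_derive T x (U x)) by (intros; apply dTm; auto).
assert (dU : forall x, is_derive U x (4 * mu * U x - 2 * lam)) by (intros; apply dUm; auto).
assert (eT : forall x, ex_derive T x) by (intros; eexists; auto).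
assert (eU : forall x, ex_derive U x) by (intros; eexists; auto).
assert (eX : forall x, D x -> ex_derive X x) by (intros; eexists; auto).
assert (eX1 : forall x, D x -> ex_derive X1 x) by (intros; eexists; auto).
assert (eX2 : forall x, D x -> ex_derive X2 x) by (intros; eexists; auto).
assert (rT : forall x, Derive (fun y : R => T y) x = U x) by (intros; apply is_derive_unique; auto).
assert (rU : forall x, Derive (fun y : R => U y) x = 4 * mu * U x - 2 * lam) by (intros; apply is_derive_unique; auto).
assert (rX : forall x, D x -> Derive (fun y : R => X y) x = X1 x) by (intros; apply is_derive_unique; auto).
assert (rX1 : forall x, D x -> Derive (fun y : R => X1 y) x = X2 x) by (intros; apply is_derive_unique; auto).
pose (P1 q := 4 * (U (X q) * X1 q / q - T (X q) / q ^ 2)).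
pose (P2 q := 4 * (((4 * mu * U (X q) - 2 * lam) * X1 q ^ 2 + U (X q) * X2 q) / q
              - 2 * U (X q) * X1 q / q ^ 2 + 2 * T (X q) / q ^ 3)).
pose (Q1 q := 4 * (2 * X1 q * X2 q / T (X q) - X1 q ^ 3 * U (X q) / T (X q) ^ 2
              - U (X q) * X1 q / q ^ 2 + 2 * T (X q) / q ^ 3)).
pose (Q2 q := Derive Q1 q).
assert (HP : forall q, 0 <= q -> D q -> is_derive radial_P q (P1 q)).
{ intros q _ Dq. assert (q0 := D_pos q Dq). assert (q1 : q <> 0) by lra.
  change radial_P with (fun q => 4 * T (X q) / q). unfold P1.
  auto_derive; [repeat split; auto; nz|].
  rewrite rT, rX; auto. field; auto. }
assert (HP1 : forall q, 0 <= q -> D q -> is_derive P1 q (P2 q)).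
{ intros q _ Dq. assert (q0 := D_pos q Dq). assert (q1 : q <> 0) by lra.
  unfold P1, P2. auto_derive; [repeat split; auto; nz|].
  rewrite rT, rX, rU, rX1; auto. field; auto. }
assert (HQ : forall q, 0 <= q -> D q -> is_derive radial_Q q (Q1 q)).
{ intros q _ Dq. assert (q0 := D_pos q Dq). assert (q1 : q <> 0) by lra.
  assert (t1 := T_pos q Dq).
  change radial_Q with (fun q => 4 * (X1 q ^ 2 / T (X q) - T (X q) / q ^ 2)). unfold Q1.
  auto_derive; [repeat split; auto; nz|].
  rewrite rT, rX, rX1; auto. field; lra. }
assert (HQ1 : forall q, 0 <= q -> D q -> is_derive Q1 q (Q2 q)).
{ intros q _ Dq. apply Derive_correct. assert (q0 := D_pos q Dq). assert (q1 : q <> 0) by lra.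
  assert (t1 := T_pos q Dq). unfold Q1. auto_derive; repeat split; auto; nz. }
assert (P_pos : forall q, 0 <= q -> D q -> 0 < radial_P q).
{ intros q _ Dq. assert (q0 := D_pos q Dq). assert (t1 := T_pos q Dq).
  unfold radial_P; fold T. apply Rdiv_lt_0_compat; lra. }
assert (N_pos : forall q, 0 <= q -> D q -> 0 < radial_P q + q * radial_Q q).
{ intros q _ Dq. assert (q0 := D_pos q Dq). assert (t1 := T_pos q Dq).
  replace (radial_P q + q * radial_Q q) with (4 * X1 q ^ 2 * q / T (X q))
    by (unfold radial_P, radial_Q; fold T; field; lra).
  apply Rdiv_lt_0_compat; auto. apply Rmult_lt_0_compat; auto.
  assert (h := X1_neq0 q Dq). assert (h2 := pow2_gt_0 _ h). lra. }
assert (sT : forall n, ck n (dom D) (fun p => T (X (nsq p)))) by (intros; apply ck_Tm; auto).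
assert (sI : forall n, ck n (dom D) (fun p => / nsq p)).
{ intros n; apply ck_inv; auto; [|apply ck_nsq; auto]. intros p Dp; specialize (D_pos _ Dp); lra. }
assert (sIT : forall n, ck n (dom D) (fun p => / T (X (nsq p)))).
{ intros n; apply ck_inv; auto. intros p Dp; specialize (T_pos _ Dp); lra. }
assert (sP : forall n, ck n (dom D) (fun p => radial_P (nsq p))).
{ intros n. unfold radial_P, Rdiv. apply ck_mult; auto. apply ck_mult; auto. apply ck_const; auto. }
assert (sQ : forall n, ck n (dom D) (fun p => radial_Q (nsq p))).
{ intros n. unfold radial_Q. apply ck_mult; auto; [apply ck_const; auto|].
  apply (ck_ext n (dom D) (fun p => X1 (nsq p) * (X1 (nsq p) * / T (X (nsq p))) +
    (-1) * (T (X (nsq p)) * (/ nsq p * / nsq p)))); auto.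
  - intros p Dp. assert (q0 := D_pos _ Dp). assert (t1 := T_pos _ Dp). fold T. field; split; lra.
  - apply ck_plus; auto; [apply ck_mult; auto; apply ck_mult; auto|].
    apply ck_mult; auto; [apply ck_const; auto|]. apply ck_mult; auto. apply ck_mult; auto. }
assert (riem : riemannian (dom D) (hm radial_P radial_Q)) by (apply riemannian_hm; auto).
split; auto.
- intros q q0 Dq; split; eexists; auto.
- split; auto. exists (fun p => 4 * mu * X (nsq p)). split.
  + apply ck_smooth; intros n. apply ck_mult; auto; apply ck_const; auto.
  + apply (soliton_hm D _ P1 P2 _ Q1 Q2 oD HP HP1 HQ HQ1 P_pos N_pos (fun q => 4 * mu * X q) (fun q => 4 * mu * X1 q) (fun q => 4 * mu * X2 q)).
    * intros; apply (is_derive_scal X); auto.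
    * intros; apply (is_derive_scal X1); auto.
    * intros q _ Dq. assert (q0 := D_pos q Dq).
      apply (momentum_soliton1 lam mu T U X X1 X2 D); auto; intros;
        try (apply HP || apply HP1 || apply HQ; auto; lra).
    * intros q q0 Dq.
      apply (momentum_soliton2 lam mu T U X X1 X2 D radial_P P1 P2); auto; intros;
        try (apply HP || apply HP1 || apply HQ; auto; lra).
- intros p Dp. rewrite (gauss_hm D _ P1 P2 _ Q1 Q2 oD HP HP1 HQ HQ1 P_pos N_pos); auto.
  apply (momentum_curv lam mu T U X X1 X2 D); auto; intros;
        try (apply HP || apply HP1 || apply HQ; auto; lra).
- intros n. apply (ck_ext n (dom (fun q => 0 < q /\ D q)) (fun p => T (X (nsq p)))); auto.
  { apply open_dom, open_and_pos, oD. }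
  apply ck_Tm; auto; [apply open_dom, open_and_pos, oD|].
  apply smooth_ck, (smooth_sub (dom D)); [intros p [_ Dp]; exact Dp|apply ck_smooth; auto].
Qed.

End Radial.

(** * Length of curves and completeness *)

(** The witness is the supremum of the times at which f is at most al; continuity excludes both
    strict inequalities there. *)
Lemma last_crossing (f : R -> R) (a b al : R) :
  a <= b -> (forall s, a <= s <= b -> continuous f s) -> f a <= al -> al < f b ->
  exists s, a <= s < b /\ f s = al /\ forall r, s < r <= b -> al < f r.
Proof.
intros ab cf fa fb.
pose (E s := a <= s <= b /\ f s <= al).
destruct (completeness E) as [s [ub lub]].
{ exists b. intros x [H _]; lra. }
{ exists a. split; auto; lra. }
assert (as_ : a <= s) by (apply ub; split; auto; lra).
assert (sb : s <= b) by (apply lub; intros x [H _]; lra).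
assert (above : forall r, s < r <= b -> al < f r).
{ intros r Hr. destruct (Rlt_le_dec al (f r)) as [h|h]; auto.
  assert (r <= s) by (apply ub; split; auto; lra). lra. }
assert (cs := cf s (conj as_ sb)).
assert (fs1 : f s <= al).
{ apply Rnot_lt_le; intros H.
  assert (e0 : 0 < f s - al) by lra.
  destruct (proj1 (filterlim_locally f (f s)) cs (mkposreal _ e0)) as [d Hd].
  assert (s <= s - d).
  { apply lub. intros x [Hx1 Hx2].
    assert (x <= s) by (apply ub; split; auto).
    apply Rnot_lt_le; intros H1.
    assert (bx := Hd x). assert (ball s d x).
    { change (Rabs (x - s) < d). apply Rabs_def1; lra. }
    specialize (bx H2). change (Rabs (f x - f s) < f s - al) in bx.
    apply Rabs_def2 in bx. lra. }
  assert (h := cond_pos d). lra. }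
assert (sb' : s < b) by (destruct sb as [h|h]; auto; subst; lra).
exists s. split; [lra|split; auto].
apply Rle_antisym; auto.
apply Rnot_lt_le; intros H.
assert (e0 : 0 < al - f s) by lra.
destruct (proj1 (filterlim_locally f (f s)) cs (mkposreal _ e0)) as [d Hd].
pose (r := Rmin b (s + d / 2)).
assert (dp := cond_pos d).
assert (hr : s < r <= b /\ r <= s + d / 2).
{ unfold r; split; [split|]; [apply Rmin_glb_lt; lra|apply Rmin_l|apply Rmin_r]. }
assert (bx := Hd r). assert (ball s d r) by (change (Rabs (r - s) < d); apply Rabs_def1; lra).
specialize (bx H0). change (Rabs (f r - f s) < al - f s) in bx.
apply Rabs_def2 in bx. specialize (above r (proj1 hr)). lra.
Qed.

(** The last visit to al, followed by the first later visit to be; in between f stays in the band,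
    which is where a radial comparison function is available. *)
Lemma crossing_up (f : R -> R) (a b al be : R) :
  a <= b -> (forall s, a <= s <= b -> continuous f s) -> f a <= al -> al < be -> be <= f b ->
  exists s0 s1, a <= s0 <= s1 /\ s1 <= b /\ f s0 = al /\ f s1 = be /\
    forall s, s0 <= s <= s1 -> al <= f s <= be.
Proof.
intros ab cf fa albe fb.
destruct (last_crossing f a b al) as [s0 [H1 [H2 H3]]]; auto; [lra|].
(* Reversing time and sign turns the first visit to be after s0 into a last crossing. *)
destruct (last_crossing (fun r => - f (s0 + b - r)) s0 b (- be)) as [s' [K1 [K2 K3]]].
- lra.
- intros s Hs. apply (continuous_opp (V := R_NormedModule) (fun r => f (s0 + b - r))).
  apply (continuous_comp (fun r => s0 + b - r) f).
  + apply (ex_derive_continuous (fun r => s0 + b - r)). auto_derive; auto.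
  + apply cf; lra.
- replace (s0 + b - s0) with b by ring. lra.
- replace (s0 + b - b) with s0 by ring. lra.
- exists s0, (s0 + b - s'). repeat split; try lra.
  + destruct (Rle_lt_or_eq_dec s0 s) as [h|h]; [lra| |subst; lra].
    left; apply H3; lra.
  + destruct (Rle_lt_or_eq_dec s (s0 + b - s')) as [h|h]; [lra| |subst; lra].
    specialize (K3 (s0 + b - s)). replace (s0 + b - (s0 + b - s)) with s in K3 by ring.
    assert (- be < - f s) by (apply K3; lra). lra.
Qed.

Lemma crossing_down (f : R -> R) (a b al be : R) :
  a <= b -> (forall s, a <= s <= b -> continuous f s) -> be <= f a -> al < be -> f b <= al ->
  exists s0 s1, a <= s0 <= s1 /\ s1 <= b /\ f s0 = be /\ f s1 = al /\
    forall s, s0 <= s <= s1 -> al <= f s <= be.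
Proof.
intros ab cf fa albe fb.
destruct (crossing_up (fun s => - f s) a b (- be) (- al)) as [s0 [s1 [H1 [H2 [H3 [H4 H5]]]]]]; try lra.
- intros s Hs; apply (continuous_opp (V := R_NormedModule) f); auto.
- exists s0, s1. repeat split; try lra; specialize (H5 s H); lra.
Qed.

Lemma nondecreasing_deriv (f df : R -> R) (a b : R) : a <= b ->
  (forall x, a <= x <= b -> is_derive f x (df x)) ->
  (forall x, a < x < b -> 0 <= df x) -> f a <= f b.
Proof.
intros ab Hf Hd. destruct ab as [ab|ab]; [|subst; lra].
destruct (MVT_cor2 f df a b ab) as [c [H1 H2]].
- intros c Hc. apply is_derive_Reals. apply Hf; auto.
- specialize (Hd c H2). nra.
Qed.

Lemma increasing_deriv (f df : R -> R) (a b : R) : a < b ->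
  (forall x, a <= x <= b -> is_derive f x (df x)) ->
  (forall x, a < x < b -> 0 < df x) -> f a < f b.
Proof.
intros ab Hf Hd.
destruct (MVT_cor2 f df a b ab) as [c [H1 H2]].
- intros c Hc. apply is_derive_Reals. apply Hf; auto.
- specialize (Hd c H2). nra.
Qed.

(** A curve is controlled only for parameters in [0, 1]; composing with the retraction onto [0, 1]
    makes the speed continuous on the whole line, so integrability holds on every interval. *)
Definition clamp (s : R) : R := Rmax 0 (Rmin 1 s).

Lemma clamp_in s : 0 <= clamp s <= 1.
Proof.
unfold clamp; split; [apply Rmax_l|apply Rmax_lub; [lra|apply Rmin_l]].
Qed.

Lemma clamp_id s : 0 <= s <= 1 -> clamp s = s.
Proof. intros H; unfold clamp. rewrite Rmin_right, Rmax_right; lra. Qed.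

Lemma clamp_continuous s : continuous clamp s.
Proof.
apply continuity_pt_filterlim. intros e e0. exists e; split; auto.
intros x [_ Hx]. unfold clamp; simpl in *; unfold R_dist in *.
unfold Rmax, Rmin, Rabs in *. repeat destruct Rle_dec; repeat destruct Rcase_abs; lra.
Qed.

Definition speed (h : metric) (c : R -> pt) (t : R) : R :=
  sqrt (quad h (c (clamp t)) (velocity c (clamp t))).

Lemma curve_length_speed h c : curve_length h c 0 1 = RInt (speed h c) 0 1.
Proof.
apply RInt_ext. intros t Ht. rewrite Rmin_left, Rmax_right in Ht by lra.
unfold speed. rewrite clamp_id; auto; lra.
Qed.

Lemma speed_ge0 h c t : 0 <= speed h c t.
Proof. apply sqrt_pos. Qed.

Lemma C1_continuous A c t : C1_curve A c -> 0 <= t <= 1 -> continuous c t.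
Proof.
intros Hc Ht. destruct (Hc t Ht) as [_ H].
apply (continuous_ext (fun s => (comp X1 (c s), comp X2 (c s)))).
- intros s; destruct (c s); reflexivity.
- apply (continuous_comp_2 (fun s => comp X1 (c s)) (fun s => comp X2 (c s)) (fun a b => (a, b) : pt)).
  + apply (ex_derive_continuous (fun s => comp X1 (c s))), (H X1).
  + apply (ex_derive_continuous (fun s => comp X2 (c s))), (H X2).
  + apply (continuous_ext (fun x : pt => x)); [intros []; reflexivity|apply continuous_id].
Qed.

Lemma speed_continuous A h c : C1_curve A c ->
  (forall i j t, 0 <= t <= 1 -> continuous (h i j) (c t)) ->
  forall t, continuous (speed h c) t.
Proof.
intros Hc Hh t. unfold speed.
apply (continuous_comp (fun t => quad h (c (clamp t)) (velocity c (clamp t))) sqrt);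
  [|apply continuous_sqrt].
apply (continuous_comp clamp (fun t => quad h (c t) (velocity c t))); [apply clamp_continuous|].
generalize (clamp_in t); generalize (clamp t); clear t; intros t Ht.
destruct (Hc t Ht) as [_ H].
assert (cc := C1_continuous A c t Hc Ht).
assert (K : forall i j, continuous (fun t => h i j (c t) * comp i (velocity c t) * comp j (velocity c t)) t).
{ intros i j. apply (continuous_mult (K := R_AbsRing) (fun t => h i j (c t) * comp i (velocity c t))).
  - apply (continuous_mult (K := R_AbsRing) (fun t => h i j (c t))).
    + apply (continuous_comp c (h i j)); auto.
    + destruct i; [exact (proj2 (H X1))|exact (proj2 (H X2))].
  - destruct j; [exact (proj2 (H X1))|exact (proj2 (H X2))]. }
unfold quad, sum_ix.
apply (continuous_plus (V := R_NormedModule)); apply (continuous_plus (V := R_NormedModule)); apply K.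
Qed.

Lemma is_derive_norm (f1 f2 : R -> R) t :
  ex_derive f1 t -> ex_derive f2 t -> 0 < f1 t ^ 2 + f2 t ^ 2 ->
  is_derive (fun s => sqrt (f1 s ^ 2 + f2 s ^ 2)) t
    ((f1 t * Derive f1 t + f2 t * Derive f2 t) / sqrt (f1 t ^ 2 + f2 t ^ 2)).
Proof.
intros e1 e2 n0. assert (s0 := sqrt_lt_R0 _ n0).
auto_derive.
- repeat split; auto. replace (f1 t * (f1 t * 1) + f2 t * (f2 t * 1)) with (f1 t ^ 2 + f2 t ^ 2) by ring. auto.
- replace (f1 t * (f1 t * 1) + f2 t * (f2 t * 1)) with (f1 t ^ 2 + f2 t ^ 2) by ring.
  change (Derive (fun x => f1 x) t) with (Derive f1 t).
  change (Derive (fun x => f2 x) t) with (Derive f2 t). field. lra.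
Qed.

(** * Lower bounds for the length of a curve *)

Section CurveLength.

Variables (A : pt -> Prop) (h : metric) (c : R -> pt).
Hypothesis Hc : C1_curve A c.
Hypothesis Hh : forall i j t, 0 <= t <= 1 -> continuous (h i j) (c t).

Lemma ex_RInt_speed a b : ex_RInt (speed h c) a b.
Proof.
apply (ex_RInt_continuous (V := R_CompleteNormedModule)).
intros; apply (speed_continuous A); auto.
Qed.

Lemma RInt_speed_sub a s0 s1 b : a <= s0 -> s0 <= s1 -> s1 <= b ->
  RInt (speed h c) s0 s1 <= RInt (speed h c) a b.
Proof.
intros H1 H2 H3.
assert (P : forall x y, x <= y -> 0 <= RInt (speed h c) x y).
{ intros x y xy. apply RInt_ge_0; auto; [apply ex_RInt_speed|]. intros; apply speed_ge0. }
rewrite <- (RInt_Chasles (speed h c) a s0 b) by apply ex_RInt_speed.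
rewrite <- (RInt_Chasles (speed h c) s0 s1 b) by apply ex_RInt_speed.
assert (Q1 := P a s0 H1). assert (Q2 := P s1 b H3).
unfold plus; simpl. lra.
Qed.

(** Length minus phi is nondecreasing along the curve. It serves with plus or minus a function of
    the radius, and with multiples of a coordinate for the comparison with the Euclidean metric. *)
Lemma length_ge (phi dphi : R -> R) a b : 0 <= a -> a <= b -> b <= 1 ->
  (forall s, a <= s <= b -> is_derive phi s (dphi s)) ->
  (forall s, a <= s <= b -> dphi s ^ 2 <= quad h (c s) (velocity c s)) ->
  phi b - phi a <= RInt (speed h c) a b.
Proof.
intros a0 ab b1 Hd Hq.
assert (K : RInt (speed h c) a a - phi a <= RInt (speed h c) a b - phi b).
{ apply (nondecreasing_deriv (fun x => RInt (speed h c) a x - phi x) (fun x => speed h c x - dphi x)); auto.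
  - intros x Hx. apply (is_derive_minus (V := R_NormedModule)); auto.
    apply (is_derive_RInt (V := R_NormedModule) (speed h c) (fun x => RInt (speed h c) a x) a x).
    + apply filter_forall. intros y. apply (RInt_correct (V := R_CompleteNormedModule)), ex_RInt_speed.
    + apply (speed_continuous A); auto.
  - intros x Hx. assert (Hx' : a <= x <= b) by lra. specialize (Hq x Hx').
    assert (dphi x <= speed h c x); [|lra].
    unfold speed. rewrite clamp_id by lra.
    apply Rle_trans with (Rabs (dphi x)); [apply Rle_abs|].
    rewrite <- sqrt_Rsqr_abs. apply sqrt_le_1_alt. unfold Rsqr. lra. }
rewrite RInt_point in K. unfold zero in K; simpl in K. lra.
Qed.

Lemma continuous_rad_curve t : 0 <= t <= 1 -> continuous (fun s => rad (c s)) t.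
Proof.
intros Ht. apply (continuous_comp c rad); [apply (C1_continuous A); auto|].
apply (continuous_comp nsq sqrt); [apply continuous_nsq|apply continuous_sqrt].
Qed.

Lemma is_derive_rad_curve t : 0 <= t <= 1 -> 0 < rad (c t) ->
  is_derive (fun s => rad (c s)) t (dot (c t) (velocity c t) / rad (c t)).
Proof.
intros Ht r0. destruct (Hc t Ht) as [_ H].
assert (K := is_derive_norm (fun s => fst (c s)) (fun s => snd (c s)) t
  (proj1 (H X1)) (proj1 (H X2))).
apply K. apply sqrt_lt_0_alt. rewrite sqrt_0. exact r0.
Qed.

Variables (L L1 : R -> R) (al be : R).
Hypothesis al_pos : 0 < al.
Hypothesis al_be : al < be.
Hypothesis dL : forall x, al <= x <= be -> is_derive L x (L1 x).
Hypothesis quad_ge : forall p v, A p -> al <= rad p <= be ->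
  (L1 (rad p) * (dot p v / rad p)) ^ 2 <= quad h p v.

Lemma length_within s0 s1 : 0 <= s0 -> s0 <= s1 -> s1 <= 1 ->
  (forall s, s0 <= s <= s1 -> al <= rad (c s) <= be) ->
  Rabs (L (rad (c s1)) - L (rad (c s0))) <= RInt (speed h c) s0 s1.
Proof.
intros H0 H1 H2 Hr.
assert (D : forall s, s0 <= s <= s1 -> is_derive (fun s => L (rad (c s))) s
   (L1 (rad (c s)) * (dot (c s) (velocity c s) / rad (c s)))).
{ intros s Hs. rewrite Rmult_comm. apply (is_derive_comp L (fun s => rad (c s))).
  - apply dL, Hr, Hs.
  - specialize (Hr s Hs). apply is_derive_rad_curve; lra. }
assert (Q : forall s, s0 <= s <= s1 ->
  (L1 (rad (c s)) * (dot (c s) (velocity c s) / rad (c s))) ^ 2 <= quad h (c s) (velocity c s)).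
{ intros s Hs. apply quad_ge; auto. apply Hc; lra. }
apply Rabs_le. split.
- assert (K := length_ge (fun s => - L (rad (c s))) (fun s => - (L1 (rad (c s)) * (dot (c s) (velocity c s) / rad (c s)))) s0 s1 H0 H1 H2).
  assert (K' : - L (rad (c s1)) - - L (rad (c s0)) <= RInt (speed h c) s0 s1); [|lra].
  apply K.
  + intros s Hs. apply (is_derive_opp (V := R_NormedModule) (fun s => L (rad (c s)))); auto.
  + intros s Hs. specialize (Q s Hs).
    replace ((- (L1 (rad (c s)) * (dot (c s) (velocity c s) / rad (c s)))) ^ 2)
     with ((L1 (rad (c s)) * (dot (c s) (velocity c s) / rad (c s))) ^ 2) by ring. auto.
- apply (length_ge (fun s => L (rad (c s))) _ s0 s1 H0 H1 H2 D Q).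
Qed.

(** The curve may leave the annulus or pass through the origin, where the radius is not
    differentiable. Only a subinterval spent crossing the band is measured; the remaining length is
    nonnegative. *)
Lemma length_crossing a b : 0 <= a -> a <= b -> b <= 1 ->
  (rad (c a) <= al /\ be <= rad (c b) \/ be <= rad (c a) /\ rad (c b) <= al) ->
  Rabs (L be - L al) <= RInt (speed h c) a b.
Proof.
intros a0 ab b1 H.
assert (C : forall s, a <= s <= b -> continuous (fun s => rad (c s)) s)
  by (intros; apply continuous_rad_curve; lra).
destruct H as [[Ha Hb]|[Ha Hb]].
- destruct (crossing_up (fun s => rad (c s)) a b al be) as [s0 [s1 [H1 [H2 [H3 [H4 H5]]]]]]; auto.
  rewrite <- H3, <- H4 at 1.
  eapply Rle_trans; [|apply (RInt_speed_sub a s0 s1 b); lra].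
  apply length_within; auto; lra.
- destruct (crossing_down (fun s => rad (c s)) a b al be) as [s0 [s1 [H1 [H2 [H3 [H4 H5]]]]]]; auto.
  rewrite <- H3, <- H4 at 1. rewrite Rabs_minus_sym.
  eapply Rle_trans; [|apply (RInt_speed_sub a s0 s1 b); lra].
  apply length_within; auto; lra.
Qed.

End CurveLength.

Lemma dist_lt_curve V h p q e : Rbar_lt (Defs.dist V h p q) (Finite e) ->
  exists c, C1_curve V c /\ c 0 = p /\ c 1 = q /\ curve_length h c 0 1 < e.
Proof.
intros H. apply Classical_Prop.NNPP. intros N.
unfold Defs.dist, set_dist in H.
destruct (Glb_Rbar_correct (fun L => exists c, C1_curve V c /\ c 0 = p /\ c 1 = q /\
                               L = curve_length h c 0 1)) as [_ G].
apply (Rbar_lt_not_le _ _ H). apply G.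
intros x [c [H1 [H2 [H3 ->]]]]. simpl.
apply Rnot_lt_le; intros H4. apply N. exists c; auto.
Qed.

Lemma dist_le_curve V h p q c : C1_curve V c -> c 0 = p -> c 1 = q ->
  Rbar_le (Defs.dist V h p q) (Finite (curve_length h c 0 1)).
Proof.
intros H1 H2 H3. unfold Defs.dist, set_dist.
apply (proj1 (Glb_Rbar_correct (fun L => exists c, C1_curve V c /\ c 0 = p /\ c 1 = q /\
                               L = curve_length h c 0 1))).
exists c; auto.
Qed.

Lemma riemannian_continuous V h : riemannian V h ->
  forall i j p, V p -> continuous (h i j) p.
Proof. intros [H _] i j p Vp. apply (H i j nil p Vp). Qed.

Lemma length_le A h c phi dphi : C1_curve A c ->
  (forall i j t, 0 <= t <= 1 -> continuous (h i j) (c t)) ->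
  (forall s, 0 <= s <= 1 -> is_derive phi s (dphi s)) ->
  (forall s, 0 <= s <= 1 -> 0 <= dphi s) ->
  (forall s, 0 <= s <= 1 -> quad h (c s) (velocity c s) <= dphi s ^ 2) ->
  curve_length h c 0 1 <= phi 1 - phi 0.
Proof.
intros Hc Hh Hd H0 Hq. rewrite curve_length_speed.
assert (E := ex_RInt_speed A h c Hc Hh).
assert (K : phi 0 - RInt (speed h c) 0 0 <= phi 1 - RInt (speed h c) 0 1).
{ apply (nondecreasing_deriv (fun x => phi x - RInt (speed h c) 0 x) (fun x => dphi x - speed h c x)); [lra| |].
  - intros x Hx. apply (is_derive_minus (V := R_NormedModule)); auto.
    apply (is_derive_RInt (V := R_NormedModule) (speed h c) (fun x => RInt (speed h c) 0 x) 0 x).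
    + apply filter_forall. intros y. apply (RInt_correct (V := R_CompleteNormedModule)), E.
    + apply (speed_continuous A); auto.
  - intros x Hx. assert (Hx' : 0 <= x <= 1) by lra. specialize (Hq x Hx'). specialize (H0 x Hx').
    assert (speed h c x <= dphi x); [|lra].
    unfold speed. rewrite clamp_id by lra.
    rewrite <- (sqrt_Rsqr (dphi x)) by auto. apply sqrt_le_1_alt. unfold Rsqr. lra. }
rewrite RInt_point in K. unfold zero in K; simpl in K. lra.
Qed.

(** * Euclidean comparison, completeness and incompleteness *)

Definition segment (p q : pt) (s : R) : pt :=
  (fst p + s * (fst q - fst p), snd p + s * (snd q - snd p)).

Lemma segment_derive p q i t : is_derive (fun s => comp i (segment p q s)) t
  (comp i q - comp i p).
Proof. destruct i; unfold segment; simpl; auto_derive; auto; ring. Qed.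

Lemma segment_velocity p q t : velocity (segment p q) t = (fst q - fst p, snd q - snd p).
Proof.
unfold velocity. f_equal; apply is_derive_unique.
- apply (segment_derive p q X1).
- apply (segment_derive p q X2).
Qed.

Lemma segment_C1 (A : pt -> Prop) p q : (forall t, 0 <= t <= 1 -> A (segment p q t)) ->
  C1_curve A (segment p q).
Proof.
intros H t Ht. split; auto. intros i; split.
- eexists; apply segment_derive.
- apply (continuous_ext (fun _ => comp i q - comp i p)); [|apply continuous_const].
  intros x; symmetry; apply is_derive_unique, segment_derive.
Qed.

Lemma segment_0 p q : segment p q 0 = p.
Proof. destruct p; unfold segment; simpl; f_equal; ring. Qed.

Lemma segment_1 p q : segment p q 1 = q.
Proof. destruct p, q; unfold segment; simpl; f_equal; ring. Qed.

Lemma quad_le h p v M : (forall i j, Rabs (h i j p) <= M) ->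
  quad h p v <= M * (Rabs (fst v) + Rabs (snd v)) ^ 2.
Proof.
intros H.
assert (K : forall i j, h i j p * comp i v * comp j v <= M * (Rabs (comp i v) * Rabs (comp j v))).
{ intros i j. apply Rle_trans with (Rabs (h i j p * comp i v * comp j v)); [apply Rle_abs|].
  rewrite !Rabs_mult, Rmult_assoc. apply Rmult_le_compat_r; auto.
  apply Rmult_le_pos; apply Rabs_pos. }
unfold quad, sum_ix.
assert (k1 := K X1 X1). assert (k2 := K X1 X2). assert (k3 := K X2 X1). assert (k4 := K X2 X2).
simpl comp in *. nra.
Qed.

(** Near q the entries of h are bounded by some M, so a straight segment to q has length at most
    sqrt M times its l^1 size; Euclidean convergence therefore implies convergence in distance. *)
Lemma dist_near (V : pt -> Prop) h q : open V -> V q -> (forall i j p, V p -> continuous (h i j) p) ->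
  forall e, 0 < e -> exists d, 0 < d /\ forall x,
    Rabs (fst x - fst q) < d -> Rabs (snd x - snd q) < d -> Rbar_lt (Defs.dist V h x q) (Finite e).
Proof.
intros oV Vq Hh e e0.
assert (B : forall i j, locally q (fun p => Rabs (h i j p) <= Rabs (h i j q) + 1)).
{ intros i j. assert (c := Hh i j q Vq).
  assert (H := proj1 (filterlim_locally (h i j) (h i j q)) c (mkposreal 1 Rlt_0_1)).
  revert H; apply filter_imp. intros p H. change (Rabs (h i j p - h i j q) < 1) in H.
  replace (h i j p) with (h i j p - h i j q + h i j q) by ring.
  eapply Rle_trans; [apply Rabs_triang|]. lra. }
pose (M := Rabs (h X1 X1 q) + Rabs (h X1 X2 q) + Rabs (h X2 X1 q) + Rabs (h X2 X2 q) + 1).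
assert (M1 : 1 <= M).
{ unfold M. assert (a1 := Rabs_pos (h X1 X1 q)). assert (a2 := Rabs_pos (h X1 X2 q)).
  assert (a3 := Rabs_pos (h X2 X1 q)). assert (a4 := Rabs_pos (h X2 X2 q)). lra. }
assert (C : locally q (fun p => V p /\ forall i j, Rabs (h i j p) <= M)).
{ assert (oVq := oV q Vq).
  assert (C := filter_and _ _ oVq (filter_and _ _ (filter_and _ _ (B X1 X1) (B X1 X2))
     (filter_and _ _ (B X2 X1) (B X2 X2)))).
  revert C; apply filter_imp. intros p [Vp [[h1 h2] [h3 h4]]]. split; auto.
  assert (a1 := Rabs_pos (h X1 X1 q)). assert (a2 := Rabs_pos (h X1 X2 q)).
  assert (a3 := Rabs_pos (h X2 X1 q)). assert (a4 := Rabs_pos (h X2 X2 q)).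
  intros i j; unfold M; destruct i, j; lra. }
destruct C as [d0 Hd0].
pose (k := sqrt M).
assert (k0 : 0 < k) by (apply sqrt_lt_R0; lra).
exists (Rmin d0 (e / (2 * k))).
assert (dp : 0 < e / (2 * k)) by (apply Rdiv_lt_0_compat; lra).
split; [apply Rmin_pos; [apply cond_pos|auto]|].
intros x Hx1 Hx2.
assert (x1a := Rlt_le_trans _ _ _ Hx1 (Rmin_l _ _)). assert (x1b := Rlt_le_trans _ _ _ Hx1 (Rmin_r _ _)).
assert (x2a := Rlt_le_trans _ _ _ Hx2 (Rmin_l _ _)). assert (x2b := Rlt_le_trans _ _ _ Hx2 (Rmin_r _ _)).
assert (In : forall t, 0 <= t <= 1 -> V (segment x q t) /\ forall i j, Rabs (h i j (segment x q t)) <= M).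
{ intros t Ht. apply Hd0. split.
  - change (Rabs (fst x + t * (fst q - fst x) - fst q) < d0).
    replace (fst x + t * (fst q - fst x) - fst q) with ((1 - t) * (fst x - fst q)) by ring.
    rewrite Rabs_mult, (Rabs_right (1 - t)) by lra.
    assert (a := Rabs_pos (fst x - fst q)). nra.
  - change (Rabs (snd x + t * (snd q - snd x) - snd q) < d0).
    replace (snd x + t * (snd q - snd x) - snd q) with ((1 - t) * (snd x - snd q)) by ring.
    rewrite Rabs_mult, (Rabs_right (1 - t)) by lra.
    assert (a := Rabs_pos (snd x - snd q)). nra. }
assert (Hc : C1_curve V (segment x q)) by (apply segment_C1; intros; apply In; auto).
eapply Rbar_le_lt_trans; [apply (dist_le_curve V h x q (segment x q)); auto; [apply segment_0|apply segment_1]|].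
simpl.
pose (w := k * (Rabs (fst q - fst x) + Rabs (snd q - snd x))).
assert (w0 : 0 <= w).
{ unfold w. assert (a1 := Rabs_pos (fst q - fst x)). assert (a2 := Rabs_pos (snd q - snd x)). nra. }
apply Rle_lt_trans with (w * 1 - w * 0).
- apply (length_le V h _ (fun s => w * s) (fun _ => w)); auto.
  + intros i j t Ht. apply Hh, In; auto.
  + intros s _. auto_derive; auto; ring.
  + intros s Hs. eapply Rle_trans; [apply (quad_le h _ _ M)|].
    * apply In; auto.
    * rewrite segment_velocity. simpl fst; simpl snd. unfold w.
      rewrite Rpow_mult_distr. unfold k. rewrite pow2_sqrt by lra. lra.
- unfold w. rewrite (Rabs_minus_sym (fst q)), (Rabs_minus_sym (snd q)).
  apply Rlt_le_trans with (k * (e / (2 * k) + e / (2 * k))).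
  + rewrite Rmult_0_r, Rmult_1_r, Rminus_0_r. apply Rmult_lt_compat_l; auto. lra.
  + right. field. lra.
Qed.

(** K1 contains the tail of a Cauchy sequence and K2 every short curve starting in K1. The metric
    dominates a multiple of the Euclidean one on K2, so the sequence is Cauchy in the plane; the
    last condition keeps its limit inside V. *)
Lemma complete_criterion (V : pt -> Prop) h : open V -> riemannian V h ->
  (forall p0, V p0 -> exists K1 K2 : pt -> Prop,
    (forall c, C1_curve V c -> c 0 = p0 -> curve_length h c 0 1 < 1 -> K1 (c 1)) /\
    (forall c, C1_curve V c -> K1 (c 0) -> curve_length h c 0 1 < 1 ->
       forall s, 0 <= s <= 1 -> K2 (c s)) /\
    (exists k, 0 < k /\ forall p v, K2 p -> k ^ 2 * nsq v <= quad h p v) /\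
    (forall (x : nat -> pt) (q : pt), (forall n, K1 (x n)) ->
       is_lim_seq (fun n => fst (x n)) (fst q) -> is_lim_seq (fun n => snd (x n)) (snd q) -> V q)) ->
  complete V h.
Proof.
intros oV Rh H x Vx Cx.
assert (Hh := riemannian_continuous V h Rh).
destruct (Cx 1 Rlt_0_1) as [N0 HN0].
destruct (H (x N0) (Vx N0)) as [K1 [K2 [H1 [H2 [[k [k0 H3]] H4]]]]].
assert (inK : forall n, (N0 <= n)%nat -> K1 (x n)).
{ intros n Hn. destruct (dist_lt_curve V h (x N0) (x n) 1) as [c [c1 [c2 [c3 c4]]]]; auto.
  rewrite <- c3. apply H1; auto. }
assert (E : forall e, 0 < e -> exists N, (N0 <= N)%nat /\ forall m n, (N <= m)%nat -> (N <= n)%nat ->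
  forall i, Rabs (comp i (x n) - comp i (x m)) < e).
{ intros e e0.
  (* The bound 1 keeps the connecting curve in K2; the bound k e turns its length into a Euclidean
     displacement below e. *)
  destruct (Cx (Rmin 1 (k * e))) as [N HN]; [apply Rmin_pos; nra|].
  exists (max N N0). split; [apply PeanoNat.Nat.le_max_r|]. intros m n Hm Hn i.
  assert (Hm' := PeanoNat.Nat.max_lub_l _ _ _ Hm). assert (Hn' := PeanoNat.Nat.max_lub_l _ _ _ Hn).
  assert (Hm'' := PeanoNat.Nat.max_lub_r _ _ _ Hm).
  destruct (dist_lt_curve _ _ _ _ _ (HN m n Hm' Hn')) as [c [c1 [c2 [c3 c4]]]].
  assert (l1 := Rlt_le_trans _ _ _ c4 (Rmin_l _ _)). assert (l2 := Rlt_le_trans _ _ _ c4 (Rmin_r _ _)).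
  assert (S : forall s, 0 <= s <= 1 -> K2 (c s)).
  { apply H2; auto. rewrite c2. apply inK; auto. }
  assert (cc : forall i j t, 0 <= t <= 1 -> continuous (h i j) (c t)) by (intros; apply Hh, c1; auto).
  rewrite curve_length_speed in l2.
  assert (G : forall sg, sg ^ 2 = 1 -> sg * k * comp i (c 1) - sg * k * comp i (c 0) <= RInt (speed h c) 0 1).
  { intros sg Hsg.
    apply (length_ge V h c c1 cc (fun s => sg * k * comp i (c s)) (fun s => sg * k * comp i (velocity c s)) 0 1); try lra.
    - intros s Hs. apply (is_derive_scal (fun s => comp i (c s))).
      destruct (c1 s Hs) as [_ D]. destruct i; apply Derive_correct; [apply (D X1)|apply (D X2)].
    - intros s Hs. eapply Rle_trans; [|apply H3, S, Hs].
      replace ((sg * k * comp i (velocity c s)) ^ 2) with (sg ^ 2 * (k ^ 2 * comp i (velocity c s) ^ 2)) by ring.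
      rewrite Hsg, Rmult_1_l. apply Rmult_le_compat_l; [apply pow2_ge_0|].
      generalize (velocity c s); intros v.
      unfold nsq. assert (a1 := pow2_ge_0 (fst v)). assert (a2 := pow2_ge_0 (snd v)).
      destruct i; simpl comp; lra. }
  rewrite c2, c3 in G. assert (G1 := G 1 ltac:(ring)). assert (G2 := G (-1) ltac:(ring)).
  apply Rabs_def1; apply (Rmult_lt_reg_l k); auto; lra. }
assert (L : forall i, exists l : R, is_lim_seq (fun n => comp i (x n)) l).
{ intros i. assert (ex_finite_lim_seq (fun n => comp i (x n))).
  { apply ex_lim_seq_cauchy_corr. intros e. destruct (E e (cond_pos e)) as [N [_ HN]].
    exists N. intros n m Hn Hm. apply HN; auto. }
  exact H0. }
destruct (L X1) as [l1 Hl1]. destruct (L X2) as [l2 Hl2].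
exists (l1, l2).
assert (Vq : V (l1, l2)).
{ apply (H4 (fun n => x (n + N0)%nat)).
  - intros n; apply inK; lia.
  - apply (is_lim_seq_incr_n (fun n => fst (x n)) N0). exact Hl1.
  - apply (is_lim_seq_incr_n (fun n => snd (x n)) N0). exact Hl2. }
split; auto.
intros e e0. destruct (dist_near V h (l1, l2) oV Vq Hh e e0) as [d [d0 Hd]].
assert (A1 := proj2 (is_lim_seq_spec _ _) Hl1 (mkposreal d d0)).
assert (A2 := proj2 (is_lim_seq_spec _ _) Hl2 (mkposreal d d0)).
destruct (filter_and _ _ A1 A2) as [N HN].
exists N. intros n Hn. destruct (HN n Hn) as [B1 B2]. apply Hd; auto.
Qed.

(** Both eigenvalues are continuous and positive on a compact range of q, so each attains a positive
    minimum. *)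
Lemma hm_lower_bound P Q q0 q1 :
  (forall q, q0 <= q <= q1 -> ex_derive P q /\ ex_derive Q q) ->
  (forall q, q0 <= q <= q1 -> 0 < P q) -> (forall q, q0 <= q <= q1 -> 0 < P q + q * Q q) ->
  exists k, 0 < k /\ forall p v, q0 <= nsq p <= q1 -> k ^ 2 * nsq v <= quad (hm P Q) p v.
Proof.
intros He HP HN.
destruct (Rlt_le_dec q1 q0) as [h|h].
{ exists 1; split; [lra|]. intros p v Hp; lra. }
assert (C1 : forall q, q0 <= q <= q1 -> continuity_pt P q).
{ intros q Hq. apply continuity_pt_filterlim.
  apply (ex_derive_continuous (K := R_AbsRing) (V := R_NormedModule)), He, Hq. }
assert (C2 : forall q, q0 <= q <= q1 -> continuity_pt (fun q => P q + q * Q q) q).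
{ intros q Hq. apply continuity_pt_filterlim.
  destruct (He q Hq) as [e1 e2].
  apply (ex_derive_continuous (K := R_AbsRing) (V := R_NormedModule) (fun q => P q + q * Q q)). auto_derive; auto. }
destruct (continuity_ab_min P q0 q1 h C1) as [a [Ha Ha']].
destruct (continuity_ab_min _ q0 q1 h C2) as [b [Hb Hb']].
pose (m := Rmin (P a) (P b + b * Q b)).
assert (m0 : 0 < m) by (apply Rmin_pos; auto).
exists (sqrt m). split; [apply sqrt_lt_R0; auto|].
intros p v Hp. rewrite pow2_sqrt by lra.
apply quad_hm_lower.
- eapply Rle_trans; [apply Rmin_l|]; auto.
- eapply Rle_trans; [apply Rmin_r|]; apply (Hb (nsq p)); auto.
Qed.

Lemma rad_nsq p : rad p ^ 2 = nsq p.
Proof. unfold rad, nsq. rewrite pow2_sqrt; auto. apply nsq_ge0. Qed.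

Lemma rad_ge0 p : 0 <= rad p.
Proof. apply sqrt_pos. Qed.

Lemma rad_axis x : 0 <= x -> rad (x, 0) = x.
Proof.
intros H. unfold rad. simpl fst; simpl snd. replace (x ^ 2 + 0 ^ 2) with (x ^ 2) by ring.
apply sqrt_pow2; auto.
Qed.

Lemma nsq_axis x : nsq (x, 0) = x ^ 2.
Proof. unfold nsq; simpl; ring. Qed.

Lemma nsq_rad_bounds p a b : 0 <= a -> a <= rad p <= b -> a ^ 2 <= nsq p <= b ^ 2.
Proof. intros a0 H. rewrite <- rad_nsq. nra. Qed.

Lemma dot_le p v k : 0 < rad p -> (k * (dot p v / rad p)) ^ 2 <= k ^ 2 * nsq v.
Proof.
intros r0. replace ((k * (dot p v / rad p)) ^ 2) with (k ^ 2 * (dot p v ^ 2 / rad p ^ 2)) by (field; lra).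
apply Rmult_le_compat_l; [apply pow2_ge_0|].
apply Rle_div_l; [apply pow_lt; auto|].
rewrite rad_nsq. assert (H := dot_crs p v). assert (c := pow2_ge_0 (crs p v)). lra.
Qed.

Lemma axis_dist V h L L1 x0 x1 :
  (forall i j p, V p -> continuous (h i j) p) ->
  (forall x, Rmin x0 x1 <= x <= Rmax x0 x1 -> V (x, 0)) ->
  (forall x, Rmin x0 x1 <= x <= Rmax x0 x1 -> is_derive L x (L1 x) /\ 0 <= L1 x /\
     forall w, quad h (x, 0) (w, 0) <= (L1 x * w) ^ 2) ->
  Rbar_le (Defs.dist V h (x0, 0) (x1, 0)) (Rabs (L x1 - L x0)).
Proof.
intros Hh HV HL.
assert (S : forall s, segment (x0, 0) (x1, 0) s = (x0 + s * (x1 - x0), 0)).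
{ intros s; unfold segment; simpl; f_equal; ring. }
assert (In : forall s, 0 <= s <= 1 -> Rmin x0 x1 <= x0 + s * (x1 - x0) <= Rmax x0 x1).
{ intros s Hs. unfold Rmin, Rmax. destruct Rle_dec; nra. }
assert (Hc : C1_curve V (segment (x0, 0) (x1, 0))).
{ apply segment_C1. intros t Ht. rewrite S. auto. }
eapply Rbar_le_trans; [apply (dist_le_curve V h _ _ _ Hc); [apply segment_0|apply segment_1]|].
simpl.
assert (D : forall s, 0 <= s <= 1 -> is_derive (fun s => L (x0 + s * (x1 - x0))) s
   ((x1 - x0) * L1 (x0 + s * (x1 - x0)))).
{ intros s Hs. apply (is_derive_comp L (fun s => x0 + s * (x1 - x0))).
  - apply HL; auto.
  - auto_derive; auto; ring. }
assert (cc : forall i j t, 0 <= t <= 1 -> continuous (h i j) (segment (x0, 0) (x1, 0) t)).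
{ intros; apply Hh, Hc; auto. }
destruct (Rle_lt_dec x0 x1) as [h0|h0].
- eapply Rle_trans; [|apply Rle_abs].
  replace (L x1 - L x0) with (L (x0 + 1 * (x1 - x0)) - L (x0 + 0 * (x1 - x0))) by (f_equal; f_equal; f_equal; ring).
  apply (length_le V h _ (fun s => L (x0 + s * (x1 - x0))) (fun s => (x1 - x0) * L1 (x0 + s * (x1 - x0)))); auto.
  + intros s Hs. destruct (HL _ (In s Hs)) as [_ [K _]]. nra.
  + intros s Hs. destruct (HL _ (In s Hs)) as [_ [_ K]].
    rewrite segment_velocity, S. simpl fst; simpl snd. rewrite Rminus_0_r.
    eapply Rle_trans; [apply K|]. right; ring.
- rewrite Rabs_minus_sym. eapply Rle_trans; [|apply Rle_abs].
  replace (L x0 - L x1) with (- L (x0 + 1 * (x1 - x0)) - - L (x0 + 0 * (x1 - x0)))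
    by (replace (x0 + 1 * (x1 - x0)) with x1 by ring; replace (x0 + 0 * (x1 - x0)) with x0 by ring; ring).
  apply (length_le V h _ (fun s => - L (x0 + s * (x1 - x0))) (fun s => - ((x1 - x0) * L1 (x0 + s * (x1 - x0))))); auto.
  + intros s Hs. apply (is_derive_opp (V := R_NormedModule) (fun s => L (x0 + s * (x1 - x0)))); auto.
  + intros s Hs. destruct (HL _ (In s Hs)) as [_ [K _]]. nra.
  + intros s Hs. destruct (HL _ (In s Hs)) as [_ [_ K]].
    rewrite segment_velocity, S. simpl fst; simpl snd. rewrite Rminus_0_r.
    eapply Rle_trans; [apply K|]. right; ring.
Qed.

(** Points moving outward along the axis are Cauchy because the monotone function L is bounded. A
    limit q would have radius below r, yet every curve from a far point back to q crosses a fixed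
    annulus beyond q, whose width costs a fixed positive length. *)
Lemma incomplete_outer (V : pt -> Prop) h (r : Rbar) r0 L L1 B (xs : nat -> R) :
  (forall i j p, V p -> continuous (h i j) p) ->
  (forall p, V p -> Rbar_lt (rad p) r) ->
  0 < r0 ->
  (forall x : R, r0 <= x -> Rbar_lt x r -> V (x, 0)) ->
  (forall x : R, r0 <= x -> Rbar_lt x r -> is_derive L x (L1 x) /\ 0 <= L1 x /\
     forall w, quad h (x, 0) (w, 0) <= (L1 x * w) ^ 2) ->
  (forall x : R, r0 <= x -> Rbar_lt x r -> L x <= B) ->
  (forall al be : R, 0 < al -> al < be -> Rbar_lt be r -> exists k, 0 < k /\
     forall p v, V p -> al <= rad p <= be -> k ^ 2 * nsq v <= quad h p v) ->
  (forall n, xs n <= xs (S n)) -> (forall n, r0 <= xs n /\ Rbar_lt (xs n) r) ->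
  (forall b : R, Rbar_lt b r -> exists n, b < xs n) ->
  incomplete V h.
Proof.
intros Hh Vr r00 HV HL LB Hk inc Hxs lim Cp.
assert (mono : forall m n, (m <= n)%nat -> xs m <= xs n).
{ intros m n; induction 1; [lra|]. eapply Rle_trans; eauto. }
assert (lt_tr : forall x y : R, x <= y -> Rbar_lt y r -> Rbar_lt x r).
{ intros x y xy yr. eapply Rbar_le_lt_trans; [|exact yr]. exact xy. }
assert (Lmono : forall x y : R, r0 <= x -> x <= y -> Rbar_lt y r -> L x <= L y).
{ intros x y rx xy yr. apply (nondecreasing_deriv L L1); auto.
  - intros z Hz. apply HL; [lra|apply (lt_tr z y); auto; lra].
  - intros z Hz. apply HL; [lra|apply (lt_tr z y); auto; lra]. }
assert (D : forall m n, Rbar_le (Defs.dist V h (xs m, 0) (xs n, 0)) (Rabs (L (xs n) - L (xs m)))).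
{ intros m n. assert (Rmax_lt : Rbar_lt (Rmax (xs m) (xs n)) r) by (unfold Rmax; destruct Rle_dec; apply Hxs).
  assert (Rmin_le : r0 <= Rmin (xs m) (xs n)) by (apply Rmin_glb; apply Hxs).
  apply (axis_dist V h L L1); auto.
  - intros x Hx. apply HV; [lra|apply (lt_tr _ _ (proj2 Hx)); auto].
  - intros x Hx. apply HL; [lra|apply (lt_tr _ _ (proj2 Hx)); auto]. }
assert (C : ex_finite_lim_seq (fun n => L (xs n))).
{ apply (ex_finite_lim_seq_incr _ B).
  - intros n. apply Lmono; auto; apply Hxs.
  - intros n. apply LB; apply Hxs. }
apply ex_lim_seq_cauchy_corr in C.
destruct (Cp (fun n => (xs n, 0))) as [q [Vq Hq]].
- intros n. apply HV; apply Hxs.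
- intros e e0. destruct (C (mkposreal e e0)) as [N HN]. exists N. intros m n Hm Hn.
  eapply Rbar_le_lt_trans; [apply D|]. apply HN; auto.
(* The level al must lie beyond q, be positive and stay below r; a later point of the sequence
   provides a level be above it. *)
- set (al := Rmax (rad q) (xs 0%nat)).
  assert (alr : Rbar_lt al r) by (unfold al, Rmax; destruct Rle_dec; [apply Hxs|auto]).
  assert (al0 : 0 < al) by (unfold al; eapply Rlt_le_trans; [|apply Rmax_r]; eapply Rlt_le_trans; [apply r00|apply Hxs]).
  destruct (lim al alr) as [n0 Hn0].
  set (be := xs n0). fold be in Hn0.
  assert (ber : Rbar_lt be r) by apply Hxs.
  destruct (Hk al be al0 Hn0 ber) as [k [k0 K]].
  destruct (Hq (k * (be - al))) as [N HN]; [nra|].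
  specialize (HN (max N n0) (PeanoNat.Nat.le_max_l _ _)).
  destruct (dist_lt_curve _ _ _ _ _ HN) as [c [c1 [c2 [c3 c4]]]].
  rewrite curve_length_speed in c4.
  assert (X := length_crossing V h c c1 (fun i j t Ht => Hh i j _ (proj1 (c1 t Ht))) (fun x => k * x) (fun _ => k) al be al0 Hn0).
  assert (X' : Rabs (k * be - k * al) <= RInt (speed h c) 0 1).
  { apply X; try lra.
    - intros x _. auto_derive; auto; ring.
    - intros p v Vp Hp. eapply Rle_trans; [|apply K; auto]. apply dot_le. lra.
    - right. rewrite c2, c3. split.
      + rewrite rad_axis; [|assert (a := proj1 (Hxs (max N n0))); lra].
        apply mono, PeanoNat.Nat.le_max_r.
      + apply Rmax_l. }
  replace (k * be - k * al) with (k * (be - al)) in X' by ring.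
  rewrite Rabs_right in X'; [lra|nra].
Qed.

(** A curve of length below 1 cannot raise L by 1, so divergence of L bounds the radii it reaches.
    The bound is uniform in the curve, which allows it to be iterated. *)
Lemma outer_bound (V : pt -> Prop) h r0 L L1 :
  (forall i j p, V p -> continuous (h i j) p) -> 0 < r0 ->
  (forall x : R, r0 <= x -> is_derive L x (L1 x)) ->
  (forall p v, V p -> r0 <= rad p -> (L1 (rad p) * (dot p v / rad p)) ^ 2 <= quad h p v) ->
  (forall B, exists b, forall x, b <= x -> B <= L x) ->
  forall b1, r0 <= b1 -> exists b2, b1 < b2 /\ forall c, C1_curve V c ->
    rad (c 0) <= b1 -> curve_length h c 0 1 < 1 -> forall s, 0 <= s <= 1 -> rad (c s) <= b2.
Proof.
intros Hh r00 HL Hq Linf b1 Hb1.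
destruct (Linf (L b1 + 1)) as [b Hb].
exists (Rmax b (b1 + 1)). assert (m1 := Rmax_l b (b1 + 1)). assert (m2 := Rmax_r b (b1 + 1)).
specialize (Hb (Rmax b (b1 + 1)) m1).
set (b2 := Rmax b (b1 + 1)) in *. split; [lra|].
intros c Hc c0 cl s Hs. apply Rnot_lt_le; intros H.
rewrite curve_length_speed in cl.
assert (cc : forall i j t, 0 <= t <= 1 -> continuous (h i j) (c t)) by (intros; apply Hh, Hc; auto).
assert (X : Rabs (L b2 - L b1) <= RInt (speed h c) 0 s).
{ apply (length_crossing V h c Hc cc L L1 b1 b2); try lra.
  - intros x Hx; apply HL; lra.
  - intros p v Vp Hp; apply Hq; auto; lra. }
assert (Y := RInt_speed_sub V h c Hc cc 0 0 s 1).
assert (Z := Rle_abs (L b2 - L b1)). lra.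
Qed.

Lemma inner_bound (V : pt -> Prop) h r0 L L1 :
  (forall i j p, V p -> continuous (h i j) p) -> 0 < r0 ->
  (forall x : R, 0 < x <= r0 -> is_derive L x (L1 x)) ->
  (forall p v, V p -> 0 < rad p <= r0 -> (L1 (rad p) * (dot p v / rad p)) ^ 2 <= quad h p v) ->
  (forall B, exists b, 0 < b /\ forall x, 0 < x <= b -> L x <= B) ->
  forall a1, 0 < a1 <= r0 -> exists a2, 0 < a2 < a1 /\ forall c, C1_curve V c ->
    a1 <= rad (c 0) -> curve_length h c 0 1 < 1 -> forall s, 0 <= s <= 1 -> a2 <= rad (c s).
Proof.
intros Hh r00 HL Hq Linf a1 Ha1.
destruct (Linf (L a1 - 1)) as [b [b0 Hb]].
assert (m1 := Rmin_l b (a1 / 2)). assert (m2 := Rmin_r b (a1 / 2)).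
assert (m0 : 0 < Rmin b (a1 / 2)) by (apply Rmin_pos; lra).
exists (Rmin b (a1 / 2)).
specialize (Hb (Rmin b (a1 / 2)) (conj m0 m1)).
set (a2 := Rmin b (a1 / 2)) in *. split; [lra|].
intros c Hc c0 cl s Hs. apply Rnot_lt_le; intros H.
rewrite curve_length_speed in cl.
assert (cc : forall i j t, 0 <= t <= 1 -> continuous (h i j) (c t)) by (intros; apply Hh, Hc; auto).
assert (X : Rabs (L a1 - L a2) <= RInt (speed h c) 0 s).
{ apply (length_crossing V h c Hc cc L L1 a2 a1); try lra.
  - intros x Hx; apply HL; lra.
  - intros p v Vp Hp; apply Hq; auto; lra. }
assert (Y := RInt_speed_sub V h c Hc cc 0 0 s 1).
assert (Z := Rle_abs (L a1 - L a2)). lra.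
Qed.

Lemma lim_norm_le (x : nat -> pt) (q : pt) :
  is_lim_seq (fun n => fst (x n)) (fst q) -> is_lim_seq (fun n => snd (x n)) (snd q) ->
  is_lim_seq (fun n => nsq (x n)) (nsq q).
Proof.
intros H1 H2. unfold nsq.
apply (is_lim_seq_ext (fun n => fst (x n) * fst (x n) + snd (x n) * snd (x n))); [intros; ring|].
replace (fst q ^ 2 + snd q ^ 2) with (fst q * fst q + snd q * snd q) by ring.
apply is_lim_seq_plus'; apply is_lim_seq_mult'; auto.
Qed.

Lemma complete_plane h r0 L L1 :
  riemannian plane h -> 0 < r0 ->
  (forall x : R, r0 <= x -> is_derive L x (L1 x)) ->
  (forall p v, r0 <= rad p -> (L1 (rad p) * (dot p v / rad p)) ^ 2 <= quad h p v) ->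
  (forall B, exists b, forall x, b <= x -> B <= L x) ->
  (forall b, exists k, 0 < k /\ forall p v, rad p <= b -> k ^ 2 * nsq v <= quad h p v) ->
  Defs.complete plane h.
Proof.
intros Rh r00 HL Hq Linf Hk.
assert (Hh := riemannian_continuous _ _ Rh).
apply complete_criterion; auto.
{ intros p _. apply filter_forall; exact (fun _ => I). }
intros p0 _.
destruct (outer_bound plane h r0 L L1 Hh r00 HL) with (b1 := Rmax r0 (rad p0)) as [b1 [Hb1 K1]]; auto.
{ apply Rmax_l. }
destruct (outer_bound plane h r0 L L1 Hh r00 HL) with (b1 := b1) as [b2 [Hb2 K2]]; auto.
{ assert (m := Rmax_l r0 (rad p0)). lra. }
(* b1 bounds the points joined to p0 by a curve of length below 1, and b2 the curves of length below
   1 that start within b1. *)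
exists (fun p => rad p <= b1), (fun p => rad p <= b2). repeat split; auto.
intros c Hc c0 cl. apply K1; auto; [|lra]. rewrite c0; apply Rmax_r.
Qed.

Lemma open_punctured : open punctured_plane.
Proof.
intros p Hp. assert (H := continuous_comp nsq sqrt p (continuous_nsq p) (continuous_sqrt _)).
apply H. apply (open_gt 0). exact Hp.
Qed.

(** Radii are trapped in a compact annulus from both sides: L tends to infinity at the outer end and
    M to minus infinity at the puncture. *)
Lemma complete_punctured h r0 L L1 r1 M M1 :
  riemannian punctured_plane h -> 0 < r0 ->
  (forall x : R, r0 <= x -> is_derive L x (L1 x)) ->
  (forall p v, punctured_plane p -> r0 <= rad p -> (L1 (rad p) * (dot p v / rad p)) ^ 2 <= quad h p v) ->
  (forall B, exists b, forall x, b <= x -> B <= L x) ->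
  0 < r1 ->
  (forall x : R, 0 < x <= r1 -> is_derive M x (M1 x)) ->
  (forall p v, punctured_plane p -> 0 < rad p <= r1 -> (M1 (rad p) * (dot p v / rad p)) ^ 2 <= quad h p v) ->
  (forall B, exists b, 0 < b /\ forall x, 0 < x <= b -> M x <= B) ->
  (forall a b, 0 < a -> exists k, 0 < k /\ forall p v, a <= rad p <= b -> k ^ 2 * nsq v <= quad h p v) ->
  Defs.complete punctured_plane h.
Proof.
intros Rh r00 HL Hq Linf r10 HM Hq' Minf Hk.
assert (Hh := riemannian_continuous _ _ Rh).
apply complete_criterion; auto; [apply open_punctured|].
intros p0 Hp0.
destruct (outer_bound _ h r0 L L1 Hh r00 HL) with (b1 := Rmax r0 (rad p0)) as [b1 [Hb1 K1]]; auto.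
{ apply Rmax_l. }
destruct (outer_bound _ h r0 L L1 Hh r00 HL) with (b1 := b1) as [b2 [Hb2 K2]]; auto.
{ assert (m := Rmax_l r0 (rad p0)). lra. }
assert (mp : 0 < Rmin r1 (rad p0)) by (apply Rmin_pos; auto).
destruct (inner_bound _ h r1 M M1 Hh r10 HM) with (a1 := Rmin r1 (rad p0)) as [a1 [Ha1 J1]]; auto.
{ split; auto. apply Rmin_l. }
destruct (inner_bound _ h r1 M M1 Hh r10 HM) with (a1 := a1) as [a2 [Ha2 J2]]; auto.
{ assert (m := Rmin_l r1 (rad p0)). lra. }
exists (fun p => a1 <= rad p <= b1), (fun p => a2 <= rad p <= b2). split; [|split; [|split]].
- intros c Hc c0 cl. split.
  + apply J1; auto; [|lra]. rewrite c0; apply Rmin_r.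
  + apply K1; auto; [|lra]. rewrite c0; apply Rmax_r.
- intros c Hc c0 cl s Hs. split; [apply J2|apply K2]; auto; apply c0.
- apply Hk. lra.
- intros x q Hx L1' L2'.
  assert (Q := lim_norm_le x q L1' L2').
  assert (a1 ^ 2 <= nsq q).
  { apply (is_lim_seq_le (fun _ => a1 ^ 2) (fun n => nsq (x n)) (a1 ^ 2) (nsq q)); auto.
    - intros n. rewrite <- rad_nsq. specialize (Hx n). nra.
    - apply is_lim_seq_const. }
  unfold punctured_plane. apply sqrt_lt_R0. change (0 < nsq q). nra.
Qed.

(** * Profiles *)

Lemma rP_G a t : rP (G a) t = a t ^ 2 / t.
Proof. reflexivity. Qed.

Lemma rQ_G a t : rQ (G a) t = 4 * t.
Proof. reflexivity. Qed.

Lemma polar_pull tau m p v : polar (pull tau m) p v =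
  rP m (tau (rad p)) * Derive tau (rad p) ^ 2 * (dot p v / rad p) ^ 2 +
  rQ m (tau (rad p)) * (crs p v / rad p ^ 2) ^ 2.
Proof. reflexivity. Qed.

(** * The metric of a surface in polar form *)

Lemma surface_quad D P Q lam mu T U X X1 p v :
  surface D P Q lam mu T U X X1 -> 0 < nsq p -> D (nsq p) ->
  quad (hm P Q) p v = 4 * X1 (nsq p) ^ 2 / T (X (nsq p)) * dot p v ^ 2 +
    4 * T (X (nsq p)) * (crs p v / nsq p) ^ 2.
Proof.
intros S q0 Dq.
assert (t0 := sf_T _ _ _ _ _ _ _ _ _ S _ q0 Dq).
apply (Rmult_eq_reg_l (nsq p)); [|lra].
rewrite nsq_quad_hm, (sf_PT _ _ _ _ _ _ _ _ _ S _ q0 Dq), (sf_QT _ _ _ _ _ _ _ _ _ S _ q0 Dq).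
field. lra.
Qed.

Lemma surface_radial_ge D P Q lam mu T U X X1 p v :
  surface D P Q lam mu T U X X1 -> 0 < rad p -> D (nsq p) ->
  (2 * rad p * X1 (nsq p) / sqrt (T (X (nsq p))) * (dot p v / rad p)) ^ 2 <= quad (hm P Q) p v.
Proof.
intros S r0 Dq.
assert (q0 : 0 < nsq p) by (rewrite <- rad_nsq; apply pow_lt; auto).
rewrite (surface_quad D P Q lam mu T U X X1); auto.
assert (t0 := sf_T _ _ _ _ _ _ _ _ _ S _ q0 Dq).
assert (s0 := sqrt_lt_R0 _ t0).
replace ((2 * rad p * X1 (nsq p) / sqrt (T (X (nsq p))) * (dot p v / rad p)) ^ 2)
  with (4 * X1 (nsq p) ^ 2 / (sqrt (T (X (nsq p))) ^ 2) * dot p v ^ 2) by (field; split; lra).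
rewrite pow2_sqrt by lra.
assert (h := pow2_ge_0 (crs p v / nsq p)). nra.
Qed.

Lemma surface_axis D P Q lam mu T U X X1 x w :
  surface D P Q lam mu T U X X1 -> 0 < x -> D (x ^ 2) ->
  quad (hm P Q) (x, 0) (w, 0) = (2 * x * X1 (x ^ 2) / sqrt (T (X (x ^ 2))) * w) ^ 2.
Proof.
intros S x0 Dx.
assert (q0 : 0 < x ^ 2) by (apply pow_lt; auto).
rewrite (surface_quad D P Q lam mu T U X X1); rewrite ?nsq_axis; auto.
assert (t0 := sf_T _ _ _ _ _ _ _ _ _ S _ q0 Dx).
assert (s0 := sqrt_lt_R0 _ t0).
transitivity (4 * x ^ 2 * X1 (x ^ 2) ^ 2 / (sqrt (T (X (x ^ 2))) ^ 2) * w ^ 2).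
- rewrite pow2_sqrt by lra. unfold dot, crs; simpl fst; simpl snd. field; lra.
- field. lra.
Qed.

Lemma surface_tau D P Q lam mu T U X X1 x :
  surface D P Q lam mu T U X X1 -> 0 < x -> D (x ^ 2) ->
  is_derive (fun x => T (X (x ^ 2))) x (2 * x * X1 (x ^ 2) * U (X (x ^ 2))).
Proof.
intros S x0 Dx. assert (q0 : 0 < x ^ 2) by (apply pow_lt; auto).
apply (is_derive_comp T (fun x => X (x ^ 2))); [apply S|].
apply (is_derive_comp X (fun x => x ^ 2)); [apply S; auto|].
auto_derive; auto. ring.
Qed.

Lemma surface_tau_Derive D P Q lam mu T U X X1 x :
  surface D P Q lam mu T U X X1 -> 0 < x -> D (x ^ 2) ->
  Derive (fun x => T (X (x ^ 2))) x = 2 * x * X1 (x ^ 2) * U (X (x ^ 2)).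
Proof. intros S x0 Dx. apply is_derive_unique. eapply surface_tau; eauto. Qed.

Lemma surface_tau_smooth D P Q lam mu T U X X1 x n :
  surface D P Q lam mu T U X X1 -> 0 < x -> D (x ^ 2) ->
  ex_derive_n (fun x => T (X (x ^ 2))) n x.
Proof.
intros S x0 Dx. assert (q0 : 0 < x ^ 2) by (apply pow_lt; auto).
apply (ex_derive_n_ext (fun s => T (X (nsq (s, 0))))).
- intros t; rewrite nsq_axis; reflexivity.
- apply (smooth_ex_derive_n (fun p => 0 < nsq p /\ D (nsq p)) (fun p => T (X (nsq p)))).
  + apply ck_smooth, S.
  + rewrite nsq_axis; auto.
Qed.

(** The parameter is t = T (X (x^2)). Since dt = U dX and a = 1 / U at t, the term a^2 dt^2 / t
    becomes dX^2 / T. *)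
Lemma surface_realizes D P Q lam mu T U X X1 r e0 e1 a :
  surface D P Q lam mu T U X X1 ->
  (forall x : R, 0 < x -> Rbar_lt x r ->
     D (x ^ 2) /\ U (X (x ^ 2)) <> 0 /\ a (T (X (x ^ 2))) = / U (X (x ^ 2))) ->
  filterlim (fun x => T (X (x ^ 2))) (at_right 0) (Rbar_locally e0) ->
  filterlim (fun x => T (X (x ^ 2))) (outer_end r) (Rbar_locally e1) ->
  realizes (hm P Q) r e0 e1 (G a).
Proof.
intros S H F0 F1. exists (fun x => T (X (x ^ 2))).
split; [|split; [exact F0|split; [exact F1|]]].
- intros x x0 xr. destruct (H x x0 xr) as [Dx [U0 _]]. split.
  + intros n. eapply surface_tau_smooth; eauto.
  + rewrite (surface_tau_Derive D P Q lam mu T U X X1 x S x0 Dx).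
    assert (X0 := sf_X1 _ _ _ _ _ _ _ _ _ S (x ^ 2) (pow_lt _ 2 x0) Dx). nz.
- intros p v x0 xr. destruct (H _ x0 xr) as [Dx [U0 Ha]].
  rewrite polar_pull, rP_G, rQ_G.
  rewrite (surface_tau_Derive D P Q lam mu T U X X1 _ S x0 Dx).
  rewrite Ha. rewrite rad_nsq in *.
  assert (q0 : 0 < nsq p) by (rewrite <- rad_nsq; apply pow_lt; auto).
  assert (t0 := sf_T _ _ _ _ _ _ _ _ _ S _ q0 Dx).
  rewrite (surface_quad D P Q lam mu T U X X1); auto.
  field. repeat split; try lra.
Qed.

(** The metric and both pulled-back models are diagonal in the radial and angular directions, so the
    operator norm estimate reduces to two scalar inequalities in the momentum coordinate y; the
    square of [s1 (T y) * U y] is the factor between ds^2 and dy^2. *)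
Lemma surface_asymptotic D P Q lam mu T U X X1 (V : R -> Prop)
  (F FX E : (R -> Prop) -> Prop) (FF : Filter F) (FFX : Filter FX) m m0 (s s1 : R -> R) :
  surface D P Q lam mu T U X X1 -> open V ->
  (forall n, ck n (fun p => (0 < nsq p /\ D (nsq p)) /\ V (nsq p)) (fun p => s (T (X (nsq p))))) ->
  F (fun x => 0 < x /\ D (x ^ 2) /\ V (x ^ 2)) ->
  filterlim (fun x => X (x ^ 2)) F FX ->
  filterlim (fun y => s (T y)) FX E ->
  (forall eps, 0 < eps -> FX (fun y =>
     is_derive s (T y) (s1 (T y)) /\ s1 (T y) <> 0 /\ U y <> 0 /\
     Rabs (1 / T y - rP m (s (T y)) * (s1 (T y) * U y) ^ 2) <= eps * (rP m0 (s (T y)) * (s1 (T y) * U y) ^ 2) /\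
     Rabs (4 * T y - rQ m (s (T y))) <= eps * rQ m0 (s (T y)))) ->
  asymptotic_rel F (hm P Q) E m m0.
Proof.
intros S oV sm FD FXl FE He.
exists (fun x => s (T (X (x ^ 2)))). split.
{ apply (filterlim_comp _ _ _ (fun x => X (x ^ 2)) (fun y => s (T y)) F FX E FXl FE). }
intros eps eps0. specialize (He eps eps0). apply FXl in He. unfold filtermap in He.
generalize (filter_and _ _ FD He). apply filter_imp.
intros x [[x0 [Dx Vx]] [Hs [Hs1 [HU [Hr Ha]]]]].
assert (q0 : 0 < x ^ 2) by (apply pow_lt; auto).
assert (X0 := sf_X1 _ _ _ _ _ _ _ _ _ S (x ^ 2) q0 Dx).
assert (ds : is_derive (fun x => s (T (X (x ^ 2)))) x
   (2 * x * X1 (x ^ 2) * U (X (x ^ 2)) * s1 (T (X (x ^ 2))))).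
{ apply (is_derive_comp s (fun x => T (X (x ^ 2)))); auto. eapply surface_tau; eauto. }
assert (es : Derive (fun x => s (T (X (x ^ 2)))) x = 2 * x * X1 (x ^ 2) * U (X (x ^ 2)) * s1 (T (X (x ^ 2)))).
{ apply is_derive_unique; auto. }
split; [|split].
- intros n. apply (ex_derive_n_ext (fun t => s (T (X (nsq (t, 0)))))).
  { intros t; rewrite nsq_axis; reflexivity. }
  apply (smooth_ex_derive_n (fun p => (0 < nsq p /\ D (nsq p)) /\ V (nsq p)) (fun p => s (T (X (nsq p))))).
  + apply ck_smooth; auto.
  + rewrite nsq_axis; auto.
- rewrite es. nz.
- intros p v Hp. subst x. rewrite !polar_pull.
  rewrite es. rewrite rad_nsq in *.
  assert (t0 := sf_T _ _ _ _ _ _ _ _ _ S _ q0 Dx).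
  rewrite (surface_quad D P Q lam mu T U X X1); auto.
  clear ds es He FD FXl FE.
  revert Hr Ha. generalize (rP m (s (T (X (nsq p))))) (rP m0 (s (T (X (nsq p))))).
  generalize (rQ m (s (T (X (nsq p))))) (rQ m0 (s (T (X (nsq p))))).
  revert Hs1 HU t0 X0. generalize (s1 (T (X (nsq p)))); intros k; generalize (U (X (nsq p))) (T (X (nsq p))) (X1 (nsq p)).
  intros u t y Hs1 HU t0 X0 qm qm0 pm pm0 Hr Ha.
  set (R := (2 * rad p * y) ^ 2 * (dot p v / rad p) ^ 2).
  set (C := (crs p v / nsq p) ^ 2).
  assert (R0 : 0 <= R) by (apply Rmult_le_pos; apply pow2_ge_0).
  assert (C0 : 0 <= C) by apply pow2_ge_0.
  replace (4 * y ^ 2 / t * dot p v ^ 2 + 4 * t * C -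
    (pm * (2 * rad p * y * u * k) ^ 2 * (dot p v / rad p) ^ 2 + qm * C))
    with ((1 / t - pm * (k * u) ^ 2) * R + (4 * t - qm) * C)
    by (unfold R; field; lra).
  replace (eps * (pm0 * (2 * rad p * y * u * k) ^ 2 * (dot p v / rad p) ^ 2 + qm0 * C))
    with (eps * (pm0 * (k * u) ^ 2) * R + eps * qm0 * C) by (unfold R; ring).
  eapply Rle_trans; [apply Rabs_triang|].
  rewrite (Rabs_mult _ R), (Rabs_mult _ C), (Rabs_right R), (Rabs_right C) by lra.
  apply Rplus_le_compat; apply Rmult_le_compat_r; auto.
Qed.

(** A primitive Z of [a] is a momentum coordinate up to a constant. Two quantities are constant
    along the solution and express 1 / a and t through exp (4 mu Z); since u0 is not the
    equilibrium, the limit of 1 / a forces Z to converge at t0, and that limit is taken as the zero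
    of the coordinate y. *)
Lemma profile_limit_form (lam mu u0 t0 : R) (e1 : Rbar) (a : R -> R) :
  mu <> 0 -> u0 <> lam / (2 * mu) -> Rbar_lt t0 e1 -> profile lam mu a t0 e1 ->
  filterlim (fun t => / a t) (at_right t0) (locally u0) ->
  exists y : R -> R, forall t, t0 < t -> Rbar_lt t e1 ->
    0 < y t /\ Tm t0 u0 lam mu (y t) = t /\ Um u0 lam mu (y t) = / a t.
Proof.
intros mu0 ud te prof lim.
set (dl := lam / (2 * mu)) in *.
assert (between : forall t s x : R, t0 < t -> Rbar_lt s e1 -> t <= x <= s -> t0 < x /\ Rbar_lt x e1).
{ intros t s x Ht Hs Hx. split; [lra|]. eapply Rbar_le_lt_trans; [|exact Hs]. apply Hx. }
assert (ex1 : exists t1 : R, t0 < t1 /\ Rbar_lt t1 e1).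
{ destruct e1 as [e| |]; simpl in te.
  - exists ((t0 + e) / 2); simpl; split; lra.
  - exists (t0 + 1); simpl; split; [lra|auto].
  - contradiction. }
destruct ex1 as [t1 [Ht1 Ht1']].
assert (ca : forall t : R, t0 < t -> Rbar_lt t e1 -> continuous a t).
{ intros t H1 H2. apply (ex_derive_continuous a). eexists; apply (prof t H1 H2). }
assert (mid : forall t x : R, t0 < t -> Rbar_lt t e1 -> Rmin t1 t <= x <= Rmax t1 t -> t0 < x /\ Rbar_lt x e1).
{ intros t x H1 H2. unfold Rmin, Rmax. destruct Rle_dec; intros Hx; [apply (between t1 t)|apply (between t t1)]; auto. }
pose (Z t := RInt a t1 t).
assert (dZ : forall t : R, t0 < t -> Rbar_lt t e1 -> is_derive Z t (a t)).
{ intros t H1 H2. apply (is_derive_RInt (V := R_NormedModule) a Z t1 t); auto.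
  assert (L : locally t (fun x : R => t0 < x /\ Rbar_lt x e1)).
  { apply (open_and (fun x : R => t0 < x) (fun x : R => Rbar_lt x e1)); auto.
    - apply open_gt.
    - destruct e1 as [e| |]; simpl; [apply open_lt|apply open_true|apply open_false]. }
  revert L; apply filter_imp. intros x [x1 x2].
  apply (RInt_correct (V := R_CompleteNormedModule)).
  apply (ex_RInt_continuous (V := R_CompleteNormedModule)).
  intros z Hz. destruct (mid x z); auto. }
assert (const : forall (f df : R -> R), (forall t : R, t0 < t -> Rbar_lt t e1 -> is_derive f t (df t)) ->
  (forall t : R, t0 < t -> Rbar_lt t e1 -> df t = 0) ->
  forall t : R, t0 < t -> Rbar_lt t e1 -> f t = f t1).
{ intros f df Hf H0.
  assert (K : forall x y : R, t0 < x -> Rbar_lt y e1 -> x <= y -> f x = f y).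
  { intros x y x0 y0 xy. apply Rle_antisym.
    - apply (nondecreasing_deriv f df); auto; intros z Hz.
      + apply Hf; apply (between x y z); auto.
      + rewrite H0; [lra| |]; apply (between x y z); auto; lra.
    - assert (- f x <= - f y); [|lra].
      apply (nondecreasing_deriv (fun x => - f x) (fun x => - df x)); auto; intros z Hz.
      + apply (is_derive_opp (V := R_NormedModule) f). apply Hf; apply (between x y z); auto.
      + rewrite H0; [lra| |]; apply (between x y z); auto; lra. }
  intros t H1 H2. destruct (Rle_lt_dec t t1) as [h|h]; [apply K; auto|symmetry; apply K; auto; lra]. }
(* First integral of (1 / a)' = 4 mu - 2 lam a: as a function of Z, the deviation of 1 / a from
   equilibrium is purely exponential. *)
pose (C := (/ a t1 - dl) * exp (- (4 * mu * Z t1))).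
assert (HC : forall t : R, t0 < t -> Rbar_lt t e1 -> / a t = dl + C * exp (4 * mu * Z t)).
{ intros t H1 H2.
  assert (K : (/ a t - dl) * exp (- (4 * mu * Z t)) = C).
  { apply (const (fun t => (/ a t - dl) * exp (- (4 * mu * Z t)))
     (fun t => (4 * mu - 2 * lam * a t) * exp (- (4 * mu * Z t)) -
        (/ a t - dl) * (4 * mu * a t) * exp (- (4 * mu * Z t)))); auto; intros s s1 s2; destruct (prof s s1 s2) as [p1 p2].
    - assert (d := dZ s s1 s2).
      assert (e1' : ex_derive a s) by (eexists; eauto).
      assert (e2' : ex_derive Z s) by (eexists; eauto).
      auto_derive; [repeat split; auto; lra|].
      replace (Derive (fun x : R => a x) s) with (2 * lam * a s ^ 3 - 4 * mu * a s ^ 2) by (symmetry; apply is_derive_unique; auto).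
      replace (Derive (fun x : R => Z x) s) with (a s) by (symmetry; apply is_derive_unique; auto).
      field. lra.
    - unfold dl. field. split; lra. }
  rewrite <- K.
  transitivity (dl + (/ a t - dl) * (exp (- (4 * mu * Z t)) * exp (4 * mu * Z t))); [|ring].
  rewrite <- exp_plus. replace (- (4 * mu * Z t) + 4 * mu * Z t) with 0 by ring. rewrite exp_0. ring. }
(* Second constant of the motion: dt = (1 / a) dZ integrated in closed form. *)
pose (E := t1 - (dl * Z t1 + C * exp (4 * mu * Z t1) / (4 * mu))).
assert (HE : forall t : R, t0 < t -> Rbar_lt t e1 -> t = dl * Z t + C * exp (4 * mu * Z t) / (4 * mu) + E).
{ intros t H1 H2.
  assert (K : t - (dl * Z t + C * exp (4 * mu * Z t) / (4 * mu)) = E); [|lra].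
  apply (const (fun t => t - (dl * Z t + C * exp (4 * mu * Z t) / (4 * mu)))
     (fun t => 1 - a t * (dl + C * exp (4 * mu * Z t)))); auto; intros s s1 s2; destruct (prof s s1 s2) as [p1 p2].
  - assert (d := dZ s s1 s2). assert (e2' : ex_derive Z s) by (eexists; eauto).
    auto_derive; [repeat split; auto; lra|].
    replace (Derive (fun x : R => Z x) s) with (a s) by (symmetry; apply is_derive_unique; auto).
    field. lra.
  - rewrite <- HC; auto. field. lra. }
assert (near : at_right t0 (fun t : R => t0 < t /\ Rbar_lt t e1)).
{ assert (L : locally t0 (fun x : R => Rbar_lt x e1)).
  { destruct e1 as [e| |]; simpl; [apply open_lt; exact te|apply filter_forall; auto|contradiction]. }
  unfold at_right, within. revert L; apply filter_imp; auto. }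
assert (limC : filterlim (fun t => C * exp (4 * mu * Z t)) (at_right t0) (locally (u0 - dl))).
{ apply (filterlim_ext_loc (fun t => / a t - dl)).
  - revert near; apply filter_imp. intros t [H1 H2]. rewrite (HC t H1 H2). lra.
  - apply (filterlim_comp _ _ _ (fun t => / a t) (fun u => u - dl) _ (locally u0)); auto.
    apply (ex_derive_continuous (fun u => u - dl)). auto_derive; auto. }
(* If C vanished, 1 / a would be constantly lam / (2 mu), against the hypothesis on u0. *)
assert (C0 : C <> 0).
{ intros C0. apply ud.
  assert (K : filterlim (fun _ : R => 0) (at_right t0) (locally (u0 - dl))).
  { revert limC. apply filterlim_ext. intros; rewrite C0; ring. }
  assert (K' := filterlim_locally_unique (F := at_right t0) (fun _ : R => 0) 0 (u0 - dl) (filterlim_const 0) K). lra. }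
pose (l := (u0 - dl) / C).
assert (limE : filterlim (fun t => exp (4 * mu * Z t)) (at_right t0) (locally l)).
{ apply (filterlim_ext (fun t => / C * (C * exp (4 * mu * Z t)))); [intros; field; auto|].
  apply (filterlim_comp _ _ _ _ (fun u => / C * u) _ (locally (u0 - dl))); auto.
  unfold l. replace ((u0 - dl) / C) with (/ C * (u0 - dl)) by (field; auto).
  apply (ex_derive_continuous (fun u => / C * u)). auto_derive; auto. }
assert (l0 : 0 < l).
{ assert (0 <= l).
  { apply (filterlim_le (F := at_right t0) (fun _ => 0) (fun t => exp (4 * mu * Z t)) 0 l).
    - apply filter_forall. intros; left; apply exp_pos.
    - apply filterlim_const.
    - exact limE. }
  destruct H as [H|H]; auto. exfalso. apply ud.
  assert (u0 - dl = l * C) by (unfold l; field; auto). rewrite <- H in H0. lra. }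
pose (z0 := ln l / (4 * mu)).
assert (limZ : filterlim Z (at_right t0) (locally z0)).
{ apply (filterlim_ext (fun t => / (4 * mu) * ln (exp (4 * mu * Z t)))).
  { intros; rewrite ln_exp; field; auto. }
  apply (filterlim_comp _ _ _ _ (fun u => / (4 * mu) * ln u) _ (locally l)); auto.
  unfold z0. replace (ln l / (4 * mu)) with (/ (4 * mu) * ln l) by (field; auto).
  apply (ex_derive_continuous (fun u => / (4 * mu) * ln u)). auto_derive; auto. }
assert (Ce : C * exp (4 * mu * z0) = u0 - dl).
{ unfold z0. replace (4 * mu * (ln l / (4 * mu))) with (ln l) by (field; auto).
  rewrite exp_ln; auto. unfold l; field; auto. }
assert (limt : filterlim (fun t : R => t) (at_right t0) (locally t0)).
{ intros P HP. unfold filtermap, at_right, within. revert HP; apply filter_imp; auto. }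
assert (HE0 : t0 = dl * z0 + (u0 - dl) / (4 * mu) + E).
{ apply (filterlim_locally_unique (F := at_right t0) (fun t : R => t) t0); auto.
  apply (filterlim_ext_loc (fun t => dl * Z t + C * exp (4 * mu * Z t) / (4 * mu) + E)).
  { revert near; apply filter_imp. intros t [H1 H2]. symmetry; auto. }
  rewrite <- Ce.
  apply (filterlim_comp _ _ _ Z (fun z => dl * z + C * exp (4 * mu * z) / (4 * mu) + E) _ (locally z0)); auto.
  apply (ex_derive_continuous (fun z => dl * z + C * exp (4 * mu * z) / (4 * mu) + E)).
  auto_derive; auto. }
assert (Zinc : forall x y : R, t0 < x -> Rbar_lt y e1 -> x < y -> Z x < Z y).
{ intros x y x0 y0 xy. apply (increasing_deriv Z a); auto; intros z Hz.
  - apply dZ; apply (between x y z); auto.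
  - apply prof; apply (between x y z); auto; lra. }
(* Z increases strictly and tends to z0 at t0, hence exceeds z0; this is the positivity of y. *)
assert (Zz0 : forall t : R, t0 < t -> Rbar_lt t e1 -> z0 < Z t).
{ intros t H1 H2. pose (t' := (t0 + t) / 2).
  assert (t'e : Rbar_lt t' e1) by (apply (between t' t t'); auto; unfold t'; lra).
  apply Rle_lt_trans with (Z t'); [|apply Zinc; auto; unfold t'; lra].
  apply (filterlim_le (F := at_right t0) Z (fun _ => Z t') z0 (Z t')); auto.
  - assert (L : locally t0 (fun x : R => x < t')) by (apply open_lt; unfold t'; lra).
    generalize (filter_and _ _ near (filter_le_within _ _ L)); apply filter_imp.
    intros x [[x1 x2] x3]. left; apply Zinc; auto.
  - apply filterlim_const. }
exists (fun t => Z t - z0). intros t H1 H2.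
assert (ez : exp (4 * mu * Z t) = exp (4 * mu * z0) * exp (4 * mu * (Z t - z0))).
{ rewrite <- exp_plus. f_equal; ring. }
assert (CE : C * exp (4 * mu * Z t) = (u0 - dl) * exp (4 * mu * (Z t - z0))).
{ rewrite ez, <- Ce. ring. }
split; [|split].
- specialize (Zz0 t H1 H2). lra.
- unfold Tm. fold dl. assert (K := HE t H1 H2). rewrite CE in K.
  replace ((u0 - dl) * (exp (4 * mu * (Z t - z0)) - 1) / (4 * mu))
    with ((u0 - dl) * exp (4 * mu * (Z t - z0)) / (4 * mu) - (u0 - dl) / (4 * mu)) by (field; auto).
  lra.
- unfold Um. fold dl. rewrite (HC t H1 H2), CE. reflexivity.
Qed.

(** U is monotone whatever the signs of mu and of u0 - lam / (2 mu), so on an interval it is bounded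
    below by one of its end values. *)
Lemma Um_between u0 lam mu x y z :
  x <= z <= y -> Rmin (Um u0 lam mu x) (Um u0 lam mu y) <= Um u0 lam mu z.
Proof.
intros H. unfold Um. set (k := u0 - lam / (2 * mu)).
assert (E : forall a b, a <= b -> exp a <= exp b).
{ intros a b [ab|ab]; [left; apply exp_increasing; auto|subst; lra]. }
assert (K : k * exp (4 * mu * x) <= k * exp (4 * mu * z) \/ k * exp (4 * mu * y) <= k * exp (4 * mu * z)).
{ destruct (Rle_dec 0 k); destruct (Rle_dec 0 mu).
  - left. apply Rmult_le_compat_l; auto. apply E. nra.
  - right. apply Rmult_le_compat_l; auto. apply E. nra.
  - right. apply Rmult_le_compat_neg_l; [lra|]. apply E. nra.
  - left. apply Rmult_le_compat_neg_l; [lra|]. apply E. nra. }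
destruct K as [K|K]; [eapply Rle_trans; [apply Rmin_l|]|eapply Rle_trans; [apply Rmin_r|]]; lra.
Qed.

Lemma Tm_lt t0 u0 lam mu x y : mu <> 0 -> x < y ->
  (forall z, x < z < y -> 0 < Um u0 lam mu z) -> Tm t0 u0 lam mu x < Tm t0 u0 lam mu y.
Proof.
intros mu0 xy H. apply (increasing_deriv _ (Um u0 lam mu)); auto.
intros; apply dTm; auto.
Qed.

(** Uniqueness with the limit of 1 / a as initial datum: the coordinate y of t and the given x have
    the same T, and T is injective where U is positive. *)
Lemma profile_value (lam mu u0 t0 : R) (e1 : Rbar) (a : R -> R) :
  mu <> 0 -> u0 <> lam / (2 * mu) -> profile lam mu a t0 e1 ->
  filterlim (fun t => / a t) (at_right t0) (locally u0) ->
  forall x, 0 < x -> (forall z, 0 < z <= x -> 0 < Um u0 lam mu z) ->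
  Rbar_lt (Tm t0 u0 lam mu x) e1 -> a (Tm t0 u0 lam mu x) = / Um u0 lam mu x.
Proof.
intros mu0 ud prof lim x x0 Ux te.
assert (t0x : t0 < Tm t0 u0 lam mu x).
{ rewrite <- (Tm_0 t0 u0 lam mu) at 1. apply Tm_lt; auto. intros z Hz; apply Ux; lra. }
destruct (profile_limit_form lam mu u0 t0 e1 a) as [y Hy]; auto.
{ eapply Rbar_lt_trans; [|exact te]. exact t0x. }
destruct (Hy _ t0x te) as [y0 [Ty Uy]].
destruct (prof _ t0x te) as [a0 _].
set (t := Tm t0 u0 lam mu x) in *.
assert (e : y t = x).
{ destruct (Rtotal_order (y t) x) as [h|[h|h]]; auto; exfalso.
  - assert (K : Tm t0 u0 lam mu (y t) < Tm t0 u0 lam mu x).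
    { apply Tm_lt; auto. intros z Hz; apply Ux; lra. }
    fold t in K. lra.
  - assert (K : Tm t0 u0 lam mu x < Tm t0 u0 lam mu (y t)).
    { apply Tm_lt; auto. intros z Hz.
      (* Beyond x positivity of U is not given; it follows from positivity at x and at [y t], where
         U equals 1 / a. *)
      eapply Rlt_le_trans; [|apply (Um_between _ _ _ x (y t)); lra].
      apply Rmin_pos; [apply Ux; lra|]. rewrite Uy. apply Rinv_0_lt_compat; auto. }
    fold t in K. lra. }
rewrite <- e, Uy, Rinv_inv. reflexivity.
Qed.

(** g is only known to undo f near x. The intermediate value theorem confines g (t + h) near x,
    after which the difference quotient of g is the reciprocal of one of f. *)
Lemma inverse_derive (f f1 g : R -> R) (x t d : R) :
  0 < d -> f x = t ->
  (forall y, x - d <= y <= x + d -> g (f y) = y) ->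
  (forall y, x - d <= y <= x + d -> is_derive f y (f1 y) /\ 0 < f1 y) ->
  is_derive g t (/ f1 x).
Proof.
intros d0 fx gf Hf.
assert (fm : forall y z, x - d <= y -> y < z -> z <= x + d -> f y < f z).
{ intros y z H1 H2 H3. apply (increasing_deriv f f1); auto; intros w Hw; apply Hf; lra. }
assert (fc : forall y, x - d <= y <= x + d -> continuity_pt f y).
{ intros y Hy. apply continuity_pt_filterlim. apply (ex_derive_continuous f). eexists; apply Hf; auto. }
assert (ivt : forall y z s, x - d <= y -> y < z -> z <= x + d -> f y < s < f z -> y < g s < z).
{ intros y z s H1 H2 H3 H4.
  destruct (Ranalysis5.IVT_interv (fun w => f w - s) y z) as [w [Hw1 Hw2]]; try lra.
  - intros w Hw. apply continuity_pt_minus; [apply fc; lra|apply continuity_pt_const; intros ? ?; reflexivity].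
  - assert (e : f w = s) by lra. rewrite <- e, gf by lra.
    split; apply Rnot_le_lt; intros [h|h].
    + lra.
    + subst w. lra.
    + lra.
    + subst w. lra. }
assert (u0 : 0 < f1 x) by (apply Hf; lra).
assert (dx : derivable_pt_lim f x (f1 x)) by (apply is_derive_Reals, Hf; lra).
apply is_derive_Reals. intros e e0.
set (u := f1 x) in *.
(* If the slope r of f satisfies |r - u| < eta, the first bound gives u r > u^2 / 4 and the second
   then |1 / r - 1 / u| < e. *)
set (eta := Rmin (u / 2) (e * (u * u / 4))).
assert (eta0 : 0 < eta).
{ apply Rmin_pos; [lra|]. apply Rmult_lt_0_compat; auto. assert (0 < u * u) by nra. lra. }
destruct (dx eta eta0) as [d1 Hd1].
set (k := Rmin d (d1 / 2)).
assert (k0 : 0 < k) by (apply Rmin_pos; [auto|assert (h := cond_pos d1); lra]).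
assert (kd : k <= d) by apply Rmin_l. assert (kd1 : k < d1).
{ eapply Rle_lt_trans; [apply Rmin_r|]. assert (h := cond_pos d1); lra. }
assert (m1 := fm (x - k) x). assert (m2 := fm x (x + k)).
assert (D0 : 0 < Rmin (f (x + k) - t) (t - f (x - k))).
{ apply Rmin_pos; rewrite <- fx; [apply Rlt_0_minus, m2|apply Rlt_0_minus, m1]; lra. }
exists (mkposreal _ D0). intros h h0 hD. simpl in hD.
assert (hD1 := Rlt_le_trans _ _ _ hD (Rmin_l _ _)). assert (hD2 := Rlt_le_trans _ _ _ hD (Rmin_r _ _)).
apply Rabs_def2 in hD1. apply Rabs_def2 in hD2.
assert (gb := ivt (x - k) (x + k) (t + h)).
assert (gb' : x - k < g (t + h) < x + k) by (apply gb; lra).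
assert (gt : g t = x) by (rewrite <- fx; apply gf; lra).
assert (fg : f (g (t + h)) = t + h).
{ destruct (Ranalysis5.IVT_interv (fun w => f w - (t + h)) (x - k) (x + k)) as [w [Hw1 Hw2]]; try lra.
  - intros w Hw. apply continuity_pt_minus; [apply fc; lra|apply continuity_pt_const; intros ? ?; reflexivity].
  - assert (ew : f w = t + h) by lra. rewrite <- ew, gf by lra. reflexivity. }
set (s := g (t + h) - x).
assert (s0 : s <> 0).
{ intros s0. apply h0. assert (e1 : g (t + h) = x) by (unfold s in s0; lra). rewrite e1 in fg. lra. }
specialize (Hd1 s s0). assert (sd : Rabs s < d1) by (apply Rabs_def1; unfold s; lra).
specialize (Hd1 sd).
replace (x + s) with (g (t + h)) in Hd1 by (unfold s; ring).
rewrite fg, fx in Hd1. replace (t + h - t) with h in Hd1 by ring.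
rewrite gt. fold s.
set (r := h / s) in *.
assert (b1 := Rlt_le_trans _ _ _ Hd1 (Rmin_l _ _)). assert (b2 := Rlt_le_trans _ _ _ Hd1 (Rmin_r _ _)).
apply Rabs_def2 in b1.
assert (r0 : u / 2 < r) by lra.
replace (s / h - / u) with ((u - r) / (u * r)) by (unfold r; field; repeat split; auto; lra).
unfold Rdiv. rewrite Rabs_mult, Rabs_minus_sym.
assert (ur : u * u / 4 < u * r) by nra.
rewrite (Rabs_right (/ (u * r))) by (apply Rle_ge, Rlt_le, Rinv_0_lt_compat; nra).
apply (Rmult_lt_reg_r (u * r)); [nra|].
rewrite Rmult_assoc, Rinv_l, Rmult_1_r by nra.
eapply Rlt_trans; [exact b2|]. apply Rmult_lt_compat_l; auto.
Qed.

(** The profile is 1 / U composed with the inverse g of T; from g' = 1 / U the linear equation of U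
    becomes the cubic equation of a. *)
Lemma profile_exists (lam mu u0 t0 : R) (xm e1 : Rbar) :
  mu <> 0 ->
  (forall x : R, 0 < x -> Rbar_lt x xm -> 0 < Um u0 lam mu x /\ Rbar_lt (Tm t0 u0 lam mu x) e1) ->
  (forall t : R, Rbar_lt t e1 -> exists x : R, 0 < x /\ Rbar_lt x xm /\ t < Tm t0 u0 lam mu x) ->
  exists a, profile lam mu a t0 e1 /\
    forall x : R, 0 < x -> Rbar_lt x xm -> a (Tm t0 u0 lam mu x) = / Um u0 lam mu x.
Proof.
intros mu0 HU HT.
set (T := Tm t0 u0 lam mu) in *. set (U := Um u0 lam mu) in *.
assert (lt_tr : forall x y : R, x <= y -> Rbar_lt y xm -> Rbar_lt x xm).
{ intros x y xy yr. eapply Rbar_le_lt_trans; [|exact yr]. exact xy. }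
assert (Tinc : forall x y : R, 0 <= x -> x < y -> Rbar_lt y xm -> T x < T y).
{ intros x y x0 xy yx. apply Tm_lt; auto. intros z Hz. apply HU; [lra|].
  apply (lt_tr z y); auto; lra. }
assert (T0 : T 0 = t0) by apply Tm_0.
(* The range conditions sit inside the existential so that choice yields a total inverse. *)
assert (ex : forall t : R, exists x : R, t0 < t -> Rbar_lt t e1 -> 0 < x /\ Rbar_lt x xm /\ T x = t).
{ intros t. destruct (Classical_Prop.classic (t0 < t /\ Rbar_lt t e1)) as [[H1 H2]|N].
  2:{ exists 0; intros; exfalso; apply N; auto. }
  destruct (HT t H2) as [y [y0 [yx Ty]]].
  destruct (Ranalysis5.IVT_interv (fun x => T x - t) 0 y) as [x [Hx1 Hx2]]; try lra.
  - intros x _. apply continuity_pt_minus; [|apply continuity_pt_const; intros ? ?; reflexivity].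
    apply continuity_pt_filterlim. apply (ex_derive_continuous T). eexists; apply dTm; auto.
  - exists x. intros _ _. assert (x0 : x <> 0) by (intros ->; lra).
    split; [lra|]. split; [apply (lt_tr x y); auto; lra|lra]. }
pose (g t := proj1_sig (ClassicalEpsilon.constructive_indefinite_description _ (ex t))).
assert (Hg : forall t : R, t0 < t -> Rbar_lt t e1 -> 0 < g t /\ Rbar_lt (g t) xm /\ T (g t) = t).
{ intros t. unfold g. destruct ClassicalEpsilon.constructive_indefinite_description; simpl; auto. }
assert (gT : forall x : R, 0 < x -> Rbar_lt x xm -> g (T x) = x).
{ intros x x0 xx. destruct (HU x x0 xx) as [_ te].
  assert (tx : t0 < T x) by (rewrite <- T0; apply Tinc; auto; lra).
  destruct (Hg (T x) tx te) as [g0 [gx Tg]].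
  destruct (Rtotal_order (g (T x)) x) as [h|[h|h]]; auto; exfalso.
  - assert (K := Tinc _ _ (Rlt_le _ _ g0) h xx). lra.
  - assert (K := Tinc _ _ (Rlt_le _ _ x0) h gx). lra. }
exists (fun t => / U (g t)). split.
- intros t H1 H2. destruct (Hg t H1 H2) as [g0 [gx Tg]].
  destruct (HU _ g0 gx) as [u0' _].
  split; [apply Rinv_0_lt_compat; auto|].
  assert (dx : exists d : R, 0 < d < g t /\ Rbar_lt (g t + d) xm).
  { destruct xm as [m| |]; simpl in gx.
    - exists (Rmin (g t / 2) ((m - g t) / 2)).
      assert (a1 := Rmin_l (g t / 2) ((m - g t) / 2)). assert (a2 := Rmin_r (g t / 2) ((m - g t) / 2)).
      split; [split; [apply Rmin_pos; lra|lra]|simpl; lra].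
    - exists (g t / 2); simpl; split; [lra|auto].
    - contradiction. }
  destruct dx as [d [Hd dm]].
  assert (dg : is_derive g t (/ U (g t))).
  { apply (inverse_derive T U g (g t) t d); auto; [lra| |].
    - intros y Hy. apply gT; [lra|]. apply (lt_tr y (g t + d)); auto; lra.
    - intros y Hy. split; [apply dTm; auto|]. apply HU; [lra|]. apply (lt_tr y (g t + d)); auto; lra. }
  assert (dU' : is_derive U (g t) (4 * mu * U (g t) - 2 * lam)) by (apply dUm; auto).
  assert (eg : ex_derive g t) by (eexists; eauto).
  assert (eU : ex_derive U (g t)) by (eexists; eauto).
  auto_derive; [repeat split; auto; lra|].
  replace (Derive (fun x : R => g x) t) with (/ U (g t)) by (symmetry; apply is_derive_unique; auto).
  replace (Derive (fun x : R => U x) (g t)) with (4 * mu * U (g t) - 2 * lam) by (symmetry; apply is_derive_unique; auto).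
  field. lra.
- intros x x0 xx. rewrite gT; auto.
Qed.

Lemma profile_limit_0 (lam mu u0 t0 : R) (xm : Rbar) (a : R -> R) :
  mu <> 0 -> Rbar_lt 0 xm ->
  (forall x : R, 0 < x -> Rbar_lt x xm -> 0 < Um u0 lam mu x) ->
  (forall x : R, 0 < x -> Rbar_lt x xm -> a (Tm t0 u0 lam mu x) = / Um u0 lam mu x) ->
  filterlim (fun t => / a t) (at_right t0) (locally u0).
Proof.
intros mu0 xm0 HU Ha.
set (T := Tm t0 u0 lam mu) in *. set (U := Um u0 lam mu) in *.
assert (T0 : T 0 = t0) by apply Tm_0. assert (U0 : U 0 = u0) by apply Um_0.
assert (lt_tr : forall x y : R, x <= y -> Rbar_lt y xm -> Rbar_lt x xm).
{ intros x y xy yr. eapply Rbar_le_lt_trans; [|exact yr]. exact xy. }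
assert (cU : continuous U 0).
{ apply (ex_derive_continuous U). eexists; apply dUm; auto. }
intros P HP. unfold filtermap, at_right, within.
rewrite <- U0 in HP. apply cU in HP. destruct HP as [d Hd].
assert (ed : exists x : R, 0 < x < d /\ Rbar_lt x xm).
{ assert (d0 := cond_pos d). destruct xm as [m| |]; simpl in xm0.
  - exists (Rmin (d / 2) (m / 2)).
    assert (a1 := Rmin_l (d / 2) (m / 2)). assert (a2 := Rmin_r (d / 2) (m / 2)).
    split; [split; [apply Rmin_pos; lra|lra]|simpl; lra].
  - exists (d / 2); simpl; split; [lra|auto].
  - contradiction. }
destruct ed as [x [Hx xx]].
assert (Tx : t0 < T x).
{ rewrite <- T0. apply Tm_lt; auto; [lra|]. intros z Hz; apply HU; [lra|apply (lt_tr z x); auto; lra]. }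
generalize (open_lt (T x) t0 Tx : locally t0 (fun t => t < T x)).
apply filter_imp. intros t tx t0t.
destruct (Ranalysis5.IVT_interv (fun x => T x - t) 0 x) as [y [Hy1 Hy2]]; try lra.
- intros y _. apply continuity_pt_minus; [|apply continuity_pt_const; intros ? ?; reflexivity].
  apply continuity_pt_filterlim. apply (ex_derive_continuous T). eexists; apply dTm; auto.
- assert (y0 : y <> 0) by (intros ->; lra).
  assert (e : t = T y) by lra. rewrite e, Ha; [|lra|apply (lt_tr y x); auto; lra].
  rewrite Rinv_inv. apply Hd. change (Rabs (y - 0) < d). apply Rabs_def1; lra.
Qed.

Lemma one_at_0_inv a : one_at_0 a -> filterlim (fun t => / a t) (at_right 0) (locally 1).
Proof.
intros H. apply (filterlim_comp _ _ _ a Rinv _ (locally 1)); auto.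
rewrite <- Rinv_1 at 2. apply (ex_derive_continuous Rinv). auto_derive; auto; lra.
Qed.

Lemma one_at_0_of_inv a : filterlim (fun t => / a t) (at_right 0) (locally 1) -> one_at_0 a.
Proof.
intros H. unfold one_at_0.
apply (filterlim_ext (fun t => / / a t)); [intros; apply Rinv_inv|].
apply (filterlim_comp _ _ _ (fun t => / a t) Rinv _ (locally 1)); auto.
rewrite <- Rinv_1 at 2. apply (ex_derive_continuous Rinv). auto_derive; auto; lra.
Qed.

Lemma blows_up_inv a (F : (R -> Prop) -> Prop) {FF : Filter F} :
  blows_up a F -> filterlim (fun t => / a t) F (locally 0).
Proof.
intros H. apply filterlim_locally. intros e. assert (e0 := cond_pos e).
assert (K : F (fun t => / e < a t)).
{ apply H. exists (/ e). intros x Hx. exact Hx. }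
revert K. apply filter_imp. intros t Ht.
assert (i0 := Rinv_0_lt_compat _ e0).
change (Rabs (/ a t - 0) < e). rewrite Rminus_0_r, Rabs_right.
- rewrite <- (Rinv_inv e). apply Rinv_lt_contravar; auto. apply Rmult_lt_0_compat; lra.
- apply Rle_ge, Rlt_le, Rinv_0_lt_compat. lra.
Qed.

Lemma blows_up_of_inv a (F : (R -> Prop) -> Prop) {FF : Filter F} :
  F (fun t => 0 < a t) -> filterlim (fun t => / a t) F (locally 0) -> blows_up a F.
Proof.
intros Hp H P [M HM].
assert (m0 : 0 < Rmax 1 M) by (eapply Rlt_le_trans; [apply Rlt_0_1|apply Rmax_l]).
assert (K := proj1 (filterlim_locally _ _) H (mkposreal _ (Rinv_0_lt_compat _ m0))).
generalize (filter_and _ _ Hp K). unfold filtermap. apply filter_imp. intros t [a0 Ht].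
apply HM. change (Rabs (/ a t - 0) < / Rmax 1 M) in Ht.
rewrite Rminus_0_r, Rabs_right in Ht by (apply Rle_ge, Rlt_le, Rinv_0_lt_compat; auto).
apply Rle_lt_trans with (Rmax 1 M); [apply Rmax_r|].
apply Rnot_le_lt. intros h. apply (Rlt_not_le _ _ Ht).
apply Rinv_le_contravar; auto.
Qed.

(** * Distance from the origin to the boundary of a disk *)

Lemma within_self {T : UniformSpace} (x : T) (D : T -> Prop) : within D (locally x) D.
Proof. unfold within. apply filter_forall; auto. Qed.

Lemma is_derive_RInt_open (f : R -> R) (a b x0 : R) : a < x0 < b ->
  (forall t, a < t < b -> continuous f t) ->
  forall t, a < t < b -> is_derive (fun t => RInt f x0 t) t (f t).
Proof.
intros Hx Hf t Ht.
apply (is_derive_RInt (V := R_NormedModule) f (fun t => RInt f x0 t) x0 t); auto.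
generalize (filter_and _ _ (open_gt a t (proj1 Ht)) (open_lt b t (proj2 Ht))).
apply filter_imp. intros x [x1 x2].
apply (RInt_correct (V := R_CompleteNormedModule)), (ex_RInt_continuous (V := R_CompleteNormedModule)).
intros z Hz. apply Hf. unfold Rmin, Rmax in Hz. destruct Rle_dec in Hz; lra.
Qed.

Lemma constant_deriv (f : R -> R) (a b : R) :
  (forall x, a < x < b -> is_derive f x 0) -> forall x y, a < x < b -> a < y < b -> f x = f y.
Proof.
intros Hf.
assert (K : forall x y, a < x -> y < b -> x <= y -> f x = f y).
{ intros x y ax yb xy. apply Rle_antisym.
  - apply (nondecreasing_deriv f (fun _ => 0)); auto; intros; [apply Hf; lra|lra].
  - assert (- f x <= - f y); [|lra].
    apply (nondecreasing_deriv (fun x => - f x) (fun _ => 0)); auto; intros; [|lra].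
    replace 0 with (- 0) by ring. apply (is_derive_opp (V := R_NormedModule) f). apply Hf; lra. }
intros x y Hx Hy. destruct (Rle_lt_dec x y); [apply K; lra|symmetry; apply K; lra].
Qed.

Lemma at_right_ex (P : R -> Prop) a b : a < b -> at_right a P -> exists x, a < x < b /\ P x.
Proof.
intros ab H.
assert (K : at_right a (fun x => (a < x /\ x < b) /\ P x)).
{ apply filter_and; auto. apply filter_and.
  - apply within_self.
  - apply filter_le_within. apply (open_lt b a ab). }
destruct (filter_ex (F := at_right a) _ K) as [x [Hx Px]]. exists x; auto.
Qed.

Lemma at_left_ex (P : R -> Prop) a b : a < b -> at_left b P -> exists x, a < x < b /\ P x.
Proof.
intros ab H.
assert (K : at_left b (fun x => (a < x /\ x < b) /\ P x)).
{ apply filter_and; auto. apply filter_and.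
  - apply filter_le_within. apply (open_gt a b ab).
  - apply within_self. }
destruct (filter_ex (F := at_left b) _ K) as [x [Hx Px]]. exists x; auto.
Qed.

(** A continuous nonvanishing derivative has one sign, and the order of the two limits makes it
    positive. *)
Lemma increasing_param (tau : R -> R) (e0 e1 : R) : e0 < e1 ->
  (forall x, 0 < x < 1 -> ex_derive tau x /\ ex_derive (Derive tau) x /\ Derive tau x <> 0) ->
  filterlim tau (at_right 0) (locally e0) -> filterlim tau (at_left 1) (locally e1) ->
  forall x, 0 < x < 1 -> 0 < Derive tau x /\ e0 < tau x < e1.
Proof.
intros ee Ht F0 F1.
assert (near0 : forall e b, 0 < e -> 0 < b -> exists x, 0 < x < b /\ Rabs (tau x - e0) < e).
{ intros e b e1' b0. apply at_right_ex; auto.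
  apply (proj1 (filterlim_locally tau e0) F0 (mkposreal e e1')). }
assert (near1 : forall e b, 0 < e -> b < 1 -> exists x, b < x < 1 /\ Rabs (tau x - e1) < e).
{ intros e b e1' b0. apply at_left_ex; auto.
  apply (proj1 (filterlim_locally tau e1) F1 (mkposreal e e1')). }
assert (pos : forall x, 0 < x < 1 -> 0 < Derive tau x).
{ intros x Hx. destruct (Rlt_le_dec 0 (Derive tau x)) as [h|h]; auto. exfalso.
  assert (neg : forall y, 0 < y < 1 -> Derive tau y < 0).
  { intros y Hy. apply Rnot_le_lt. intros hy.
    assert (x1 := proj2 (proj2 (Ht x Hx))). assert (y1 := proj2 (proj2 (Ht y Hy))).
    assert (C : forall z, 0 < z < 1 -> continuity_pt (Derive tau) z).
    { intros z Hz. apply continuity_pt_filterlim. apply (ex_derive_continuous (Derive tau)), Ht, Hz. }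
    destruct (Rtotal_order x y) as [xy|[xy|xy]].
    - destruct (Ranalysis5.IVT_interv (Derive tau) x y) as [z [Hz1 Hz2]]; try lra.
      + intros z Hz; apply C; lra.
      + apply (proj2 (proj2 (Ht z ltac:(lra)))); auto.
    - subst y. lra.
    - destruct (Ranalysis5.IVT_interv (fun z => - Derive tau z) y x) as [z [Hz1 Hz2]]; try lra.
      + intros z Hz; apply continuity_pt_opp, C; lra.
      + apply (proj2 (proj2 (Ht z ltac:(lra)))); lra. }
  assert (dec : forall y z, 0 < y -> y <= z -> z < 1 -> tau z <= tau y).
  { intros y z y0 yz z1. assert (- tau y <= - tau z); [|lra].
    apply (nondecreasing_deriv (fun w => - tau w) (fun w => - Derive tau w)); auto; intros w Hw.
    - apply (is_derive_opp (V := R_NormedModule) tau), Derive_correct, Ht; lra.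
    - assert (Derive tau w < 0) by (apply neg; lra). lra. }
  destruct (near0 ((e1 - e0) / 2) (1 / 2)) as [y [Hy1 Hy2]]; try lra.
  destruct (near1 ((e1 - e0) / 2) (1 / 2)) as [z [Hz1 Hz2]]; try lra.
  assert (K := dec y z). apply Rabs_def2 in Hy2. apply Rabs_def2 in Hz2.
  assert (tau z <= tau y) by (apply K; lra). lra. }
assert (inc : forall y z, 0 < y -> y < z -> z < 1 -> tau y < tau z).
{ intros y z y0 yz z1.
  apply (increasing_deriv tau (Derive tau)); auto; intros w Hw.
  - apply Derive_correct, Ht; lra.
  - apply pos; lra. }
intros x Hx. split; auto. split; apply Rnot_le_lt; intros h.
- assert (K := inc (x / 2) x). assert (k : tau (x / 2) < tau x) by (apply K; lra).
  destruct (near0 (e0 - tau (x / 2)) (x / 2)) as [y [Hy1 Hy2]]; try lra.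
  apply Rabs_def2 in Hy2. assert (tau y < tau (x / 2)) by (apply inc; lra). lra.
- assert (K := inc x ((x + 1) / 2)). assert (k : tau x < tau ((x + 1) / 2)) by (apply K; lra).
  destruct (near1 (tau ((x + 1) / 2) - e1) ((x + 1) / 2)) as [y [Hy1 Hy2]]; try lra.
  apply Rabs_def2 in Hy2. assert (tau ((x + 1) / 2) < tau y) by (apply inc; lra). lra.
Qed.

(** r is the geodesic radius of [G a]. The density a / sqrt t may be singular at both ends, so the
    improper integral is encoded by a primitive with prescribed limits. *)
Definition arclength (a : R -> R) (nu : R) (r : R -> R) : Prop :=
  (forall t, 0 < t < 1 / 4 -> is_derive r t (a t / sqrt t)) /\
  filterlim r (at_right 0) (locally 0) /\ filterlim r (at_left (1 / 4)) (locally nu).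

(** Smoothness up to the circle gives the axis segment a finite length [l 1], and a primitive of a /
    sqrt t along tau differs from its partial length by a constant. Conversely any curve to the
    circle crosses every annulus inside the open disk, where the radial part of [G a] bounds its
    length from below. *)
Lemma disk_dist a h : smooth_to_boundary disk h -> realizes h 1 0 (1 / 4) (G a) ->
  (forall t, 0 < t < 1 / 4 -> 0 < a t /\ continuous a t) ->
  exists nu r, set_dist closed_unit_disk h (0, 0) unit_circle = Finite nu /\ arclength a nu r.
Proof.
intros [R1 [R1_gt Rh]] [tau [Ht [F0 [F1 Hq]]]] Ha.
assert (Ht' : forall x, 0 < x < 1 -> ex_derive tau x /\ ex_derive (Derive tau) x /\ Derive tau x <> 0).
{ intros x [x0 x1]. destruct (Ht x x0 x1) as [H1 H2]. split; [apply (H1 1%nat)|split; auto].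
  apply (H1 2%nat). }
assert (e14 : 0 < 1 / 4) by lra.
assert (inc := increasing_param tau 0 (1 / 4) e14 Ht' F0 F1).
assert (Hh : forall i j p, rad p <= 1 -> continuous (h i j) p).
{ intros i j p Hp. apply (riemannian_continuous _ _ Rh). unfold disk. lra. }
pose (f t := a t / sqrt t).
assert (cf : forall t, 0 < t < 1 / 4 -> continuous f t).
{ intros t Ht1. destruct (Ha t Ht1) as [_ ca]. unfold f, Rdiv.
  apply (continuous_mult (K := R_AbsRing) a (fun t => / sqrt t)); auto.
  apply (ex_derive_continuous (fun t => / sqrt t)). auto_derive.
  split; [lra|split; auto]. apply Rgt_not_eq, sqrt_lt_R0; lra. }
assert (f_pos : forall t, 0 < t < 1 / 4 -> 0 < f t).
{ intros t Ht1. apply Rdiv_lt_0_compat; [apply Ha; auto|apply sqrt_lt_R0; lra]. }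
pose (r0 t := RInt f (1 / 8) t).
assert (dr0 : forall t, 0 < t < 1 / 4 -> is_derive r0 t (f t)).
{ apply (is_derive_RInt_open f 0 (1 / 4) (1 / 8)); auto; lra. }
pose (c := segment (0, 0) (1, 0)).
assert (cE : forall s, c s = (s, 0)).
{ intros s; unfold c, segment; simpl; f_equal; ring. }
assert (Hc : C1_curve closed_unit_disk c).
{ apply segment_C1. intros t Ht1. fold c. rewrite cE. unfold closed_unit_disk. rewrite rad_axis; lra. }
assert (hc : forall i j t, 0 <= t <= 1 -> continuous (h i j) (c t)).
{ intros i j t Ht1. apply Hh, Hc; auto. }
pose (l s := RInt (speed h c) 0 s).
assert (dl : forall s, is_derive l s (speed h c s)).
{ intros s. apply (is_derive_RInt (V := R_NormedModule) (speed h c) l 0 s).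
  - apply filter_forall. intros y. apply (RInt_correct (V := R_CompleteNormedModule)).
    apply (ex_RInt_speed closed_unit_disk); auto.
  - apply (speed_continuous closed_unit_disk); auto. }
assert (l00 : l 0 = 0) by apply (RInt_point (V := R_CompleteNormedModule) 0 (speed h c)).
assert (sp : forall s, 0 < s < 1 -> speed h c s = Derive tau s * f (tau s)).
{ intros s Hs. unfold speed. rewrite clamp_id by lra.
  unfold c. rewrite segment_velocity. fold c. rewrite cE. simpl fst; simpl snd.
  assert (ra : rad (s, 0) = s) by (apply rad_axis; lra).
  rewrite Hq; [|rewrite ra; lra|rewrite ra; simpl; lra].
  rewrite polar_pull, rP_G, rQ_G, ra.
  destruct (inc s Hs) as [d0 t0]. destruct (Ha _ t0) as [a0 _].
  assert (s0 := sqrt_lt_R0 _ (proj1 t0)).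
  rewrite <- (sqrt_Rsqr (Derive tau s * f (tau s))) by (apply Rmult_le_pos; [lra|left; auto]).
  f_equal. unfold f, Rsqr, dot, crs. simpl fst; simpl snd.
  transitivity (a (tau s) ^ 2 / (sqrt (tau s) ^ 2) * Derive tau s ^ 2).
  - rewrite pow2_sqrt by lra. field; lra.
  - field; lra. }
assert (k : exists k, forall s, 0 < s < 1 -> r0 (tau s) = l s + k).
{ exists (r0 (tau (1 / 2)) - l (1 / 2)). intros s Hs.
  assert (K := constant_deriv (fun s => r0 (tau s) - l s) 0 1).
  enough (r0 (tau s) - l s = r0 (tau (1 / 2)) - l (1 / 2)) by lra.
  apply K; try lra. intros x Hx. destruct (inc x Hx) as [d0 t0].
  replace 0 with (Derive tau x * f (tau x) - speed h c x) by (rewrite sp; auto; ring).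
  apply (is_derive_minus (V := R_NormedModule) (fun s => r0 (tau s)) l); auto.
  apply (is_derive_comp r0 tau); auto. apply Derive_correct, Ht', Hx. }
destruct k as [k Hk].
pose (r t := r0 t - k).
assert (dr : forall t, 0 < t < 1 / 4 -> is_derive r t (f t)).
{ intros t Ht1. replace (f t) with (f t - 0) by ring.
  apply (is_derive_minus (V := R_NormedModule) r0 (fun _ => k)); auto.
  apply (is_derive_const (V := R_NormedModule) k). }
assert (rt : forall s, 0 < s < 1 -> r (tau s) = l s) by (intros s Hs; unfold r; rewrite Hk; auto; ring).
assert (rinc : forall s t, 0 < s -> s < t -> t < 1 / 4 -> r s < r t).
{ intros s t s0 st t1. apply (increasing_deriv r f); auto; intros; [apply dr|apply f_pos]; lra. }
assert (linc : forall s t, s <= t -> l s <= l t).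
{ intros s t st. apply (nondecreasing_deriv l (speed h c)); auto. intros; apply speed_ge0. }
assert (lc : forall s, continuous l s) by (intros s; apply (ex_derive_continuous l); eexists; apply dl).
assert (near0 : forall e, 0 < e -> exists x, 0 < x < 1 /\ l x < e).
{ intros e e0. apply at_right_ex; [lra|].
  assert (K := proj1 (filterlim_locally l (l 0)) (lc 0) (mkposreal e e0)).
  apply (filter_le_within (F := locally 0)). revert K; apply filter_imp.
  intros x Hx. change (Rabs (l x - l 0) < e) in Hx. apply Rabs_def2 in Hx. lra. }
assert (near1 : forall e, 0 < e -> exists x, 0 < x < 1 /\ l 1 - e < l x).
{ intros e e0. apply at_left_ex; [lra|].
  assert (K := proj1 (filterlim_locally l (l 1)) (lc 1) (mkposreal e e0)).
  apply (filter_le_within (F := locally 1)). revert K; apply filter_imp.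
  intros x Hx. change (Rabs (l x - l 1) < e) in Hx. apply Rabs_def2 in Hx. lra. }
exists (l 1), r. split; [|split; [exact dr|split]].
- apply is_glb_Rbar_unique. split.
  + intros x [d [Hd [d0 [d1 ->]]]]. simpl. apply Rnot_lt_le. intros hlt.
    rewrite curve_length_speed in hlt.
    set (len := RInt (speed h d) 0 1) in *.
    assert (e0 : 0 < (l 1 - len) / 2) by lra.
    destruct (near0 _ e0) as [al [Hal1 Hal2]]. destruct (near1 _ e0) as [be' [Hbe1 Hbe2]].
    (* be has to exceed al as well as be', hence the midpoint of al and 1. *)
    pose (be := Rmax be' ((al + 1) / 2)).
    assert (Hb : al < be < 1 /\ be' <= be).
    { unfold be. split; [split|apply Rmax_l].
      - eapply Rlt_le_trans; [|apply Rmax_r]. lra.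
      - apply Rmax_lub_lt; lra. }
    assert (hd : forall i j t, 0 <= t <= 1 -> continuous (h i j) (d t)) by (intros; apply Hh, Hd; auto).
    assert (X := length_crossing closed_unit_disk h d Hd hd (fun s => r (tau s))
      (fun s => Derive tau s * f (tau s)) al be (proj1 Hal1) (proj1 (proj1 Hb))).
    assert (X' : Rabs (r (tau be) - r (tau al)) <= RInt (speed h d) 0 1).
    { apply X; try lra.
      - intros y Hy. destruct (inc y ltac:(lra)) as [_ ty].
        apply (is_derive_comp r tau); auto. apply Derive_correct, Ht'. lra.
      - intros p v _ Hp. destruct (inc (rad p) ltac:(lra)) as [_ tp].
        rewrite Hq; [|lra|simpl; lra]. rewrite polar_pull, rP_G, rQ_G.
        assert (s0 := sqrt_lt_R0 _ (proj1 tp)).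
        unfold f. replace ((Derive tau (rad p) * (a (tau (rad p)) / sqrt (tau (rad p))) * (dot p v / rad p)) ^ 2)
          with (a (tau (rad p)) ^ 2 / (sqrt (tau (rad p)) ^ 2) * Derive tau (rad p) ^ 2 * (dot p v / rad p) ^ 2)
          by (field; lra).
        rewrite pow2_sqrt by lra.
        assert (q0 := pow2_ge_0 (crs p v / rad p ^ 2)). nra.
      - left. rewrite d0. split.
        + rewrite rad_axis; lra.
        + rewrite d1. lra. }
    rewrite !rt in X' by lra. fold len in X'.
    assert (Y := Rle_abs (l be - l al)). assert (Z := linc be' be (proj2 Hb)). lra.
  + intros b Hb. apply Hb. exists c. split; [exact Hc|].
    split; [rewrite cE; reflexivity|]. split.
    * rewrite cE. unfold unit_circle. rewrite rad_axis; lra.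
    * rewrite curve_length_speed. reflexivity.
- apply filterlim_locally. intros e. destruct (near0 e (cond_pos e)) as [s [Hs1 Hs2]].
  destruct (inc s Hs1) as [_ ts].
  apply filter_imp with (fun t => 0 < t /\ t < tau s).
  + intros t [t0 tls]. change (Rabs (r t - 0) < e). rewrite Rminus_0_r.
    assert (rs := rinc t (tau s) t0 tls (proj2 ts)). rewrite rt in rs by auto.
    assert (K : exists x, 0 < x < 1 /\ Rabs (tau x - 0) < t).
    { apply at_right_ex; [lra|]. apply (proj1 (filterlim_locally tau 0) F0 (mkposreal t t0)). }
    destruct K as [x [Hx1 Hx2]]. apply Rabs_def2 in Hx2. destruct (inc x Hx1) as [_ tx].
    assert (rx : r (tau x) < r t) by (apply rinc; lra). rewrite rt in rx by auto.
    assert (l 0 <= l x) by (apply linc; lra). apply Rabs_def1; lra.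
  + apply filter_and; [apply within_self|apply filter_le_within; apply (open_lt (tau s) 0 (proj1 ts))].
- apply filterlim_locally. intros e. destruct (near1 e (cond_pos e)) as [s [Hs1 Hs2]].
  destruct (inc s Hs1) as [_ ts].
  apply filter_imp with (fun t => tau s < t /\ t < 1 / 4).
  + intros t [tls t1]. change (Rabs (r t - l 1) < e).
    assert (rs := rinc (tau s) t (proj1 ts) tls t1). rewrite rt in rs by auto.
    assert (e1 : 0 < 1 / 4 - t) by lra.
    assert (K : exists x, 0 < x < 1 /\ Rabs (tau x - 1 / 4) < 1 / 4 - t).
    { apply at_left_ex; [lra|]. apply (proj1 (filterlim_locally tau (1 / 4)) F1 (mkposreal _ e1)). }
    destruct K as [x [Hx1 Hx2]]. apply Rabs_def2 in Hx2. destruct (inc x Hx1) as [_ tx].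
    assert (rx : r t < r (tau x)) by (apply rinc; lra). rewrite rt in rx by auto.
    assert (l x <= l 1) by (apply linc; lra). apply Rabs_def1; lra.
  + apply filter_and; [apply filter_le_within; apply (open_gt (tau s) (1 / 4) (proj2 ts))|apply within_self].
Qed.

(** For u = 1 / a the profile equation reads u' = - 2 lam (1 - gm u) / u; this is the primitive that
    appears on separating variables. *)
Definition Gi (gm v : R) : R := RInt (fun s => s / (1 - gm * s)) 0 v.

Lemma dGi gm v : 0 < 1 - gm * v -> is_derive (Gi gm) v (v / (1 - gm * v)).
Proof.
intros Hv.
assert (C : forall s, 0 < 1 - gm * s -> continuous (fun s => s / (1 - gm * s)) s).
{ intros s Hs. apply (ex_derive_continuous (fun s => s / (1 - gm * s))). auto_derive. lra. }
apply (is_derive_RInt (V := R_NormedModule) (fun s => s / (1 - gm * s)) (Gi gm) 0 v); auto.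
assert (L : locally v (fun x => 0 < 1 - gm * x)).
{ assert (c : continuous (fun x => 1 - gm * x) v) by (apply (ex_derive_continuous (fun x => 1 - gm * x)); auto_derive; auto).
  apply c. apply (open_gt 0 _ Hv). }
revert L; apply filter_imp. intros x Hx.
apply (RInt_correct (V := R_CompleteNormedModule)), (ex_RInt_continuous (V := R_CompleteNormedModule)).
intros z Hz. apply C. unfold Rmin, Rmax in Hz. destruct Rle_dec in Hz; destruct (Rle_dec 0 gm); nra.
Qed.

Lemma Gi_0 gm : Gi gm 0 = 0.
Proof. apply (RInt_point (V := R_CompleteNormedModule) 0). Qed.

Lemma one_minus_pos gm v : gm < 1 -> 0 <= v <= 1 -> 0 < 1 - gm * v.
Proof. intros H1 H2. destruct (Rle_dec 0 gm); nra. Qed.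

Lemma Gi_increasing gm x y : 0 <= x -> x < y -> 0 < 1 - gm * y -> Gi gm x < Gi gm y.
Proof.
intros x0 xy Hy.
assert (K : forall s, x <= s <= y -> 0 < 1 - gm * s) by (intros s Hs; destruct (Rle_dec 0 gm); nra).
apply (increasing_deriv (Gi gm) (fun s => s / (1 - gm * s))); auto.
- intros s Hs; apply dGi, K; lra.
- intros s Hs; apply Rdiv_lt_0_compat; [lra|apply K; lra].
Qed.

Lemma Gi_inj gm x y : 0 <= x -> 0 <= y -> 0 < 1 - gm * x -> 0 < 1 - gm * y ->
  Gi gm x = Gi gm y -> x = y.
Proof.
intros x0 y0 Hx Hy e. destruct (Rtotal_order x y) as [h|[h|h]]; auto; exfalso.
- assert (K := Gi_increasing gm x y x0 h Hy). lra.
- assert (K := Gi_increasing gm y x y0 h Hx). lra.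
Qed.

(** This ratio is the quotient of the integrands of [Gi gm'] and [Gi gm]. It increases with s, so on
    either side of a point it is bounded by its value there; the comparisons of integrals that
    follow rest on this. *)
Lemma ratio_lt gm gm' s v : gm < gm' -> gm' < 1 -> 0 <= s -> s < v -> v <= 1 ->
  (1 - gm * s) / (1 - gm' * s) < (1 - gm * v) / (1 - gm' * v).
Proof.
intros H1 H2 s0 sv v1.
assert (a := one_minus_pos gm' s H2 ltac:(lra)). assert (b := one_minus_pos gm' v H2 ltac:(lra)).
apply Rlt_div_l; auto.
replace ((1 - gm * v) / (1 - gm' * v) * (1 - gm' * s)) with ((1 - gm * v) * (1 - gm' * s) / (1 - gm' * v)) by (field; lra).
apply Rlt_div_r; auto. nra.
Qed.

Lemma weight_eq gm gm' s : gm < 1 -> gm' < 1 -> 0 <= s <= 1 ->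
  s / (1 - gm' * s) = (1 - gm * s) / (1 - gm' * s) * (s / (1 - gm * s)).
Proof.
intros H1 H2 Hs.
assert (a := one_minus_pos gm s H1 Hs). assert (b := one_minus_pos gm' s H2 Hs).
field; lra.
Qed.

Lemma Gi_compare_below gm gm' v : gm < gm' -> gm' < 1 -> 0 < v <= 1 ->
  Gi gm' v < (1 - gm * v) / (1 - gm' * v) * Gi gm v.
Proof.
intros H1 H2 Hv. set (w := (1 - gm * v) / (1 - gm' * v)).
assert (K : w * Gi gm 0 - Gi gm' 0 < w * Gi gm v - Gi gm' v).
{ apply (increasing_deriv (fun s => w * Gi gm s - Gi gm' s)
    (fun s => w * (s / (1 - gm * s)) - s / (1 - gm' * s))); [lra| |].
  - intros s Hs. apply (is_derive_minus (V := R_NormedModule) (fun s => w * Gi gm s) (Gi gm')).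
    + apply (is_derive_scal (Gi gm)), dGi, one_minus_pos; lra.
    + apply dGi, one_minus_pos; lra.
  - intros s Hs. rewrite (weight_eq gm gm' s) by lra.
    assert (r := ratio_lt gm gm' s v H1 H2 ltac:(lra) ltac:(lra) ltac:(lra)). fold w in r.
    assert (p : 0 < s / (1 - gm * s)) by (apply Rdiv_lt_0_compat; [lra|apply one_minus_pos; lra]).
    nra. }
rewrite !Gi_0 in K. lra.
Qed.

Lemma Gi_compare_above gm gm' v : gm < gm' -> gm' < 1 -> 0 <= v < 1 ->
  (1 - gm * v) / (1 - gm' * v) * (Gi gm 1 - Gi gm v) < Gi gm' 1 - Gi gm' v.
Proof.
intros H1 H2 Hv. set (w := (1 - gm * v) / (1 - gm' * v)).
assert (K : Gi gm' v - w * Gi gm v < Gi gm' 1 - w * Gi gm 1).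
{ apply (increasing_deriv (fun s => Gi gm' s - w * Gi gm s)
    (fun s => s / (1 - gm' * s) - w * (s / (1 - gm * s)))); [lra| |].
  - intros s Hs. apply (is_derive_minus (V := R_NormedModule) (Gi gm') (fun s => w * Gi gm s)).
    + apply dGi, one_minus_pos; lra.
    + apply (is_derive_scal (Gi gm)), dGi, one_minus_pos; lra.
  - intros s Hs. rewrite (weight_eq gm gm' s) by lra.
    assert (r := ratio_lt gm gm' v s H1 H2 ltac:(lra) ltac:(lra) ltac:(lra)). fold w in r.
    assert (p : 0 < s / (1 - gm * s)) by (apply Rdiv_lt_0_compat; [lra|apply one_minus_pos; lra]).
    nra. }
lra.
Qed.

Lemma Gi_compare_top gm gm' v : gm < gm' -> gm' < 1 -> 0 <= v < 1 ->
  Gi gm' 1 - Gi gm' v <= (1 - gm) / (1 - gm') * (Gi gm 1 - Gi gm v).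
Proof.
intros H1 H2 Hv. set (w := (1 - gm) / (1 - gm')).
assert (K : w * Gi gm v - Gi gm' v <= w * Gi gm 1 - Gi gm' 1).
{ apply (nondecreasing_deriv (fun s => w * Gi gm s - Gi gm' s)
    (fun s => w * (s / (1 - gm * s)) - s / (1 - gm' * s))); [lra| |].
  - intros s Hs. apply (is_derive_minus (V := R_NormedModule) (fun s => w * Gi gm s) (Gi gm')).
    + apply (is_derive_scal (Gi gm)), dGi, one_minus_pos; lra.
    + apply dGi, one_minus_pos; lra.
  - intros s Hs. rewrite (weight_eq gm gm' s) by lra.
    assert (r := ratio_lt gm gm' s 1 H1 H2 ltac:(lra) ltac:(lra) ltac:(lra)).
    rewrite !Rmult_1_r in r. fold w in r.
    assert (p : 0 < s / (1 - gm * s)) by (apply Rdiv_lt_0_compat; [lra|apply one_minus_pos; lra]).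
    nra. }
lra.
Qed.

(* [gm] is the ratio [2 mu / lam]; then [lam = 2 Gi gm 1], and [gm = 0] is the round hemisphere. *)
Record dprof (gm : R) (a : R -> R) : Prop := {
  dp_gm : gm < 1;
  dp_pos : forall t, 0 < t < 1 / 4 -> 0 < a t;
  dp_lt : forall t, 0 < t < 1 / 4 -> / a t < 1;
  dp_G : forall t, 0 < t < 1 / 4 -> Gi gm (/ a t) = Gi gm 1 * (1 - 4 * t);
  dp_derive : forall t, 0 < t < 1 / 4 ->
    is_derive (fun t => / a t) t (4 * Gi gm 1 * (gm - a t));
  dp_0 : filterlim (fun t => / a t) (at_right 0) (locally 1);
  dp_1 : filterlim (fun t => / a t) (at_left (1 / 4)) (locally 0)
}.

Lemma Gi_1_pos gm : gm < 1 -> 0 < Gi gm 1.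
Proof. intros H. rewrite <- (Gi_0 gm). apply Gi_increasing; lra. Qed.

(** The weight at v bounds the integral below v from above and the integral beyond v from below, so
    Gi gm' v / Gi gm' 1 < Gi gm v / Gi gm 1. These quotients are the height 1 - 4 t at slope v, so v
    = 1 / a' cannot be at most 1 / a at the same t. *)
Lemma dprof_compare gm gm' a a' t : gm < gm' -> dprof gm a -> dprof gm' a' -> 0 < t < 1 / 4 ->
  a' t < a t.
Proof.
intros Hg D D' Ht.
assert (p := dp_pos _ _ D t Ht). assert (p' := dp_pos _ _ D' t Ht).
assert (i := Rinv_0_lt_compat _ p). assert (i' := Rinv_0_lt_compat _ p').
assert (q := dp_lt _ _ D t Ht). assert (q' := dp_lt _ _ D' t Ht).
assert (e := dp_G _ _ D t Ht). assert (e' := dp_G _ _ D' t Ht).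
assert (g1 := dp_gm _ _ D'). assert (g0 := dp_gm _ _ D).
apply Rnot_le_lt; intros h. apply Rinv_le_contravar in h; auto.
set (u := / a t) in *. set (v := / a' t) in *.
assert (m : Gi gm v <= Gi gm u).
{ destruct h as [h|h]; [left; apply Gi_increasing; try lra; apply one_minus_pos; lra|rewrite h; lra]. }
assert (k1 := Gi_compare_below gm gm' v Hg g1 ltac:(lra)).
assert (k2 := Gi_compare_above gm gm' v Hg g1 ltac:(lra)).
set (w := (1 - gm * v) / (1 - gm' * v)) in *.
assert (v0 : 0 < Gi gm v) by (rewrite <- (Gi_0 gm); apply Gi_increasing; try lra; apply one_minus_pos; lra).
assert (d0 : Gi gm v < Gi gm 1) by (apply Gi_increasing; lra).
assert (G1 := Gi_1_pos gm g0). assert (G1' := Gi_1_pos gm' g1).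
(* Multiplying the two estimates crosswise eliminates w. *)
assert (A : Gi gm v * (w * (Gi gm 1 - Gi gm v)) < Gi gm v * (Gi gm' 1 - Gi gm' v)) by (apply Rmult_lt_compat_l; lra).
assert (B : Gi gm' v * (Gi gm 1 - Gi gm v) < w * Gi gm v * (Gi gm 1 - Gi gm v)) by (apply Rmult_lt_compat_r; lra).
assert (C : Gi gm' v * Gi gm 1 < Gi gm v * Gi gm' 1) by lra.
rewrite e' in C. rewrite e in m.
assert (m' : Gi gm v * Gi gm' 1 <= Gi gm 1 * (1 - 4 * t) * Gi gm' 1) by (apply Rmult_le_compat_r; lra).
lra.
Qed.

(** Radial distances are known at the ends only as limits. For the strict inequality, two interior
    points separate the limits by a fixed amount. *)
Lemma limits_increasing (f f1 : R -> R) a b l0 l1 : a < b ->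
  (forall t, a < t < b -> is_derive f t (f1 t)) ->
  filterlim f (at_right a) (locally l0) -> filterlim f (at_left b) (locally l1) ->
  ((forall t, a < t < b -> 0 <= f1 t) -> l0 <= l1) /\
  ((forall t, a < t < b -> 0 < f1 t) -> l0 < l1).
Proof.
intros ab Hf F0 F1.
assert (K : (forall t, a < t < b -> 0 <= f1 t) -> forall x, a < x < b -> l0 <= f x <= l1).
{ intros Hp. assert (m : forall x y, a < x -> x <= y -> y < b -> f x <= f y).
  { intros x y ax xy yb. apply (nondecreasing_deriv f f1); auto; intros; [apply Hf|apply Hp]; lra. }
  intros x Hx. split; apply Rnot_lt_le; intros h.
  - destruct (at_right_ex (fun y => Rabs (f y - l0) < l0 - f x) a x) as [y [Hy1 Hy2]]; [lra| |].
    + assert (e0 : 0 < l0 - f x) by lra. apply (proj1 (filterlim_locally f l0) F0 (mkposreal _ e0)).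
    + apply Rabs_def2 in Hy2. assert (f y <= f x) by (apply m; lra). lra.
  - destruct (at_left_ex (fun y => Rabs (f y - l1) < f x - l1) x b) as [y [Hy1 Hy2]]; [lra| |].
    + assert (e0 : 0 < f x - l1) by lra. apply (proj1 (filterlim_locally f l1) F1 (mkposreal _ e0)).
    + apply Rabs_def2 in Hy2. assert (f x <= f y) by (apply m; lra). lra. }
split; intros Hp.
- assert (k := K Hp ((a + b) / 2) ltac:(lra)). lra.
- assert (Hp' : forall t, a < t < b -> 0 <= f1 t) by (intros; left; auto).
  assert (k := K Hp' ((2 * a + b) / 3) ltac:(lra)). assert (k' := K Hp' ((a + 2 * b) / 3) ltac:(lra)).
  assert (f ((2 * a + b) / 3) < f ((a + 2 * b) / 3)); [|lra].
  apply (increasing_deriv f f1); [lra| |]; intros; [apply Hf|apply Hp]; lra.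
Qed.

Lemma filterlim_sub (F : (R -> Prop) -> Prop) (FF : Filter F) (f g : R -> R) (l l' : R) :
  filterlim f F (locally l) -> filterlim g F (locally l') ->
  filterlim (fun t => f t - g t) F (locally (l - l')).
Proof.
intros L L'.
apply (filterlim_comp_2 (G := locally l) (H := locally (- l')) f (fun t => - g t) Rplus); auto.
- apply (filterlim_comp _ _ _ g Ropp F (locally l')); auto.
  apply (filterlim_opp (V := R_NormedModule) l').
- apply (filterlim_plus (V := R_NormedModule) l (- l')).
Qed.

Lemma filterlim_cont (F : (R -> Prop) -> Prop) (FF : Filter F) (f phi : R -> R) (l : R) :
  filterlim f F (locally l) -> continuous phi l -> filterlim (fun t => phi (f t)) F (locally (phi l)).
Proof. intros L C. apply (filterlim_comp _ _ _ f phi F (locally l)); auto. Qed.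

Lemma filterlim_at_right_of_continuous (f : R -> R) x : continuous f x -> filterlim f (at_right x) (locally (f x)).
Proof. intros C. apply (filterlim_filter_le_1 (F := locally x) (G := at_right x)); auto. apply filter_le_within. Qed.

Lemma filterlim_at_left_of_continuous (f : R -> R) x : continuous f x -> filterlim f (at_left x) (locally (f x)).
Proof. intros C. apply (filterlim_filter_le_1 (F := locally x) (G := at_left x)); auto. apply filter_le_within. Qed.

Lemma arclength_lt a a' nu nu' r r' : arclength a nu r -> arclength a' nu' r' ->
  (forall t, 0 < t < 1 / 4 -> a' t < a t) -> nu' < nu.
Proof.
intros [H1 [H2 H3]] [K1 [K2 K3]] Ha.
assert (C := limits_increasing (fun t => r t - r' t) (fun t => a t / sqrt t - a' t / sqrt t) 0 (1 / 4) (0 - 0) (nu - nu')).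
enough (0 - 0 < nu - nu') by lra.
apply C; [lra| |apply filterlim_sub; auto; apply within_filter, locally_filter|apply filterlim_sub; auto; apply within_filter, locally_filter|].
- intros t Ht. apply (is_derive_minus (V := R_NormedModule) r r'); auto.
- intros t Ht. assert (s0 := sqrt_lt_R0 _ (proj1 Ht)). specialize (Ha t Ht).
  replace (a t / sqrt t - a' t / sqrt t) with ((a t - a' t) / sqrt t) by (field; lra).
  apply Rdiv_lt_0_compat; lra.
Qed.

(** * The flat disk and the hemisphere as comparison models *)

Lemma sqrt_4t_unit t : 0 < t < 1 / 4 -> 0 < sqrt (1 - 4 * t).
Proof. intros Ht. apply sqrt_lt_R0. lra. Qed.

Lemma arclength_one : arclength (fun _ => 1) 1 (fun t => 2 * sqrt t).
Proof.
assert (C : forall t, continuous (fun t => 2 * sqrt t) t).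
{ intros t. apply (continuous_scal_r (V := R_NormedModule) 2 sqrt), continuous_sqrt. }
split; [|split].
- intros t Ht. assert (s0 := sqrt_lt_R0 _ (proj1 Ht)). auto_derive; [lra|]. field. lra.
- assert (E : 2 * sqrt 0 = 0) by (rewrite sqrt_0; ring).
  assert (K := filterlim_at_right_of_continuous _ 0 (C 0)). cbv beta in K. rewrite E in K. exact K.
- assert (E : 2 * sqrt (1 / 4) = 1).
  { replace (1 / 4) with ((1 / 2) ^ 2) by field. rewrite sqrt_pow2; lra. }
  assert (K := filterlim_at_left_of_continuous (fun t => 2 * sqrt t) (1 / 4) (C _)).
  cbv beta in K. rewrite E in K. exact K.
Qed.

(** On the unit sphere 2 sqrt t = sin r. The half-angle formula tan (r / 2) = sin r / (1 + cos r) is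
    used because the expression is continuous across the equator t = 1 / 4, so the limit there is a
    value. *)
Lemma arclength_hemisphere : arclength (fun t => / sqrt (1 - 4 * t)) (PI / 2)
  (fun t => 2 * atan (2 * sqrt t / (1 + sqrt (1 - 4 * t)))).
Proof.
assert (C : forall t, continuous (fun t => 2 * atan (2 * sqrt t / (1 + sqrt (1 - 4 * t)))) t).
{ intros t. assert (w0 := sqrt_pos (1 - 4 * t)).
  apply (continuous_scal_r (V := R_NormedModule) 2 (fun t => atan (2 * sqrt t / (1 + sqrt (1 - 4 * t))))).
  apply (continuous_comp (fun t => 2 * sqrt t / (1 + sqrt (1 - 4 * t))) atan).
  - apply (continuous_mult (K := R_AbsRing) (fun t => 2 * sqrt t) (fun t => / (1 + sqrt (1 - 4 * t)))).
    + apply (continuous_scal_r (V := R_NormedModule) 2 sqrt), continuous_sqrt.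
    + apply (continuous_comp (fun t => 1 + sqrt (1 - 4 * t)) Rinv).
      * apply (continuous_plus (V := R_NormedModule) (fun _ => 1)); [apply continuous_const|].
        apply (continuous_comp (fun t => 1 - 4 * t) sqrt); [|apply continuous_sqrt].
        apply (ex_derive_continuous (fun t => 1 - 4 * t)). auto_derive; auto.
      * apply (ex_derive_continuous Rinv). auto_derive; auto; lra.
  - apply (ex_derive_continuous atan). eexists; apply is_derive_atan. }
split; [|split].
- intros t Ht. assert (s0 := sqrt_lt_R0 _ (proj1 Ht)). assert (w0 := sqrt_4t_unit t Ht).
  assert (ss : sqrt t * sqrt t = t) by (apply sqrt_sqrt; lra).
  assert (ww : sqrt (1 - 4 * t) * sqrt (1 - 4 * t) = 1 - 4 * t) by (apply sqrt_sqrt; lra).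
  set (z := 2 * sqrt t / (1 + sqrt (1 - 4 * t))).
  assert (d : is_derive (fun t => 2 * sqrt t / (1 + sqrt (1 - 4 * t))) t
     (/ (sqrt t * sqrt (1 - 4 * t) * (1 + sqrt (1 - 4 * t))))).
  { auto_derive; replace (1 + - (4 * t)) with (1 - 4 * t) by ring; [repeat split; auto; lra|].
    apply (Rmult_eq_reg_r (sqrt t * sqrt (1 - 4 * t) * (1 + sqrt (1 - 4 * t)) ^ 2)); [|nz].
    transitivity (sqrt (1 - 4 * t) * (1 + sqrt (1 - 4 * t)) + 4 * (sqrt t * sqrt t)); [field; repeat split; lra|].
    rewrite ss. transitivity (1 + sqrt (1 - 4 * t)); [nra|field; repeat split; lra]. }
  replace (/ sqrt (1 - 4 * t) / sqrt t) with
    (2 * (/ (sqrt t * sqrt (1 - 4 * t) * (1 + sqrt (1 - 4 * t))) * / (1 + Rsqr z))).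
  + apply (is_derive_scal (fun t => atan (2 * sqrt t / (1 + sqrt (1 - 4 * t))))).
    apply (is_derive_comp atan (fun t => 2 * sqrt t / (1 + sqrt (1 - 4 * t)))); auto.
    unfold z. apply (is_derive_atan (2 * sqrt t / (1 + sqrt (1 - 4 * t)))).
  + assert (e : 1 + Rsqr z = 2 / (1 + sqrt (1 - 4 * t))).
    { unfold Rsqr, z. apply (Rmult_eq_reg_r ((1 + sqrt (1 - 4 * t)) ^ 2)); [|nz].
      transitivity ((1 + sqrt (1 - 4 * t)) ^ 2 + 4 * (sqrt t * sqrt t)); [field; lra|].
      rewrite ss. transitivity (2 * (1 + sqrt (1 - 4 * t))); [nra|field; lra]. }
    rewrite e. field. repeat split; lra.
- assert (K := filterlim_at_right_of_continuous _ 0 (C 0)). cbv beta in K.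
  rewrite sqrt_0 in K. unfold Rdiv in K. rewrite Rmult_0_r, Rmult_0_l, atan_0, Rmult_0_r in K. exact K.
- assert (E : 2 * atan (2 * sqrt (1 / 4) / (1 + sqrt (1 - 4 * (1 / 4)))) = PI / 2).
  { replace (1 - 4 * (1 / 4)) with 0 by field.
    replace (1 / 4) with ((1 / 2) ^ 2) by field. rewrite sqrt_pow2, sqrt_0 by lra.
    replace (2 * (1 / 2) / (1 + 0)) with 1 by field. rewrite atan_1. field. }
  assert (K := filterlim_at_left_of_continuous _ (1 / 4) (C _)). cbv beta in K. rewrite E in K. exact K.
Qed.

Lemma Gi_zero v : Gi 0 v = v ^ 2 / 2.
Proof.
unfold Gi. apply is_RInt_unique.
apply (is_RInt_ext (fun s => s)).
{ intros x _. change (x = x / (1 - 0 * x)). field. }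
replace (v ^ 2 / 2) with (minus (v ^ 2 / 2) (0 ^ 2 / 2)) by (unfold minus, plus, opp; simpl; field).
apply (is_RInt_derive (fun s => s ^ 2 / 2) (fun s => s)).
- intros. auto_derive; auto; field.
- intros. apply continuous_id.
Qed.

Lemma dprof_hemisphere : dprof 0 (fun t => / sqrt (1 - 4 * t)).
Proof.
assert (C : forall t, continuous (fun t => sqrt (1 - 4 * t)) t).
{ intros t. apply (continuous_comp (fun t => 1 - 4 * t) sqrt); [|apply continuous_sqrt].
  apply (ex_derive_continuous (fun t => 1 - 4 * t)). auto_derive; auto. }
split; [lra| | | | | |].
- intros t Ht. apply Rinv_0_lt_compat, sqrt_4t_unit; auto.
- intros t Ht. rewrite Rinv_inv. rewrite <- sqrt_1 at 2. apply sqrt_lt_1; lra.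
- intros t Ht. rewrite Rinv_inv, !Gi_zero, pow2_sqrt by lra. field.
- intros t Ht. assert (w0 := sqrt_4t_unit t Ht).
  apply (is_derive_ext (fun t => sqrt (1 - 4 * t))); [intros; symmetry; apply Rinv_inv|].
  rewrite Gi_zero. auto_derive; [lra|]. replace (1 + - (4 * t)) with (1 - 4 * t) by ring. field. lra.
- apply (filterlim_ext (fun t => sqrt (1 - 4 * t))); [intros; symmetry; apply Rinv_inv|].
  assert (E : sqrt (1 - 4 * 0) = 1) by (rewrite Rmult_0_r, Rminus_0_r; apply sqrt_1).
  assert (K := filterlim_at_right_of_continuous _ 0 (C 0)). cbv beta in K. rewrite E in K. exact K.
- apply (filterlim_ext (fun t => sqrt (1 - 4 * t))); [intros; symmetry; apply Rinv_inv|].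
  assert (E : sqrt (1 - 4 * (1 / 4)) = 0) by (replace (1 - 4 * (1 / 4)) with 0 by field; apply sqrt_0).
  assert (K := filterlim_at_left_of_continuous _ (1 / 4) (C _)). cbv beta in K. rewrite E in K. exact K.
Qed.

Lemma filterlim_at_right_intro {T : Type} (F : (T -> Prop) -> Prop) (FF : Filter F) (f : T -> R) (l : R) :
  filterlim f F (locally l) -> F (fun x => l < f x) -> filterlim f F (at_right l).
Proof.
intros H1 H2 P HP. apply H1 in HP. unfold filtermap in *.
generalize (filter_and _ _ H2 HP). apply filter_imp. intros x [x1 x2]; auto.
Qed.

Lemma filterlim_at_left_intro {T : Type} (F : (T -> Prop) -> Prop) (FF : Filter F) (f : T -> R) (l : R) :
  filterlim f F (locally l) -> F (fun x => f x < l) -> filterlim f F (at_left l).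
Proof.
intros H1 H2 P HP. apply H1 in HP. unfold filtermap in *.
generalize (filter_and _ _ H2 HP). apply filter_imp. intros x [x1 x2]; auto.
Qed.

Lemma at_right_between a b : a < b -> at_right a (fun x => a < x < b).
Proof.
intros ab. apply filter_and; [apply within_self|apply filter_le_within; apply (open_lt b a ab)].
Qed.

Lemma at_left_between a b : a < b -> at_left b (fun x => a < x < b).
Proof.
intros ab. apply filter_and; [apply filter_le_within; apply (open_gt a b ab)|apply within_self].
Qed.

Lemma dprof_nu_gt1 gm a nu r : dprof gm a -> arclength a nu r -> 1 < nu.
Proof.
intros D A. apply (arclength_lt a (fun _ => 1) nu 1 r _ A arclength_one).
intros t Ht. assert (p := dp_pos _ _ D t Ht). assert (q := dp_lt _ _ D t Ht).
apply (Rmult_lt_reg_l (/ a t)); [apply Rinv_0_lt_compat; auto|].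
rewrite Rinv_l, Rmult_1_r by lra. auto.
Qed.

Lemma dprof_nu_lt gm gm' a a' nu nu' r r' : gm < gm' -> dprof gm a -> dprof gm' a' ->
  arclength a nu r -> arclength a' nu' r' -> nu' < nu.
Proof.
intros Hg D D' A A'. apply (arclength_lt a a' nu nu' r r' A A').
intros t Ht. apply (dprof_compare gm gm'); auto.
Qed.

(** * The distance as an integral over the slope *)

Section ByHeightSlope.

Variables (gm : R) (a : R -> R) (nu : R) (r : R -> R).
Hypothesis D : dprof gm a.
Hypothesis A : arclength a nu r.

(** The height t as a function of the slope u = 1 / a, by inverting [dp_G]. Two profiles can then be
    compared at equal slope, where the densities of arclength are explicit. *)
Let tg u := (1 - Gi gm u / Gi gm 1) / 4.

Lemma tg_in u : 0 < u < 1 -> 0 < tg u < 1 / 4.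
Proof.
intros Hu. assert (g := dp_gm _ _ D). assert (G1 := Gi_1_pos gm g).
assert (p : 0 < Gi gm u < Gi gm 1).
{ split; [rewrite <- (Gi_0 gm)|]; apply Gi_increasing; try lra; apply one_minus_pos; lra. }
unfold tg. assert (q : 0 < Gi gm u / Gi gm 1) by (apply Rdiv_lt_0_compat; lra).
assert (q' : Gi gm u / Gi gm 1 < 1) by (apply Rlt_div_l; lra). lra.
Qed.

Lemma tg_inv u : 0 < u < 1 -> a (tg u) = / u.
Proof.
intros Hu. assert (g := dp_gm _ _ D). assert (G1 := Gi_1_pos gm g).
assert (Ht := tg_in u Hu).
assert (p := dp_pos _ _ D _ Ht). assert (q := dp_lt _ _ D _ Ht).
assert (i := Rinv_0_lt_compat _ p).
rewrite <- (Rinv_inv (a (tg u))). f_equal.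
apply (Gi_inj gm); try lra; try (apply one_minus_pos; lra).
rewrite (dp_G _ _ D _ Ht). unfold tg. field. lra.
Qed.

(** The density |dr / du| by the chain rule: |dt / du| = u / (4 Gi gm 1 (1 - gm u)), a = 1 / u, and
    2 Gi gm 1 sqrt t is the square root that appears here. *)
Definition slope_speed (gm u : R) : R :=
  / (2 * (1 - gm * u) * sqrt (Gi gm 1 * (Gi gm 1 - Gi gm u))).

Lemma d_r_tg u : 0 < u < 1 -> is_derive (fun u => r (tg u)) u (- slope_speed gm u).
Proof.
intros Hu. assert (g := dp_gm _ _ D). assert (G1 := Gi_1_pos gm g).
assert (Ht := tg_in u Hu). assert (o := one_minus_pos gm u g ltac:(lra)).
assert (dt : is_derive tg u (- (u / (1 - gm * u)) / (4 * Gi gm 1))).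
{ unfold tg. apply (is_derive_ext (fun u => / 4 + (- / (4 * Gi gm 1)) * Gi gm u)).
  { intros t. change (/ 4 + - / (4 * Gi gm 1) * Gi gm t = (1 - Gi gm t / Gi gm 1) / 4). field; lra. }
  replace (- (u / (1 - gm * u)) / (4 * Gi gm 1)) with (0 + (- / (4 * Gi gm 1)) * (u / (1 - gm * u))) by (field; split; lra).
  apply (is_derive_plus (V := R_NormedModule) (fun _ => / 4)); [apply (is_derive_const (V := R_NormedModule))|].
  apply (is_derive_scal (Gi gm)), dGi; auto. }
assert (e : sqrt (Gi gm 1 * (Gi gm 1 - Gi gm u)) = 2 * Gi gm 1 * sqrt (tg u)).
{ replace (Gi gm 1 * (Gi gm 1 - Gi gm u)) with ((2 * Gi gm 1) ^ 2 * tg u) by (unfold tg; field; lra).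
  rewrite sqrt_mult_alt by apply pow2_ge_0. rewrite sqrt_pow2 by lra. reflexivity. }
assert (s0 := sqrt_lt_R0 _ (proj1 Ht)).
replace (- slope_speed gm u) with (- (u / (1 - gm * u)) / (4 * Gi gm 1) * (a (tg u) / sqrt (tg u))).
- apply (is_derive_comp r tg); auto. apply A; auto.
- rewrite (tg_inv u Hu). unfold slope_speed. rewrite e. field. repeat split; lra.
Qed.

Lemma tg_cont u : 0 <= u <= 1 -> continuous tg u.
Proof.
intros Hu. assert (g := dp_gm _ _ D). assert (o := one_minus_pos gm u g Hu).
apply (continuous_comp (Gi gm) (fun y => (1 - y / Gi gm 1) / 4)).
- apply (ex_derive_continuous (Gi gm)). eexists; apply dGi; auto.
- apply (ex_derive_continuous (fun y => (1 - y / Gi gm 1) / 4)).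
  assert (G1 := Gi_1_pos gm g). auto_derive. lra.
Qed.

Lemma r_tg_1 : filterlim (fun u => r (tg u)) (at_left 1) (locally 0).
Proof.
apply (filterlim_comp _ _ _ tg r _ (at_right 0)); [|apply A].
apply filterlim_at_right_intro; [apply within_filter, locally_filter| |].
- assert (g := dp_gm _ _ D). assert (G1 := Gi_1_pos gm g).
  assert (K := filterlim_at_left_of_continuous tg 1 (tg_cont 1 ltac:(lra))).
  replace (tg 1) with 0 in K by (unfold tg; field; lra). exact K.
- generalize (at_left_between 0 1 Rlt_0_1). apply filter_imp. intros u Hu. apply tg_in; auto.
Qed.

Lemma r_tg_0 : filterlim (fun u => r (tg u)) (at_right 0) (locally nu).
Proof.
apply (filterlim_comp _ _ _ tg r _ (at_left (1 / 4))); [|apply A].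
apply filterlim_at_left_intro; [apply within_filter, locally_filter| |].
- assert (g := dp_gm _ _ D). assert (G1 := Gi_1_pos gm g).
  assert (K := filterlim_at_right_of_continuous tg 0 (tg_cont 0 ltac:(lra))).
  replace (tg 0) with (1 / 4) in K by (unfold tg; rewrite Gi_0; field; lra). exact K.
- generalize (at_right_between 0 1 Rlt_0_1). apply filter_imp. intros u Hu. apply tg_in; auto.
Qed.

(** Since sqrt t <= 1 / 2, arclength grows at least like 2 a dt, which is up to sign the
    differential of k ln (1 - gm / a); the bound s / (1 - gm s) <= 1 / (- gm) gives k >= 1 / 2. This
    sends nu to infinity as gm tends to minus infinity. *)
Lemma dprof_nu_lower : gm < 0 -> ln (1 - gm) / 2 <= nu.
Proof.
intros g0. assert (g := dp_gm _ _ D). assert (G1 := Gi_1_pos gm g).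
assert (ub : Gi gm 1 <= / - gm).
{ assert (K : Gi gm 1 - / - gm * 1 <= Gi gm 0 - / - gm * 0); [|rewrite Gi_0 in K; lra].
  assert (K : - (Gi gm 0 - / - gm * 0) <= - (Gi gm 1 - / - gm * 1)); [|lra].
  apply (nondecreasing_deriv (fun s => - (Gi gm s - / - gm * s)) (fun s => - (s / (1 - gm * s) - / - gm))); [lra| |].
  - intros s Hs. apply (is_derive_opp (V := R_NormedModule) (fun s => Gi gm s - / - gm * s)).
    apply (is_derive_minus (V := R_NormedModule) (Gi gm) (fun s => / - gm * s)).
    + apply dGi, one_minus_pos; lra.
    + auto_derive; auto; ring.
  - intros s Hs. assert (o := one_minus_pos gm s g ltac:(lra)).
    assert (e : - (s / (1 - gm * s) - / - gm) = / ((1 - gm * s) * - gm)) by (field; split; lra).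
    rewrite e. left; apply Rinv_0_lt_compat. nra. }
assert (lnp : 0 < ln (1 - gm)) by (rewrite <- ln_1; apply ln_increasing; lra).
set (k := / (2 * Gi gm 1 * - gm)).
assert (k2 : / 2 <= k).
{ unfold k. apply Rinv_le_contravar; [nra|].
  apply (Rmult_le_compat_r (2 * - gm)) in ub; [|lra].
  replace (/ - gm * (2 * - gm)) with 2 in ub by (field; lra). lra. }
assert (lim : forall F l, Filter F -> filterlim (fun t => / a t) F (locally l) -> 0 <= l <= 1 ->
   filterlim (fun t => k * ln (1 - gm * / a t)) F (locally (k * ln (1 - gm * l)))).
{ intros F l FF L Hl. apply (filterlim_cont F FF (fun t => / a t) (fun u => k * ln (1 - gm * u)) l L).
  apply (ex_derive_continuous (fun u => k * ln (1 - gm * u))).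
  assert (o := one_minus_pos gm l g Hl). auto_derive. lra. }
assert (C := limits_increasing (fun t => r t - - (k * ln (1 - gm * / a t)))
  (fun t => a t / sqrt t - - (k * ((- gm * (4 * Gi gm 1 * (gm - a t))) / (1 - gm * / a t))))
  0 (1 / 4) (0 - - (k * ln (1 - gm * 1))) (nu - - (k * ln (1 - gm * 0)))).
assert (K : 0 - - (k * ln (1 - gm * 1)) <= nu - - (k * ln (1 - gm * 0))).
{ apply C; [lra| | | |].
  - intros t Ht. apply (is_derive_minus (V := R_NormedModule) r (fun t => - (k * ln (1 - gm * / a t)))); [apply A; auto|].
    apply (is_derive_opp (V := R_NormedModule) (fun t => k * ln (1 - gm * / a t))).
    apply (is_derive_scal (fun t => ln (1 - gm * / a t))).
    assert (p := dp_pos _ _ D _ Ht). assert (q := dp_lt _ _ D _ Ht). assert (i := Rinv_0_lt_compat _ p).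
    assert (o := one_minus_pos gm (/ a t) g ltac:(lra)).
    replace (- gm * (4 * Gi gm 1 * (gm - a t)) / (1 - gm * / a t)) with
      (4 * Gi gm 1 * (gm - a t) * (- gm / (1 - gm * / a t))) by (field; split; nz).
    apply (is_derive_comp (fun u => ln (1 - gm * u)) (fun t => / a t)); [|apply D; auto].
    auto_derive; [lra|]. field. lra.
  - apply filterlim_sub; [apply within_filter, locally_filter|apply A|].
    apply (filterlim_comp _ _ _ _ Ropp _ (locally (k * ln (1 - gm * 1)))).
    + apply lim; [apply within_filter, locally_filter|apply D|lra].
    + apply (filterlim_opp (V := R_NormedModule)).
  - apply filterlim_sub; [apply within_filter, locally_filter|apply A|].
    apply (filterlim_comp _ _ _ _ Ropp _ (locally (k * ln (1 - gm * 0)))).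
    + apply lim; [apply within_filter, locally_filter|apply D|lra].
    + apply (filterlim_opp (V := R_NormedModule)).
  - intros t Ht. assert (p := dp_pos _ _ D _ Ht). assert (q := dp_lt _ _ D _ Ht). assert (i := Rinv_0_lt_compat _ p).
    assert (o := one_minus_pos gm (/ a t) g ltac:(lra)).
    assert (s0 := sqrt_lt_R0 _ (proj1 Ht)).
    assert (s1 : sqrt t <= / 2).
    { replace (/ 2) with (sqrt ((/ 2) ^ 2)) by (apply sqrt_pow2; lra). apply sqrt_le_1_alt. lra. }
    assert (e : k * (- gm * (4 * Gi gm 1 * (gm - a t)) / (1 - gm * / a t)) = - (2 * a t)).
    { unfold k. field. repeat split; lra. }
    rewrite e. assert (2 * a t <= a t / sqrt t); [|lra].
    assert (z : 0 <= a t * (/ 2 - sqrt t)) by (apply Rmult_le_pos; lra).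
    apply (proj1 (Rle_div_r (2 * a t) (a t) (sqrt t) s0)); lra. }
rewrite Rmult_1_r, Rmult_0_r, Rminus_0_r, ln_1 in K.
assert (ln (1 - gm) / 2 <= k * ln (1 - gm)) by nra. lra.
Qed.

End ByHeightSlope.

(** Each of Gi gm 1 and Gi gm 1 - Gi gm u changes by at most the factor w, the weight at s = 1, so
    the square root of their product does too; the remaining factor 1 - gm u moves in the favourable
    direction. *)
Lemma slope_speed_compare gm gm' u : gm < gm' -> gm' < 1 -> 0 < u < 1 ->
  slope_speed gm u <= (1 - gm) / (1 - gm') * slope_speed gm' u.
Proof.
intros H1 H2 Hu. set (w := (1 - gm) / (1 - gm')).
assert (w0 : 0 < w) by (apply Rdiv_lt_0_compat; lra).
assert (o := one_minus_pos gm u ltac:(lra) ltac:(lra)).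
assert (o' := one_minus_pos gm' u ltac:(lra) ltac:(lra)).
assert (k1 := Gi_compare_top gm gm' u H1 H2 ltac:(lra)). fold w in k1.
assert (k0 := Gi_compare_top gm gm' 0 H1 H2 ltac:(lra)). fold w in k0. rewrite !Gi_0, !Rminus_0_r in k0.
assert (g := Gi_1_pos gm ltac:(lra)). assert (g' := Gi_1_pos gm' H2).
assert (d : Gi gm u < Gi gm 1) by (apply Gi_increasing; lra).
assert (d' : Gi gm' u < Gi gm' 1) by (apply Gi_increasing; lra).
set (X := Gi gm 1 * (Gi gm 1 - Gi gm u)). set (X' := Gi gm' 1 * (Gi gm' 1 - Gi gm' u)).
assert (X0 : 0 < X) by (apply Rmult_lt_0_compat; lra).
assert (X0' : 0 < X') by (apply Rmult_lt_0_compat; lra).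
assert (XX : X' <= w ^ 2 * X).
{ unfold X, X'. replace (w ^ 2 * (Gi gm 1 * (Gi gm 1 - Gi gm u))) with ((w * Gi gm 1) * (w * (Gi gm 1 - Gi gm u))) by ring.
  apply Rmult_le_compat; lra. }
assert (S : sqrt X' <= w * sqrt X).
{ replace (w * sqrt X) with (sqrt (w ^ 2 * X)).
  - apply sqrt_le_1_alt; auto.
  - rewrite sqrt_mult_alt by apply pow2_ge_0. rewrite sqrt_pow2; lra. }
unfold slope_speed. fold X X'.
assert (s0 := sqrt_lt_R0 _ X0). assert (s0' := sqrt_lt_R0 _ X0').
assert (oo : 1 - gm' * u <= 1 - gm * u) by nra.
apply (Rmult_le_reg_r (2 * (1 - gm * u) * sqrt X * (2 * (1 - gm' * u) * sqrt X'))).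
{ repeat apply Rmult_lt_0_compat; lra. }
replace (/ (2 * (1 - gm * u) * sqrt X) * (2 * (1 - gm * u) * sqrt X * (2 * (1 - gm' * u) * sqrt X')))
  with (2 * ((1 - gm' * u) * sqrt X')) by (field; split; lra).
replace (w * / (2 * (1 - gm' * u) * sqrt X') * (2 * (1 - gm * u) * sqrt X * (2 * (1 - gm' * u) * sqrt X')))
  with (2 * ((1 - gm * u) * (w * sqrt X))) by (field; split; lra).
apply Rmult_le_compat_l; [lra|]. apply Rmult_le_compat; lra.
Qed.

(** The quantitative counterpart of [dprof_nu_lt]: together they squeeze nu and give its continuity
    in gm. *)
Lemma dprof_nu_ratio gm gm' a a' nu nu' r r' : gm < gm' -> dprof gm a -> dprof gm' a' ->
  arclength a nu r -> arclength a' nu' r' -> nu <= (1 - gm) / (1 - gm') * nu'.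
Proof.
intros Hg D D' A A'. set (w := (1 - gm) / (1 - gm')).
assert (g := dp_gm _ _ D').
pose (f u := r ((1 - Gi gm u / Gi gm 1) / 4)).
pose (f' u := r' ((1 - Gi gm' u / Gi gm' 1) / 4)).
assert (C := limits_increasing (fun u => f u - w * f' u)
  (fun u => - slope_speed gm u - w * - slope_speed gm' u) 0 1 (nu - w * nu') (0 - w * 0)).
assert (K : nu - w * nu' <= 0 - w * 0); [|lra].
assert (sc : forall F l, Filter F -> filterlim f' F (locally l) -> filterlim (fun u => w * f' u) F (locally (w * l))).
{ intros F l FF L. apply (filterlim_cont F FF f' (fun y => w * y) l L).
  apply (ex_derive_continuous (fun y => w * y)). auto_derive; auto. }
apply C; [lra| | | |].
- intros u Hu. apply (is_derive_minus (V := R_NormedModule) f (fun u => w * f' u)).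
  + apply (d_r_tg gm a nu r D A u Hu).
  + apply (is_derive_scal f'). apply (d_r_tg gm' a' nu' r' D' A' u Hu).
- apply filterlim_sub; [apply within_filter, locally_filter|apply (r_tg_0 gm a nu r D A)|].
  apply sc; [apply within_filter, locally_filter|apply (r_tg_0 gm' a' nu' r' D' A')].
- apply filterlim_sub; [apply within_filter, locally_filter|apply (r_tg_1 gm a nu r D A)|].
  apply sc; [apply within_filter, locally_filter|apply (r_tg_1 gm' a' nu' r' D' A')].
- intros u Hu. assert (S := slope_speed_compare gm gm' u Hg g Hu). fold w in S. lra.
Qed.

(** A value F gm is chosen for each gm < 0. Monotonicity and the ratio bound hold for any choice and
    make F continuous, so the intermediate value theorem applies between an explicit gm with F > nu
    and one with F < nu. *)
Lemma dprof_surjective (N : R -> R -> Prop) :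
  (forall gm, gm < 0 -> exists nu, N gm nu) ->
  (forall gm nu, N gm nu -> exists a r, dprof gm a /\ arclength a nu r) ->
  forall nu, PI / 2 < nu -> exists gm, gm < 0 /\ N gm nu.
Proof.
intros Hex HN nu Hnu.
assert (Hex' : forall gm, exists nu, gm < 0 -> N gm nu).
{ intros gm. destruct (Rlt_le_dec gm 0) as [h|h].
  - destruct (Hex gm h) as [n H]. exists n; auto.
  - exists 0. intros; lra. }
pose (F gm := proj1_sig (ClassicalEpsilon.constructive_indefinite_description _ (Hex' gm))).
assert (NF : forall gm, gm < 0 -> N gm (F gm)).
{ intros gm. unfold F. destruct ClassicalEpsilon.constructive_indefinite_description; simpl; auto. }
assert (HF : forall gm, gm < 0 -> exists a r, dprof gm a /\ arclength a (F gm) r) by auto.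
assert (dec : forall x y, x < y -> y < 0 -> F y < F x /\ F x <= (1 - x) / (1 - y) * F y).
{ intros x y xy y0. destruct (HF x ltac:(lra)) as [a [r [D A]]]. destruct (HF y y0) as [a' [r' [D' A']]].
  split; [apply (dprof_nu_lt x y a a' _ _ r r')|apply (dprof_nu_ratio x y a a' _ _ r r')]; auto. }
assert (Fpos : forall x, x < 0 -> 1 < F x).
{ intros x x0. destruct (HF x x0) as [a [r [D A]]]. apply (dprof_nu_gt1 x a _ r); auto. }
(* The ratio bound rewritten: (1 - x) / (1 - y) = 1 + (y - x) / (1 - y), and 1 / (1 - y) <= 1 for y
   < 0. *)
assert (lip : forall x y, x < y -> y < 0 -> F x - F y <= (y - x) * F y).
{ intros x y xy y0. destruct (dec x y xy y0) as [_ H]. assert (p := Fpos y y0).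
  replace ((1 - x) / (1 - y) * F y) with (F y + (y - x) * F y * / (1 - y)) in H by (field; lra).
  assert (/ (1 - y) <= 1) by (rewrite <- Rinv_1 at 2; apply Rinv_le_contravar; lra).
  assert (0 <= (y - x) * F y) by nra. nra. }
(* Chosen so that the logarithmic lower bound equals nu + 1. *)
pose (g1 := 1 - exp (2 * nu + 2)).
assert (P0 := PI_RGT_0).
assert (g10 : g1 < 0).
{ unfold g1. assert (H := exp_increasing 0 (2 * nu + 2)). rewrite exp_0 in H. lra. }
assert (Fg1 : nu < F g1).
{ destruct (HF g1 g10) as [a [r [D A]]]. assert (K := dprof_nu_lower g1 a _ r D A g10).
  unfold g1 in K at 1. replace (1 - (1 - exp (2 * nu + 2))) with (exp (2 * nu + 2)) in K by ring.
  rewrite ln_exp in K. lra. }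
(* Comparison with the hemisphere bounds F g2 by (1 - g2) pi / 2, which here is the mean of pi / 2
   and nu. *)
pose (g2 := - ((nu - PI / 2) / PI)).
assert (g20 : g2 < 0).
{ unfold g2. assert (0 < (nu - PI / 2) / PI) by (apply Rdiv_lt_0_compat; lra). lra. }
assert (Fg2 : F g2 < nu).
{ destruct (HF g2 g20) as [a [r [D A]]].
  assert (K := dprof_nu_ratio g2 0 a _ _ _ r _ g20 D dprof_hemisphere A arclength_hemisphere).
  replace ((1 - g2) / (1 - 0) * (PI / 2)) with (PI / 2 + (nu - PI / 2) / 2) in K by (unfold g2; field; lra). lra. }
assert (g12 : g1 < g2).
{ apply Rnot_le_lt. intros [h|h].
  - assert (K := proj1 (dec g2 g1 h g10)). lra.
  - rewrite h in Fg2. lra. }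
destruct (Ranalysis5.IVT_interv (fun x => nu - F x) g1 g2) as [gm [Hg1 Hg2]]; try lra.
- intros x Hx. apply continuity_pt_minus; [apply continuity_pt_const; intros ? ?; reflexivity|].
  intros e e0. assert (p := Fpos x ltac:(lra)).
  (* The first bound makes the Lipschitz estimate smaller than e, the second keeps y negative. *)
  assert (d0 : 0 < Rmin (e / F x) (- x)) by (apply Rmin_pos; [apply Rdiv_lt_0_compat|]; lra).
  exists (Rmin (e / F x) (- x)). split; auto.
  intros y [_ Hy]. simpl in *. unfold R_dist in *.
  assert (h1 := Rlt_le_trans _ _ _ Hy (Rmin_l _ _)). assert (h2 := Rlt_le_trans _ _ _ Hy (Rmin_r _ _)).
  assert (m : Rabs (y - x) * F x < e).
  { apply (Rmult_lt_compat_r (F x)) in h1; [|lra]. replace (e / F x * F x) with e in h1 by (field; lra). auto. }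
  apply Rabs_def2 in h2. assert (y0 : y < 0) by lra.
  destruct (Rtotal_order x y) as [xy|[xy|xy]].
  + assert (l := lip x y xy y0). destruct (dec x y xy y0) as [dc _].
    rewrite (Rabs_right (y - x)) in m by lra. rewrite Rabs_left by lra.
    assert (p' := Fpos y y0). nra.
  + subst y. rewrite Rminus_diag, Rabs_R0. auto.
  + assert (l := lip y x xy ltac:(lra)). destruct (dec y x xy ltac:(lra)) as [dc _].
    rewrite (Rabs_left (y - x)) in m by lra. rewrite Rabs_right by lra. nra.
- assert (gm0 : gm < 0) by lra. exists gm. split; auto. replace nu with (F gm) by lra. auto.
Qed.

(** Gi (1 / a) + 2 lam t is constant; its limits at t = 0, where 1 / a tends to 1, and at t = 1 / 4,
    where 1 / a tends to 0, determine both the constant and lam. *)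
Lemma dprof_of_profile lam mu a : 0 < lam -> mu <> 0 -> gam lam mu < 1 -> g4_profile lam mu a ->
  dprof (gam lam mu) a /\ lam = 2 * Gi (gam lam mu) 1.
Proof.
intros l0 mu0 g1 [prof [one blow]].
set (gm := gam lam mu) in *.
assert (gmE : 2 * mu = gm * lam) by (unfold gm, gam; field; lra).
assert (gm0 : gm <> 0) by (intros h; rewrite h in gmE; lra).
assert (dE : lam / (2 * mu) = / gm) by (rewrite gmE; field; lra).
assert (ud : 1 <> lam / (2 * mu)).
{ rewrite dE. intros h. apply (f_equal Rinv) in h. rewrite Rinv_1, Rinv_inv in h. lra. }
destruct (profile_limit_form lam mu 1 0 (1 / 4) a mu0 ud) as [y Hy]; auto.
{ simpl; lra. }
{ apply one_at_0_inv; auto. }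
assert (pos : forall t, 0 < t < 1 / 4 -> 0 < a t) by (intros t [t0 t1]; apply (prof t); auto).
(* The explicit form of 1 / a gives 1 - gm / a = (1 - gm) exp (4 mu y), so the integrand of [Gi] has
   no pole on the range of 1 / a. *)
assert (o : forall t, 0 < t < 1 / 4 -> 0 < 1 - gm * / a t).
{ intros t [t0 t1]. destruct (Hy t t0 t1) as [_ [_ <-]]. unfold Um. rewrite dE.
  replace (1 - gm * (/ gm + (1 - / gm) * exp (4 * mu * y t))) with ((1 - gm) * exp (4 * mu * y t)) by (field; auto).
  apply Rmult_lt_0_compat; [lra|apply exp_pos]. }
assert (du : forall t, 0 < t < 1 / 4 -> is_derive (fun t => / a t) t (2 * lam * (gm - a t))).
{ intros t [t0 t1]. destruct (prof t t0 t1) as [p d].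
  assert (e : ex_derive a t) by (eexists; eauto).
  auto_derive; [split; auto; lra|].
  replace (Derive (fun x : R => a x) t) with (2 * lam * a t ^ 3 - 4 * mu * a t ^ 2) by (symmetry; apply is_derive_unique; auto).
  replace (4 * mu) with (2 * (gm * lam)) by lra. field. lra. }
assert (lim0 : filterlim (fun t => / a t) (at_right 0) (locally 1)) by (apply one_at_0_inv; auto).
assert (lim1 : filterlim (fun t => / a t) (at_left (1 / 4)) (locally 0)) by (apply blows_up_inv; [apply within_filter, locally_filter|auto]).
assert (cG : forall t, 0 < t < 1 / 4 -> is_derive (fun t => Gi gm (/ a t) + 2 * lam * t) t 0).
{ intros t Ht. assert (p := pos t Ht). assert (ot := o t Ht).
  replace 0 with (2 * lam * (gm - a t) * (/ a t / (1 - gm * / a t)) + 2 * lam * 1).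
  - apply (is_derive_plus (V := R_NormedModule) (fun t => Gi gm (/ a t)) (fun t => 2 * lam * t)).
    + apply (is_derive_comp (Gi gm) (fun t => / a t)); auto. apply dGi; auto.
    + auto_derive; auto.
  - field. split; [lra|]. intros h.
    replace (1 - gm * / a t) with ((a t - gm) * / a t) in ot by (field; lra). rewrite h in ot. lra. }
assert (K := constant_deriv _ 0 (1 / 4) cG).
assert (cont : forall u, 0 <= u <= 1 -> continuous (Gi gm) u).
{ intros u Hu. apply (ex_derive_continuous (Gi gm)). eexists. apply dGi, one_minus_pos; auto. }
set (k := Gi gm (/ a (1 / 8)) + 2 * lam * (1 / 8)) in *.
assert (GE : forall t, 0 < t < 1 / 4 -> Gi gm (/ a t) = k - 2 * lam * t).
{ intros t Ht. assert (e := K t (1 / 8) Ht ltac:(lra)). cbv beta in e. unfold k. lra. }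
assert (k1 : k = Gi gm 1).
{ assert (L := filterlim_cont (at_right 0) ltac:(apply within_filter, locally_filter) _ (Gi gm) 1 lim0 (cont 1 ltac:(lra))).
  assert (L' : filterlim (fun t => k - 2 * lam * t) (at_right 0) (locally (k - 2 * lam * 0))).
  { apply (filterlim_at_right_of_continuous (fun t => k - 2 * lam * t)).
    apply (ex_derive_continuous (fun t => k - 2 * lam * t)). auto_derive; auto. }
  assert (L2 : filterlim (fun t => Gi gm (/ a t)) (at_right 0) (locally (k - 2 * lam * 0))).
  { apply (filterlim_ext_loc (fun t => k - 2 * lam * t)); auto.
    generalize (at_right_between 0 (1 / 4) ltac:(lra)). apply filter_imp. intros t Ht. symmetry; auto. }
  assert (E := filterlim_locally_unique (F := at_right 0) _ _ _ L L2). lra. }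
assert (k2 : k - 2 * lam * (1 / 4) = 0).
{ assert (L := filterlim_cont (at_left (1 / 4)) ltac:(apply within_filter, locally_filter) _ (Gi gm) 0 lim1 (cont 0 ltac:(lra))).
  rewrite Gi_0 in L.
  assert (L' : filterlim (fun t => k - 2 * lam * t) (at_left (1 / 4)) (locally (k - 2 * lam * (1 / 4)))).
  { apply (filterlim_at_left_of_continuous (fun t => k - 2 * lam * t)).
    apply (ex_derive_continuous (fun t => k - 2 * lam * t)). auto_derive; auto. }
  assert (L2 : filterlim (fun t => Gi gm (/ a t)) (at_left (1 / 4)) (locally (k - 2 * lam * (1 / 4)))).
  { apply (filterlim_ext_loc (fun t => k - 2 * lam * t)); auto.
    generalize (at_left_between 0 (1 / 4) ltac:(lra)). apply filter_imp. intros t Ht. symmetry; auto. }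
  symmetry. apply (filterlim_locally_unique (F := at_left (1 / 4)) _ _ _ L L2). }
assert (lE : lam = 2 * Gi gm 1) by (rewrite <- k1; lra).
split; auto. split; auto.
- intros t Ht. assert (p := pos t Ht). assert (ot := o t Ht). apply Rnot_le_lt. intros h.
  assert (Gi gm 1 <= Gi gm (/ a t)).
  { destruct h as [h|h]; [left; apply Gi_increasing; lra|rewrite <- h; lra]. }
  rewrite GE in H by auto. rewrite k1 in H. nra.
- intros t Ht. rewrite GE, k1 by auto. rewrite lE. field.
- intros t Ht. replace (4 * Gi gm 1) with (2 * lam) by (rewrite lE at 1; ring). auto.
Qed.

(** * Asymptotics of the ends *)

Lemma exp_ge_sq x : 0 <= x -> x ^ 2 / 4 <= exp x.
Proof.
intros x0. replace (exp x) with (exp (x / 2) * exp (x / 2)) by (rewrite <- exp_plus; f_equal; field).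
assert (H := exp_ineq1_le (x / 2)). nra.
Qed.

Lemma quadratic_dominates A B c : 0 < c -> exists M, forall y, M < y -> 0 < y /\ Rabs A + Rabs B * y <= c * y ^ 2.
Proof.
intros c0. assert (a := Rabs_pos A). assert (b := Rabs_pos B).
exists (Rmax 1 ((Rabs A + Rabs B) / c)). intros y Hy.
assert (m1 := Rmax_l 1 ((Rabs A + Rabs B) / c)). assert (m2 := Rmax_r 1 ((Rabs A + Rabs B) / c)).
split; [lra|].
assert (K : Rabs A + Rabs B <= c * y).
{ apply Rle_trans with (c * ((Rabs A + Rabs B) / c)); [right; field; lra|].
  apply Rmult_le_compat_l; lra. }
assert (Rabs A <= Rabs A * y) by nra.
assert ((Rabs A + Rabs B) * y <= c * y * y) by (apply Rmult_le_compat_r; lra). nra.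
Qed.

(** U - 4 mu T has constant derivative - 2 lam. When T grows exponentially U is thus asymptotic to 4
    mu T, which links it to the slope 1 + 4 nu^2 t of [a2] for mu = nu^2. *)
Lemma Tm_linear_part t0 u0 lam mu y : mu <> 0 ->
  Um u0 lam mu y = 4 * mu * Tm t0 u0 lam mu y + (u0 - 4 * mu * t0 - 2 * lam * y).
Proof. intros m0. unfold Um, Tm. field. auto. Qed.

Lemma Tm_growth t0 u0 lam mu : 0 < mu -> lam / (2 * mu) < u0 ->
  exists c M, 0 < c /\ forall y, M < y -> 0 < y /\ c * y ^ 2 <= Tm t0 u0 lam mu y.
Proof.
intros m0 ud. set (k := u0 - lam / (2 * mu)). assert (k0 : 0 < k) by (unfold k; lra).
destruct (quadratic_dominates (t0 - k / (4 * mu)) (lam / (2 * mu)) (k * mu / 2)) as [M HM]; [nra|].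
exists (k * mu / 2), M. split; [nra|]. intros y Hy. destruct (HM y Hy) as [y0 H]. split; auto.
assert (e := exp_ge_sq (4 * mu * y) ltac:(nra)).
assert (K : k * mu * y ^ 2 <= k / (4 * mu) * exp (4 * mu * y)).
{ replace (k * mu * y ^ 2) with (k / (4 * mu) * ((4 * mu * y) ^ 2 / 4)) by (field; lra).
  apply Rmult_le_compat_l; auto. apply Rlt_le, Rdiv_lt_0_compat; lra. }
unfold Tm. fold k.
replace (k * (exp (4 * mu * y) - 1) / (4 * mu)) with (k / (4 * mu) * exp (4 * mu * y) - k / (4 * mu)) by (field; lra).
assert (a := Rle_abs (- (t0 - k / (4 * mu)))). rewrite Rabs_Ropp in a.
assert (b := Rle_abs (- (lam / (2 * mu)))). rewrite Rabs_Ropp in b. nra.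
Qed.

Lemma Tm_exp_growth t0 u0 lam mu : 0 < mu -> lam / (2 * mu) < u0 ->
  exists c M, 0 < c /\ forall y, M < y -> 0 < y /\ c * exp (4 * mu * y) <= Tm t0 u0 lam mu y.
Proof.
intros m0 ud. set (k := u0 - lam / (2 * mu)). assert (k0 : 0 < k) by (unfold k; lra).
destruct (quadratic_dominates (t0 - k / (4 * mu)) (lam / (2 * mu)) (k * mu / 2)) as [M HM]; [nra|].
exists (k / (8 * mu)), M. split; [apply Rdiv_lt_0_compat; lra|]. intros y Hy. destruct (HM y Hy) as [y0 H]. split; auto.
assert (e := exp_ge_sq (4 * mu * y) ltac:(nra)).
assert (K : k * mu / 2 * y ^ 2 <= k / (8 * mu) * exp (4 * mu * y)).
{ replace (k * mu / 2 * y ^ 2) with (k / (8 * mu) * ((4 * mu * y) ^ 2 / 4)) by (field; lra).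
  apply Rmult_le_compat_l; auto. apply Rlt_le, Rdiv_lt_0_compat; lra. }
unfold Tm. fold k.
replace (k * (exp (4 * mu * y) - 1) / (4 * mu)) with (k / (8 * mu) * exp (4 * mu * y) + k / (8 * mu) * exp (4 * mu * y) - k / (4 * mu)) by (field; lra).
assert (a := Rle_abs (- (t0 - k / (4 * mu)))). rewrite Rabs_Ropp in a.
assert (b := Rle_abs (- (lam / (2 * mu)))). rewrite Rabs_Ropp in b. nra.
Qed.

Lemma Tm_unbounded_pos t0 u0 lam mu : 0 < mu -> lam / (2 * mu) < u0 ->
  filterlim (Tm t0 u0 lam mu) (Rbar_locally p_infty) (Rbar_locally p_infty).
Proof.
intros m0 ud. destruct (Tm_growth t0 u0 lam mu m0 ud) as [c [M [c0 HM]]].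
intros P [N HN]. destruct (quadratic_dominates N 0 c c0) as [M' HM'].
exists (Rmax M (M' + 1)). intros y Hy. apply HN.
assert (m1 := Rmax_l M (M' + 1)). assert (m2 := Rmax_r M (M' + 1)).
destruct (HM y ltac:(lra)) as [y0 K].
destruct (HM' (M' + 1) ltac:(lra)) as [z0 K2]. rewrite Rabs_R0, Rmult_0_l, Rplus_0_r in K2.
assert (a := Rle_abs N).
assert (c * (M' + 1) ^ 2 < c * y ^ 2) by (apply Rmult_lt_compat_l; nra). lra.
Qed.

Lemma Tm_unbounded_neg t0 u0 lam mu : mu < 0 -> 0 < lam / (2 * mu) ->
  filterlim (Tm t0 u0 lam mu) (Rbar_locally p_infty) (Rbar_locally p_infty).
Proof.
intros m0 d0. set (d := lam / (2 * mu)) in *. set (k := u0 - d).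
intros P [N HN]. exists (Rmax 0 ((N - t0 + Rabs (k / (4 * mu)) + 1) / d)). intros y Hy. apply HN.
assert (m1 := Rmax_l 0 ((N - t0 + Rabs (k / (4 * mu)) + 1) / d)).
assert (m2 := Rmax_r 0 ((N - t0 + Rabs (k / (4 * mu)) + 1) / d)).
assert (dy : N - t0 + Rabs (k / (4 * mu)) + 1 <= d * y).
{ apply Rle_trans with (d * ((N - t0 + Rabs (k / (4 * mu)) + 1) / d)); [right; field; lra|].
  apply Rmult_le_compat_l; lra. }
assert (e0 := exp_pos (4 * mu * y)).
assert (e1 : exp (4 * mu * y) <= 1) by (rewrite <- exp_0; left; apply exp_increasing; nra).
unfold Tm. fold d. fold k.
replace (k * (exp (4 * mu * y) - 1) / (4 * mu)) with (- (k / (4 * mu)) * (1 - exp (4 * mu * y))) by (field; lra).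
assert (a := Rle_abs (k / (4 * mu))). assert (a' := Rabs_pos (k / (4 * mu))).
nra.
Qed.

Lemma Um_limit_neg u0 lam mu : mu < 0 ->
  filterlim (Um u0 lam mu) (Rbar_locally p_infty) (locally (lam / (2 * mu))).
Proof.
intros m0. apply filterlim_locally. intros e. assert (e0 := cond_pos e).
set (k := u0 - lam / (2 * mu)).
destruct (quadratic_dominates (Rabs k / e) 0 (4 * mu ^ 2)) as [M HM]; [nra|].
exists (Rmax M 0). intros y Hy. assert (m1 := Rmax_l M 0). assert (m2 := Rmax_r M 0).
(* A point strictly between [Rmax M 0] and y, so that the quadratic bound becomes strict at y. *)
destruct (HM ((y + Rmax M 0) / 2) ltac:(lra)) as [y0 K].
rewrite Rabs_R0, Rmult_0_l, Rplus_0_r in K.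
assert (E := exp_ge_sq (- (4 * mu * y)) ltac:(nra)).
change (Rabs (lam / (2 * mu) + (u0 - lam / (2 * mu)) * exp (4 * mu * y) - lam / (2 * mu)) < e).
fold k. replace (lam / (2 * mu) + k * exp (4 * mu * y) - lam / (2 * mu)) with (k * exp (4 * mu * y)) by ring.
rewrite Rabs_mult, (Rabs_right (exp _)) by (apply Rle_ge, Rlt_le, exp_pos).
replace (exp (4 * mu * y)) with (/ exp (- (4 * mu * y))) by (rewrite <- exp_Ropp; f_equal; ring).
assert (p := exp_pos (- (4 * mu * y))).
apply (Rmult_lt_reg_r (exp (- (4 * mu * y)))); auto.
rewrite Rmult_assoc, Rinv_l, Rmult_1_r by lra.
assert (kk : 0 <= Rabs k / e) by (apply Rmult_le_pos; [apply Rabs_pos|left; apply Rinv_0_lt_compat; auto]).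
rewrite (Rabs_right (Rabs k / e)) in K by lra.
assert (K' : Rabs k / e < exp (- (4 * mu * y))).
{ eapply Rle_lt_trans; [exact K|]. eapply Rlt_le_trans; [|exact E].
  set (z := (y + Rmax M 0) / 2) in *. assert (zy : 0 < z < y) by (unfold z in *; lra).
  replace ((- (4 * mu * y)) ^ 2 / 4) with (4 * mu ^ 2 * y ^ 2) by field.
  apply Rmult_lt_compat_l; nra. }
apply (Rmult_lt_compat_l e) in K'; auto. replace (e * (Rabs k / e)) with (Rabs k) in K' by (field; lra). lra.
Qed.

Section Asymptotics.

Variables (D : R -> Prop) (P Q : R -> R) (t0 u0 lam mu : R) (X X1 : R -> R).
Let T := Tm t0 u0 lam mu.
Let U := Um u0 lam mu.
Hypothesis S : surface D P Q lam mu T U X X1.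
Hypothesis mu0 : mu <> 0.

Variable F : (R -> Prop) -> Prop.
Hypothesis FF : Filter F.
Hypothesis FD : F (fun x => 0 < x /\ D (x ^ 2)).

Lemma FD_true : F (fun x => 0 < x /\ D (x ^ 2) /\ True).
Proof. revert FD. apply filter_imp. intros x [H1 H2]; auto. Qed.

Lemma open_sf : open (fun p => 0 < nsq p /\ D (nsq p)).
Proof. apply (open_dom (fun q => 0 < q /\ D q)), open_and_pos, (sf_open _ _ _ _ _ _ _ _ _ S). Qed.

Lemma ck_true (f : pt -> R) : (forall n, ck n (fun p => 0 < nsq p /\ D (nsq p)) f) ->
  forall n, ck n (fun p => (0 < nsq p /\ D (nsq p)) /\ True) f.
Proof.
intros H. apply smooth_ck. apply (smooth_sub (fun p => 0 < nsq p /\ D (nsq p))).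
- intros p [Hp _]; auto.
- apply ck_smooth; auto.
Qed.

Lemma sm_T : forall n, ck n (fun p => 0 < nsq p /\ D (nsq p)) (fun p => T (X (nsq p))).
Proof. apply S. Qed.

(** The comparison map is the identity in t, so the angular parts agree exactly and only the slopes
    1 / a of the two radial parts have to be compared. *)
Lemma asymptotic_g2_end nu : 0 < nu -> mu = nu ^ 2 -> lam / (2 * mu) < u0 ->
  filterlim (fun x => X (x ^ 2)) F (Rbar_locally p_infty) -> asymptotic_g2 F (hm P Q) nu.
Proof.
intros n0 mE ud FX. assert (m0 : 0 < mu) by (rewrite mE; apply pow_lt; auto).
apply (surface_asymptotic D P Q lam mu T U X X1 (fun _ => True) F (Rbar_locally p_infty) _ _ _ _ _ (fun t => t) (fun _ => 1)); auto.
- apply open_true.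
- apply ck_true, sm_T.
- apply FD_true.
- apply Tm_unbounded_pos; auto.
- intros eps eps0.
  destruct (Tm_growth t0 u0 lam mu m0 ud) as [c [M1 [c0 G1]]].
  destruct (Tm_exp_growth t0 u0 lam mu m0 ud) as [c' [M2 [c0' G2]]].
  (* the model and [U] differ by a linear function of [y], while [U] grows quadratically *)
  set (B := 1 + 4 * mu * t0 - u0).
  (* The error factors as (w - U) (w + U), and w + U <= 3 U once |w - U| <= U / 2; this explains
     both bounds on eta. *)
  set (eta := Rmin (eps / 3) (/ 2)).
  assert (eta0 : 0 < eta) by (apply Rmin_pos; lra).
  assert (eta1 : eta <= eps / 3) by apply Rmin_l. assert (eta2 : eta <= / 2) by apply Rmin_r.
  destruct (quadratic_dominates B (2 * lam) (eta * (2 * mu * c)) ltac:(repeat apply Rmult_lt_0_compat; lra)) as [M3 G3].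
  destruct (quadratic_dominates (u0 - 4 * mu * t0) (2 * lam) (2 * mu * c) ltac:(repeat apply Rmult_lt_0_compat; lra)) as [M4 G4].
  exists (Rmax (Rmax M1 M2) (Rmax M3 M4)). intros y Hy.
  assert (b0 := Rmax_l (Rmax M1 M2) (Rmax M3 M4)). assert (b2 := Rmax_r (Rmax M1 M2) (Rmax M3 M4)).
  assert (b1 := Rmax_l M1 M2). assert (b3 := Rmax_l M3 M4). assert (b4 := Rmax_r M3 M4).
  destruct (G1 y ltac:(lra)) as [y0 H1]. destruct (G3 y ltac:(lra)) as [_ H3]. destruct (G4 y ltac:(lra)) as [_ H4].
  assert (TU := Tm_linear_part t0 u0 lam mu y mu0). fold T in TU, H1. fold U in TU.
  assert (T0 : 0 < T y) by (eapply Rlt_le_trans; [|exact H1]; apply Rmult_lt_0_compat; auto; apply pow_lt; auto).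
  assert (lin : forall A, Rabs (A - 2 * lam * y) <= Rabs A + Rabs (2 * lam) * y).
  { intros A. unfold Rminus. eapply Rle_trans; [apply Rabs_triang|].
    rewrite Rabs_Ropp, (Rabs_mult _ y), (Rabs_right y) by lra. lra. }
  assert (U2 : 2 * mu * T y <= U y).
  { assert (h := lin (u0 - 4 * mu * t0)). assert (h' := Rle_abs (- (u0 - 4 * mu * t0 - 2 * lam * y))).
    rewrite Rabs_Ropp in h'. assert (2 * mu * (c * y ^ 2) <= 2 * mu * T y) by (apply Rmult_le_compat_l; lra). lra. }
  assert (U0 : 0 < U y) by (eapply Rlt_le_trans; [|exact U2]; repeat apply Rmult_lt_0_compat; lra).
  assert (W : Rabs ((1 + 4 * mu * T y) - U y) <= eta * U y).
  { replace (1 + 4 * mu * T y - U y) with (B - - (2 * lam) * y) by (rewrite TU; unfold B; ring).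
    assert (h : Rabs (B - - (2 * lam) * y) <= Rabs B + Rabs (2 * lam) * y).
    { replace (B - - (2 * lam) * y) with (B + 2 * lam * y) by ring. eapply Rle_trans; [apply Rabs_triang|].
      rewrite (Rabs_mult _ y), (Rabs_right y) by lra. lra. }
    assert (eta * (2 * mu * c) * y ^ 2 <= eta * U y).
    { rewrite Rmult_assoc. apply Rmult_le_compat_l; [lra|].
      assert (2 * mu * (c * y ^ 2) <= 2 * mu * T y) by (apply Rmult_le_compat_l; lra). lra. }
    lra. }
  split; [auto_derive; auto|split; [lra|split; [lra|split]]].
  + rewrite rP_G. unfold a2. rewrite <- mE.
    set (w := 1 + 4 * mu * T y) in *.
    assert (w0 : 0 < w) by (unfold w; assert (0 < mu * T y) by (apply Rmult_lt_0_compat; auto); lra).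
    replace (1 / T y - (/ w) ^ 2 / T y * (1 * U y) ^ 2) with ((w - U y) * (w + U y) * / (T y * w ^ 2)) by (field; split; lra).
    replace (eps * ((/ w) ^ 2 / T y * (1 * U y) ^ 2)) with ((eps * U y ^ 2) * / (T y * w ^ 2)) by (field; split; lra).
    assert (i0 : 0 < / (T y * w ^ 2)) by (apply Rinv_0_lt_compat, Rmult_lt_0_compat; auto; apply pow_lt; auto).
    rewrite Rabs_mult, (Rabs_right (/ _)) by lra. apply Rmult_le_compat_r; [lra|].
    rewrite Rabs_mult. rewrite (Rabs_right (w + U y)) by lra.
    assert (wU : w + U y <= 3 * U y).
    { assert (h := Rle_abs (w - U y)). assert (eta * U y <= / 2 * U y) by (apply Rmult_le_compat_r; lra). lra. }
    apply Rle_trans with ((eta * U y) * (3 * U y)).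
    * apply Rmult_le_compat; auto; [apply Rabs_pos|lra].
    * replace (eta * U y * (3 * U y)) with (3 * eta * U y ^ 2) by ring. apply Rmult_le_compat_r; [apply pow2_ge_0|lra].
  + rewrite rQ_G. replace (4 * T y - 4 * T y) with 0 by ring. rewrite Rabs_R0. nra.
Qed.

(** With s = 2 sqrt t / d the angular parts agree exactly. The radial ratio is d^2 / U^2, which
    tends to 1 because for mu < 0 the slope U converges to its equilibrium d = nu / (2 pi). *)
Lemma asymptotic_cone_end nu : mu < 0 -> 0 < nu -> lam / (2 * mu) = nu / (2 * PI) ->
  filterlim (fun x => X (x ^ 2)) F (Rbar_locally p_infty) -> asymptotic_cone F (hm P Q) nu.
Proof.
intros m0 n0 dE FX. unfold asymptotic_cone. rewrite <- dE. set (d := lam / (2 * mu)) in *.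
assert (d0 : 0 < d) by (rewrite dE; apply Rdiv_lt_0_compat; auto; assert (p := PI_RGT_0); lra).
assert (TI : filterlim T (Rbar_locally p_infty) (Rbar_locally p_infty)) by (apply Tm_unbounded_neg; auto).
apply (surface_asymptotic D P Q lam mu T U X X1 (fun _ => True) F (Rbar_locally p_infty) _ _ _ _ _ (fun t => 2 * sqrt t / d) (fun t => / (d * sqrt t))); auto.
- apply open_true.
- apply ck_true. intros n. assert (o := open_sf).
  apply (ck_mult n _ (fun p => 2 * sqrt (T (X (nsq p)))) (fun _ => / d)); auto; [|apply ck_const; auto].
  apply ck_mult; auto; [apply ck_const; auto|]. apply ck_sqrt; auto; [|apply sm_T].
  intros p [q0 Dp]. apply (sf_T _ _ _ _ _ _ _ _ _ S); auto.
- apply FD_true.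
- apply (filterlim_comp _ _ _ T (fun t => 2 * sqrt t / d) _ (Rbar_locally p_infty)); auto.
  intros R0 [M HM]. exists ((d * Rmax 0 M) ^ 2). intros t Ht. apply HM.
  assert (m1 := Rmax_l 0 M). assert (m2 := Rmax_r 0 M).
  assert (s : d * Rmax 0 M < sqrt t).
  { rewrite <- (sqrt_pow2 (d * Rmax 0 M)); [|nra]. apply sqrt_lt_1_alt. split; auto. apply pow2_ge_0. }
  apply Rle_lt_trans with (Rmax 0 M); auto.
  apply Rlt_div_r; auto. assert (z := Rmult_le_pos d (Rmax 0 M)). nra.
- intros eps eps0.
  assert (UL : filterlim U (Rbar_locally p_infty) (locally d)) by (apply Um_limit_neg; auto).
  assert (C : continuous (fun u => d ^ 2 / u ^ 2) d).
  { apply (ex_derive_continuous (fun u => d ^ 2 / u ^ 2)). auto_derive. nz. }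
  assert (L := filterlim_comp _ _ _ U (fun u => d ^ 2 / u ^ 2) _ _ _ UL C). cbv beta in L.
  assert (E1 : Rbar_locally p_infty (fun y => Rabs (d ^ 2 / U y ^ 2 - 1) < eps)).
  { assert (K := proj1 (filterlim_locally _ _) L (mkposreal eps eps0)).
    revert K. apply filter_imp. intros y Hy. change (Rabs (d ^ 2 / U y ^ 2 - d ^ 2 / d ^ 2) < eps) in Hy.
    replace (d ^ 2 / d ^ 2) with 1 in Hy by (field; lra). auto. }
  assert (E2 : Rbar_locally p_infty (fun y => 0 < U y)) by (apply UL; apply (open_gt 0 d d0)).
  assert (E3 : Rbar_locally p_infty (fun y => 0 < T y)) by (apply TI; exists 0; auto).
  generalize (filter_and _ _ E1 (filter_and _ _ E2 E3)). apply filter_imp. clear E1 E2 E3.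
  intros y [E1 [E2 E3]]. assert (s0 := sqrt_lt_R0 _ E3).
  split; [|split; [|split; [lra|split]]].
  + auto_derive; [auto|]. field. split; lra.
  + apply Rinv_neq_0_compat. nz.
  + change (rP (warped (fun s : R => d * s)) (2 * sqrt (T y) / d)) with 1.
    set (K := (/ (d * sqrt (T y)) * U y) ^ 2).
    replace (1 / T y - 1 * K) with ((d ^ 2 / U y ^ 2 - 1) * K).
    * assert (K0 : 0 <= K) by apply pow2_ge_0. rewrite Rabs_mult, (Rabs_right K) by lra.
      replace (eps * (1 * K)) with (eps * K) by ring. apply Rmult_le_compat_r; lra.
    * unfold K. replace (T y) with (sqrt (T y) ^ 2) at 2 by (apply pow2_sqrt; lra). field. repeat split; lra.
  + change (rQ (warped (fun s : R => d * s)) (2 * sqrt (T y) / d)) with ((d * (2 * sqrt (T y) / d)) ^ 2).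
    replace ((d * (2 * sqrt (T y) / d)) ^ 2) with (4 * sqrt (T y) ^ 2) by (field; lra).
    rewrite pow2_sqrt by lra. replace (4 * T y - 4 * T y) with 0 by ring. rewrite Rabs_R0. nra.
Qed.

(** The choice exp (2 s) = 4 t makes the angular parts equal. For lam = -1 the expansions T = y^2 +
    ... and U = 2 y + ... at the double zero of T give the radial condition, 4 T / U^2 tending to
    1. *)
Lemma asymptotic_cusp_end : t0 = 0 -> u0 = 0 -> lam = -1 ->
  filterlim (fun x => X (x ^ 2)) F (at_right 0) -> asymptotic_cusp F (hm P Q).
Proof.
intros tE uE lE FX.
assert (TE : forall y, T y = 2 * y ^ 2 * phi2 (4 * mu * y)).
{ intros y. unfold T, Tm. rewrite tE, uE, lE, (exp_phi2 (4 * mu * y)). field. auto. }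
assert (UE : forall y, U y = 2 * y * (1 + 4 * mu * y * phi2 (4 * mu * y))).
{ intros y. unfold U, Um. rewrite uE, lE, (exp_phi2 (4 * mu * y)). field. auto. }
assert (Cp : continuous (fun y => phi2 (4 * mu * y)) 0).
{ apply (continuous_comp (fun y => 4 * mu * y) phi2).
  - apply (ex_derive_continuous (fun y => 4 * mu * y)). auto_derive; auto.
  - apply (ex_derive_continuous phi2). eexists. apply is_derive_PS, CV_radius_phi2. }
assert (p00 : phi2 (4 * mu * 0) = / 2) by (rewrite Rmult_0_r; apply phi2_0).
assert (Cz : continuous (fun y => 1 + 4 * mu * y * phi2 (4 * mu * y)) 0).
{ apply (continuous_plus (V := R_NormedModule) (fun _ => 1)); [apply continuous_const|].
  apply (continuous_mult (K := R_AbsRing) (fun y => 4 * mu * y)); auto.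
  apply (ex_derive_continuous (fun y => 4 * mu * y)). auto_derive; auto. }
assert (Er : at_right 0 (fun y => 0 < y)) by apply within_self.
assert (Ep : at_right 0 (fun y => 0 < phi2 (4 * mu * y))).
{ apply filter_le_within. apply Cp. rewrite p00. apply (open_gt 0). lra. }
assert (Ez : at_right 0 (fun y => 0 < 1 + 4 * mu * y * phi2 (4 * mu * y))).
{ apply filter_le_within. apply Cz. rewrite Rmult_0_r, Rmult_0_l. apply (open_gt 0). lra. }
assert (ET : at_right 0 (fun y => 0 < T y)).
{ generalize (filter_and _ _ Er Ep). apply filter_imp. intros y [y0 py]. rewrite TE.
  apply Rmult_lt_0_compat; auto. apply Rmult_lt_0_compat; [lra|apply pow_lt; auto]. }
apply (surface_asymptotic D P Q lam mu T U X X1 (fun _ => True) F (at_right 0) _ _ _ _ _ (fun t => / 2 * ln (4 * t)) (fun t => / (2 * t))); auto.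
- apply open_true.
- apply ck_true. intros n. assert (o := open_sf).
  apply ck_mult; auto; [apply ck_const; auto|]. apply ck_ln; auto.
  + intros p [q0 Dp]. assert (t1 := sf_T _ _ _ _ _ _ _ _ _ S _ q0 Dp). lra.
  + apply ck_mult; auto; [apply ck_const; auto|apply sm_T].
- apply FD_true.
- assert (T4 : filterlim (fun y => 4 * T y) (at_right 0) (at_right 0)).
  { apply filterlim_at_right_intro; [apply within_filter, locally_filter| |].
    - assert (c : continuous (fun y => 4 * T y) 0).
      { apply (ex_derive_continuous (fun y => 4 * T y)). apply (ex_derive_scal T). eexists; apply dTm; auto. }
      assert (K := filterlim_at_right_of_continuous _ 0 c). cbv beta in K.
      replace (4 * T 0) with 0 in K by (rewrite TE; ring). exact K.
    - revert ET. apply filter_imp. intros; lra. }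
  intros P0 [M HM]. assert (L := filterlim_comp _ _ _ _ ln _ _ _ T4 is_lim_ln_0).
  assert (K := L (fun z => z < 2 * M) (ex_intro _ (2 * M) (fun x H => H))).
  revert K. unfold filtermap. apply filter_imp. intros y Hy. apply HM. lra.
- intros eps eps0.
  assert (C : continuous (fun y => 2 * phi2 (4 * mu * y) / (1 + 4 * mu * y * phi2 (4 * mu * y)) ^ 2) 0).
  { apply (continuous_mult (K := R_AbsRing) (fun y => 2 * phi2 (4 * mu * y))).
    - apply (continuous_scal_r (V := R_NormedModule) 2); auto.
    - apply (continuous_comp (fun y => 1 + 4 * mu * y * phi2 (4 * mu * y)) (fun z => / z ^ 2)); auto.
      apply (ex_derive_continuous (fun z => / z ^ 2)). rewrite Rmult_0_r, Rmult_0_l, Rplus_0_r. auto_derive. lra. }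
  assert (E1 : at_right 0 (fun y => Rabs (2 * phi2 (4 * mu * y) / (1 + 4 * mu * y * phi2 (4 * mu * y)) ^ 2 - 1) < eps)).
  { apply filter_le_within. assert (K := proj1 (filterlim_locally _ _) C (mkposreal eps eps0)).
    revert K. apply filter_imp. intros y Hy.
    match type of Hy with ball ?a _ ?b => change (Rabs (b - a) < eps) in Hy end.
    rewrite p00, Rmult_0_r, Rmult_0_l, Rplus_0_r in Hy. replace (2 * / 2 / 1 ^ 2) with 1 in Hy by field. exact Hy. }
  generalize (filter_and _ _ (filter_and _ _ Er Ep) (filter_and _ _ (filter_and _ _ Ez ET) E1)).
  apply filter_imp. clear E1 Er Ep Ez ET. intros y [[y0 py] [[z0 T0] E1]].
  assert (U0 : U y <> 0) by (rewrite UE; nz).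
  split; [|split; [|split; [auto|split]]].
  + auto_derive; [lra|]. field. lra.
  + apply Rinv_neq_0_compat. lra.
  + change (rP (warped exp) (/ 2 * ln (4 * T y))) with 1.
    set (K := (/ (2 * T y) * U y) ^ 2).
    replace (1 / T y - 1 * K) with ((2 * phi2 (4 * mu * y) / (1 + 4 * mu * y * phi2 (4 * mu * y)) ^ 2 - 1) * K).
    * assert (K0 : 0 <= K) by apply pow2_ge_0. rewrite Rabs_mult, (Rabs_right K) by lra.
      replace (eps * (1 * K)) with (eps * K) by ring. apply Rmult_le_compat_r; lra.
    * replace (2 * phi2 (4 * mu * y) / (1 + 4 * mu * y * phi2 (4 * mu * y)) ^ 2) with (4 * T y / U y ^ 2)
        by (rewrite TE, UE; field; split; lra).
      unfold K. field. split; auto; lra.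
  + change (rQ (warped exp) (/ 2 * ln (4 * T y))) with (exp (/ 2 * ln (4 * T y)) ^ 2).
    replace (exp (/ 2 * ln (4 * T y)) ^ 2) with (4 * T y).
    * replace (4 * T y - 4 * T y) with 0 by ring. rewrite Rabs_R0. nra.
    * rewrite <- (exp_ln (4 * T y)) at 1 by lra.
      replace (exp (/ 2 * ln (4 * T y)) ^ 2) with (exp (/ 2 * ln (4 * T y)) * exp (/ 2 * ln (4 * T y))) by ring.
      rewrite <- exp_plus. f_equal. field.
Qed.

Lemma exp_m_infty eps : 0 < eps -> Rbar_locally m_infty (fun y => exp (4 * y) < eps).
Proof.
intros e0. exists (ln eps / 4). intros y Hy. rewrite <- (exp_ln eps) by auto. apply exp_increasing. lra.
Qed.

(** The parameters encode 1 / a = 4 t - nu^2, with base point T (0) = nu^2 / 4 + 1. For nu > 0 the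
    map is s = 2 y / nu written in terms of t. For nu = 0 it is the geodesic parameter s = - 1 / (2
    sqrt t), so the radial parts agree exactly and only 4 T -> 0 remains. *)
Lemma asymptotic_cylinder_end nu : 0 <= nu -> lam = 0 -> mu = 1 -> u0 = 4 -> t0 = nu ^ 2 / 4 + 1 ->
  filterlim (fun x => X (x ^ 2)) F (Rbar_locally m_infty) -> asymptotic_cylinder F (hm P Q) nu.
Proof.
intros n0 lE mE uE tE FX.
assert (TE : forall y, T y = nu ^ 2 / 4 + exp (4 * y)).
{ intros y. unfold T, Tm. rewrite lE, mE, uE, tE. rewrite !Rmult_1_r. field. }
assert (UE : forall y, U y = 4 * exp (4 * y)).
{ intros y. unfold U, Um. rewrite lE, mE, uE. rewrite !Rmult_1_r. field. }
unfold asymptotic_cylinder. destruct n0 as [n0|n0].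
- apply (surface_asymptotic D P Q lam mu T U X X1 (fun _ => True) F (Rbar_locally m_infty) _ _ _ _ _
    (fun t => / (2 * nu) * ln (t - nu ^ 2 / 4)) (fun t => / (2 * nu * (t - nu ^ 2 / 4)))); auto.
  + apply open_true.
  + apply ck_true. intros n. assert (o := open_sf).
    apply ck_mult; auto; [apply ck_const; auto|]. apply ck_ln; auto.
    * intros p _. rewrite TE. assert (e := exp_pos (4 * X (nsq p))). lra.
    * apply (ck_plus n _ (fun p => T (X (nsq p))) (fun _ => - (nu ^ 2 / 4))); auto; [apply sm_T|apply ck_const; auto].
  + apply FD_true.
  + intros P0 [M HM]. exists (nu / 2 * M). intros y Hy. apply HM.
    rewrite TE. replace (nu ^ 2 / 4 + exp (4 * y) - nu ^ 2 / 4) with (exp (4 * y)) by ring. rewrite ln_exp.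
    replace (/ (2 * nu) * (4 * y)) with (2 * y / nu) by (field; lra). apply Rlt_div_l; auto. lra.
  + intros eps eps0.
    assert (n2 : 0 < nu ^ 2) by (apply pow_lt; auto).
    assert (e0 : 0 < Rmin (eps / 4) (eps * (nu ^ 2 / 4))) by (apply Rmin_pos; nra).
    generalize (exp_m_infty _ e0). apply filter_imp. intros y Hy.
    assert (h1 := Rlt_le_trans _ _ _ Hy (Rmin_l _ _)). assert (h2 := Rlt_le_trans _ _ _ Hy (Rmin_r _ _)).
    assert (ep := exp_pos (4 * y)). set (E := exp (4 * y)) in *.
    rewrite TE, UE. fold E. replace (nu ^ 2 / 4 + E - nu ^ 2 / 4) with E by ring.
    split; [|split; [|split; [lra|split]]].
    * auto_derive; replace (nu * (nu * 1) * / 4) with (nu ^ 2 / 4) by field; [lra|].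
      replace (nu ^ 2 / 4 + E + - (nu ^ 2 / 4)) with E by ring. field. lra.
    * apply Rinv_neq_0_compat. nz.
    * change (rP (warped (fun _ : R => nu)) (/ (2 * nu) * ln E)) with 1.
      change (rP (warped (fun _ : R => 1)) (/ (2 * nu) * ln E)) with 1.
      replace (/ (2 * nu * E) * (4 * E)) with (2 / nu) by (field; split; lra).
      replace (1 / (nu ^ 2 / 4 + E) - 1 * (2 / nu) ^ 2) with (- (4 * E * / (nu ^ 2 * (nu ^ 2 / 4 + E))))
        by (field; split; nra).
      rewrite Rabs_Ropp, Rabs_right.
      -- apply (Rmult_le_reg_r (nu ^ 2 * (nu ^ 2 / 4 + E))); [apply Rmult_lt_0_compat; lra|].
         rewrite Rmult_assoc, Rinv_l, Rmult_1_r by nz.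
         replace (eps * (1 * (2 / nu) ^ 2) * (nu ^ 2 * (nu ^ 2 / 4 + E))) with (4 * (eps * (nu ^ 2 / 4)) + 4 * (eps * E)) by (field; lra).
         assert (0 < eps * E) by (apply Rmult_lt_0_compat; lra). lra.
      -- apply Rle_ge, Rmult_le_pos; [lra|]. left; apply Rinv_0_lt_compat, Rmult_lt_0_compat; lra.
    * change (rQ (warped (fun _ : R => nu)) (/ (2 * nu) * ln E)) with (nu ^ 2).
      change (rQ (warped (fun _ : R => 1)) (/ (2 * nu) * ln E)) with (1 ^ 2).
      replace (4 * (nu ^ 2 / 4 + E) - nu ^ 2) with (4 * E) by field. rewrite Rabs_right by lra. lra.
- apply (surface_asymptotic D P Q lam mu T U X X1 (fun _ => True) F (Rbar_locally m_infty) _ _ _ _ _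
    (fun t => - / (2 * sqrt t)) (fun t => / (4 * (t * sqrt t)))); auto.
  + apply open_true.
  + apply ck_true. intros n. assert (o := open_sf).
    apply (ck_ext n _ (fun p => (-1) * / (2 * sqrt (T (X (nsq p)))))); auto; [intros; ring|].
    apply ck_mult; auto; [apply ck_const; auto|]. apply ck_inv; auto.
    * intros p [q0 Dp]. assert (t1 := sqrt_lt_R0 _ (sf_T _ _ _ _ _ _ _ _ _ S _ q0 Dp)). lra.
    * apply ck_mult; auto; [apply ck_const; auto|]. apply ck_sqrt; auto; [|apply sm_T].
      intros p [q0 Dp]. apply (sf_T _ _ _ _ _ _ _ _ _ S); auto.
  + apply FD_true.
  + intros P0 [M HM].
    assert (k0 : 0 < 2 * (Rabs M + 1)) by (assert (a := Rabs_pos M); lra).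
    assert (e0 : 0 < (/ (2 * (Rabs M + 1))) ^ 2) by (apply pow_lt, Rinv_0_lt_compat; auto).
    generalize (exp_m_infty _ e0). unfold filtermap. apply filter_imp. intros y Hy. apply HM.
    rewrite TE, <- n0. replace (0 ^ 2 / 4 + exp (4 * y)) with (exp (4 * y)) by field.
    assert (ep := exp_pos (4 * y)).
    assert (s : sqrt (exp (4 * y)) < / (2 * (Rabs M + 1))).
    { rewrite <- (sqrt_pow2 (/ (2 * (Rabs M + 1)))) by (left; apply Rinv_0_lt_compat; auto). apply sqrt_lt_1_alt. lra. }
    assert (s0 := sqrt_lt_R0 _ ep).
    assert (K : Rabs M + 1 <= / (2 * sqrt (exp (4 * y)))).
    { apply (Rmult_le_reg_r (2 * sqrt (exp (4 * y)))); [lra|]. rewrite Rinv_l by lra.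
      apply (Rmult_lt_compat_l (2 * (Rabs M + 1))) in s; auto. rewrite Rinv_r in s by lra. lra. }
    assert (a := Rle_abs (- M)). rewrite Rabs_Ropp in a. lra.
  + intros eps eps0. assert (e0 : 0 < eps / 4) by lra.
    generalize (exp_m_infty _ e0). apply filter_imp. intros y Hy.
    assert (ep := exp_pos (4 * y)). rewrite TE, UE, <- n0. set (E := exp (4 * y)) in *.
    replace (0 ^ 2 / 4 + E) with E by field. assert (s0 := sqrt_lt_R0 _ ep).
    split; [|split; [|split; [lra|split]]].
    * auto_derive; [repeat split; auto; lra|].
      apply (Rmult_eq_reg_r (4 * (E * sqrt E))); [|nz]. rewrite Rinv_l by nz.
      transitivity (E / (sqrt E ^ 2)); [field; lra|]. rewrite pow2_sqrt by lra. field. lra.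
    * apply Rinv_neq_0_compat. nz.
    * change (rP (warped (fun _ : R => 0)) (- / (2 * sqrt E))) with 1.
      change (rP (warped (fun _ : R => 1)) (- / (2 * sqrt E))) with 1.
      replace (/ (4 * (E * sqrt E)) * (4 * E)) with (/ sqrt E) by (field; split; lra).
      assert (ee : (/ sqrt E) ^ 2 = 1 / E) by (rewrite <- (pow2_sqrt E) at 2 by lra; field; lra).
      rewrite ee. replace (1 / E - 1 * (1 / E)) with 0 by ring. rewrite Rabs_R0.
      apply Rmult_le_pos; [lra|]. rewrite Rmult_1_l. left; apply Rdiv_lt_0_compat; lra.
    * change (rQ (warped (fun _ : R => 0)) (- / (2 * sqrt E))) with (0 ^ 2).
      change (rQ (warped (fun _ : R => 1)) (- / (2 * sqrt E))) with (1 ^ 2).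
      replace (4 * E - 0 ^ 2) with (4 * E) by ring. rewrite Rabs_right by lra. lra.
Qed.

End Asymptotics.

(* Satisfied by both ends x -> 0 and x -> infinity; convexity of J allows integrating along the end. *)
Definition ray (F : (R -> Prop) -> Prop) : Prop :=
  ProperFilter F /\ forall P, F P -> exists J : R -> Prop,
    F J /\ (forall x, J x -> 0 < x /\ P x) /\
    (forall x y z, J x -> J z -> x <= y <= z -> J y).

Lemma ray_p_infty : ray (Rbar_locally p_infty).
Proof.
split; [apply Rbar_locally_filter|]. intros P [M HM].
exists (fun x => Rmax 0 M < x). assert (a := Rmax_l 0 M). assert (b := Rmax_r 0 M). split; [|split].
- exists (Rmax 0 M); auto.
- intros x Hx. split; [lra|apply HM; lra].
- intros x y z Hx Hz Hy. lra.
Qed.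

Lemma ray_at_right_0 : ray (at_right 0).
Proof.
split; [apply at_right_proper_filter|]. intros P [d Hd].
exists (fun x => 0 < x < d). assert (d0 := cond_pos d). split; [|split].
- apply at_right_between; auto.
- intros x Hx. split; [lra|]. apply Hd; [|lra]. change (Rabs (x - 0) < d). apply Rabs_def1; lra.
- intros x y z Hx Hz Hy. lra.
Qed.

Lemma continuous_sign (f : R -> R) (J : R -> Prop) :
  (forall x y z, J x -> J z -> x <= y <= z -> J y) ->
  (forall x, J x -> continuous f x /\ f x <> 0) ->
  exists sg, (sg = 1 \/ sg = -1) /\ forall x, J x -> 0 < sg * f x.
Proof.
intros cJ Hf.
assert (K : forall x y, J x -> J y -> f x < 0 -> 0 < f y -> False).
{ intros x y Jx Jy fx fy. destruct (Rtotal_order x y) as [xy|[xy|xy]].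
  - destruct (Ranalysis5.IVT_interv f x y) as [z [Hz1 Hz2]]; auto.
    + intros z Hz. apply continuity_pt_filterlim, Hf, (cJ x z y); auto.
    + apply (proj2 (Hf z (cJ x z y Jx Jy Hz1))); auto.
  - subst; lra.
  - destruct (Ranalysis5.IVT_interv (fun z => - f z) y x) as [z [Hz1 Hz2]]; try lra.
    + intros z Hz. apply continuity_pt_opp, continuity_pt_filterlim, Hf, (cJ y z x); auto.
    + apply (proj2 (Hf z (cJ y z x Jy Jx Hz1))); lra. }
destruct (Classical_Prop.classic (exists x, J x /\ f x < 0)) as [[x [Jx fx]]|N].
- exists (-1). split; auto. intros y Jy. destruct (Hf y Jy) as [_ n].
  destruct (Rlt_le_dec 0 (f y)) as [h|h]; [exfalso; eauto|lra].
- exists 1. split; auto. intros y Jy. destruct (Hf y Jy) as [_ n].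
  destruct (Rlt_le_dec 0 (f y)) as [h|h]; [lra|]. exfalso; apply N; exists y; split; auto; lra.
Qed.

Lemma g2_radial_axis sigma nu x : 0 < x ->
  polar (pull sigma (G (a2 nu))) (x, 0) (1, 0) =
  (Derive sigma x / (1 + 4 * nu ^ 2 * sigma x)) ^ 2 / sigma x.
Proof.
intros x0. rewrite polar_pull, rP_G, rQ_G, rad_axis by lra. unfold a2.
unfold dot, crs; simpl fst; simpl snd.
replace ((x * 1 + 0 * 0) / x) with 1 by (field; lra).
replace ((x * 0 - 0 * 1) / x ^ 2) with 0 by (field; lra).
unfold Rdiv. rewrite Rpow_mult_distr. ring.
Qed.

Lemma g2_angular_axis sigma nu x : 0 < x ->
  polar (pull sigma (G (a2 nu))) (x, 0) (0, 1) = 4 * sigma x / x ^ 2.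
Proof.
intros x0. rewrite polar_pull, rP_G, rQ_G, rad_axis by lra.
unfold dot, crs; simpl fst; simpl snd.
replace ((x * 0 + 0 * 1) / x) with 0 by (field; lra).
replace ((x * 1 - 0 * 0) / x ^ 2) with (/ x) by (field; lra).
assert (Z : forall r, r * 0 ^ 2 = 0) by (intros; ring). rewrite Z. field. lra.
Qed.

Lemma relative_error_trans e A E E' : 0 <= e < 1 ->
  Rabs (A - E) <= e * E -> Rabs (A - E') <= e * E' -> E' <= (1 + e) / (1 - e) * E.
Proof.
intros He H H'.
assert (h := Rle_abs (A - E)). assert (h' := Rle_abs (- (A - E'))). rewrite Rabs_Ropp in h'.
apply (Rmult_le_reg_l (1 - e)); [lra|].
replace ((1 - e) * ((1 + e) / (1 - e) * E)) with ((1 + e) * E) by (field; lra). lra.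
Qed.

(* Along the end, L = ln (1 + 4 nu^2 s) / (4 nu^2) integrates ds / (1 + 4 nu^2 s).  The angular
   components give s ~ s' and the radial ones |dL'| <= kap |dL|, with kap arbitrarily close to 1;
   as L ~ ln s / (4 nu^2), this forces nu <= nu'. *)
Lemma g2_label_le F h nu nu' : ray F -> 0 < nu -> 0 < nu' ->
  asymptotic_g2 F h nu -> asymptotic_g2 F h nu' -> nu <= nu'.
Proof.
intros [PF ray] n0 n0' [s [Hs As]] [s' [Hs' As']].
apply Rnot_lt_le; intros lt.
assert (ratio : 1 < nu ^ 2 / nu' ^ 2).
{ apply (proj1 (Rlt_div_r 1 (nu ^ 2) (nu' ^ 2) ltac:(nra))). nra. }
(* kap lies strictly between 1 and nu^2 / nu'^2, and e is the error whose distortion (1 + e) / (1 -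
   e) between the two models is kap. *)
set (kap := (1 + nu ^ 2 / nu' ^ 2) / 2).
assert (k1 : 1 < kap < nu ^ 2 / nu' ^ 2) by (unfold kap; lra).
set (e := (kap - 1) / (kap + 1)).
assert (e0 : 0 < e < 1).
{ unfold e. split; [apply Rdiv_lt_0_compat; lra|apply Rlt_div_l; lra]. }
assert (ke : (1 + e) / (1 - e) = kap) by (unfold e; field; lra).
specialize (As e (proj1 e0)). specialize (As' e (proj1 e0)).
assert (S0 : F (fun x => 0 < s x)) by (apply Hs; exists 0; auto).
assert (S0' : F (fun x => 0 < s' x)) by (apply Hs'; exists 0; auto).
destruct (ray _ (filter_and _ _ (filter_and _ _ As As') (filter_and _ _ S0 S0'))) as [J [FJ [HJ cJ]]].
set (w x := 1 + 4 * nu ^ 2 * s x). set (w' x := 1 + 4 * nu' ^ 2 * s' x).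
assert (n2 : 0 < nu ^ 2) by (apply pow_lt; auto). assert (n2' : 0 < nu' ^ 2) by (apply pow_lt; auto).
assert (wpos : forall x, J x -> 0 < w x /\ 0 < w' x /\ 0 < s x /\ 0 < s' x).
{ intros x Jx. destruct (HJ x Jx) as [_ [_ [a b]]]. unfold w, w'.
  assert (0 < nu ^ 2 * s x) by (apply Rmult_lt_0_compat; auto).
  assert (0 < nu' ^ 2 * s' x) by (apply Rmult_lt_0_compat; auto). lra. }
assert (ang : forall x, J x -> s' x <= kap * s x /\ s x <= kap * s' x).
{ intros x Jx. destruct (HJ x Jx) as [x0 [[[_ [_ A]] [_ [_ A']]] _]].
  assert (r : rad (x, 0) = x) by (apply rad_axis; lra).
  specialize (A _ (0, 1) r). specialize (A' _ (0, 1) r). rewrite g2_angular_axis in A, A' by auto.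
  assert (B := relative_error_trans e _ _ _ ltac:(lra) A A'). assert (B' := relative_error_trans e _ _ _ ltac:(lra) A' A).
  rewrite ke in B, B'. assert (x2 : 0 < x ^ 2) by (apply pow_lt; auto).
  split; [clear B'|clear B].
  - apply (Rmult_le_reg_r (4 / x ^ 2)); [apply Rdiv_lt_0_compat; lra|].
    replace (s' x * (4 / x ^ 2)) with (4 * s' x / x ^ 2) by (field; lra).
    replace (kap * s x * (4 / x ^ 2)) with (kap * (4 * s x / x ^ 2)) by (field; lra). auto.
  - apply (Rmult_le_reg_r (4 / x ^ 2)); [apply Rdiv_lt_0_compat; lra|].
    replace (s x * (4 / x ^ 2)) with (4 * s x / x ^ 2) by (field; lra).
    replace (kap * s' x * (4 / x ^ 2)) with (kap * (4 * s' x / x ^ 2)) by (field; lra). auto. }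
assert (rdl : forall x, J x -> Rabs (Derive s' x / w' x) <= kap * Rabs (Derive s x / w x)).
{ intros x Jx. destruct (HJ x Jx) as [x0 [[[_ [_ A]] [_ [_ A']]] _]].
  destruct (wpos x Jx) as [w0 [w0' [sp sp']]]. destruct (ang x Jx) as [an _].
  assert (r : rad (x, 0) = x) by (apply rad_axis; lra).
  specialize (A _ (1, 0) r). specialize (A' _ (1, 0) r). rewrite g2_radial_axis in A, A' by auto.
  assert (B := relative_error_trans e _ _ _ ltac:(lra) A A'). rewrite ke in B.
  fold (w x) in B. fold (w' x) in B.
  set (d := Derive s x / w x) in *. set (d' := Derive s' x / w' x) in *.
  assert (B2 : d' ^ 2 <= (kap * Rabs d) ^ 2).
  { apply Rle_trans with (s' x * (kap * (d ^ 2 / s x))).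
    - replace (d' ^ 2) with (s' x * (d' ^ 2 / s' x)) by (field; lra). apply Rmult_le_compat_l; lra.
    - rewrite Rpow_mult_distr, pow2_abs.
      replace (s' x * (kap * (d ^ 2 / s x))) with ((kap * (d ^ 2 / s x)) * s' x) by ring.
      replace (kap ^ 2 * d ^ 2) with ((kap * (d ^ 2 / s x)) * (kap * s x)) by (field; lra).
      apply Rmult_le_compat_l; auto. apply Rmult_le_pos; [lra|].
      apply Rmult_le_pos; [apply pow2_ge_0|left; apply Rinv_0_lt_compat; auto]. }
  assert (a := Rabs_pos d).
  rewrite <- (sqrt_pow2 (kap * Rabs d)) by nra. rewrite <- sqrt_Rsqr_abs.
  apply sqrt_le_1_alt. unfold Rsqr. lra. }
destruct (filter_ex _ FJ) as [x0 Jx0].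
(* The comparison map may traverse the end in either direction; its derivative keeps one sign on the
   convex set J, recorded by [sg]. *)
destruct (continuous_sign (Derive s) J cJ) as [sg [Hsg sgn]].
{ intros x Jx. destruct (HJ x Jx) as [_ [[[A1 [A2 _]] _] _]]. split; auto.
  apply (ex_derive_continuous (Derive s)). apply (A1 2%nat). }
set (L x := ln (w x) / (4 * nu ^ 2)). set (L' x := ln (w' x) / (4 * nu' ^ 2)).
assert (dL : forall x, J x -> is_derive L x (Derive s x / w x)).
{ intros x Jx. destruct (wpos x Jx) as [w0 [w0' [sp sp']]].
  destruct (HJ x Jx) as [_ [[[A1 [A2 _]] _] _]]. assert (e1 := A1 1%nat). simpl in e1.
  unfold L, w. auto_derive; [split; auto|].
  change (Derive (fun x1 => s x1) x) with (Derive s x). unfold w in w0. field. lra. }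
assert (dL' : forall x, J x -> is_derive L' x (Derive s' x / w' x)).
{ intros x Jx. destruct (wpos x Jx) as [w0 [w0' [sp sp']]].
  destruct (HJ x Jx) as [_ [[_ [A1 [A2 _]]] _]]. assert (e1 := A1 1%nat). simpl in e1.
  unfold L', w'. auto_derive; [split; auto|].
  change (Derive (fun x1 => s' x1) x) with (Derive s' x). unfold w' in w0'. field. lra. }
(* The values u = 1 and u = -1 bound L' from above to the right and to the left of x0. *)
assert (mono : forall u, (u = 1 \/ u = -1) -> forall x y, J x -> J y -> x <= y ->
   u * L' y - kap * sg * L y <= u * L' x - kap * sg * L x).
{ intros u Hu x y Jx Jy xy.
  assert (K : kap * sg * L x - u * L' x <= kap * sg * L y - u * L' y); [|lra].
  apply (nondecreasing_deriv (fun z => kap * sg * L z - u * L' z)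
    (fun z => kap * sg * (Derive s z / w z) - u * (Derive s' z / w' z))); auto.
  - intros z Hz. assert (Jz := cJ x z y Jx Jy Hz).
    apply (is_derive_minus (V := R_NormedModule) (fun z => kap * sg * L z) (fun z => u * L' z)).
    + apply (is_derive_scal L); auto.
    + apply (is_derive_scal L'); auto.
  - intros z Hz. assert (Jz := cJ x z y Jx Jy ltac:(lra)).
    assert (R1 := rdl z Jz). destruct (wpos z Jz) as [w0 _]. assert (sz := sgn z Jz).
    assert (E : Rabs (Derive s z / w z) = sg * (Derive s z / w z)).
    { assert (q : 0 < sg * (Derive s z / w z)).
      { replace (sg * (Derive s z / w z)) with (sg * Derive s z * / w z) by (unfold Rdiv; ring).
        apply Rmult_lt_0_compat; auto. apply Rinv_0_lt_compat; auto. }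
      destruct Hsg as [-> | ->]; [rewrite Rabs_right|rewrite Rabs_left]; lra. }
    rewrite E in R1.
    assert (u * (Derive s' z / w' z) <= Rabs (Derive s' z / w' z)).
    { destruct Hu as [-> | ->].
      - rewrite Rmult_1_l. apply Rle_abs.
      - rewrite <- Rabs_Ropp. eapply Rle_trans; [|apply Rle_abs]. lra. }
    lra. }
assert (bound : forall x, J x -> L' x <= L' x0 + kap * Rabs (L x - L x0)).
{ intros x Jx. destruct (Rle_lt_dec x0 x) as [h0|h0].
  - assert (M := mono 1 (or_introl eq_refl) x0 x Jx0 Jx h0).
    assert (kap * (sg * (L x - L x0)) <= kap * Rabs (L x - L x0)); [|lra].
    apply Rmult_le_compat_l; [lra|]. destruct Hsg as [-> | ->].
    + rewrite Rmult_1_l; apply Rle_abs.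
    + rewrite <- Rabs_Ropp. eapply Rle_trans; [|apply Rle_abs]. lra.
  - assert (M := mono (-1) (or_intror eq_refl) x x0 Jx Jx0 ltac:(lra)).
    assert (kap * (sg * (L x0 - L x)) <= kap * Rabs (L x - L x0)); [|lra].
    apply Rmult_le_compat_l; [lra|]. rewrite Rabs_minus_sym. destruct Hsg as [-> | ->].
    + rewrite Rmult_1_l; apply Rle_abs.
    + rewrite <- Rabs_Ropp. eapply Rle_trans; [|apply Rle_abs]. lra. }
(* [ln (w' x) >= ln (w x) - ln C] while [L' <= kap * L + O(1)] *)
set (C := 1 + kap * nu ^ 2 / nu' ^ 2).
assert (C0 : 1 < C).
{ assert (0 < kap * nu ^ 2 / nu' ^ 2) by (apply Rdiv_lt_0_compat; auto; apply Rmult_lt_0_compat; lra). unfold C; lra. }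
assert (lower : forall x, J x -> ln (w x) <= ln (w' x) + ln C).
{ intros x Jx. destruct (wpos x Jx) as [w0 [w0' [sp sp']]]. destruct (ang x Jx) as [_ an].
  rewrite <- ln_mult by lra. apply ln_le; auto. unfold w, w', C.
  assert (nu ^ 2 * s x <= nu ^ 2 * (kap * s' x)) by (apply Rmult_le_compat_l; lra).
  replace ((1 + 4 * nu' ^ 2 * s' x) * (1 + kap * nu ^ 2 / nu' ^ 2)) with
    (1 + kap * nu ^ 2 / nu' ^ 2 + 4 * nu' ^ 2 * s' x + 4 * (nu ^ 2 * (kap * s' x))) by (field; lra).
  assert (0 < kap * nu ^ 2 / nu' ^ 2) by (unfold C in C0; lra).
  assert (0 < nu' ^ 2 * s' x) by (apply Rmult_lt_0_compat; auto). lra. }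
set (rho := nu ^ 2 / nu' ^ 2) in *.
set (B := L' x0 + kap * Rabs (L x0) + ln C / (4 * nu' ^ 2)).
assert (fin : forall x, J x -> (rho - kap) * L x <= B).
{ intros x Jx. destruct (wpos x Jx) as [w0 [w0' [sp sp']]].
  assert (L0 : 0 <= L x).
  { unfold L. apply Rmult_le_pos; [|left; apply Rinv_0_lt_compat; lra].
    rewrite <- ln_1. apply ln_le; [lra|]. unfold w. assert (0 < nu ^ 2 * s x) by (apply Rmult_lt_0_compat; auto). lra. }
  assert (b := bound x Jx). assert (l := lower x Jx).
  assert (t : Rabs (L x - L x0) <= L x + Rabs (L x0)).
  { unfold Rminus. eapply Rle_trans; [apply Rabs_triang|]. rewrite Rabs_Ropp, (Rabs_right (L x)) by lra. lra. }
  assert (kap * Rabs (L x - L x0) <= kap * (L x + Rabs (L x0))) by (apply Rmult_le_compat_l; lra).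
  assert (rl : rho * L x <= L' x + ln C / (4 * nu' ^ 2)).
  { replace (rho * L x) with (ln (w x) / (4 * nu' ^ 2)) by (unfold rho, L; field; split; lra).
    unfold L'. replace (ln (w' x) / (4 * nu' ^ 2) + ln C / (4 * nu' ^ 2)) with ((ln (w' x) + ln C) / (4 * nu' ^ 2)) by (field; lra).
    apply Rmult_le_compat_r; auto. left; apply Rinv_0_lt_compat; lra. }
  unfold B. lra. }
(* Beyond this value of s, L exceeds |B| / (rho - kap) + 1, against [fin]. *)
set (big := exp (4 * nu ^ 2 * (Rabs B / (rho - kap) + 1)) / (4 * nu ^ 2)).
assert (Fbig : F (fun x => big < s x)) by (apply Hs; exists big; auto).
destruct (filter_ex _ (filter_and _ _ FJ Fbig)) as [x [Jx bx]].
assert (f := fin x Jx). destruct (wpos x Jx) as [w0 _].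
assert (Lb : Rabs B / (rho - kap) + 1 <= L x).
{ unfold L. apply (proj1 (Rle_div_r _ _ (4 * nu ^ 2) ltac:(lra))).
  rewrite <- (ln_exp ((Rabs B / (rho - kap) + 1) * (4 * nu ^ 2))). apply ln_le; [apply exp_pos|].
  replace ((Rabs B / (rho - kap) + 1) * (4 * nu ^ 2)) with (4 * nu ^ 2 * (Rabs B / (rho - kap) + 1)) by ring.
  unfold w. apply (Rmult_lt_compat_l (4 * nu ^ 2)) in bx; [|lra].
  replace (4 * nu ^ 2 * big) with (exp (4 * nu ^ 2 * (Rabs B / (rho - kap) + 1))) in bx by (unfold big; field; lra). lra. }
assert (a := Rle_abs B).
apply (Rmult_le_compat_l (rho - kap)) in Lb; [|lra].
replace ((rho - kap) * (Rabs B / (rho - kap) + 1)) with (Rabs B + (rho - kap)) in Lb by (field; lra). lra.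
Qed.

Lemma g2_label_of_asymptotic F h nu : ray F -> 0 < nu -> asymptotic_g2 F h nu -> g2_label F h nu.
Proof.
intros HF n0 A. split; auto. split; auto. intros nu' n0' A'.
apply Rle_antisym; eapply g2_label_le; eauto.
Qed.

(** * Solitons on the plane, disks and annuli *)

(** U (x) - u0 is 2 mu u0 - lam times (exp (4 mu x) - 1) / (2 mu), and the last factor is positive
    for x > 0 whatever the sign of mu. *)
Lemma Um_pos_increasing u0 lam mu x : mu <> 0 -> 0 <= u0 -> lam < 2 * mu * u0 -> 0 < x ->
  0 < Um u0 lam mu x.
Proof.
intros m0 hu hl x0.
assert (e : Um u0 lam mu x = u0 + (2 * mu * u0 - lam) * ((exp (4 * mu * x) - 1) / (2 * mu))) by (unfold Um; field; auto).
assert (p : 0 < (exp (4 * mu * x) - 1) / (2 * mu)).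
{ destruct (Rtotal_order mu 0) as [h|[h|h]]; [|lra|].
  - replace ((exp (4 * mu * x) - 1) / (2 * mu)) with ((1 - exp (4 * mu * x)) / (2 * - mu)) by (field; auto).
    apply Rdiv_lt_0_compat; [|lra]. assert (exp (4 * mu * x) < exp 0) by (apply exp_increasing; nra).
    rewrite exp_0 in H. lra.
  - apply Rdiv_lt_0_compat; [|lra]. assert (exp 0 < exp (4 * mu * x)) by (apply exp_increasing; nra).
    rewrite exp_0 in H. lra. }
rewrite e. assert (0 < (2 * mu * u0 - lam) * ((exp (4 * mu * x) - 1) / (2 * mu))) by (apply Rmult_lt_0_compat; lra). lra.
Qed.

Lemma Um_pos_above u0 lam mu x : 0 <= lam / (2 * mu) < u0 -> 0 < Um u0 lam mu x.
Proof.
intros H. unfold Um. assert (e := exp_pos (4 * mu * x)).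
assert (0 < (u0 - lam / (2 * mu)) * exp (4 * mu * x)) by (apply Rmult_lt_0_compat; lra). lra.
Qed.

Lemma Tm_pos t0 u0 lam mu x : mu <> 0 -> 0 <= t0 -> 0 < x ->
  (forall z, 0 < z < x -> 0 < Um u0 lam mu z) -> 0 < Tm t0 u0 lam mu x.
Proof.
intros m0 ht x0 H. assert (K := Tm_lt t0 u0 lam mu 0 x m0 x0 H). rewrite Tm_0 in K. lra.
Qed.

Lemma origin_S_pos lam mu x : mu <> 0 -> 0 <= x -> (forall z, 0 < z < x -> 0 < Um 1 lam mu z) ->
  0 < origin_S lam mu x.
Proof.
intros m0 x0 H. destruct x0 as [x0|<-].
- assert (K := Tm_pos 0 1 lam mu x m0 (Rle_refl 0) x0 H). rewrite Tm_origin_S in K by auto.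
  apply (Rmult_lt_reg_l x); auto. rewrite Rmult_0_r. auto.
- unfold origin_S. rewrite Rmult_0_l. lra.
Qed.

Lemma Tm_continuous t0 u0 lam mu x : mu <> 0 -> continuous (Tm t0 u0 lam mu) x.
Proof. intros m0. apply (ex_derive_continuous (Tm t0 u0 lam mu)). eexists; apply dTm; auto. Qed.

Lemma square_p_infty c : 0 < c ->
  filterlim (fun x => c * x ^ 2) (Rbar_locally p_infty) (Rbar_locally p_infty).
Proof.
intros c0 P [M HM]. destruct (quadratic_dominates M 0 c c0) as [N HN].
exists (Rmax N 0 + 1). intros x Hx. apply HM. assert (a := Rmax_l N 0). assert (b := Rmax_r N 0).
destruct (HN (Rmax N 0 + 1) ltac:(lra)) as [_ K]. rewrite Rabs_R0, Rmult_0_l, Rplus_0_r in K.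
assert (m := Rle_abs M).
assert (c * (Rmax N 0 + 1) ^ 2 < c * x ^ 2) by (apply Rmult_lt_compat_l; nra). lra.
Qed.

Lemma square_at_right_0 c : 0 < c -> filterlim (fun x => c * x ^ 2) (at_right 0) (at_right 0).
Proof.
intros c0. apply filterlim_at_right_intro; [apply within_filter, locally_filter| |].
- assert (C : continuous (fun x => c * x ^ 2) 0) by (apply (ex_derive_continuous (fun x => c * x ^ 2)); auto_derive; auto).
  assert (K := filterlim_at_right_of_continuous _ 0 C). cbv beta in K.
  replace (c * 0 ^ 2) with 0 in K by ring. exact K.
- generalize (within_self 0 (fun x => 0 < x)). apply filter_imp. intros x x0.
  apply Rmult_lt_0_compat; auto. apply pow_lt; auto.
Qed.

Lemma Tm_at_right_0 t0 u0 lam mu : mu <> 0 ->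
  filterlim (Tm t0 u0 lam mu) (at_right 0) (Rbar_locally t0).
Proof.
intros m0. assert (K := filterlim_at_right_of_continuous _ 0 (Tm_continuous t0 u0 lam mu 0 m0)).
rewrite Tm_0 in K. exact K.
Qed.

Lemma F_infty_axis (D : R -> Prop) : (forall q, 0 < q -> D q) ->
  Rbar_locally p_infty (fun x => 0 < x /\ D (x ^ 2)).
Proof. intros H. exists 0. intros x x0. split; auto. apply H, pow_lt; auto. Qed.

(** * Ends at finite and at infinite distance *)

Section SurfaceEnds.

Variables (D : R -> Prop) (P Q : R -> R) (t0 u0 lam mu : R) (X X1 : R -> R).
Let T := Tm t0 u0 lam mu.
Let U := Um u0 lam mu.
Hypothesis S : surface D P Q lam mu T U X X1.

Lemma surface_lower_bound q0 q1 : 0 <= q0 -> (forall q, q0 <= q <= q1 -> D q) ->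
  exists k, 0 < k /\ forall p v, q0 <= nsq p <= q1 -> k ^ 2 * nsq v <= quad (hm P Q) p v.
Proof.
intros h HD. apply hm_lower_bound; intros q Hq.
- apply S; [lra|auto].
- apply S; [lra|auto].
- apply S; [lra|auto].
Qed.

Lemma surface_continuous (V : pt -> Prop) : (forall p, V p -> D (nsq p)) ->
  forall i j p, V p -> continuous (hm P Q i j) p.
Proof.
intros VD i j p Vp. apply (riemannian_continuous (dom D)); [apply S|apply VD; auto].
Qed.

(** L is a bounded primitive of an upper bound for the radial speed, so the axis runs to infinity in
    finite length. *)
Lemma surface_incomplete_infty (V : pt -> Prop) r0 L L1 B :
  (forall p, V p -> D (nsq p)) -> (forall q, 0 < q -> D q) -> 0 < r0 ->
  (forall x, r0 <= x -> V (x, 0)) ->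
  (forall x, r0 <= x -> is_derive L x (L1 x)) ->
  (forall x, r0 <= x -> 0 <= L1 x) ->
  (forall x, r0 <= x -> (2 * x * X1 (x ^ 2)) ^ 2 / T (X (x ^ 2)) <= L1 x ^ 2) ->
  (forall x, r0 <= x -> L x <= B) ->
  incomplete V (hm P Q).
Proof.
intros VD HD r00 HV dL L0 HL LB.
apply (incomplete_outer V (hm P Q) p_infty r0 L L1 B (fun n => r0 + INR n)); auto.
- apply surface_continuous; auto.
- intros p _; exact I.
- intros x Hx _. split; [auto|split; [auto|]]. intros w.
  assert (x0 : 0 < x) by lra. assert (q0 : 0 < x ^ 2) by (apply pow_lt; auto).
  rewrite (surface_axis D P Q lam mu T U X X1); auto.
  assert (tp := sf_T _ _ _ _ _ _ _ _ _ S _ q0 (HD _ q0)). assert (sp := sqrt_lt_R0 _ tp).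
  replace ((2 * x * X1 (x ^ 2) / sqrt (T (X (x ^ 2))) * w) ^ 2) with
    ((2 * x * X1 (x ^ 2)) ^ 2 / sqrt (T (X (x ^ 2))) ^ 2 * w ^ 2) by (field; lra).
  rewrite pow2_sqrt by lra. rewrite (Rpow_mult_distr (L1 x)).
  apply Rmult_le_compat_r; [apply pow2_ge_0|auto].
- intros al be al0 albe _.
  destruct (surface_lower_bound (al ^ 2) (be ^ 2)) as [k [k0 K]].
  + apply pow2_ge_0.
  + intros q Hq. apply HD. assert (0 < al ^ 2) by (apply pow_lt; auto). lra.
  + exists k. split; auto. intros p v _ Hp. apply K. apply nsq_rad_bounds; lra.
- intros n. rewrite S_INR. lra.
- intros n. split; [assert (h := pos_INR n); lra|exact I].
- intros b _. destruct (nfloor_ex (Rmax 0 b)) as [n Hn]; [apply Rmax_l|].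
  exists (n + 1)%nat. rewrite plus_INR. simpl. assert (m := Rmax_r 0 b). lra.
Qed.

Lemma surface_incomplete_one (V : pt -> Prop) K :
  (forall p, V p -> D (nsq p)) -> (forall q, 0 < q < 1 -> D q) ->
  (forall p, V p -> rad p < 1) ->
  (forall x, 1 / 2 <= x < 1 -> V (x, 0)) -> 0 <= K ->
  (forall x, 1 / 2 <= x < 1 -> (2 * x * X1 (x ^ 2)) ^ 2 / T (X (x ^ 2)) <= K ^ 2) ->
  incomplete V (hm P Q).
Proof.
intros VD HD V1 HV K0 HL.
apply (incomplete_outer V (hm P Q) 1 (1 / 2) (fun x => K * x) (fun _ => K) K (fun n => 1 - / 2 * / INR (n + 1))); auto.
- apply surface_continuous; auto.
- lra.
- intros x Hx x1. simpl in x1. split; [auto_derive; auto; ring|split; [auto|]]. intros w.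
  assert (q0 : 0 < x ^ 2 < 1) by nra.
  rewrite (surface_axis D P Q lam mu T U X X1); auto; [|lra].
  assert (tp := sf_T _ _ _ _ _ _ _ _ _ S _ (proj1 q0) (HD _ q0)). assert (sp := sqrt_lt_R0 _ tp).
  replace ((2 * x * X1 (x ^ 2) / sqrt (T (X (x ^ 2))) * w) ^ 2) with
    ((2 * x * X1 (x ^ 2)) ^ 2 / sqrt (T (X (x ^ 2))) ^ 2 * w ^ 2) by (field; lra).
  rewrite pow2_sqrt by lra. rewrite (Rpow_mult_distr K).
  apply Rmult_le_compat_r; [apply pow2_ge_0|]. apply HL. lra.
- intros x Hx x1. simpl in x1. nra.
- intros al be al0 albe be1. simpl in be1.
  destruct (surface_lower_bound (al ^ 2) (be ^ 2)) as [k [k0 Hk]].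
  + apply pow2_ge_0.
  + intros q Hq. apply HD. assert (0 < al ^ 2) by (apply pow_lt; auto). nra.
  + exists k. split; auto. intros p v _ Hp. apply Hk. apply nsq_rad_bounds; lra.
- intros n. assert (h : 0 < INR (n + 1)) by (apply lt_0_INR; lia).
  assert (/ INR (Datatypes.S n + 1) <= / INR (n + 1)) by (apply Rinv_le_contravar; auto; apply le_INR; lia). lra.
- intros n. assert (h : 0 < INR (n + 1)) by (apply lt_0_INR; lia).
  assert (i := Rinv_0_lt_compat _ h). assert (1 <= INR (n + 1)) by (apply (le_INR 1); lia).
  assert (/ INR (n + 1) <= 1) by (rewrite <- Rinv_1; apply Rinv_le_contravar; lra). split; simpl; lra.
- intros b b1. simpl in b1. destruct (nfloor_ex (/ (1 - b))) as [n Hn].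
  { left; apply Rinv_0_lt_compat; lra. }
  exists n. rewrite plus_INR. simpl.
  assert (/ (INR n + 1) < 1 - b).
  { rewrite <- (Rinv_inv (1 - b)). apply Rinv_lt_contravar; [|lra].
    apply Rmult_lt_0_compat; [apply Rinv_0_lt_compat; lra|]. assert (h := pos_INR n). lra. }
  assert (0 < / (INR n + 1)) by (apply Rinv_0_lt_compat; assert (h := pos_INR n); lra). lra.
Qed.

Lemma surface_radial_lower k p v : 0 < rad p -> D (nsq p) ->
  k ^ 2 * T (X (nsq p)) <= (2 * rad p * X1 (nsq p)) ^ 2 ->
  (k * (dot p v / rad p)) ^ 2 <= quad (hm P Q) p v.
Proof.
intros r0 Dp Hk. eapply Rle_trans; [|apply (surface_radial_ge D P Q lam mu T U X X1); auto].
assert (q0 : 0 < nsq p) by (rewrite <- rad_nsq; apply pow_lt; auto).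
assert (tp := sf_T _ _ _ _ _ _ _ _ _ S _ q0 Dp). assert (sp := sqrt_lt_R0 _ tp).
replace ((2 * rad p * X1 (nsq p) / sqrt (T (X (nsq p))) * (dot p v / rad p)) ^ 2) with
  ((2 * rad p * X1 (nsq p)) ^ 2 / sqrt (T (X (nsq p))) ^ 2 * (dot p v / rad p) ^ 2) by (field; lra).
rewrite pow2_sqrt by lra. rewrite (Rpow_mult_distr k). apply Rmult_le_compat_r; [apply pow2_ge_0|].
apply (proj1 (Rle_div_r _ _ _ tp)). auto.
Qed.

End SurfaceEnds.

(** The function is the primitive of dy / sqrt (C (1 + y)) at y = c x^2, a lower bound for radial
    length when T <= C (1 + y), which holds for mu < 0. *)
Lemma linear_end_L C c x : 0 < C -> 0 < c ->
  is_derive (fun x => 2 * sqrt ((1 + c * x ^ 2) / C)) x (2 * c * x / (C * sqrt ((1 + c * x ^ 2) / C))).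
Proof.
intros C0 c0. assert (h : 0 < (1 + c * x ^ 2) / C) by (apply Rdiv_lt_0_compat; auto; assert (q := pow2_ge_0 x); nra).
assert (s := sqrt_lt_R0 _ h).
auto_derive; replace ((1 + c * (x * (x * 1))) * / C) with ((1 + c * x ^ 2) / C) by (unfold Rdiv; ring); auto.
field. lra.
Qed.

Lemma linear_end_infty C c : 0 < C -> 0 < c ->
  forall B, exists b, forall x, b <= x -> B <= 2 * sqrt ((1 + c * x ^ 2) / C).
Proof.
intros C0 c0 B. exists (Rmax 0 (B ^ 2 * C / c + 1)). intros x Hx.
assert (m1 := Rmax_l 0 (B ^ 2 * C / c + 1)). assert (m2 := Rmax_r 0 (B ^ 2 * C / c + 1)).
assert (b0 : 0 <= B ^ 2 * C / c) by (apply Rmult_le_pos; [apply Rmult_le_pos; [apply pow2_ge_0|lra]|left; apply Rinv_0_lt_compat; auto]).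
assert (K : B ^ 2 <= (1 + c * x ^ 2) / C).
{ apply (proj1 (Rle_div_r _ _ _ C0)). assert (x1 : 1 <= x) by lra.
  assert (B ^ 2 * C <= c * x).
  { replace (B ^ 2 * C) with (c * (B ^ 2 * C / c)) by (field; lra). apply Rmult_le_compat_l; lra. }
  assert (c * x <= c * x ^ 2) by (apply Rmult_le_compat_l; nra). lra. }
assert (s := sqrt_le_1_alt _ _ K). rewrite <- (pow2_abs B) in s. rewrite sqrt_pow2 in s by apply Rabs_pos.
assert (a := Rle_abs B). assert (p := Rabs_pos B). lra.
Qed.

Lemma Tm_linear_bound t0 u0 lam mu : mu < 0 ->
  exists C, 0 < C /\ forall x, 0 <= x -> Tm t0 u0 lam mu x <= C * (1 + x).
Proof.
intros m0. set (d := lam / (2 * mu)). set (k := (u0 - d) / (4 * mu)).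
exists (Rabs t0 + Rabs d + Rabs k + 1).
assert (a1 := Rabs_pos t0). assert (a2 := Rabs_pos d). assert (a3 := Rabs_pos k). split; [lra|].
intros x x0. unfold Tm. fold d.
replace ((u0 - d) * (exp (4 * mu * x) - 1) / (4 * mu)) with (- k * (1 - exp (4 * mu * x))) by (unfold k; field; lra).
assert (e := exp_pos (4 * mu * x)).
assert (e1 : exp (4 * mu * x) <= 1).
{ rewrite <- exp_0. destruct x0 as [x0|<-]; [left; apply exp_increasing; nra|rewrite Rmult_0_r; lra]. }
assert (b1 := Rle_abs t0). assert (b2 := Rle_abs d). assert (b3 := Rle_abs (- k)). rewrite Rabs_Ropp in b3.
assert (d * x <= Rabs d * x) by (apply Rmult_le_compat_r; auto).
assert (- k * (1 - exp (4 * mu * x)) <= Rabs k).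
{ apply Rle_trans with (Rabs k * (1 - exp (4 * mu * x))); [apply Rmult_le_compat_r; lra|]. nra. }
assert (0 <= Rabs t0 * x) by (apply Rmult_le_pos; auto). assert (0 <= Rabs k * x) by (apply Rmult_le_pos; auto).
lra.
Qed.

Lemma linear_outer D P Q t0 u0 lam mu c :
  surface D P Q lam mu (Tm t0 u0 lam mu) (Um u0 lam mu) (fun q => c * q) (fun _ => c) ->
  0 < c -> mu < 0 -> exists C, 0 < C /\ forall p v, 1 <= rad p -> D (nsq p) ->
  (2 * c * rad p / (C * sqrt ((1 + c * rad p ^ 2) / C)) * (dot p v / rad p)) ^ 2 <= quad (hm P Q) p v.
Proof.
intros S c0 m0. destruct (Tm_linear_bound t0 u0 lam mu m0) as [C [C0 HC]].
exists C. split; auto. intros p v r1 Dp.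
apply (surface_radial_lower _ _ _ _ _ _ _ _ _ S); [lra|auto|].
rewrite <- rad_nsq. set (x := rad p) in *.
assert (h : 0 < (1 + c * x ^ 2) / C) by (apply Rdiv_lt_0_compat; auto; assert (q := pow2_ge_0 x); nra).
assert (s := sqrt_lt_R0 _ h).
replace ((2 * c * x / (C * sqrt ((1 + c * x ^ 2) / C))) ^ 2) with ((2 * c * x) ^ 2 / (C ^ 2 * sqrt ((1 + c * x ^ 2) / C) ^ 2)) by (field; lra).
rewrite pow2_sqrt by lra.
assert (q : 0 <= c * x ^ 2) by (apply Rmult_le_pos; [lra|apply pow2_ge_0]).
replace ((2 * c * x) ^ 2 / (C ^ 2 * ((1 + c * x ^ 2) / C)) * Tm t0 u0 lam mu (c * x ^ 2)) with
  ((2 * x * c) ^ 2 * (Tm t0 u0 lam mu (c * x ^ 2) / (C * (1 + c * x ^ 2)))) by (field; split; lra).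
rewrite <- (Rmult_1_r ((2 * x * c) ^ 2)) at 2. apply Rmult_le_compat_l; [apply pow2_ge_0|].
apply (proj2 (Rle_div_l _ _ (C * (1 + c * x ^ 2)) ltac:(nra))). rewrite Rmult_1_l. auto.
Qed.

(** T dominates k exp (4 mu y), so radial length is at most the convergent integral of exp (- 2 mu
    y) / sqrt k, whose primitive at y = c x^2 is the comparison function. *)
Lemma linear_incomplete D P Q t0 u0 lam mu c (V : pt -> Prop) :
  surface D P Q lam mu (Tm t0 u0 lam mu) (Um u0 lam mu) (fun q => c * q) (fun _ => c) ->
  0 < c -> 0 < mu -> lam < 2 * mu * u0 ->
  (forall p, V p -> D (nsq p)) -> (forall q, 0 < q -> D q) -> (forall x, 1 <= x -> V (x, 0)) ->
  incomplete V (hm P Q).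
Proof.
intros S c0 m0 hl VD HD HV. assert (ud : lam / (2 * mu) < u0) by (apply Rlt_div_l; lra).
destruct (Tm_exp_growth t0 u0 lam mu m0 ud) as [k [M [k0 HM]]].
set (r0 := Rmax 1 (M / c + 1)). assert (m1 := Rmax_l 1 (M / c + 1)). assert (m2 := Rmax_r 1 (M / c + 1)).
fold r0 in m1, m2. assert (sk := sqrt_lt_R0 _ k0).
apply (surface_incomplete_infty _ _ _ _ _ _ _ _ _ S V r0
  (fun x => - exp (- (2 * mu * (c * x ^ 2))) / (2 * mu * sqrt k))
  (fun x => 2 * c * x * exp (- (2 * mu * (c * x ^ 2))) / sqrt k) 0); auto; try lra.
- intros x Hx; apply HV; lra.
- intros x Hx. auto_derive; auto. replace (x * (x * 1)) with (x ^ 2) by ring. field. lra.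
- intros x Hx. assert (e := exp_pos (- (2 * mu * (c * x ^ 2)))).
  apply Rmult_le_pos; [|left; apply Rinv_0_lt_compat; auto]. repeat apply Rmult_le_pos; lra.
- intros x Hx. assert (x2 : M < c * x ^ 2).
  { assert (M / c < x ^ 2) by nra. apply (Rmult_lt_compat_l c) in H; auto. replace (c * (M / c)) with M in H by (field; lra). auto. }
  destruct (HM _ x2) as [_ K].
  assert (e := exp_pos (4 * mu * (c * x ^ 2))).
  replace ((2 * c * x * exp (- (2 * mu * (c * x ^ 2))) / sqrt k) ^ 2) with
    ((2 * c * x) ^ 2 * (exp (- (2 * mu * (c * x ^ 2))) * exp (- (2 * mu * (c * x ^ 2)))) / (sqrt k ^ 2)) by (field; lra).
  rewrite pow2_sqrt, <- exp_plus by lra.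
  replace (- (2 * mu * (c * x ^ 2)) + - (2 * mu * (c * x ^ 2))) with (- (4 * mu * (c * x ^ 2))) by ring.
  rewrite exp_Ropp. replace ((2 * c * x) ^ 2 * / exp (4 * mu * (c * x ^ 2)) / k) with
    ((2 * x * c) ^ 2 * / (k * exp (4 * mu * (c * x ^ 2)))) by (field; lra).
  apply Rmult_le_compat_l; [apply pow2_ge_0|]. apply Rinv_le_contravar; auto. apply Rmult_lt_0_compat; auto.
- intros x Hx. assert (e := exp_pos (- (2 * mu * (c * x ^ 2)))).
  assert (0 < exp (- (2 * mu * (c * x ^ 2))) / (2 * mu * sqrt k)).
  { apply Rdiv_lt_0_compat; auto. repeat apply Rmult_lt_0_compat; lra. }
  unfold Rdiv in *. rewrite Ropp_mult_distr_l_reverse. lra.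
Qed.

(** * Metrics on the whole plane *)

Section OriginPlane.

Variables (lam mu c : R).
Hypothesis mu0 : mu <> 0.
Hypothesis c0 : 0 < c.
Hypothesis Upos : forall x, 0 < x -> 0 < Um 1 lam mu x.

(** Changing c pulls the metric back by a dilation of the plane; c = 1 / nu^2 will exhibit the
    steady families as literal multiples of one metric. *)
Definition origin_metric (lam mu c : R) : metric := hm (origin_P lam mu c) (origin_Q lam mu c).

Lemma plane_surface : surface (fun _ => True) (origin_P lam mu c) (origin_Q lam mu c) lam mu
  (Tm 0 1 lam mu) (Um 1 lam mu) (fun q => c * q) (fun _ => c).
Proof.
apply origin_surface; auto; [apply open_true|].
intros q q0 _. apply origin_S_pos; auto; [nra|]. intros; apply Upos; lra.
Qed.

Lemma plane_soliton : gradient_soliton plane (origin_metric lam mu c) lam.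
Proof. apply (gradient_soliton_sub (dom (fun _ => True))); [intros; exact I|apply plane_surface]. Qed.

Lemma plane_riemannian : riemannian plane (origin_metric lam mu c).
Proof. apply plane_soliton. Qed.

Lemma plane_gauss p : gauss (origin_metric lam mu c) p =
  (lam - 2 * mu) * exp (4 * mu * (c * nsq p)).
Proof.
unfold origin_metric. rewrite (sf_curv _ _ _ _ _ _ _ _ _ plane_surface p I), Um_curv by auto. ring.
Qed.

Lemma plane_pos_curved : 2 * mu < lam -> pos_curved plane (origin_metric lam mu c).
Proof. intros H p _. rewrite plane_gauss. apply Rmult_lt_0_compat; [lra|apply exp_pos]. Qed.

Lemma plane_neg_curved : lam < 2 * mu -> neg_curved plane (origin_metric lam mu c).
Proof.
intros H p _. rewrite plane_gauss. assert (e := exp_pos (4 * mu * (c * nsq p))).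
assert (0 < (2 * mu - lam) * exp (4 * mu * (c * nsq p))) by (apply Rmult_lt_0_compat; lra). lra.
Qed.

Lemma plane_realizes a e1 :
  (forall x, 0 < x -> a (Tm 0 1 lam mu x) = / Um 1 lam mu x) ->
  filterlim (Tm 0 1 lam mu) (Rbar_locally p_infty) (Rbar_locally e1) ->
  realizes (origin_metric lam mu c) p_infty 0 e1 (G a).
Proof.
intros Ha He1. apply (surface_realizes _ _ _ _ _ _ _ _ _ _ _ _ _ plane_surface).
- intros x x0 _. assert (h : 0 < c * x ^ 2) by (apply Rmult_lt_0_compat; auto; apply pow_lt; auto).
  split; [exact I|]. split; [assert (u := Upos _ h); lra|auto].
- apply (filterlim_comp _ _ _ (fun x => c * x ^ 2) (Tm 0 1 lam mu) _ (at_right 0)).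
  + apply square_at_right_0; auto.
  + apply Tm_at_right_0; auto.
- apply (filterlim_comp _ _ _ (fun x => c * x ^ 2) (Tm 0 1 lam mu) _ (Rbar_locally p_infty)); auto.
  apply square_p_infty; auto.
Qed.

Lemma plane_complete : mu < 0 -> Defs.complete plane (origin_metric lam mu c).
Proof.
intros m0. destruct (linear_outer _ _ _ _ _ _ _ _ plane_surface c0 m0) as [C [C0 HC]].
apply (complete_plane _ 1 (fun x => 2 * sqrt ((1 + c * x ^ 2) / C))
  (fun x => 2 * c * x / (C * sqrt ((1 + c * x ^ 2) / C)))).
- apply plane_riemannian.
- lra.
- intros x _. apply linear_end_L; auto.
- intros p v r1. apply HC; auto.
- apply linear_end_infty; auto.
- intros b. destruct (surface_lower_bound _ _ _ _ _ _ _ _ _ plane_surface 0 (b ^ 2) (Rle_refl 0)) as [k [k0 K]]; [auto|].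
  exists k. split; auto. intros p v Hp. apply K. split; [apply nsq_ge0|].
  rewrite <- rad_nsq. assert (r := rad_ge0 p). nra.
Qed.

Lemma plane_incomplete : 0 < mu -> lam < 2 * mu -> incomplete plane (origin_metric lam mu c).
Proof.
intros m0 hl. apply (linear_incomplete _ _ _ _ _ _ _ _ plane plane_surface); auto; try lra.
intros; exact I.
Qed.

End OriginPlane.

(** The circumference 2 pi sqrt (q P) is critical at q = 1 exactly when P' (1) = - P (1). The
    standard parametrization then has zero acceleration, so it is itself a geodesic. *)
Lemma geodesic_circle P Q :
  ex_derive P 1 -> ex_derive Q 1 -> P 1 = 1 -> 0 < 1 + Q 1 -> Derive P 1 = - 1 ->
  circle_totally_geodesic (hm P Q) /\ curve_length (hm P Q) circle_param 0 (2 * PI) = 2 * PI.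
Proof.
intros eP eQ P1 N1 dP.
assert (cs : forall t, cos t ^ 2 + sin t ^ 2 = 1).
{ intros t. assert (h := sin2_cos2 t). unfold Rsqr in h. lra. }
assert (q1 : forall t, nsq (circle_param t) = 1) by (intros t; unfold nsq, circle_param; simpl fst; simpl snd; apply cs).
assert (vel : forall t, velocity circle_param t = (- sin t, cos t)).
{ intros t. unfold velocity, circle_param. simpl. f_equal; apply is_derive_unique; auto_derive; auto; ring. }
split.
- intros t n _.
  assert (acc : acceleration (hm P Q) circle_param t = (0, 0)).
  { assert (Chr : forall k i j, christoffel (hm P Q) k i j (circle_param t) =
      (comp i (circle_param t) * kron j k + comp j (circle_param t) * kron i k) * (-1) +
      kron i j * comp k (circle_param t) +
      comp i (circle_param t) * comp j (circle_param t) * comp k (circle_param t) *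
      ((Derive Q 1 - 2 * (-1) * Q 1) / (1 + Q 1))).
    { intros k i j. rewrite (christoffel_hm P Q _ (-1) (Derive Q 1)); rewrite ?q1, ?P1.
      - field. lra.
      - rewrite <- dP. apply Derive_correct; auto.
      - apply Derive_correct; auto.
      - lra.
      - lra. }
    assert (D2c : Derive_n (fun s => comp X1 (circle_param s)) 2 t = - cos t).
    { simpl. rewrite (Derive_ext _ (fun s => - sin s)).
      - apply is_derive_unique. auto_derive; auto; ring.
      - intros s. apply is_derive_unique. auto_derive; auto; ring. }
    assert (D2s : Derive_n (fun s => comp X2 (circle_param s)) 2 t = - sin t).
    { simpl. rewrite (Derive_ext _ (fun s => cos s)).
      - apply is_derive_unique. auto_derive; auto; ring.
      - intros s. apply is_derive_unique. auto_derive; auto; ring. }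
    unfold acceleration. rewrite D2c, D2s, vel. unfold sum_ix. rewrite !Chr.
    generalize ((Derive Q 1 - 2 * (-1) * Q 1) / (1 + Q 1)). intros g.
    simpl comp. simpl kron. assert (c := cs t).
    set (x := cos t) in *. set (y := sin t) in *.
    f_equal.
    - transitivity (- x + (x ^ 2 + y ^ 2) * x); [ring|rewrite c; ring].
    - transitivity (- y + (x ^ 2 + y ^ 2) * y); [ring|rewrite c; ring]. }
  rewrite acc. unfold bilin, sum_ix. simpl comp. ring.
- unfold curve_length. rewrite (RInt_ext _ (fun _ => 1)).
  + rewrite RInt_const. unfold scal; simpl; unfold mult; simpl. ring.
  + intros t _. rewrite vel, quad_hm, q1, P1.
    replace (nsq (- sin t, cos t)) with 1 by (unfold nsq; simpl fst; simpl snd; rewrite <- (cs t); ring).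
    replace (dot (circle_param t) (- sin t, cos t)) with 0 by (unfold dot, circle_param; simpl fst; simpl snd; ring).
    transitivity (sqrt 1); [f_equal; ring|apply sqrt_1].
Qed.

(** Since q P = 4 T, the circumference is critical where U vanishes. *)
Lemma surface_geodesic D P Q lam mu T U X X1 :
  surface D P Q lam mu T U X X1 -> D 1 -> T (X 1) = 1 / 4 -> U (X 1) = 0 ->
  circle_totally_geodesic (hm P Q) /\ curve_length (hm P Q) circle_param 0 (2 * PI) = 2 * PI.
Proof.
intros S D1 T1 U1.
assert (P1 : P 1 = 1) by (rewrite (sf_PT _ _ _ _ _ _ _ _ _ S 1 Rlt_0_1 D1), T1; field).
assert (N := sf_N _ _ _ _ _ _ _ _ _ S 1 Rle_0_1 D1). rewrite P1, Rmult_1_l in N.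
destruct (sf_ex _ _ _ _ _ _ _ _ _ S 1 Rle_0_1 D1) as [eP eQ].
apply geodesic_circle; auto.
assert (oD := sf_open _ _ _ _ _ _ _ _ _ S).
apply (is_derive_eq_loc (fun q => 0 < q /\ D q) P (fun q => 4 * T (X q) / q) 1).
- apply open_and_pos; auto.
- split; auto; lra.
- intros y [y0 Dy]. apply S; auto.
- apply Derive_correct; auto.
- assert (d : is_derive (fun q => T (X q)) 1 (X1 1 * U (X 1))).
  { apply (is_derive_comp T X); apply S; auto; lra. }
  rewrite U1, Rmult_0_r in d.
  replace (- 1) with ((4 * 0) * / 1 + (4 * T (X 1)) * (- 1 / 1 ^ 2)) by (rewrite T1; field).
  apply (is_derive_mult (fun q => 4 * T (X q)) Rinv 1 (4 * 0) (- 1 / 1 ^ 2)).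
  + apply (is_derive_scal (fun q => T (X q))); auto.
  + auto_derive; [lra|field].
  + intros; apply Rmult_comm.
Qed.

(** * Shrinking solitons on disks *)

Lemma positive_near (f : R -> R) x : continuous f x -> 0 < f x ->
  exists e, 0 < e /\ forall y, Rabs (y - x) < e -> 0 < f y.
Proof.
intros C H. destruct (C (fun z => 0 < z) (open_gt 0 _ H)) as [e He].
exists e. split; [apply cond_pos|]. intros y Hy. apply He. exact Hy.
Qed.

Lemma disk_rad r p : 0 <= r -> rad p < r -> nsq p < r ^ 2.
Proof. intros r0 H. rewrite <- rad_nsq. assert (a := rad_ge0 p). nra. Qed.

(** U decreases to its zero x1, and the blow-up of a forces T (x1) = 1 / 4: a smaller value would
    leave heights below 1 / 4 that T does not reach before x1, a larger one would keep 1 / a away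
    from 0 near 1 / 4. *)
Lemma disk_profile_end lam mu a : 0 < lam -> mu <> 0 -> gam lam mu < 1 -> g4_profile lam mu a ->
  exists x1, 0 < x1 /\ Um 1 lam mu x1 = 0 /\ Tm 0 1 lam mu x1 = 1 / 4 /\
    (forall x, x < x1 -> 0 < Um 1 lam mu x) /\
    (forall x, 0 < x < x1 -> a (Tm 0 1 lam mu x) = / Um 1 lam mu x).
Proof.
intros l0 mu0 g1 Hp. assert (Hp' := Hp). destruct Hp' as [prof [one blow]].
set (gm := gam lam mu) in *.
assert (gmE : 2 * mu = gm * lam) by (unfold gm, gam; field; lra).
assert (gm0 : gm <> 0) by (intros h; rewrite h in gmE; lra).
assert (dE : lam / (2 * mu) = / gm) by (rewrite gmE; field; lra).
assert (ud : 1 <> lam / (2 * mu)).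
{ rewrite dE. intros h. apply (f_equal Rinv) in h. rewrite Rinv_1, Rinv_inv in h. lra. }
set (U := Um 1 lam mu). set (T := Tm 0 1 lam mu).
(* The root of 1 / gm + (1 - 1 / gm) exp (4 mu x) = 0. *)
set (x1 := - ln (1 - gm) / (4 * mu)).
assert (x10 : 0 < x1).
{ unfold x1. destruct (Rtotal_order mu 0) as [h|[h|h]]; [|lra|].
  - assert (gm < 0) by nra. assert (0 < ln (1 - gm)) by (rewrite <- ln_1; apply ln_increasing; lra).
    replace (- ln (1 - gm) / (4 * mu)) with (ln (1 - gm) / (4 * - mu)) by (field; lra). apply Rdiv_lt_0_compat; lra.
  - assert (0 < gm) by nra. assert (ln (1 - gm) < 0) by (rewrite <- ln_1; apply ln_increasing; lra).
    apply Rdiv_lt_0_compat; lra. }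
assert (Ux1 : U x1 = 0).
{ unfold U, Um, x1. rewrite dE. replace (4 * mu * (- ln (1 - gm) / (4 * mu))) with (- ln (1 - gm)) by (field; auto).
  rewrite exp_Ropp, exp_ln by lra. field. split; lra. }
assert (Udec : forall x y, x < y -> U y < U x).
{ intros x y xy. assert (- U x < - U y); [|lra].
  apply (increasing_deriv (fun x => - U x) (fun x => - (4 * mu * U x - 2 * lam))); auto; intros z Hz.
  - apply (is_derive_opp (V := R_NormedModule) U). apply dUm; auto.
  - assert (e := Um_curv 1 lam mu z mu0). fold U in e. assert (p := exp_pos (4 * mu * z)).
    assert (0 < (lam - 2 * mu * 1) * exp (4 * mu * z)).
    { apply Rmult_lt_0_compat; auto. rewrite gmE. nra. }
    lra. }
assert (Upos : forall x, x < x1 -> 0 < U x) by (intros x Hx; rewrite <- Ux1; apply Udec; auto).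
assert (Tinc : forall x y, x < y -> y <= x1 -> T x < T y).
{ intros x y xy yx. apply Tm_lt; auto. intros z Hz. apply Upos. lra. }
destruct (profile_limit_form lam mu 1 0 (1 / 4) a mu0 ud) as [y Hy]; auto.
{ simpl; lra. }
{ apply one_at_0_inv; auto. }
assert (yx1 : forall t, 0 < t < 1 / 4 -> y t < x1).
{ intros t [ta tb]. destruct (Hy t ta tb) as [_ [_ K]]. fold U in K. destruct (prof t ta tb) as [p _].
  apply Rnot_le_lt; intros h. assert (U (y t) <= 0).
  { destruct h as [h|h]; [rewrite <- Ux1; left; auto|rewrite <- h; lra]. }
  rewrite K in H. assert (i := Rinv_0_lt_compat _ p). lra. }
assert (Tge : 1 / 4 <= T x1).
{ apply Rnot_lt_le. intros h. set (t := (Rmax (T x1) 0 + 1 / 4) / 2).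
  assert (m1 := Rmax_l (T x1) 0). assert (m2 := Rmax_r (T x1) 0).
  assert (m3 : Rmax (T x1) 0 < 1 / 4) by (apply Rmax_lub_lt; lra).
  assert (Ht : 0 < t < 1 / 4) by (unfold t; lra).
  destruct (Hy t (proj1 Ht) (proj2 Ht)) as [_ [K _]]. fold T in K.
  assert (T (y t) < T x1) by (apply Tinc; [apply yx1; auto|lra]). unfold t in *. lra. }
assert (T0 : T 0 = 0) by apply Tm_0.
assert (Tx1 : T x1 = 1 / 4).
{ destruct Tge as [h|h]; auto. exfalso.
  destruct (Ranalysis5.IVT_interv (fun x => T x - 1 / 4) 0 x1) as [x2 [Hx2 e]]; try lra.
  { intros x _. apply continuity_pt_minus; [|apply continuity_pt_const; intros ? ?; reflexivity].
    apply continuity_pt_filterlim, Tm_continuous; auto. }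
  assert (x21 : x2 < x1) by (destruct (proj2 Hx2) as [k|k]; auto; subst x2; lra).
  assert (L := blows_up_inv a (at_left (1 / 4)) blow).
  assert (K := proj1 (filterlim_locally _ _) L (mkposreal _ (Upos x2 x21))).
  destruct (at_left_ex _ 0 (1 / 4) ltac:(lra) K) as [t [Ht Hb]].
  change (Rabs (/ a t - 0) < U x2) in Hb. apply Rabs_def2 in Hb.
  destruct (Hy t (proj1 Ht) (proj2 Ht)) as [y0 [Ty Uy]]. fold T in Ty. fold U in Uy.
  assert (h2 : y t < x2).
  { apply Rnot_le_lt. intros hh. assert (T x2 <= T (y t)).
    { destruct hh as [hh|hh]; [left; apply Tinc; auto; left; apply yx1; auto|rewrite hh; lra]. }
    lra. }
  assert (U x2 < U (y t)) by (apply Udec; auto). lra. }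
exists x1. repeat split; auto.
intros x Hx. apply (profile_value lam mu 1 0 (1 / 4) a); auto.
- apply one_at_0_inv; auto.
- lra.
- intros z Hz. apply Upos. lra.
- simpl. fold T. rewrite <- Tx1. apply Tinc; lra.
Qed.

(** Taking c = x1 places the zero of U, hence the geodesic circle, at q = 1. *)
Lemma g4_metric lam mu a : 0 < lam -> mu <> 0 -> gam lam mu < 1 -> g4_profile lam mu a ->
  exists h nu, closed_disk_metric a h nu /\ shrinking_soliton (disk 1) h lam /\
    incomplete (disk 1) h /\ pos_curved (disk 1) h /\ geodesic_boundary disk h.
Proof.
intros l0 mu0 g1 Hp.
assert (cv : 2 * mu < lam).
{ unfold gam in g1. apply (Rmult_lt_compat_r lam) in g1; auto. replace (2 * mu / lam * lam) with (2 * mu) in g1 by (field; lra). lra. }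
destruct (dprof_of_profile lam mu a l0 mu0 g1 Hp) as [Dp _].
destruct (disk_profile_end lam mu a l0 mu0 g1 Hp) as [x1 [x10 [Ux1 [Tx1 [Upos aT]]]]].
(* T (x) / x is continuous and positive at x1, so the same formulas define the metric slightly
   beyond the closed disk. *)
assert (Cs : continuous (origin_S lam mu) x1).
{ unfold origin_S. apply (continuous_plus (V := R_NormedModule) (fun _ => 1)); [apply continuous_const|].
  apply (continuous_mult (K := R_AbsRing) (fun x => x)); [apply continuous_id|].
  apply (ex_derive_continuous (fun x => (4 * mu - 2 * lam) * phi2 (4 * mu * x))).
  eexists. apply PS_affine, CV_radius_phi2. }
assert (Sx1 : 0 < origin_S lam mu x1) by (apply origin_S_pos; auto; [lra|intros; apply Upos; lra]).
destruct (positive_near _ _ Cs Sx1) as [e [e0 He]].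
pose (D q := q < 1 + e / x1).
assert (ex : 0 < e / x1) by (apply Rdiv_lt_0_compat; auto).
assert (S : surface D (origin_P lam mu x1) (origin_Q lam mu x1) lam mu
  (Tm 0 1 lam mu) (Um 1 lam mu) (fun q => x1 * q) (fun _ => x1)).
{ apply origin_surface; auto; [apply open_lt|].
  intros q q0 Dq. destruct (Rle_lt_dec q 1) as [h|h].
  - apply origin_S_pos; auto; [nra|]. intros z Hz. apply Upos. nra.
  - apply He. rewrite Rabs_right by nra. unfold D in Dq.
    apply (Rmult_lt_compat_l x1) in Dq; auto. replace (x1 * (1 + e / x1)) with (x1 + e) in Dq by (field; lra). lra. }
set (h := hm (origin_P lam mu x1) (origin_Q lam mu x1)) in *.
assert (D1 : forall q, q <= 1 -> D q) by (intros q Hq; unfold D; lra).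
assert (V1 : forall p, disk 1 p -> D (nsq p)).
{ intros p Hp'. apply D1. assert (k := disk_rad 1 p ltac:(lra) Hp'). lra. }
assert (sm : smooth_to_boundary disk h).
{ exists (sqrt (1 + e / x1)). split.
  - rewrite <- sqrt_1 at 1. apply sqrt_lt_1; lra.
  - apply (riemannian_sub (dom D)); [|apply S]. intros p Hp'. unfold dom, D.
    assert (k := disk_rad _ p (sqrt_pos _) Hp'). rewrite pow2_sqrt in k by lra. auto. }
assert (T0 := Tm_continuous 0 1 lam mu x1 mu0).
assert (re : realizes h 1 0 (1 / 4) (G a)).
{ apply (surface_realizes _ _ _ _ _ _ _ _ _ _ _ _ _ S).
  - intros x x0 xr. simpl in xr. assert (x2 : 0 < x ^ 2 < 1) by nra.
    split; [apply D1; lra|]. split.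
    + assert (k : 0 < Um 1 lam mu (x1 * x ^ 2)) by (apply Upos; nra). lra.
    + apply aT. split; nra.
  - apply (filterlim_comp _ _ _ (fun x => x1 * x ^ 2) (Tm 0 1 lam mu) _ (at_right 0)).
    + apply square_at_right_0; auto.
    + apply Tm_at_right_0; auto.
  - assert (C : continuous (fun x => Tm 0 1 lam mu (x1 * x ^ 2)) 1).
    { apply (continuous_comp (fun x => x1 * x ^ 2) (Tm 0 1 lam mu)).
      + apply (ex_derive_continuous (fun x => x1 * x ^ 2)). auto_derive; auto.
      + apply Tm_continuous; auto. }
    assert (K := filterlim_at_left_of_continuous _ 1 C). cbv beta in K.
    replace (x1 * 1 ^ 2) with x1 in K by ring. rewrite Tx1 in K. exact K. }
destruct (disk_dist a h sm re) as [nu [r [sd _]]].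
{ intros t [ta tb]. destruct (proj1 Hp t ta tb) as [p d]. split; auto.
  apply (ex_derive_continuous a). eexists; eauto. }
exists h, nu. split; [split; auto|]. split; [split; auto|split; [|split]].
- apply (gradient_soliton_sub (dom D)); [exact V1|apply S].
- assert (m0 : 0 < Tm 0 1 lam mu (x1 / 4)).
  { apply Tm_pos; auto; [lra|lra|]. intros z Hz. apply Upos. lra. }
  assert (sm0 := sqrt_lt_R0 _ m0).
  (* For x >= 1 / 2 the momentum x1 x^2 is at least x1 / 4, and T at that point bounds the
     denominator of the radial speed from below. *)
  apply (surface_incomplete_one _ _ _ _ _ _ _ _ _ S (disk 1) (2 * x1 / sqrt (Tm 0 1 lam mu (x1 / 4)))); auto.
  + intros q Hq. apply D1. lra.
  + intros x Hx. unfold disk. rewrite rad_axis; lra.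
  + apply Rmult_le_pos; [lra|left; apply Rinv_0_lt_compat; auto].
  + intros x Hx.
    replace ((2 * x1 / sqrt (Tm 0 1 lam mu (x1 / 4))) ^ 2) with ((2 * x1) ^ 2 / sqrt (Tm 0 1 lam mu (x1 / 4)) ^ 2) by (field; lra).
    rewrite pow2_sqrt by lra.
    assert (mono : Tm 0 1 lam mu (x1 / 4) <= Tm 0 1 lam mu (x1 * x ^ 2)).
    { assert (x2 : / 4 <= x ^ 2 < 1) by nra.
      assert (q : x1 / 4 <= x1 * x ^ 2) by (apply Rmult_le_compat_l; lra). destruct q as [q|q]; [|rewrite <- q; lra].
      left. apply Tm_lt; auto. intros z Hz. apply Upos. nra. }
    apply Rmult_le_compat.
    * apply pow2_ge_0.
    * left; apply Rinv_0_lt_compat. lra.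
    * rewrite !Rpow_mult_distr. assert (x ^ 2 <= 1) by nra. assert (0 < x1 ^ 2) by (apply pow_lt; auto). nra.
    * apply Rinv_le_contravar; auto.
- intros p Hp'. unfold h. rewrite (sf_curv _ _ _ _ _ _ _ _ _ S p (V1 p Hp')), Um_curv by auto.
  apply Rmult_lt_0_compat; [lra|apply exp_pos].
- destruct (surface_geodesic _ _ _ _ _ _ _ _ _ S) as [G1 G2].
  + apply D1; lra.
  + rewrite Rmult_1_r; auto.
  + rewrite Rmult_1_r; auto.
  + split; auto.
Qed.

(** * Metrics on annuli *)

Lemma ck_nsq_pos (D : R -> Prop) : open D -> (forall q, D q -> 0 < q) -> forall n,
  ck n (dom D) (fun p => ln (nsq p)) /\ ck n (dom D) (fun p => / nsq p).
Proof.
intros oD Dp n. assert (oV := open_dom D oD). split.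
- apply ck_ln; auto. apply ck_nsq; auto.
- apply ck_inv; auto; [|apply ck_nsq; auto]. intros p Hp. specialize (Dp _ Hp). lra.
Qed.

Lemma log_surface t0 u0 lam mu k (D : R -> Prop) : mu <> 0 -> k <> 0 -> open D -> (forall q, D q -> 0 < q) ->
  (forall q, D q -> 0 < Tm t0 u0 lam mu (k * ln q)) ->
  surface D (radial_P t0 u0 lam mu (fun q => k * ln q)) (radial_Q t0 u0 lam mu (fun q => k * ln q) (fun q => k / q))
   lam mu (Tm t0 u0 lam mu) (Um u0 lam mu) (fun q => k * ln q) (fun q => k / q).
Proof.
intros m0 k0 oD Dp Tp.
apply (radial_surface t0 u0 lam mu D (fun q => k * ln q) (fun q => k / q) (fun q => - k / q ^ 2) (fun q => 2 * k / q ^ 3)); auto.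
- intros q Dq. specialize (Dp q Dq). auto_derive; auto. field. lra.
- intros q Dq. specialize (Dp q Dq). auto_derive; [lra|]. field. lra.
- intros q Dq. specialize (Dp q Dq). auto_derive; [nz|]. field. lra.
- intros q Dq. specialize (Dp q Dq). unfold Rdiv. apply Rmult_integral_contrapositive_currified; auto.
  apply Rinv_neq_0_compat. lra.
- intros n. apply ck_mult; [apply open_dom; auto|apply ck_const, open_dom; auto|apply ck_nsq_pos; auto].
- intros n. unfold Rdiv. apply ck_mult; [apply open_dom; auto|apply ck_const, open_dom; auto|apply ck_nsq_pos; auto].
Qed.

Lemma linear_surface t0 u0 lam mu : mu <> 0 -> (forall q, 0 < q -> 0 < Tm t0 u0 lam mu q) ->
  surface (fun q => 0 < q) (radial_P t0 u0 lam mu (fun q => 1 * q)) (radial_Q t0 u0 lam mu (fun q => 1 * q) (fun _ => 1))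
   lam mu (Tm t0 u0 lam mu) (Um u0 lam mu) (fun q => 1 * q) (fun _ => 1).
Proof.
intros m0 Tp. assert (oD : open (fun q : R => 0 < q)) by apply open_gt.
apply (radial_surface t0 u0 lam mu (fun q => 0 < q) (fun q => 1 * q) (fun _ => 1) (fun _ => 0) (fun _ => 0)); auto; intros.
- auto_derive; auto; ring.
- auto_derive; auto.
- auto_derive; auto.
- apply ck_mult; [apply open_dom; auto|apply ck_const, open_dom; auto|apply ck_nsq, open_dom; auto].
- apply ck_const, open_dom; auto.
- rewrite Rmult_1_l; auto.
Qed.

Lemma punctured_nsq p : punctured_plane p -> 0 < nsq p.
Proof. intros H. rewrite <- rad_nsq. apply pow_lt. exact H. Qed.

Lemma log_square_at_right_0 k : 0 < k ->
  filterlim (fun x => - k * ln (x ^ 2)) (at_right 0) (Rbar_locally p_infty) /\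
  filterlim (fun x => k * ln (x ^ 2)) (at_right 0) (Rbar_locally m_infty).
Proof.
intros k0.
assert (L : filterlim (fun x => ln (1 * x ^ 2)) (at_right 0) (Rbar_locally m_infty)).
{ apply (filterlim_comp _ _ _ (fun x => 1 * x ^ 2) ln _ (at_right 0)); [apply square_at_right_0; lra|apply is_lim_ln_0]. }
split; intros P [M HM].
- assert (K := L (fun z => z < - M / k) (ex_intro _ (- M / k) (fun x H => H))).
  revert K. unfold filtermap. apply filter_imp. intros x Hx. apply HM. rewrite Rmult_1_l in Hx.
  apply (Rmult_lt_compat_l k) in Hx; auto. replace (k * (- M / k)) with (- M) in Hx by (field; lra). lra.
- assert (K := L (fun z => z < M / k) (ex_intro _ (M / k) (fun x H => H))).
  revert K. unfold filtermap. apply filter_imp. intros x Hx. apply HM. rewrite Rmult_1_l in Hx.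
  apply (Rmult_lt_compat_l k) in Hx; auto. replace (k * (M / k)) with M in Hx by (field; lra). lra.
Qed.

Lemma log_square_p_infty k : 0 < k ->
  filterlim (fun x => k * ln (x ^ 2)) (Rbar_locally p_infty) (Rbar_locally p_infty).
Proof.
intros k0 P [M HM].
assert (L : filterlim (fun x => 1 * x ^ 2) (Rbar_locally p_infty) (Rbar_locally p_infty)) by (apply square_p_infty; lra).
assert (K := L (fun z => exp (M / k) < z) (ex_intro _ _ (fun x H => H))).
revert K. unfold filtermap. apply filter_imp. intros x Hx. apply HM. rewrite Rmult_1_l in Hx.
apply ln_increasing in Hx; [|apply exp_pos]. rewrite ln_exp in Hx.
apply (Rmult_lt_compat_l k) in Hx; auto. replace (k * (M / k)) with M in Hx by (field; lra). lra.
Qed.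

(** With x = ln q / 4 the exponential exp (4 x) is q itself, so T = nu^2 / 4 + q and U = 4 q. *)
Lemma g3_metric nu : 0 <= nu -> exists h : metric,
  realizes h p_infty (nu ^ 2 / 4) p_infty (G (a3 nu)) /\
  steady_soliton punctured_plane h /\ incomplete punctured_plane h /\
  neg_curved punctured_plane h /\ asymptotic_cylinder (at_right 0) h nu /\
  asymptotic_g2 (Rbar_locally p_infty) h 1.
Proof.
intros n0. set (t0 := nu ^ 2 / 4 + 1).
assert (m0 : 1 <> 0) by lra.
assert (TE : forall y, Tm t0 4 0 1 y = nu ^ 2 / 4 + exp (4 * y)).
{ intros y. unfold Tm, t0. rewrite !Rmult_1_r. field. }
assert (UE : forall y, Um 4 0 1 y = 4 * exp (4 * y)).
{ intros y. unfold Um. rewrite !Rmult_1_r. field. }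
assert (n2 := pow2_ge_0 nu).
assert (S : surface (fun q => 0 < q) (radial_P t0 4 0 1 (fun q => / 4 * ln q)) (radial_Q t0 4 0 1 (fun q => / 4 * ln q) (fun q => / 4 / q))
   0 1 (Tm t0 4 0 1) (Um 4 0 1) (fun q => / 4 * ln q) (fun q => / 4 / q)).
{ apply log_surface; auto; [lra|apply open_gt|]. intros q q0. rewrite TE.
  assert (e := exp_pos (4 * (/ 4 * ln q))). lra. }
assert (TX : forall q, 0 < q -> Tm t0 4 0 1 (/ 4 * ln q) = nu ^ 2 / 4 + q).
{ intros q q0. rewrite TE. replace (4 * (/ 4 * ln q)) with (ln q) by field. rewrite exp_ln; auto. }
assert (UX : forall q, 0 < q -> Um 4 0 1 (/ 4 * ln q) = 4 * q).
{ intros q q0. rewrite UE. replace (4 * (/ 4 * ln q)) with (ln q) by field. rewrite exp_ln; auto. }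
exists (hm (radial_P t0 4 0 1 (fun q => / 4 * ln q)) (radial_Q t0 4 0 1 (fun q => / 4 * ln q) (fun q => / 4 / q))).
assert (F0 : at_right 0 (fun x : R => 0 < x /\ 0 < x ^ 2)).
{ generalize (within_self 0 (fun x => 0 < x)). apply filter_imp. intros x x0. split; auto. apply pow_lt; auto. }
split; [|split; [|split; [|split; [|split]]]].
- apply (surface_realizes _ _ _ _ _ _ _ _ _ _ _ _ _ S).
  + intros x x0 _. assert (q0 : 0 < x ^ 2) by (apply pow_lt; auto).
    split; [exact q0|]. rewrite TX, UX by auto. split; [lra|]. unfold a3. f_equal. field.
  + apply (filterlim_ext_loc (fun x => nu ^ 2 / 4 + x ^ 2)).
    * revert F0. apply filter_imp. intros x [_ x2]. rewrite TX; auto.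
    * assert (C : continuous (fun x => nu ^ 2 / 4 + x ^ 2) 0) by (apply (ex_derive_continuous (fun x => nu ^ 2 / 4 + x ^ 2)); auto_derive; auto).
      assert (K := filterlim_at_right_of_continuous _ 0 C). cbv beta in K.
      replace (nu ^ 2 / 4 + 0 ^ 2) with (nu ^ 2 / 4) in K by ring. exact K.
  + apply (filterlim_comp _ _ _ (fun x => / 4 * ln (x ^ 2)) (Tm t0 4 0 1) _ (Rbar_locally p_infty)).
    * apply log_square_p_infty. lra.
    * apply Tm_unbounded_pos; lra.
- apply (gradient_soliton_sub (dom (fun q => 0 < q))); [apply punctured_nsq|apply S].
(* The radial speed is 1 / (2 x sqrt T) with T >= x^2, hence at most 1 / (2 x^2), which has the
   bounded primitive - 1 / (2 x). *)
- apply (surface_incomplete_infty _ _ _ _ _ _ _ _ _ S punctured_plane 1 (fun x => - / (2 * x)) (fun x => / (2 * x ^ 2)) 0); auto; try lra.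
  + apply punctured_nsq.
  + intros x x1. unfold punctured_plane. rewrite rad_axis; lra.
  + intros x x1. auto_derive; [lra|]. field. lra.
  + intros x x1. left; apply Rinv_0_lt_compat. nra.
  + intros x x1. assert (q0 : 0 < x ^ 2) by nra. rewrite TX by auto.
    replace ((2 * x * (/ 4 / x ^ 2)) ^ 2) with (/ (4 * x ^ 2)) by (field; lra).
    replace ((/ (2 * x ^ 2)) ^ 2) with (/ (4 * x ^ 2) * / x ^ 2) by (field; lra).
    apply Rmult_le_compat_l; [left; apply Rinv_0_lt_compat; lra|]. apply Rinv_le_contravar; lra.
  + intros x x1. assert (0 < / (2 * x)) by (apply Rinv_0_lt_compat; lra). lra.
- intros p Hp. assert (q0 := punctured_nsq p Hp). rewrite (sf_curv _ _ _ _ _ _ _ _ _ S p q0), UX by auto. lra.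
- apply (asymptotic_cylinder_end _ _ _ t0 4 0 1 _ _ S m0); auto; try typeclasses eauto.
  apply log_square_at_right_0. lra.
- apply (asymptotic_g2_end _ _ _ t0 4 0 1 _ _ S m0); auto; try typeclasses eauto; try lra.
  + apply F_infty_axis; auto.
  + apply log_square_p_infty. lra.
Qed.

(** The data t0 = u0 = 0 give T a double zero at x = 0, which pushes the puncture to infinite
    distance. *)
Definition cusp_metric (mu : R) : metric :=
  hm (radial_P 0 0 (-1) mu (fun q => 1 * q)) (radial_Q 0 0 (-1) mu (fun q => 1 * q) (fun _ => 1)).

Section Cusp.

Variable mu : R.
Hypothesis mu0 : mu <> 0.

Let T := Tm 0 0 (-1) mu.
Let U := Um 0 (-1) mu.

Lemma cusp_U x : 0 < x -> 0 < U x.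
Proof. intros x0. apply Um_pos_increasing; auto; lra. Qed.

Lemma cusp_surface : surface (fun q => 0 < q) (radial_P 0 0 (-1) mu (fun q => 1 * q))
  (radial_Q 0 0 (-1) mu (fun q => 1 * q) (fun _ => 1)) (-1) mu T U (fun q => 1 * q) (fun _ => 1).
Proof.
apply linear_surface; auto. intros q q0. apply Tm_pos; auto; [lra|]. intros; apply cusp_U; lra.
Qed.

Lemma cusp_soliton : expanding_soliton punctured_plane (cusp_metric mu) (-1).
Proof.
split; [lra|]. apply (gradient_soliton_sub (dom (fun q => 0 < q))); [apply punctured_nsq|apply cusp_surface].
Qed.

Lemma cusp_neg_curved : neg_curved punctured_plane (cusp_metric mu).
Proof.
intros p Hp. assert (q0 := punctured_nsq p Hp). unfold cusp_metric.
rewrite (sf_curv _ _ _ _ _ _ _ _ _ cusp_surface p q0). unfold U. rewrite Um_curv by auto.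
assert (e := exp_pos (4 * mu * (1 * nsq p))). rewrite Rmult_0_r. lra.
Qed.

Lemma cusp_realizes a : (forall x, 0 < x -> a (T x) = / U x) ->
  filterlim T (Rbar_locally p_infty) (Rbar_locally p_infty) ->
  realizes (cusp_metric mu) p_infty 0 p_infty (G a).
Proof.
intros Ha He1. apply (surface_realizes _ _ _ _ _ _ _ _ _ _ _ _ _ cusp_surface).
- intros x x0 _. assert (h : 0 < 1 * x ^ 2) by (rewrite Rmult_1_l; apply pow_lt; auto).
  split; [lra|]. split; [assert (u := cusp_U _ h); lra|auto].
- apply (filterlim_comp _ _ _ (fun x => 1 * x ^ 2) T _ (at_right 0)).
  + apply square_at_right_0; lra.
  + apply Tm_at_right_0; auto.
- apply (filterlim_comp _ _ _ (fun x => 1 * x ^ 2) T _ (Rbar_locally p_infty)); auto.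
  apply square_p_infty; lra.
Qed.

Lemma cusp_asymptotic : asymptotic_cusp (at_right 0) (cusp_metric mu).
Proof.
apply (asymptotic_cusp_end _ _ _ 0 0 (-1) mu _ _ cusp_surface); auto; try typeclasses eauto.
- generalize (within_self 0 (fun x => 0 < x)). apply filter_imp. intros x x0. split; auto. apply pow_lt; auto.
- apply square_at_right_0; lra.
Qed.

Lemma cusp_incomplete : 0 < mu -> incomplete punctured_plane (cusp_metric mu).
Proof.
intros m0. apply (linear_incomplete _ _ _ _ _ _ _ _ punctured_plane cusp_surface); auto; try lra.
- apply punctured_nsq.
- intros x x1. unfold punctured_plane. rewrite rad_axis; lra.
Qed.

Lemma cusp_complete : mu < 0 -> Defs.complete punctured_plane (cusp_metric mu).
Proof.
intros m0. destruct (linear_outer _ _ _ _ _ _ _ _ cusp_surface Rlt_0_1 m0) as [C [C0 HC]].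
(* For mu < 0 the equation U' = 4 mu U + 2 gives U <= 2 x, hence T <= x^2. Radial length towards the
   puncture is then at least the integral of dy / y at y = x^2, that is 2 ln x. *)
assert (Ule : forall x, 0 <= x -> U x <= 2 * x).
{ intros x x0. assert (K : 2 * 0 - U 0 <= 2 * x - U x).
  - apply (nondecreasing_deriv (fun x => 2 * x - U x) (fun x => 2 - (4 * mu * U x - 2 * -1))); auto; intros z Hz.
    + apply (is_derive_minus (V := R_NormedModule) (fun x => 2 * x) U); [auto_derive; auto; ring|apply dUm; auto].
    + assert (u := cusp_U z ltac:(lra)). nra.
  - unfold U in K at 1. rewrite Um_0 in K. lra. }
assert (Tle : forall x, 0 <= x -> T x <= x ^ 2).
{ intros x x0. assert (K : 0 ^ 2 - T 0 <= x ^ 2 - T x).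
  - apply (nondecreasing_deriv (fun x => x ^ 2 - T x) (fun x => 2 * x - U x)); auto; intros z Hz.
    + apply (is_derive_minus (V := R_NormedModule) (fun x => x ^ 2) T); [auto_derive; auto; ring|apply dTm; auto].
    + assert (u := Ule z ltac:(lra)). lra.
  - unfold T in K at 1. rewrite Tm_0 in K. lra. }
apply (complete_punctured _ 1 (fun x => 2 * sqrt ((1 + 1 * x ^ 2) / C))
  (fun x => 2 * 1 * x / (C * sqrt ((1 + 1 * x ^ 2) / C))) 1 (fun x => 2 * ln x) (fun x => 2 / x)).
- apply cusp_soliton.
- lra.
- intros x _. apply linear_end_L; lra.
- intros p v Hp r1. apply HC; auto. apply punctured_nsq; auto.
- apply linear_end_infty; lra.
- lra.
- intros x Hx. auto_derive; [lra|]. field. lra.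
- intros p v Hp r1. assert (q0 := punctured_nsq p Hp).
  apply (surface_radial_lower _ _ _ _ _ _ _ _ _ cusp_surface); [lra|auto|].
  rewrite Rmult_1_l. rewrite <- rad_nsq in *. assert (t := Tle (rad p ^ 2) ltac:(lra)).
  replace ((2 * rad p * 1) ^ 2) with ((2 / rad p) ^ 2 * (rad p ^ 2) ^ 2) by (field; lra).
  apply Rmult_le_compat_l; [apply pow2_ge_0|auto].
- intros B. exists (exp (B / 2)). split; [apply exp_pos|]. intros x [x0 xb].
  assert (l := ln_le x _ x0 xb). rewrite ln_exp in l. lra.
- intros a b a0. assert (a2 : 0 < a ^ 2) by (apply pow_lt; auto).
  destruct (surface_lower_bound _ _ _ _ _ _ _ _ _ cusp_surface (a ^ 2) (b ^ 2) ltac:(lra)) as [k [k0 K]].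
  { intros q Hq. lra. }
  exists k. split; auto. intros p v Hp. apply K. apply nsq_rad_bounds; lra.
Qed.

End Cusp.

(** * Annuli with a geodesic boundary circle *)

Section Boundary.

Variables (lam mu : R).
Hypothesis mu0 : mu <> 0.
Hypothesis lam0 : lam < 0.

Let T := Tm (1 / 4) 0 lam mu.
Let U := Um 0 lam mu.

Lemma boundary_U x : 0 < x -> 0 < U x.
Proof. intros x0. apply Um_pos_increasing; auto; lra. Qed.

(** The momentum coordinate is - ln q: the unit circle is x = 0, where T = 1 / 4 and U = 0, and the
    puncture is x -> infinity. The metric extends past the circle because T stays positive for small
    negative x. *)
Lemma boundary_metric a : (forall x, 0 < x -> a (T x) = / U x) ->
  filterlim T (Rbar_locally p_infty) (Rbar_locally p_infty) ->
  exists P Q D, surface D P Q lam mu T U (fun q => -1 * ln q) (fun q => -1 / q) /\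
    (forall q, 0 < q < 1 -> D q) /\
    realizes (hm P Q) 1 p_infty (1 / 4) (G a) /\
    expanding_soliton (punctured_disk 1) (hm P Q) lam /\
    incomplete (punctured_disk 1) (hm P Q) /\ neg_curved (punctured_disk 1) (hm P Q) /\
    geodesic_boundary punctured_disk (hm P Q).
Proof.
intros Ha TI.
assert (T0 : T 0 = 1 / 4) by apply Tm_0.
assert (Tge : forall x, 0 <= x -> 1 / 4 <= T x).
{ intros x [x0|<-]; [|lra]. rewrite <- T0. left. apply Tm_lt; auto. intros; apply boundary_U; lra. }
destruct (positive_near T 0) as [e [e0 He]]; [apply Tm_continuous; auto|lra|].
pose (D q := 0 < q /\ q < exp e).
assert (ee : 1 < exp e) by (rewrite <- exp_0; apply exp_increasing; auto).
assert (S : surface D (radial_P (1 / 4) 0 lam mu (fun q => -1 * ln q)) (radial_Q (1 / 4) 0 lam mu (fun q => -1 * ln q) (fun q => -1 / q))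
   lam mu T U (fun q => -1 * ln q) (fun q => -1 / q)).
{ apply log_surface; auto; [lra| | |].
  - apply open_and; [apply open_gt|apply open_lt].
  - intros q [q0 _]; auto.
  - intros q [q0 qe]. fold T. destruct (Rle_lt_dec q 1) as [h|h].
    + assert (l : ln q <= 0) by (rewrite <- ln_1; apply ln_le; auto).
      assert (t := Tge (-1 * ln q) ltac:(lra)). lra.
    + apply He. assert (l : 0 < ln q) by (rewrite <- ln_1; apply ln_increasing; lra).
      assert (l' : ln q < e) by (rewrite <- (ln_exp e); apply ln_increasing; auto).
      apply Rabs_def1; lra. }
assert (D1 : forall q, 0 < q < 1 -> D q) by (intros q Hq; split; lra).
assert (VD : forall p, punctured_disk 1 p -> 0 < nsq p < 1).
{ intros p [p0 p1]. rewrite <- rad_nsq. split; nra. }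
assert (lnq : forall q, 0 < q < 1 -> 0 < -1 * ln q).
{ intros q Hq. assert (l : ln q < 0) by (rewrite <- ln_1; apply ln_increasing; lra). lra. }
exists (radial_P (1 / 4) 0 lam mu (fun q => -1 * ln q)), (radial_Q (1 / 4) 0 lam mu (fun q => -1 * ln q) (fun q => -1 / q)), D.
split; [exact S|]. split; [exact D1|].
split; [|split; [|split; [|split]]].
- apply (surface_realizes _ _ _ _ _ _ _ _ _ _ _ _ _ S).
  + intros x x0 x1. simpl in x1. assert (q : 0 < x ^ 2 < 1) by nra.
    split; [auto|]. split; [assert (u := boundary_U _ (lnq _ q)); lra|apply Ha, lnq; auto].
  + apply (filterlim_comp _ _ _ (fun x => -1 * ln (x ^ 2)) T _ (Rbar_locally p_infty)); auto.
    apply (filterlim_ext (fun x => - (1) * ln (x ^ 2))); [intros; ring|].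
    apply (log_square_at_right_0 1 Rlt_0_1).
  + assert (C : continuous (fun x => T (-1 * ln (x ^ 2))) 1).
    { apply (continuous_comp (fun x => -1 * ln (x ^ 2)) T); [|apply Tm_continuous; auto].
      apply (ex_derive_continuous (fun x => -1 * ln (x ^ 2))). auto_derive. lra. }
    assert (K := filterlim_at_left_of_continuous _ 1 C). cbv beta in K.
    replace (-1 * ln (1 ^ 2)) with 0 in K by (rewrite pow1, ln_1; ring). rewrite T0 in K. exact K.
- split; auto. apply (gradient_soliton_sub (dom D)); [|apply S]. intros p Hp. apply D1, VD; auto.
(* For x >= 1 / 2 the squared radial speed is 4 / (x^2 T) with T >= 1 / 4, so at most 64 = 8^2. *)
- apply (surface_incomplete_one _ _ _ _ _ _ _ _ _ S (punctured_disk 1) 8); auto; try lra.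
  + intros p [_ p1]; auto.
  + intros x Hx. unfold punctured_disk. rewrite rad_axis; lra.
  + intros x Hx. assert (q : 0 < x ^ 2 < 1) by nra. assert (t := Tge _ (Rlt_le _ _ (lnq _ q))).
    replace ((2 * x * (-1 / x ^ 2)) ^ 2) with (4 * / x ^ 2) by (field; lra).
    fold T. assert (i : / x ^ 2 <= 4) by (rewrite <- (Rinv_inv 4); apply Rinv_le_contravar; nra).
    apply (proj2 (Rle_div_l _ _ (T (-1 * ln (x ^ 2))) ltac:(lra))). nra.
- intros p Hp. rewrite (sf_curv _ _ _ _ _ _ _ _ _ S p (D1 _ (VD p Hp))). unfold U. rewrite Um_curv by auto.
  rewrite Rmult_0_r, Rminus_0_r. assert (x := exp_pos (4 * mu * (-1 * ln (nsq p)))). nra.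
- destruct (surface_geodesic _ _ _ _ _ _ _ _ _ S) as [G1 G2].
  + split; lra.
  + rewrite ln_1, Rmult_0_r. auto.
  + rewrite ln_1, Rmult_0_r. apply Um_0.
  + split; [|split; auto]. exists (sqrt (exp e)). split.
    * rewrite <- sqrt_1 at 1. apply sqrt_lt_1; lra.
    * apply (riemannian_sub (dom D)); [|apply S]. intros p [p0 pr]. split.
      -- rewrite <- rad_nsq. apply pow_lt; auto.
      -- assert (k := disk_rad _ p (sqrt_pos _) pr). rewrite pow2_sqrt in k by lra. auto.
Qed.

End Boundary.

(** * The twelve families *)

Lemma unbounded_above (f : R -> R) :
  filterlim f (Rbar_locally p_infty) (Rbar_locally p_infty) ->
  forall t : R, exists x : R, 0 < x /\ t < f x.
Proof.
intros H t. destruct (H (fun z => t < z) (ex_intro _ t (fun x h => h))) as [M HM].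
exists (Rmax M 0 + 1). assert (a := Rmax_l M 0). assert (b := Rmax_r M 0). split; [lra|]. apply HM. lra.
Qed.

Section Profiles.

Variables (t0 u0 lam mu : R).
Hypothesis mu0 : mu <> 0.
Hypothesis Upos : forall x, 0 < x -> 0 < Um u0 lam mu x.
Hypothesis TI : filterlim (Tm t0 u0 lam mu) (Rbar_locally p_infty) (Rbar_locally p_infty).

Lemma end_profile_exists : exists a, profile lam mu a t0 p_infty /\
  filterlim (fun t => / a t) (at_right t0) (locally u0).
Proof.
destruct (profile_exists lam mu u0 t0 p_infty p_infty mu0) as [a [H1 H2]].
- intros x x0 _. split; [auto|exact I].
- intros t _. destruct (unbounded_above _ TI t) as [x [x0 Hx]]. exists x. split; auto. split; [exact I|auto].
- exists a. split; auto. apply (profile_limit_0 lam mu u0 t0 p_infty); auto. exact I.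
Qed.

Lemma end_profile_value a : u0 <> lam / (2 * mu) -> profile lam mu a t0 p_infty ->
  filterlim (fun t => / a t) (at_right t0) (locally u0) ->
  forall x, 0 < x -> a (Tm t0 u0 lam mu x) = / Um u0 lam mu x.
Proof.
intros ud Hp L x x0. apply (profile_value lam mu u0 t0 p_infty a); auto.
- intros z Hz; apply Upos; lra.
- exact I.
Qed.

End Profiles.

Lemma profile_blows_up lam mu a (t0 : R) :
  profile lam mu a t0 p_infty -> filterlim (fun t => / a t) (at_right t0) (locally 0) ->
  blows_up a (at_right t0).
Proof.
intros Hp L. apply blows_up_of_inv; auto; [apply within_filter, locally_filter|].
generalize (within_self t0 (fun t => t0 < t)). apply filter_imp. intros t Ht.
apply (Hp t Ht). exact I.
Qed.

Lemma gam_gt1 lam mu : lam <> 0 -> (1 < gam lam mu -> 0 < lam -> lam < 2 * mu) /\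
  (1 < gam lam mu -> lam < 0 -> 2 * mu < lam).
Proof.
intros l0. unfold gam.
split; intros H l; [apply (Rmult_lt_compat_r lam) in H|apply (Rmult_lt_compat_r (- lam)) in H]; try lra.
- replace (2 * mu / lam * lam) with (2 * mu) in H by (field; auto). lra.
- replace (2 * mu / lam * - lam) with (- (2 * mu)) in H by (field; auto). lra.
Qed.

Lemma gam_sign lam mu : lam <> 0 -> mu <> 0 ->
  (0 < gam lam mu -> 0 < lam * mu) /\ (gam lam mu < 0 -> lam * mu < 0).
Proof.
intros l0 m0. unfold gam.
assert (l2 : 0 < lam ^ 2) by (assert (h := pow2_gt_0 lam l0); lra).
split; intros H; apply (Rmult_lt_compat_r (lam ^ 2)) in H; auto;
  replace (2 * mu / lam * lam ^ 2) with (2 * (lam * mu)) in H by (field; auto); lra.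
Qed.

Lemma gam_lt1_neg lam mu : lam < 0 -> gam lam mu < 1 -> lam < 2 * mu.
Proof.
intros l0 H. unfold gam in H. apply (Rmult_lt_compat_r (- lam)) in H; [|lra].
replace (2 * mu / lam * - lam) with (- (2 * mu)) in H by (field; lra). lra.
Qed.

Lemma gam_inv lam mu : lam <> 0 -> mu <> 0 -> lam / (2 * mu) = / gam lam mu.
Proof. intros l0 m0. unfold gam. field. auto. Qed.

Lemma neq_ratio lam mu (u : R) : mu <> 0 -> 2 * mu * u <> lam -> u <> lam / (2 * mu).
Proof. intros m0 H e. apply H. rewrite e. field; auto. Qed.

Lemma id_isometric h k : (forall p v, quad k p v = quad h p v) -> isometric plane h plane k.
Proof.
intros H. exists (fun p => p), (fun p => p).
assert (o : open plane) by (intros p _; apply filter_forall; exact (fun _ => I)).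
assert (sm : smooth_map plane plane (fun p => p)).
{ split; auto. intros i. apply ck_smooth. intros n. apply ck_coord; auto. }
split; [exact sm|split; [exact sm|split; [auto|split; [auto|]]]].
intros p _ v. rewrite H. f_equal. unfold push, sum_ix.
rewrite (is_pd_unique X1 (fun x => fst x) p 1 (is_pd_coord X1 X1 p)), (is_pd_unique X2 (fun x => fst x) p 0 (is_pd_coord X2 X1 p)),
  (is_pd_unique X1 (fun x => snd x) p 0 (is_pd_coord X1 X2 p)), (is_pd_unique X2 (fun x => snd x) p 1 (is_pd_coord X2 X2 p)).
destruct v as [a b]; simpl. f_equal; ring.
Qed.

(** For lam = 0 the product mu c, and with it the argument of [phi2], is unchanged by mu -> mu nu^2
    and c -> c / nu^2, so the two forms differ by the factor 1 / nu^2. The sign s is -1 for the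
    cigars and 1 for the exploding solitons. *)
Lemma steady_scaling s nu : s <> 0 -> 0 < nu -> forall p v,
  quad (rescale (/ nu ^ 2) (origin_metric 0 s 1)) p v = quad (origin_metric 0 (s * nu ^ 2) (/ nu ^ 2)) p v.
Proof.
intros s0 n0 p v.
assert (e : quad (rescale (/ nu ^ 2) (origin_metric 0 s 1)) p v = / nu ^ 2 * quad (origin_metric 0 s 1) p v).
{ unfold quad, sum_ix, rescale. ring. }
rewrite e. unfold origin_metric. rewrite !quad_hm. unfold origin_P, origin_Q, origin_S.
replace (4 * (s * nu ^ 2) * (/ nu ^ 2 * nsq p)) with (4 * s * (1 * nsq p)) by (field; lra).
replace (1 + / nu ^ 2 * nsq p * ((4 * (s * nu ^ 2) - 2 * 0) * phi2 (4 * s * (1 * nsq p))))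
  with (1 + 1 * nsq p * ((4 * s - 2 * 0) * phi2 (4 * s * (1 * nsq p)))) by (field; lra).
set (y := 1 + 1 * nsq p * ((4 * s - 2 * 0) * phi2 (4 * s * (1 * nsq p)))).
generalize (1 + / y) (phi2 (4 * s * (1 * nsq p))). intros w z. field. lra.
Qed.

Lemma cigar_family : exists h : R -> metric, forall nu : R, 0 < nu ->
     realizes (h nu) p_infty 0 (1 / (4 * nu ^ 2)) (G (a1 nu)) /\
     steady_soliton plane (h nu) /\ Defs.complete plane (h nu) /\ pos_curved plane (h nu) /\
     isometric plane (h nu) plane (rescale (/ nu ^ 2) (h 1)).
Proof.
(* For lam = 0 one has U = 1 + 4 mu T, so mu = - nu^2 produces the slope 1 - 4 nu^2 t of [a1]. *)
exists (fun nu => origin_metric 0 (-1 * nu ^ 2) (/ nu ^ 2)). intros nu n0.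
assert (n2 : 0 < nu ^ 2) by (apply pow_lt; auto).
assert (m0 : -1 * nu ^ 2 <> 0) by lra.
assert (c0 : 0 < / nu ^ 2) by (apply Rinv_0_lt_compat; auto).
assert (UE : forall x, Um 1 0 (-1 * nu ^ 2) x = exp (- (4 * nu ^ 2 * x))).
{ intros x. unfold Um. replace (4 * (-1 * nu ^ 2) * x) with (- (4 * nu ^ 2 * x)) by ring. field. lra. }
assert (TE : forall x, Tm 0 1 0 (-1 * nu ^ 2) x = (1 - exp (- (4 * nu ^ 2 * x))) / (4 * nu ^ 2)).
{ intros x. unfold Tm. replace (4 * (-1 * nu ^ 2) * x) with (- (4 * nu ^ 2 * x)) by ring. field. lra. }
assert (Upos : forall x, 0 < x -> 0 < Um 1 0 (-1 * nu ^ 2) x) by (intros; rewrite UE; apply exp_pos).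
split; [|split; [|split; [|split]]].
- apply plane_realizes; auto.
  + intros x x0. rewrite TE, UE. unfold a1. f_equal. field. lra.
  + change (filterlim (Tm 0 1 0 (-1 * nu ^ 2)) (Rbar_locally p_infty) (locally (1 / (4 * nu ^ 2)))).
    apply (filterlim_ext (fun x => (1 - Um 1 0 (-1 * nu ^ 2) x) / (4 * nu ^ 2))).
    { intros x. rewrite TE, UE. reflexivity. }
    assert (L := Um_limit_neg 1 0 (-1 * nu ^ 2) ltac:(lra)).
    assert (C : continuous (fun u => (1 - u) / (4 * nu ^ 2)) (0 / (2 * (-1 * nu ^ 2)))).
    { apply (ex_derive_continuous (fun u => (1 - u) / (4 * nu ^ 2))). auto_derive; auto. }
    assert (K := filterlim_comp _ _ _ _ _ _ _ _ L C). cbv beta in K.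
    replace ((1 - 0 / (2 * (-1 * nu ^ 2))) / (4 * nu ^ 2)) with (1 / (4 * nu ^ 2)) in K by (field; lra). exact K.
- apply plane_soliton; auto.
- apply plane_complete; auto; lra.
- apply plane_pos_curved; auto; lra.
- apply id_isometric; auto. intros p v.
  replace (-1 * 1 ^ 2) with (-1) by ring. replace (/ 1 ^ 2) with 1 by field. apply steady_scaling; lra.
Qed.

Lemma exploding_family : exists h : R -> metric, forall nu : R, 0 < nu ->
     realizes (h nu) p_infty 0 p_infty (G (a2 nu)) /\
     steady_soliton plane (h nu) /\ incomplete plane (h nu) /\
     neg_curved plane (h nu) /\ curvature_unbounded_below plane (h nu) /\
     isometric plane (h nu) plane (rescale (/ nu ^ 2) (h 1)).
Proof.
exists (fun nu => origin_metric 0 (1 * nu ^ 2) (/ nu ^ 2)). intros nu n0.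
assert (n2 : 0 < nu ^ 2) by (apply pow_lt; auto).
assert (m0 : 1 * nu ^ 2 <> 0) by lra.
assert (c0 : 0 < / nu ^ 2) by (apply Rinv_0_lt_compat; auto).
assert (UE : forall x, Um 1 0 (1 * nu ^ 2) x = exp (4 * nu ^ 2 * x)).
{ intros x. unfold Um. rewrite Rmult_1_l. field. lra. }
assert (TE : forall x, Tm 0 1 0 (1 * nu ^ 2) x = (exp (4 * nu ^ 2 * x) - 1) / (4 * nu ^ 2)).
{ intros x. unfold Tm. rewrite Rmult_1_l. field. lra. }
assert (Upos : forall x, 0 < x -> 0 < Um 1 0 (1 * nu ^ 2) x) by (intros; rewrite UE; apply exp_pos).
split; [|split; [|split; [|split; [|split]]]].
- apply plane_realizes; auto.
  + intros x x0. rewrite TE, UE. unfold a2. f_equal. field. lra.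
  + apply Tm_unbounded_pos; [lra|]. unfold Rdiv. rewrite Rmult_0_l. lra.
- apply plane_soliton; auto.
- apply plane_incomplete; auto; lra.
- apply plane_neg_curved; auto; lra.
- intros M.
  (* At momentum x the curvature is - 2 nu^2 exp (4 nu^2 x), and exp z >= 1 + z makes an x linear in
     |M| sufficient. *)
  assert (K : exists x, 0 < x /\ Rabs M < nu ^ 2 * (nu ^ 2 * x)).
  { exists ((Rabs M + 1) / (nu ^ 2 * nu ^ 2)). assert (a := Rabs_pos M). assert (n4 : 0 < nu ^ 2 * nu ^ 2) by (apply Rmult_lt_0_compat; auto). split; [apply Rdiv_lt_0_compat; lra|].
    replace (nu ^ 2 * (nu ^ 2 * ((Rabs M + 1) / (nu ^ 2 * nu ^ 2)))) with (Rabs M + 1) by (field; lra). lra. }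
  destruct K as [x [x0 Hx]].
  exists (sqrt (nu ^ 2 * x), 0). split; [exact I|].
  rewrite plane_gauss, nsq_axis, pow2_sqrt by (auto; nra).
  replace (4 * (1 * nu ^ 2) * (/ nu ^ 2 * (nu ^ 2 * x))) with (4 * (nu ^ 2 * x)) by (field; lra).
  assert (e : 1 + 4 * (nu ^ 2 * x) <= exp (4 * (nu ^ 2 * x))) by apply exp_ineq1_le.
  assert (b := Rabs_pos M). assert (m := Rle_abs (- M)). rewrite Rabs_Ropp in m. nra.
- replace (1 * 1 ^ 2) with 1 by ring. replace (/ 1 ^ 2) with 1 by field.
  apply id_isometric. intros p v. apply steady_scaling; lra.
Qed.

Lemma critical_slope_lt lam mu u : 0 < mu -> lam < 2 * mu * u -> lam / (2 * mu) < u.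
Proof.
intros m0 H. apply (Rmult_lt_reg_r (2 * mu)); [lra|].
replace (lam / (2 * mu) * (2 * mu)) with lam by (field; lra). lra.
Qed.

(** * Families on the plane *)

Section OriginFamilies.

Variables (lam mu : R).
Hypothesis mu0 : mu <> 0.
Hypothesis Upos : forall x, 0 < x -> 0 < Um 1 lam mu x.
Hypothesis TI : filterlim (Tm 0 1 lam mu) (Rbar_locally p_infty) (Rbar_locally p_infty).

Lemma origin_profile_exists : exists a, origin_profile lam mu a.
Proof.
destruct (end_profile_exists 0 1 lam mu mu0 Upos TI) as [a [H1 H2]].
exists a. split; auto. apply one_at_0_of_inv; auto.
Qed.

Lemma origin_profile_realized a : lam <> 2 * mu -> origin_profile lam mu a ->
  realizes (origin_metric lam mu 1) p_infty 0 p_infty (G a).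
Proof.
intros ne [prof one]. apply plane_realizes; auto; try lra.
apply (end_profile_value 0 1 lam mu mu0 Upos); auto.
- apply neq_ratio; auto. lra.
- apply one_at_0_inv; auto.
Qed.

End OriginFamilies.

Section OriginExploding.

Variables (nu lam mu : R).
Hypothesis nu0 : 0 < nu.
Hypothesis muE : mu = nu ^ 2.
Hypothesis lt : lam < 2 * mu.

Lemma origin_exploding_mu : 0 < mu.
Proof. rewrite muE. apply pow_lt; auto. Qed.

Lemma origin_exploding_pos x : 0 < x -> 0 < Um 1 lam mu x.
Proof. assert (m := origin_exploding_mu). apply Um_pos_increasing; lra. Qed.

Lemma origin_exploding_range :
  filterlim (Tm 0 1 lam mu) (Rbar_locally p_infty) (Rbar_locally p_infty).
Proof. assert (m := origin_exploding_mu). apply Tm_unbounded_pos; auto. apply critical_slope_lt; lra. Qed.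

Lemma origin_exploding_exists : exists a, origin_profile lam mu a.
Proof.
assert (m := origin_exploding_mu).
apply origin_profile_exists; [lra|exact origin_exploding_pos|exact origin_exploding_range].
Qed.

Lemma origin_exploding a : origin_profile lam mu a ->
  let h := origin_metric lam mu 1 in
  realizes h p_infty 0 p_infty (G a) /\ gradient_soliton plane h lam /\
  incomplete plane h /\ neg_curved plane h /\ asymptotic_g2 (Rbar_locally p_infty) h nu.
Proof.
intros prof h. assert (m := origin_exploding_mu). assert (U0 := origin_exploding_pos).
assert (m0 : mu <> 0) by lra.
split; [|split; [|split; [|split]]].
- apply origin_profile_realized; auto; [exact origin_exploding_range|lra].
- apply plane_soliton; auto; lra.
- apply plane_incomplete; auto; lra.
- apply plane_neg_curved; auto; lra.
- apply (asymptotic_g2_end _ _ _ 0 1 lam mu _ _ (plane_surface lam mu 1 m0 Rlt_0_1 U0) m0);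
    auto; try typeclasses eauto.
  + apply (F_infty_axis (fun _ => True)); auto.
  + apply critical_slope_lt; lra.
  + apply square_p_infty; lra.
Qed.

End OriginExploding.

Section OriginConical.

Variables (nu lam mu : R).
Hypothesis nu0 : 0 < nu.
Hypothesis mu0 : mu < 0.
Hypothesis gamE : lam / (2 * mu) = nu / (2 * PI).
Hypothesis Upos : forall x, 0 < x -> 0 < Um 1 lam mu x.

Lemma origin_conical_range :
  filterlim (Tm 0 1 lam mu) (Rbar_locally p_infty) (Rbar_locally p_infty).
Proof.
apply Tm_unbounded_neg; auto. rewrite gamE. assert (p := PI_RGT_0). apply Rdiv_lt_0_compat; lra.
Qed.

Lemma origin_conical_exists : exists a, origin_profile lam mu a.
Proof. apply origin_profile_exists; [lra|auto|exact origin_conical_range]. Qed.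

Lemma origin_conical a : lam <> 2 * mu -> origin_profile lam mu a ->
  let h := origin_metric lam mu 1 in
  realizes h p_infty 0 p_infty (G a) /\ gradient_soliton plane h lam /\
  Defs.complete plane h /\ asymptotic_cone (Rbar_locally p_infty) h nu.
Proof.
intros ne prof h. assert (m0 : mu <> 0) by lra.
split; [|split; [|split]].
- apply origin_profile_realized; auto. exact origin_conical_range.
- apply plane_soliton; auto; lra.
- apply plane_complete; auto; lra.
- apply (asymptotic_cone_end _ _ _ 0 1 lam mu _ _ (plane_surface lam mu 1 m0 Rlt_0_1 Upos) m0);
    auto; try typeclasses eauto.
  + apply (F_infty_axis (fun _ => True)); auto.
  + apply square_p_infty; lra.
Qed.

End OriginConical.

(** * Families with a cusp *)

Section CuspFamilies.

Variable mu : R.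
Hypothesis mu0 : mu <> 0.
Hypothesis TI : filterlim (Tm 0 0 (-1) mu) (Rbar_locally p_infty) (Rbar_locally p_infty).

Lemma cusp_profile_exists : exists a, cusp_profile (-1) mu a.
Proof.
destruct (end_profile_exists 0 0 (-1) mu mu0 (cusp_U mu mu0) TI) as [a [H1 H2]].
exists a. split; auto. apply (profile_blows_up (-1) mu); auto.
Qed.

Lemma cusp_profile_realized a : cusp_profile (-1) mu a ->
  realizes (cusp_metric mu) p_infty 0 p_infty (G a).
Proof.
intros [prof blow]. apply cusp_realizes; auto.
apply (end_profile_value 0 0 (-1) mu mu0 (cusp_U mu mu0)); auto.
- apply neq_ratio; auto. lra.
- apply blows_up_inv; auto. apply within_filter, locally_filter.
Qed.

End CuspFamilies.

Lemma cusp_exploding_range mu : 0 < mu ->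
  filterlim (Tm 0 0 (-1) mu) (Rbar_locally p_infty) (Rbar_locally p_infty).
Proof. intros m. apply Tm_unbounded_pos; auto. apply critical_slope_lt; lra. Qed.

Lemma cusp_exploding nu mu a : 0 < nu -> mu = nu ^ 2 -> cusp_profile (-1) mu a ->
  let h := cusp_metric mu in
  realizes h p_infty 0 p_infty (G a) /\ expanding_soliton punctured_plane h (-1) /\
  incomplete punctured_plane h /\ neg_curved punctured_plane h /\
  asymptotic_cusp (at_right 0) h /\ asymptotic_g2 (Rbar_locally p_infty) h nu.
Proof.
intros n0 mE prof h. assert (m : 0 < mu) by (rewrite mE; apply pow_lt; auto).
assert (m0 : mu <> 0) by lra.
split; [|split; [|split; [|split; [|split]]]].
- apply cusp_profile_realized; auto. apply cusp_exploding_range; auto.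
- apply cusp_soliton; auto.
- apply cusp_incomplete; auto.
- apply cusp_neg_curved; auto.
- apply cusp_asymptotic; auto.
- apply (asymptotic_g2_end _ _ _ 0 0 (-1) mu _ _ (cusp_surface mu m0) m0); auto; try typeclasses eauto.
  + apply (F_infty_axis (fun q => 0 < q)); auto.
  + apply critical_slope_lt; lra.
  + apply square_p_infty; lra.
Qed.

Lemma cusp_conical_range nu mu : 0 < nu -> mu < 0 -> -1 / (2 * mu) = nu / (2 * PI) ->
  filterlim (Tm 0 0 (-1) mu) (Rbar_locally p_infty) (Rbar_locally p_infty).
Proof.
intros n0 m e. apply Tm_unbounded_neg; auto. rewrite e. assert (p := PI_RGT_0). apply Rdiv_lt_0_compat; lra.
Qed.

Lemma cusp_conical nu mu a : 0 < nu -> mu < 0 -> -1 / (2 * mu) = nu / (2 * PI) -> cusp_profile (-1) mu a ->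
  let h := cusp_metric mu in
  realizes h p_infty 0 p_infty (G a) /\ expanding_soliton punctured_plane h (-1) /\
  Defs.complete punctured_plane h /\ neg_curved punctured_plane h /\
  asymptotic_cusp (at_right 0) h /\ asymptotic_cone (Rbar_locally p_infty) h nu.
Proof.
intros n0 m e prof h. assert (m0 : mu <> 0) by lra.
split; [|split; [|split; [|split; [|split]]]].
- apply cusp_profile_realized; auto. apply (cusp_conical_range nu); auto.
- apply cusp_soliton; auto.
- apply cusp_complete; auto.
- apply cusp_neg_curved; auto.
- apply cusp_asymptotic; auto.
- apply (asymptotic_cone_end _ _ _ 0 0 (-1) mu _ _ (cusp_surface mu m0) m0); auto; try typeclasses eauto.
  + apply (F_infty_axis (fun q => 0 < q)); auto.
  + apply square_p_infty; lra.
Qed.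

(** * Families with a boundary circle *)

Section BoundaryFamilies.

Variables (lam mu : R).
Hypothesis mu0 : mu <> 0.
Hypothesis lam0 : lam < 0.
Hypothesis TI : filterlim (Tm (1 / 4) 0 lam mu) (Rbar_locally p_infty) (Rbar_locally p_infty).

Lemma boundary_profile_exists : exists a, boundary_profile lam mu a.
Proof.
destruct (end_profile_exists (1 / 4) 0 lam mu mu0 (boundary_U lam mu mu0 lam0) TI) as [a [H1 H2]].
exists a. split; auto. apply (profile_blows_up lam mu); auto.
Qed.

Lemma boundary_profile_metric a : boundary_profile lam mu a ->
  exists P Q D, surface D P Q lam mu (Tm (1 / 4) 0 lam mu) (Um 0 lam mu) (fun q => -1 * ln q) (fun q => -1 / q) /\
    (forall q, 0 < q < 1 -> D q) /\
    realizes (hm P Q) 1 p_infty (1 / 4) (G a) /\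
    expanding_soliton (punctured_disk 1) (hm P Q) lam /\
    incomplete (punctured_disk 1) (hm P Q) /\ neg_curved (punctured_disk 1) (hm P Q) /\
    geodesic_boundary punctured_disk (hm P Q).
Proof.
intros [prof blow]. apply boundary_metric; auto.
apply (end_profile_value (1 / 4) 0 lam mu mu0 (boundary_U lam mu mu0 lam0)); auto.
- apply neq_ratio; auto. lra.
- apply blows_up_inv; auto. apply within_filter, locally_filter.
Qed.

End BoundaryFamilies.

Lemma unit_axis_at_right_0 (D : R -> Prop) : (forall q, 0 < q < 1 -> D q) ->
  at_right 0 (fun x => 0 < x /\ D (x ^ 2)).
Proof.
intros H. generalize (at_right_between 0 1 Rlt_0_1). apply filter_imp. intros x Hx. split; [lra|]. apply H. nra.
Qed.

Lemma minus_log_square_at_right_0 :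
  filterlim (fun x => -1 * ln (x ^ 2)) (at_right 0) (Rbar_locally p_infty).
Proof.
apply (filterlim_ext (fun x => - 1 * ln (x ^ 2))); [intros; ring|].
apply (log_square_at_right_0 1 Rlt_0_1).
Qed.

Lemma boundary_exploding_range lam mu : 0 < mu -> lam < 0 ->
  filterlim (Tm (1 / 4) 0 lam mu) (Rbar_locally p_infty) (Rbar_locally p_infty).
Proof. intros m l. apply Tm_unbounded_pos; auto. apply critical_slope_lt; lra. Qed.

Lemma boundary_exploding nu lam mu a : 0 < nu -> mu = nu ^ 2 -> lam < 0 -> boundary_profile lam mu a ->
  exists h, realizes h 1 p_infty (1 / 4) (G a) /\
    expanding_soliton (punctured_disk 1) h lam /\
    incomplete (punctured_disk 1) h /\ neg_curved (punctured_disk 1) h /\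
    asymptotic_g2 (at_right 0) h nu /\ geodesic_boundary punctured_disk h.
Proof.
intros n0 mE l prof. assert (m : 0 < mu) by (rewrite mE; apply pow_lt; auto).
assert (m0 : mu <> 0) by lra.
destruct (boundary_profile_metric lam mu m0 l (boundary_exploding_range lam mu m l) a prof)
  as [P [Q [D [S [HD [H1 [H2 [H3 [H4 H5]]]]]]]]].
exists (hm P Q). repeat (split; [assumption|]). split; [|assumption].
apply (asymptotic_g2_end _ _ _ (1 / 4) 0 lam mu _ _ S m0); auto; try typeclasses eauto.
- apply unit_axis_at_right_0; auto.
- apply critical_slope_lt; lra.
- apply minus_log_square_at_right_0.
Qed.

Lemma boundary_conical_range nu lam mu : 0 < nu -> mu < 0 -> lam / (2 * mu) = nu / (2 * PI) ->
  filterlim (Tm (1 / 4) 0 lam mu) (Rbar_locally p_infty) (Rbar_locally p_infty).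
Proof.
intros n0 m e. apply Tm_unbounded_neg; auto. rewrite e. assert (p := PI_RGT_0). apply Rdiv_lt_0_compat; lra.
Qed.

Lemma boundary_conical nu lam mu a : 0 < nu -> mu < 0 -> lam < 0 -> lam / (2 * mu) = nu / (2 * PI) ->
  boundary_profile lam mu a ->
  exists h, realizes h 1 p_infty (1 / 4) (G a) /\
    expanding_soliton (punctured_disk 1) h lam /\
    incomplete (punctured_disk 1) h /\ neg_curved (punctured_disk 1) h /\
    asymptotic_cone (at_right 0) h nu /\ geodesic_boundary punctured_disk h.
Proof.
intros n0 m l e prof. assert (m0 : mu <> 0) by lra.
destruct (boundary_profile_metric lam mu m0 l (boundary_conical_range nu lam mu n0 m e) a prof)
  as [P [Q [D [S [HD [H1 [H2 [H3 [H4 H5]]]]]]]]].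
exists (hm P Q). repeat (split; [assumption|]). split; [|assumption].
apply (asymptotic_cone_end _ _ _ (1 / 4) 0 lam mu _ _ S m0); auto; try typeclasses eauto.
- apply unit_axis_at_right_0; auto.
- apply minus_log_square_at_right_0.
Qed.

(** * Existence of the disk profiles *)

Section DiskProfile.

Variable gm : R.
Hypothesis g1 : gm < 1.
Hypothesis g0 : gm <> 0.

(* The solution of U(x1) = 0, T(x1) = 1/4 and 2 mu = gm lam, for T(0) = 0 and U(0) = 1. *)
Let mu := - ln (1 - gm) / gm - 1.
Let lam := 2 * mu / gm.
Let x1 := - ln (1 - gm) / (4 * mu).

(** mu gm = - ln (1 - gm) - gm is positive, by ln (1 - gm) < - gm. *)
Lemma disk_mu_sign : (0 < gm -> 0 < mu) /\ (gm < 0 -> mu < 0).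
Proof.
assert (L : ln (1 - gm) < - gm).
{ rewrite <- (ln_exp (- gm)). apply ln_increasing; [lra|].
  assert (h := exp_ineq1 (- gm) ltac:(lra)). lra. }
assert (E : mu * gm = - ln (1 - gm) - gm) by (unfold mu; field; auto).
split; intros h; nra.
Qed.

Lemma disk_mu_neq : mu <> 0.
Proof. destruct disk_mu_sign as [a b]. destruct (Rtotal_order gm 0) as [h|[h|h]]; [specialize (b h)|tauto|specialize (a h)]; lra. Qed.

Lemma disk_lam_pos : 0 < lam.
Proof.
destruct disk_mu_sign as [a b]. unfold lam. destruct (Rtotal_order gm 0) as [h|[h|h]]; [|tauto|].
- specialize (b h). replace (2 * mu / gm) with (2 * - mu / - gm) by (field; auto). apply Rdiv_lt_0_compat; lra.
- specialize (a h). apply Rdiv_lt_0_compat; lra.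
Qed.

Lemma disk_x1_pos : 0 < x1.
Proof.
destruct disk_mu_sign as [a b]. unfold x1. destruct (Rtotal_order gm 0) as [h|[h|h]]; [|tauto|].
- specialize (b h). assert (l : ln 1 < ln (1 - gm)) by (apply ln_increasing; lra). rewrite ln_1 in l.
  replace (- ln (1 - gm) / (4 * mu)) with (ln (1 - gm) / (4 * - mu)) by (field; lra). apply Rdiv_lt_0_compat; lra.
- specialize (a h). assert (l : ln (1 - gm) < ln 1) by (apply ln_increasing; lra). rewrite ln_1 in l.
  apply Rdiv_lt_0_compat; lra.
Qed.

Lemma disk_exp : exp (4 * mu * x1) = / (1 - gm).
Proof.
unfold x1. assert (m := disk_mu_neq). replace (4 * mu * (- ln (1 - gm) / (4 * mu))) with (- ln (1 - gm)) by (field; auto).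
rewrite exp_Ropp, exp_ln; lra.
Qed.

Lemma disk_gam : gam lam mu = gm.
Proof. unfold gam, lam. assert (m := disk_mu_neq). field. auto. Qed.

Lemma disk_ratio : lam / (2 * mu) = / gm.
Proof. unfold lam. assert (m := disk_mu_neq). field. auto. Qed.

Lemma disk_Um_x1 : Um 1 lam mu x1 = 0.
Proof. unfold Um. rewrite disk_ratio, disk_exp. field. split; lra. Qed.

Lemma disk_Tm_x1 : Tm 0 1 lam mu x1 = 1 / 4.
Proof.
unfold Tm. rewrite disk_ratio, disk_exp. unfold x1. assert (m := disk_mu_neq).
assert (E : ln (1 - gm) = - (gm * (mu + 1))) by (unfold mu; field; auto).
rewrite E. field. repeat split; lra.
Qed.

Lemma disk_Um_pos x : x < x1 -> 0 < Um 1 lam mu x.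
Proof.
intros H. rewrite <- disk_Um_x1. assert (m := disk_mu_neq).
assert (l := disk_lam_pos).
apply Ropp_lt_cancel.
apply (increasing_deriv (fun x => - Um 1 lam mu x) (fun x => - (4 * mu * Um 1 lam mu x - 2 * lam))); auto.
- intros z _. apply (is_derive_opp (V := R_NormedModule) (Um 1 lam mu)). apply dUm; auto.
- intros z _. assert (c := Um_curv 1 lam mu z m). assert (e := exp_pos (4 * mu * z)).
  assert (g : 0 < lam - 2 * mu).
  { replace (lam - 2 * mu) with (lam * (1 - gm)) by (unfold lam; field; auto). apply Rmult_lt_0_compat; lra. }
  assert (0 < (lam - 2 * mu * 1) * exp (4 * mu * z)) by (apply Rmult_lt_0_compat; lra). lra.
Qed.

Lemma disk_Tm_lt x y : x < y -> y <= x1 -> Tm 0 1 lam mu x < Tm 0 1 lam mu y.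
Proof. intros H1 H2. apply Tm_lt; auto; [apply disk_mu_neq|]. intros z Hz. apply disk_Um_pos; lra. Qed.

Lemma disk_profile_exists : exists a, g4_profile lam mu a.
Proof.
assert (m := disk_mu_neq). assert (x10 := disk_x1_pos).
destruct (profile_exists lam mu 1 0 x1 (1 / 4) m) as [a [H1 H2]].
- intros x x0 Hx. split; [apply disk_Um_pos; exact Hx|]. simpl. rewrite <- disk_Tm_x1.
  apply disk_Tm_lt; [exact Hx|lra].
- intros t Ht. simpl in Ht.
  assert (C := Tm_continuous 0 1 lam mu x1 m).
  assert (tl : t < Tm 0 1 lam mu x1) by (rewrite disk_Tm_x1; lra).
  assert (K := C (fun z => t < z) (open_gt t _ tl)).
  destruct K as [e He]. assert (e0 := cond_pos e).
  (* Close enough to x1 for T to exceed t, and positive whatever e is. *)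
  exists (Rmax (x1 / 2) (x1 - e / 2)).
  assert (b : 0 < Rmax (x1 / 2) (x1 - e / 2) < x1 /\ x1 - e / 2 <= Rmax (x1 / 2) (x1 - e / 2)).
  { assert (p := Rmax_l (x1 / 2) (x1 - e / 2)). assert (q := Rmax_r (x1 / 2) (x1 - e / 2)).
    split; [split; [lra|apply Rmax_lub_lt; lra]|auto]. }
  split; [lra|]. split; [simpl; lra|]. apply He.
  change (Rabs (Rmax (x1 / 2) (x1 - e / 2) - x1) < e). apply Rabs_def1; lra.
- exists a. split; [exact H1|split].
  + apply one_at_0_of_inv. apply (profile_limit_0 lam mu 1 0 x1); auto. intros x _ Hx. apply disk_Um_pos; exact Hx.
  + apply blows_up_of_inv; [apply within_filter, locally_filter| |].
    * generalize (at_left_between 0 (1 / 4) ltac:(lra)). apply filter_imp. intros t Ht. apply (H1 t); simpl; lra.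
    (* Heights above [Tm 0 1 lam mu y] are attained at momenta between y and x1, where continuity of
       U at its zero makes 1 / a small. *)
    * apply filterlim_locally. intros e. assert (e0 := cond_pos e).
      assert (C : continuous (Um 1 lam mu) x1) by (apply (ex_derive_continuous (Um 1 lam mu)); eexists; apply dUm; auto).
      assert (K := proj1 (filterlim_locally _ _) C e). destruct K as [d Hd]. assert (d0 := cond_pos d).
      set (y := Rmax (x1 / 2) (x1 - d / 2)).
      assert (b : 0 < y < x1 /\ x1 - d / 2 <= y).
      { assert (p := Rmax_l (x1 / 2) (x1 - d / 2)). assert (q := Rmax_r (x1 / 2) (x1 - d / 2)).
        split; [split; [unfold y; lra|apply Rmax_lub_lt; lra]|auto]. }
      assert (tb : Tm 0 1 lam mu y < 1 / 4) by (rewrite <- disk_Tm_x1; apply disk_Tm_lt; lra).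
      generalize (at_left_between _ _ tb). apply filter_imp. intros t Ht.
      destruct (IVT_gen (Tm 0 1 lam mu) y x1 t) as [z [Hz Ez]].
      -- intros z. apply continuity_pt_filterlim, Tm_continuous; auto.
      -- rewrite disk_Tm_x1. rewrite Rmin_left, Rmax_right by lra. lra.
      -- rewrite Rmin_left, Rmax_right in Hz by lra.
         assert (zl : z < x1).
         { destruct (proj2 Hz) as [h|h]; auto. rewrite h, disk_Tm_x1 in Ez. lra. }
         rewrite <- Ez, H2, Rinv_inv by (simpl; lra).
         assert (K := Hd z). rewrite disk_Um_x1 in K. apply K. change (Rabs (z - x1) < d). apply Rabs_def1; lra.
Qed.

End DiskProfile.

Lemma g4_profile_exists gm : gm < 1 -> gm <> 0 -> exists lam mu a,
  0 < lam /\ (0 < gm -> 0 < mu) /\ (gm < 0 -> mu < 0) /\ g4_profile lam mu a /\ gam lam mu = gm.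
Proof.
intros g1 g0. destruct (disk_profile_exists gm g1 g0) as [a Ha].
do 2 eexists; exists a. split; [apply (disk_lam_pos gm g1 g0)|].
split; [apply (disk_mu_sign gm g1 g0)|split; [apply (disk_mu_sign gm g1 g0)|]].
split; [exact Ha|apply (disk_gam gm g1 g0)].
Qed.

Lemma g4_plus_signs lam mu a : g4_plus lam mu a -> 0 < lam /\ mu <> 0 /\ gam lam mu < 1 /\ g4_profile lam mu a.
Proof.
intros [l [m [g H]]]. assert (m0 : mu <> 0) by lra.
assert (s := proj1 (gam_sign lam mu l m0) (proj1 g)). split; [nra|]. split; [auto|]. split; [lra|exact H].
Qed.

Lemma g4_minus_signs lam mu a : g4_minus lam mu a -> 0 < lam /\ mu <> 0 /\ gam lam mu < 1 /\ g4_profile lam mu a.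
Proof.
intros [l [m [g H]]]. assert (m0 : mu <> 0) by lra.
assert (s := proj2 (gam_sign lam mu l m0) g). split; [nra|]. split; [auto|]. split; [lra|exact H].
Qed.

Lemma closed_disk_arclength lam mu a h nu : profile lam mu a 0 (1 / 4) -> closed_disk_metric a h nu ->
  exists r, arclength a nu r.
Proof.
intros prof [H1 [H2 H3]]. destruct (disk_dist a h H1 H2) as [nu' [r [E A]]].
- intros t Ht. destruct (prof t) as [p d]; simpl; try lra. split; auto.
  apply (ex_derive_continuous a). eexists; apply d.
- rewrite H3 in E. injection E as E. subst nu'. exists r; auto.
Qed.

Lemma dprof_unique gm a a' t : dprof gm a -> dprof gm a' -> 0 < t < 1 / 4 -> a t = a' t.
Proof.
intros D D' Ht. assert (p := dp_pos _ _ D t Ht). assert (p' := dp_pos _ _ D' t Ht).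
assert (i := Rinv_0_lt_compat _ p). assert (i' := Rinv_0_lt_compat _ p').
assert (q := dp_lt _ _ D t Ht). assert (q' := dp_lt _ _ D' t Ht).
rewrite <- (Rinv_inv (a t)), <- (Rinv_inv (a' t)). f_equal.
apply (Gi_inj gm); try lra; try (apply one_minus_pos; [apply (dp_gm _ _ D)|lra]).
rewrite (dp_G _ _ D t Ht), (dp_G _ _ D' t Ht). reflexivity.
Qed.

(** nu is strictly monotone in gam, so equal distances give equal gam; then lam = 2 Gi gam 1 and mu
    follow, and [dp_G] determines the profile. *)
Lemma g4_injective lam mu a h lam' mu' a' h' nu :
  0 < lam /\ mu <> 0 /\ gam lam mu < 1 /\ g4_profile lam mu a -> closed_disk_metric a h nu ->
  0 < lam' /\ mu' <> 0 /\ gam lam' mu' < 1 /\ g4_profile lam' mu' a' -> closed_disk_metric a' h' nu ->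
  lam = lam' /\ mu = mu' /\ forall t, 0 < t < 1 / 4 -> a t = a' t.
Proof.
intros [l [m [g H]]] C [l' [m' [g' H']]] C'.
destruct (closed_disk_arclength lam mu a h nu (proj1 H) C) as [r A].
destruct (closed_disk_arclength lam' mu' a' h' nu (proj1 H') C') as [r' A'].
destruct (dprof_of_profile lam mu a l m g H) as [D L]. destruct (dprof_of_profile lam' mu' a' l' m' g' H') as [D' L'].
assert (gE : gam lam mu = gam lam' mu').
{ destruct (Rtotal_order (gam lam mu) (gam lam' mu')) as [k|[k|k]]; auto; exfalso.
  - assert (c := dprof_nu_lt _ _ _ _ _ _ _ _ k D D' A A'). lra.
  - assert (c := dprof_nu_lt _ _ _ _ _ _ _ _ k D' D A' A). lra. }
assert (lE : lam = lam') by (rewrite L, L', gE; reflexivity).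
split; auto. split.
- assert (e : mu = gam lam mu * lam / 2) by (unfold gam; field; lra).
  assert (e' : mu' = gam lam' mu' * lam' / 2) by (unfold gam; field; lra).
  rewrite e, e', gE, lE. reflexivity.
- intros t Ht. rewrite <- gE in D'. apply (dprof_unique (gam lam mu)); auto.
Qed.

Lemma g4_minus_exists gm : gm < 0 -> exists lam mu a, g4_minus lam mu a /\ gam lam mu = gm.
Proof.
intros H. destruct (g4_profile_exists gm) as [lam [mu [a [l [_ [m [K E]]]]]]]; try lra.
exists lam, mu, a. split; auto. split; [lra|]. split; [auto|]. rewrite E. split; auto.
Qed.

(** The relation passed to [dprof_surjective] records a profile together with its metric, so the
    conclusion returns these witnesses along with nu. *)
Lemma g4_minus_surjective nu : PI / 2 < nu ->
  exists lam mu a h, g4_minus lam mu a /\ closed_disk_metric a h nu.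
Proof.
intros Hnu.
destruct (dprof_surjective (fun gm nu => exists lam mu a h,
  g4_minus lam mu a /\ gam lam mu = gm /\ closed_disk_metric a h nu)) with (nu := nu)
  as [gm [_ [lam [mu [a [h [H [_ C]]]]]]]]; auto.
- intros gm g. destruct (g4_minus_exists gm g) as [lam [mu [a [H E]]]].
  destruct (g4_minus_signs lam mu a H) as [l [m [g1 K]]].
  destruct (g4_metric lam mu a l m g1 K) as [h [nu' [C _]]].
  exists nu', lam, mu, a, h. auto.
- intros gm nu' [lam [mu [a [h [H [E C]]]]]].
  destruct (g4_minus_signs lam mu a H) as [l [m [g1 K]]].
  destruct (closed_disk_arclength lam mu a h nu' (proj1 K) C) as [r A].
  exists a, r. split; auto. rewrite <- E. apply dprof_of_profile; auto.
- exists lam, mu, a, h. auto.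
Qed.

Lemma conical_param nu lam mu : 0 < nu -> lam <> 0 -> mu < 0 -> gam lam mu = 2 * PI / nu ->
  lam < 0 /\ lam / (2 * mu) = nu / (2 * PI).
Proof.
intros n0 l0 m E. assert (p := PI_RGT_0). assert (m0 : mu <> 0) by lra.
assert (g : 0 < gam lam mu) by (rewrite E; apply Rdiv_lt_0_compat; lra).
assert (s := proj1 (gam_sign lam mu l0 m0) g). split; [nra|].
rewrite gam_inv, E by auto. field. lra.
Qed.

Lemma conical_param_exists nu : 0 < nu -> - PI / nu < 0 /\ gam (-1) (- PI / nu) = 2 * PI / nu.
Proof.
intros n0. assert (p := PI_RGT_0). split.
- replace (- PI / nu) with (- (PI / nu)) by (field; lra). assert (0 < PI / nu) by (apply Rdiv_lt_0_compat; auto). lra.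
- unfold gam. field. lra.
Qed.

Lemma angle_ratio nu : 0 < nu -> (1 < 2 * PI / nu <-> nu < 2 * PI).
Proof.
intros n0. assert (E : 2 * PI / nu * nu = 2 * PI) by (field; lra). split; intros H.
- apply (Rmult_lt_compat_r nu) in H; lra.
- apply (Rmult_lt_reg_r nu); lra.
Qed.

Lemma angle_ratio_lt nu : 0 < nu -> (2 * PI / nu < 1 <-> 2 * PI < nu).
Proof.
intros n0. assert (E : 2 * PI / nu * nu = 2 * PI) by (field; lra). split; intros H.
- apply (Rmult_lt_compat_r nu) in H; lra.
- apply (Rmult_lt_reg_r nu); lra.
Qed.

Lemma g5_signs nu lam mu : g5_param nu lam mu -> 0 < nu /\ mu = nu ^ 2 /\ 0 < lam /\ lam < 2 * mu.
Proof.
intros [n0 [l0 [mE g]]]. assert (m : 0 < mu) by (rewrite mE; apply pow_lt; auto).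
assert (s := proj1 (gam_sign lam mu l0 (Rgt_not_eq _ _ m)) ltac:(lra)).
assert (l : 0 < lam) by nra. repeat (split; auto). apply (gam_gt1 lam mu l0); auto.
Qed.

Lemma g5_param_iff nu : 0 < nu <-> exists lam mu, g5_param nu lam mu.
Proof.
split; [|intros [lam [mu H]]; apply H].
(* lam = mu gives gam = 2, which exceeds 1. *)
intros n0. assert (n2 : 0 < nu ^ 2) by (apply pow_lt; auto). exists (nu ^ 2), (nu ^ 2).
repeat (split; [auto; lra|]). replace (gam (nu ^ 2) (nu ^ 2)) with 2 by (unfold gam; field; lra). lra.
Qed.

Lemma g6_signs nu lam mu : g6_param nu lam mu -> 0 < nu /\ mu < 0 /\ lam < 0 /\
  lam / (2 * mu) = nu / (2 * PI) /\ 2 * mu < lam /\ forall x, 0 < x -> 0 < Um 1 lam mu x.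
Proof.
intros [n0 [l0 [m [E g]]]]. destruct (conical_param nu lam mu n0 l0 m E) as [l e].
repeat (split; [assumption|]). split; [apply (gam_gt1 lam mu l0); auto|].
intros x _. apply Um_pos_above. rewrite gam_inv by lra.
assert (i := Rinv_0_lt_compat (gam lam mu) ltac:(lra)). split; [lra|].
rewrite <- Rinv_1. apply Rinv_lt_contravar; lra.
Qed.

Lemma g6_param_iff nu : 0 < nu < 2 * PI <-> exists lam mu, g6_param nu lam mu.
Proof.
split.
- intros [n0 n1]. destruct (conical_param_exists nu n0) as [m E]. exists (-1), (- PI / nu).
  repeat (split; [assumption || lra|]). rewrite E. apply angle_ratio; auto.
- intros [lam [mu [n0 [_ [_ [E g]]]]]]. split; auto. rewrite E in g. apply angle_ratio; auto.
Qed.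

Lemma g7_signs nu lam mu : g7_param nu lam mu -> 0 < nu /\ mu < 0 /\ lam < 0 /\
  lam / (2 * mu) = nu / (2 * PI) /\ lam < 2 * mu /\ forall x, 0 < x -> 0 < Um 1 lam mu x.
Proof.
intros [n0 [l0 [m [E g]]]]. destruct (conical_param nu lam mu n0 l0 m E) as [l e].
assert (lt : lam < 2 * mu) by (apply gam_lt1_neg; lra).
repeat (split; [assumption|]). intros x x0. apply Um_pos_increasing; lra.
Qed.

Lemma g7_param_iff nu : 2 * PI < nu <-> exists lam mu, g7_param nu lam mu.
Proof.
assert (p := PI_RGT_0). split.
- intros n1. assert (n0 : 0 < nu) by lra. destruct (conical_param_exists nu n0) as [m E]. exists (-1), (- PI / nu).
  repeat (split; [assumption || lra|]). rewrite E. apply angle_ratio_lt; auto.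
- intros [lam [mu [n0 [_ [_ [E g]]]]]]. rewrite E in g. apply angle_ratio_lt; tauto.
Qed.

(** The label will be sqrt mu, since an end with mu > 0 is asymptotic to the member of g_2 with nu^2
    = mu. *)
Lemma g10_signs lam mu : g10_param lam mu -> 0 < mu /\ lam < 0 /\ mu = sqrt mu ^ 2 /\ 0 < sqrt mu.
Proof.
intros [l0 [m g]]. assert (s := proj2 (gam_sign lam mu l0 (Rgt_not_eq _ _ m)) g).
split; auto. split; [nra|]. split; [rewrite pow2_sqrt; lra|apply sqrt_lt_R0; auto].
Qed.

Lemma g10_param_square nu : 0 < nu -> g10_param (-1) (nu ^ 2).
Proof.
intros n0. assert (n2 : 0 < nu ^ 2) by (apply pow_lt; auto).
split; [lra|]. split; auto. unfold gam. lra.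
Qed.

Lemma g11_param_g10 lam mu : g11_param lam mu <-> lam = -1 /\ g10_param lam mu.
Proof. unfold g11_param, g10_param. split; intros H; repeat split; try tauto; lra. Qed.

Theorem theorem1 :
  (* (1a) *)
  (exists h : R -> metric, forall nu : R, 0 < nu ->
     realizes (h nu) p_infty 0 (1 / (4 * nu ^ 2)) (G (a1 nu)) /\
     steady_soliton plane (h nu) /\ complete plane (h nu) /\ pos_curved plane (h nu) /\
     isometric plane (h nu) plane (rescale (/ nu ^ 2) (h 1))) /\
  (* (1b) *)
  (exists h : R -> metric, forall nu : R, 0 < nu ->
     realizes (h nu) p_infty 0 p_infty (G (a2 nu)) /\
     steady_soliton plane (h nu) /\ incomplete plane (h nu) /\
     neg_curved plane (h nu) /\ curvature_unbounded_below plane (h nu) /\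
     isometric plane (h nu) plane (rescale (/ nu ^ 2) (h 1))) /\
  (* (1c) *)
  (forall nu : R, 0 <= nu -> exists h : metric,
     realizes h p_infty (nu ^ 2 / 4) p_infty (G (a3 nu)) /\
     steady_soliton punctured_plane h /\ incomplete punctured_plane h /\
     neg_curved punctured_plane h /\
     asymptotic_cylinder (at_right 0) h nu /\
     asymptotic_g2 (Rbar_locally p_infty) h 1) /\
  (* (2a), g_4^+ *)
  ((forall gamma : R, 0 < gamma < 1 ->
      exists lam mu a, g4_plus lam mu a /\ gam lam mu = gamma) /\
   (forall lam mu a, g4_plus lam mu a -> exists (h : metric) (nu : R),
      closed_disk_metric a h nu /\ 1 < nu /\
      shrinking_soliton (disk 1) h lam /\ incomplete (disk 1) h /\
      pos_curved (disk 1) h /\ geodesic_boundary disk h) /\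
   (forall lam mu a h lam' mu' a' h' nu,
      g4_plus lam mu a -> closed_disk_metric a h nu ->
      g4_plus lam' mu' a' -> closed_disk_metric a' h' nu ->
      lam = lam' /\ mu = mu' /\ forall t, 0 < t < 1 / 4 -> a t = a' t)) /\
  (* (2a), g_4^- *)
  ((forall gamma : R, gamma < 0 ->
      exists lam mu a, g4_minus lam mu a /\ gam lam mu = gamma) /\
   (forall lam mu a, g4_minus lam mu a -> exists (h : metric) (nu : R),
      closed_disk_metric a h nu /\ PI / 2 < nu /\
      shrinking_soliton (disk 1) h lam /\ incomplete (disk 1) h /\
      pos_curved (disk 1) h /\ geodesic_boundary disk h) /\
   (forall lam mu a h lam' mu' a' h' nu,
      g4_minus lam mu a -> closed_disk_metric a h nu ->
      g4_minus lam' mu' a' -> closed_disk_metric a' h' nu ->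
      lam = lam' /\ mu = mu' /\ forall t, 0 < t < 1 / 4 -> a t = a' t) /\
   (forall nu : R, PI / 2 < nu ->
      exists lam mu a h, g4_minus lam mu a /\ closed_disk_metric a h nu)) /\
  (* (2b) *)
  ((forall nu : R, 0 < nu <-> exists lam mu, g5_param nu lam mu) /\
   (forall nu lam mu, g5_param nu lam mu -> exists a, origin_profile lam mu a) /\
   (forall nu lam mu a, g5_param nu lam mu -> origin_profile lam mu a ->
      exists h : metric,
        realizes h p_infty 0 p_infty (G a) /\
        shrinking_soliton plane h lam /\ incomplete plane h /\ neg_curved plane h /\
        asymptotic_g2 (Rbar_locally p_infty) h nu)) /\
  (* (3a) *)
  ((forall nu : R, 0 < nu < 2 * PI <-> exists lam mu, g6_param nu lam mu) /\
   (forall nu lam mu, g6_param nu lam mu -> exists a, origin_profile lam mu a) /\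
   (forall nu lam mu a, g6_param nu lam mu -> origin_profile lam mu a ->
      exists h : metric,
        realizes h p_infty 0 p_infty (G a) /\
        expanding_soliton plane h lam /\ complete plane h /\ pos_curved plane h /\
        asymptotic_cone (Rbar_locally p_infty) h nu)) /\
  (* (3b) *)
  ((forall nu : R, 2 * PI < nu <-> exists lam mu, g7_param nu lam mu) /\
   (forall nu lam mu, g7_param nu lam mu -> exists a, origin_profile lam mu a) /\
   (forall nu lam mu a, g7_param nu lam mu -> origin_profile lam mu a ->
      exists h : metric,
        realizes h p_infty 0 p_infty (G a) /\
        expanding_soliton plane h lam /\ complete plane h /\ neg_curved plane h /\
        asymptotic_cone (Rbar_locally p_infty) h nu)) /\
  (* (3c) *)
  ((forall nu : R, 0 < nu <-> exists lam mu, g8_param nu lam mu) /\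
   (forall nu lam mu, g8_param nu lam mu -> exists a, cusp_profile lam mu a) /\
   (forall nu lam mu a, g8_param nu lam mu -> cusp_profile lam mu a ->
      exists h : metric,
        realizes h p_infty 0 p_infty (G a) /\
        expanding_soliton punctured_plane h lam /\ complete punctured_plane h /\
        neg_curved punctured_plane h /\
        asymptotic_cusp (at_right 0) h /\
        asymptotic_cone (Rbar_locally p_infty) h nu)) /\
  (* (3d) *)
  ((forall nu : R, 0 < nu <-> exists lam mu, g9_param nu lam mu) /\
   (forall nu lam mu, g9_param nu lam mu -> exists a, boundary_profile lam mu a) /\
   (forall nu lam mu a, g9_param nu lam mu -> boundary_profile lam mu a ->
      exists h : metric,
        realizes h 1 p_infty (1 / 4) (G a) /\
        expanding_soliton (punctured_disk 1) h lam /\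
        incomplete (punctured_disk 1) h /\ neg_curved (punctured_disk 1) h /\
        asymptotic_cone (at_right 0) h nu /\
        geodesic_boundary punctured_disk h)) /\
  (* (3e) *)
  ((forall lam mu, g10_param lam mu -> exists a, origin_profile lam mu a) /\
   (forall lam mu a, g10_param lam mu -> origin_profile lam mu a ->
      exists (h : metric) (nu : R),
        realizes h p_infty 0 p_infty (G a) /\
        expanding_soliton plane h lam /\ incomplete plane h /\ neg_curved plane h /\
        g2_label (Rbar_locally p_infty) h nu) /\
   (forall nu : R, 0 < nu -> exists lam mu a h,
      g10_param lam mu /\ origin_profile lam mu a /\
      realizes h p_infty 0 p_infty (G a) /\ riemannian plane h /\
      g2_label (Rbar_locally p_infty) h nu)) /\
  (* (3f) *)
  ((forall lam mu, g11_param lam mu -> exists a, cusp_profile lam mu a) /\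
   (forall lam mu a, g11_param lam mu -> cusp_profile lam mu a ->
      exists (h : metric) (nu : R),
        realizes h p_infty 0 p_infty (G a) /\
        expanding_soliton punctured_plane h lam /\ incomplete punctured_plane h /\
        neg_curved punctured_plane h /\
        asymptotic_cusp (at_right 0) h /\
        g2_label (Rbar_locally p_infty) h nu) /\
   (forall nu : R, 0 < nu -> exists lam mu a h,
      g11_param lam mu /\ cusp_profile lam mu a /\
      realizes h p_infty 0 p_infty (G a) /\ riemannian punctured_plane h /\
      g2_label (Rbar_locally p_infty) h nu)) /\
  (* (3g) *)
  ((forall lam mu, g12_param lam mu -> exists a, boundary_profile lam mu a) /\
   (forall lam mu a, g12_param lam mu -> boundary_profile lam mu a ->
      exists (h : metric) (nu : R),
        realizes h 1 p_infty (1 / 4) (G a) /\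
        expanding_soliton (punctured_disk 1) h lam /\
        incomplete (punctured_disk 1) h /\ neg_curved (punctured_disk 1) h /\
        g2_label (at_right 0) h nu /\
        geodesic_boundary punctured_disk h) /\
   (forall nu : R, 0 < nu -> exists lam mu a h,
      g12_param lam mu /\ boundary_profile lam mu a /\
      realizes h 1 p_infty (1 / 4) (G a) /\ riemannian (punctured_disk 1) h /\
      g2_label (at_right 0) h nu)).
Proof.
split; [exact cigar_family|].
split; [exact exploding_family|].
split; [exact g3_metric|].
split; [|split; [|split; [|split; [|split; [|split; [|split; [|split; [|split]]]]]]]].
- split; [|split].
  + intros gm g. destruct (g4_profile_exists gm) as [lam [mu [a [l [m [_ [K E]]]]]]]; try lra.
    exists lam, mu, a. split; auto. split; [lra|]. split; [apply m; lra|]. rewrite E. auto.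
  + intros lam mu a H. destruct (g4_plus_signs lam mu a H) as [l [m [g K]]].
    destruct (g4_metric lam mu a l m g K) as [h [nu [C R]]]. exists h, nu. split; auto. split; auto.
    destruct (closed_disk_arclength lam mu a h nu (proj1 K) C) as [r A].
    apply (dprof_nu_gt1 (gam lam mu) a nu r); auto. apply dprof_of_profile; auto.
  + intros lam mu a h lam' mu' a' h' nu H C H' C'.
    apply (g4_injective lam mu a h lam' mu' a' h' nu); auto; apply g4_plus_signs; auto.
- split; [exact g4_minus_exists|split; [|split; [|exact g4_minus_surjective]]].
  + intros lam mu a H. destruct (g4_minus_signs lam mu a H) as [l [m [g K]]].
    destruct (g4_metric lam mu a l m g K) as [h [nu [C R]]]. exists h, nu. split; auto. split; auto.
    destruct (closed_disk_arclength lam mu a h nu (proj1 K) C) as [r A].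
    (* Strict monotonicity is applied against the hemisphere, the model at gam = 0, which lies just
       outside the range gam < 0. *)
    refine (dprof_nu_lt (gam lam mu) 0 a _ nu _ r _ _ _ dprof_hemisphere A arclength_hemisphere); [apply H|].
    apply dprof_of_profile; auto.
  + intros lam mu a h lam' mu' a' h' nu H C H' C'.
    apply (g4_injective lam mu a h lam' mu' a' h' nu); auto; apply g4_minus_signs; auto.
- split; [exact g5_param_iff|split].
  + intros nu lam mu H. destruct (g5_signs nu lam mu H) as [n0 [mE [l lt]]].
    apply (origin_exploding_exists nu); auto.
  + intros nu lam mu a H prof. destruct (g5_signs nu lam mu H) as [n0 [mE [l lt]]].
    destruct (origin_exploding nu lam mu n0 mE lt a prof) as [H1 [H2 [H3 [H4 H5]]]].
    eexists. repeat (split; [eassumption|]). split; [split; eassumption|]. auto.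
- split; [exact g6_param_iff|split].
  + intros nu lam mu H. destruct (g6_signs nu lam mu H) as [n0 [m [l [e [lt U0]]]]].
    apply (origin_conical_exists nu); auto.
  + intros nu lam mu a H prof. destruct (g6_signs nu lam mu H) as [n0 [m [l [e [lt U0]]]]].
    destruct (origin_conical nu lam mu n0 m e U0 a) as [H1 [H2 [H3 H4]]]; auto; [lra|].
    eexists. split; [eassumption|]. split; [split; eassumption|]. split; [auto|]. split; auto.
    apply plane_pos_curved; auto; lra.
- split; [exact g7_param_iff|split].
  + intros nu lam mu H. destruct (g7_signs nu lam mu H) as [n0 [m [l [e [lt U0]]]]].
    apply (origin_conical_exists nu); auto.
  + intros nu lam mu a H prof. destruct (g7_signs nu lam mu H) as [n0 [m [l [e [lt U0]]]]].
    destruct (origin_conical nu lam mu n0 m e U0 a) as [H1 [H2 [H3 H4]]]; auto; [lra|].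
    eexists. split; [eassumption|]. split; [split; eassumption|]. split; [auto|]. split; auto.
    apply plane_neg_curved; auto; lra.
- split; [|split].
  + intros nu. split; [|intros [lam [mu H]]; apply H].
    intros n0. destruct (conical_param_exists nu n0) as [m E]. exists (-1), (- PI / nu). repeat split; auto.
  + intros nu lam mu [n0 [-> [m E]]]. destruct (conical_param nu (-1) mu n0 ltac:(lra) m E) as [_ e].
    apply cusp_profile_exists; [lra|]. apply (cusp_conical_range nu); auto.
  + intros nu lam mu a [n0 [-> [m E]]] prof. destruct (conical_param nu (-1) mu n0 ltac:(lra) m E) as [_ e].
    eexists. apply (cusp_conical nu mu a); auto.
- split; [|split].
  + intros nu. split; [|intros [lam [mu H]]; apply H].
    intros n0. destruct (conical_param_exists nu n0) as [m E]. exists (-1), (- PI / nu). repeat split; auto. lra.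
  + intros nu lam mu [n0 [l0 [m E]]]. destruct (conical_param nu lam mu n0 l0 m E) as [l e].
    apply boundary_profile_exists; auto; [lra|]. apply (boundary_conical_range nu); auto.
  + intros nu lam mu a [n0 [l0 [m E]]] prof. destruct (conical_param nu lam mu n0 l0 m E) as [l e].
    apply (boundary_conical nu lam mu a); auto.
- assert (ex : forall lam mu, g10_param lam mu -> exists a, origin_profile lam mu a).
  { intros lam mu H. destruct (g10_signs lam mu H) as [m [l [mE s]]].
    apply (origin_exploding_exists (sqrt mu)); auto. lra. }
  split; [exact ex|split].
  + intros lam mu a H prof. destruct (g10_signs lam mu H) as [m [l [mE s]]].
    destruct (origin_exploding (sqrt mu) lam mu s mE ltac:(lra) a prof) as [H1 [H2 [H3 [H4 H5]]]].
    eexists. exists (sqrt mu). split; [eassumption|]. split; [split; eassumption|]. split; [auto|]. split; auto.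
    apply g2_label_of_asymptotic; auto. apply ray_p_infty.
  + intros nu n0. assert (H := g10_param_square nu n0). destruct (ex _ _ H) as [a prof].
    assert (n2 : 0 < nu ^ 2) by (apply pow_lt; auto).
    destruct (origin_exploding nu (-1) (nu ^ 2) n0 eq_refl ltac:(lra) a prof) as [H1 [H2 [H3 [H4 H5]]]].
    (* mu = nu^2 fixes the label; lam = -1 is one choice among the negative numbers. *)
    exists (-1), (nu ^ 2), a. eexists. split; [auto|]. split; [auto|]. split; [eassumption|]. split; [apply H2|].
    apply g2_label_of_asymptotic; auto. apply ray_p_infty.
- assert (ex : forall lam mu, g11_param lam mu -> exists a, cusp_profile lam mu a).
  { intros lam mu H. apply g11_param_g10 in H. destruct H as [-> H]. destruct (g10_signs _ mu H) as [m _].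
    apply cusp_profile_exists; [lra|]. apply cusp_exploding_range; auto. }
  split; [exact ex|split].
  + intros lam mu a H prof. apply g11_param_g10 in H. destruct H as [-> H].
    destruct (g10_signs _ mu H) as [m [_ [mE s]]].
    destruct (cusp_exploding (sqrt mu) mu a s mE prof) as [H1 [H2 [H3 [H4 [H5 H6]]]]].
    eexists. exists (sqrt mu). repeat (split; [eassumption|]).
    apply g2_label_of_asymptotic; auto. apply ray_p_infty.
  + intros nu n0. assert (H := g10_param_square nu n0).
    assert (H' : g11_param (-1) (nu ^ 2)) by (apply g11_param_g10; auto).
    destruct (ex _ _ H') as [a prof].
    destruct (cusp_exploding nu (nu ^ 2) a n0 eq_refl prof) as [H1 [H2 [H3 [H4 [H5 H6]]]]].
    exists (-1), (nu ^ 2), a. eexists. repeat (split; [eassumption|]). split; [apply H2|].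
    apply g2_label_of_asymptotic; auto. apply ray_p_infty.
- assert (ex : forall lam mu, g12_param lam mu -> exists a, boundary_profile lam mu a).
  { intros lam mu H. destruct (g10_signs _ mu H) as [m [l _]].
    apply boundary_profile_exists; auto; [lra|]. apply boundary_exploding_range; auto. }
  split; [exact ex|split].
  + intros lam mu a H prof. destruct (g10_signs _ mu H) as [m [l [mE s]]].
    destruct (boundary_exploding (sqrt mu) lam mu a s mE l prof) as [h [H1 [H2 [H3 [H4 [H5 H6]]]]]].
    exists h, (sqrt mu). repeat (split; [eassumption|]). split; auto.
    apply g2_label_of_asymptotic; auto. apply ray_at_right_0.
  + intros nu n0. assert (H := g10_param_square nu n0). destruct (ex _ _ H) as [a prof].
    destruct (boundary_exploding nu (-1) (nu ^ 2) a n0 eq_refl ltac:(lra) prof) as [h [H1 [H2 [H3 [H4 [H5 H6]]]]]].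
    exists (-1), (nu ^ 2), a, h. repeat (split; [eassumption|]). split; [apply H2|].
    apply g2_label_of_asymptotic; auto. apply ray_at_right_0.
Qed.
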